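(* Let $n\ge1$ and let $\Omega\subset\mathbb{R}^{n+1}$ be a bounded convex domain whose boundary $\Sigma=\partial\Omega$ is a smooth closed convex hypersurface. Then $$\int_\Sigma H_n|X|^2\,d\mu-\frac{n+1}{\omega_n}I_{n-1}^2+nI_{n-2}=(n+1)\,\delta_2\left(\Omega,B_0(r)\right)^2,$$ where $B_0(r)$ is the ball centered at $0$ of radius $r=\frac{I_{n-1}}{\omega_n}$; moreover this $r$ equals half of the mean width $\overline{w}(\Omega)$ of $\Omega$.
   Context: $X$ is the position vector, $d\mu$ the induced area measure, $\kappa_1,\dots,\kappa_n$ the principal curvatures of $\Sigma$ with respect to the outward unit normal (positive for round spheres), $H_j=\binom{n}{j}^{-1}\sigma_j(\kappa)$ with $\sigma_j$ the $j$-th elementary symmetric polynomial ($H_0=1$). $I_{-1}=(n+1)|\Omega|$, $I_j=\int_\Sigma H_j\,d\mu$ for $0\le j\le n$. $\omega_n=|\mathbb{S}^n|$ is the area of the unit sphere. For convex bodies $K_1,K_2$ in $\mathbb{R}^{n+1}$ with support functions $u_{K_1},u_{K_2}:\mathbb{S}^n\to\mathbb{R}$, $\delta_2(K_1,K_2)=\left(\int_{\mathbb{S}^n}(u_{K_1}-u_{K_2})^2\,d\theta\right)^{1/2}$, with $d\theta$ the standard measure on $\mathbb{S}^n$. The mean width $\overline{w}(\Omega)$ is the average over all directions $\xi\in\mathbb{S}^n$ of the width $u_\Omega(\xi)+u_\Omega(-\xi)$ of $\Omega$. *)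

(* Defs.v *)
From HB Require Import structures.
From mathcomp Require Import all_boot all_order all_algebra.
From mathcomp Require Import all_classical all_reals all_analysis.

Set Implicit Arguments.
Unset Strict Implicit.
Unset Printing Implicit Defensive.

Import Order.TTheory GRing.Theory Num.Theory.
Import numFieldNormedType.Exports.

Local Open Scope classical_set_scope.
Local Open Scope ring_scope.

(** The library norm on ['rV[R]_m] is the sup norm; it is used only for the
    topology.  Lengths and angles are those of [dot]. *)

Definition dot (R : realType) (m : nat) (u v : 'rV[R]_m) : R :=
  (u *m v^T) 0 0.

Definition enorm (R : realType) (m : nat) (u : 'rV[R]_m) : R :=
  Num.sqrt (dot u u).

Definition esphere (R : realType) (m : nat) : set 'rV[R]_m :=
  [set x | enorm x = 1].

Definition eball (R : realType) (m : nat) (r : R) : set 'rV[R]_m :=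
  [set x | enorm x <= r].

Definition boundary (T : topologicalType) (A : set T) : set T :=
  closure A `\` interior A.

(** Class [C^k] on the open set [U]. *)
Fixpoint class_C (R : realType) (V W : normedModType R) (k : nat)
    (U : set V) (f : V -> W) : Prop :=
  match k with
  | 0 => forall x, U x -> {for x, continuous f}
  | k'.+1 => (forall x, U x -> differentiable f x) /\
             (forall v : V, class_C k' U ('D_v f))
  end.

Definition smooth_on (R : realType) (V W : normedModType R)
    (U : set V) (f : V -> W) : Prop := forall k, class_C k U f.

(** [R^m] with its Borel sigma-algebra. *)
Definition borel_rV (R : realType) (m : nat) :=
  g_sigma_algebraType (@open 'rV[R]_m).

(** Lebesgue measure of a Borel subset of [R^m], as an iterated product: on
    [R^(1+m)] it is the integral of the measures of the sections, which is the
    library's product measure of [lebesgue_measure] with the [m]-dimensional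
    one. *)
Fixpoint lebesgue_rV (R : realType) (m : nat) : set (borel_rV R m) -> \bar R :=
  match m with
  | 0 => fun A : set 'rV[R]_0 => (\1_A 0)%:E
  | m'.+1 => fun A : set 'rV[R]_(1 + m') =>
      (\int[lebesgue_measure]_(x in [set: R])
         lebesgue_rV [set v : 'rV[R]_m' | A (row_mx x%:M v)])%E
  end.

Section Hypersurface.
Context {R : realType} {n : nat}.
Implicit Types (S : set 'rV[R]_n.+1) (Omega : set 'rV[R]_n.+1).

(** Smooth regular local parametrizations of [S]: the third clause says that
    [phi] is open onto [S], hence a homeomorphism of [U] onto its image. *)
Definition is_chart S (U : set 'rV[R]_n) (phi : 'rV[R]_n -> 'rV[R]_n.+1) :=
  [/\ open U /\ smooth_on U phi,
      {in U &, injective phi},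
      (forall V, open V -> V `<=` U ->
         exists2 W, open W & phi @` V = S `&` W) &
      (forall y, U y -> \rank (jacobian phi y) = n)].

Definition smooth_hypersurface S :=
  forall p, S p -> exists U phi, is_chart S U phi /\ (phi @` U) p.

(** The rows of the Jacobian matrix are the partial derivatives of [phi], so
    [g] is the first fundamental form. *)
Definition area_density (phi : 'rV[R]_n -> 'rV[R]_n.+1) (y : 'rV[R]_n) : R :=
  let g := jacobian phi y *m (jacobian phi y)^T in Num.sqrt (\det g).

(** [mu] is the area measure induced on [S] by the Euclidean metric, seen as a
    Borel measure of the ambient space carried by [S]. *)
Definition is_area_measure S
    (mu : {measure set (borel_rV R n.+1) -> \bar R}) :=
  mu (~` S) = 0%E /\
  forall U phi, is_chart S U phi ->
  forall B : set (borel_rV R n), measurable B -> B `<=` U ->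
    mu (phi @` B) =
    (\int[@lebesgue_rV R n]_(y in B) (area_density phi y)%:E)%E.

Definition is_curve_at S (p : 'rV[R]_n.+1) (c : R^o -> 'rV[R]_n.+1) :=
  c 0 = p /\
  exists2 e : R, 0 < e &
    smooth_on (ball (0 : R^o) e) c /\ (c @` ball (0 : R^o) e `<=` S).

Definition tangent_space S (p : 'rV[R]_n.+1) : set 'rV[R]_n.+1 :=
  [set 'D_1 c 0 | c in is_curve_at S p].

Definition is_outward_unit_normal Omega (p nu : 'rV[R]_n.+1) :=
  [/\ enorm nu = 1,
      forall v, tangent_space (boundary Omega) p v -> dot v nu = 0 &
      exists2 e : R, 0 < e &
        forall t : R, 0 < t < e -> ~ Omega (p + t *: nu)].

Definition outward_normal Omega (p : 'rV[R]_n.+1) : 'rV[R]_n.+1 :=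
  get (is_outward_unit_normal Omega p).

(** [w] is the value at [v] of the differential at [p] of the Gauss map. *)
Definition is_dnormal Omega (p v w : 'rV[R]_n.+1) :=
  forall c, is_curve_at (boundary Omega) p c -> 'D_1 c 0 = v ->
    is_derive (0 : R^o) (1 : R^o) (outward_normal Omega \o c) w.

(** The principal curvatures are the eigenvalues, with multiplicity, of the
    differential of the outward Gauss map; they are positive on spheres. *)
Definition are_principal_curvatures Omega (p : 'rV[R]_n.+1)
    (k : 'rV[R]_n) :=
  exists e : 'I_n -> 'rV[R]_n.+1,
    [/\ forall i, tangent_space (boundary Omega) p (e i),
        forall i j, dot (e i) (e j) = (i == j)%:R &
        forall i, is_dnormal Omega p (e i) (k 0 i *: e i)].

Definition principal_curvatures Omega (p : 'rV[R]_n.+1) : 'rV[R]_n :=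
  get (are_principal_curvatures Omega p).

Definition elem_sym (j : nat) (k : 'rV[R]_n) : R :=
  \sum_(A : {set 'I_n} | #|A| == j) \prod_(i in A) k 0 i.

Definition mean_curvature Omega (j : nat) (p : 'rV[R]_n.+1) : R :=
  ('C(n, j)%:R)^-1 * elem_sym j (principal_curvatures Omega p).

(** [I_j]; only [j >= -1] is meaningful, with [I_{-1} = (n+1)|Omega|]. *)
Definition curvature_integral Omega
    (mu : {measure set (borel_rV R n.+1) -> \bar R}) (j : int) : R :=
  match j with
  | Posz j' => \int[mu]_(x in boundary Omega) mean_curvature Omega j' x
  | Negz _ => n.+1%:R * fine (lebesgue_rV Omega)
  end.

Definition support_function (K : set 'rV[R]_n.+1) (xi : 'rV[R]_n.+1) : R :=
  sup [set dot x xi | x in K].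

Definition delta2 (theta : {measure set (borel_rV R n.+1) -> \bar R})
    (K1 K2 : set 'rV[R]_n.+1) : R :=
  Num.sqrt (\int[theta]_(xi in @esphere R n.+1)
              (support_function K1 xi - support_function K2 xi) ^+ 2).

Definition sphere_area (theta : {measure set (borel_rV R n.+1) -> \bar R}) : R :=
  fine (theta (@esphere R n.+1)).

Definition mean_width (theta : {measure set (borel_rV R n.+1) -> \bar R})
    (K : set 'rV[R]_n.+1) : R :=
  (sphere_area theta)^-1 *
  \int[theta]_(xi in @esphere R n.+1)
     (support_function K xi + support_function K (- xi)).

End Hypersurface.

(* Main.v *)
Require Import Defs.
From HB Require Import structures.
From mathcomp Require Import all_boot all_order all_algebra.
From mathcomp Require Import all_classical all_reals all_analysis.
From mathcomp Require Import perm measurable_realfun ring lra zify.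

(**
For large [t] the volume of the parallel body [K + tB] is computed twice.  By
Steiner's formula it is a polynomial in [t] with coefficients
[C(n+1, j+1) I_j]; weighting the tube by [|proj Y|^2] replaces [I_j] by
[\int H_j |X|^2].  In polar coordinates around the origin, if [u] is the
support function and [m_R = dist(R xi, K)^2 - R^2 + 2 R u(xi)], then [m_R] is
nonnegative, nondecreasing in [R], bounded, and the radial function of
[K + tB] is [u + sqrt(t^2 + u^2 - m)] with [m] squeezed between [m_(t/2)] and
[m_(2t)].  With [L] the limit of [\int m_R] and [|proj (R xi)|^2] squeezed
between [2 m_(R/2) - m_R] and [m_R], comparison of the three leading
coefficients gives
  [I_(n-1) = \int u],  [n I_(n-2) = (n+1) \int u^2 - L],
  [\int H_n |X|^2 = L],
and [L] cancels in the sum, which leaves [(n+1) (\int u^2 - r^2 omega)].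
*)

Set Implicit Arguments.
Unset Strict Implicit.
Unset Printing Implicit Defensive.

Import Order.TTheory GRing.Theory Num.Theory.
Import numFieldNormedType.Exports.

Local Open Scope classical_set_scope.
Local Open Scope ring_scope.

(** * Borel sets and dyadic cells of R^m *)

(** The difficulty is that the hypersurface is only weakly convex: a principal curvature may vanish,
    so the Gauss map need not have a differentiable inverse, and integrals over the sphere cannot be
    moved to $\Sigma$ by substitution. Both kinds of integral are read off from volumes in the
    ambient space, where the projection onto $K$ is defined everywhere and Lipschitz. The properties
    of $m_R$ have one source: $m(Y)$ is the minimum over $z\in K$ of $|z|^2+2(u(Y)-\langle
    z,Y\rangle)$, attained at the projection. Along a ray these are affine functions of $R$ with
    nonnegative slope, so $m_R$ is monotone and concave; the one attaining the minimum at $R$ has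
    value $|proj(R\xi)|^2$ at $0$, and evaluating it at $R/2$ gives the bound with $2m_{R/2}-m_R$.
    The radii $t/2$ and $2t$ occur because the radial function lies between them for large $t$. The
    value of $L$ remains unknown; monotonicity alone makes the sandwich close. In the code $s=1/t$
    and the coefficients are compared as $s\to0$. The unit sphere is treated as the boundary of the
    unit ball, so that the polar coordinates themselves follow from the tube formula. *)

Section RowVectors.
Context {R : realType} {m : nat}.
Implicit Types v : 'rV[R]_m.

Lemma coord_le_norm v i : `|v 0 i| <= `|v|.
Proof.
rewrite [leRHS](mx_normrE v); apply/bigmax_geP; right => /=.
by exists (0, i).
Qed.

Lemma norm_rV_le (e : R) v : 0 <= e -> (forall i, `|v 0 i| <= e) -> `|v| <= e.
Proof.
move=> e0 H; rewrite [leLHS](mx_normrE v); apply/bigmax_leP; split => //=.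
by move=> [i j] _ /=; rewrite (ord1 i).
Qed.

Lemma norm_rV_lt (e : R) v : 0 < e -> (forall i, `|v 0 i| < e) -> `|v| < e.
Proof.
move=> e0 H; rewrite [ltLHS](mx_normrE v); apply/bigmax_ltP; split => //=.
by move=> [i j] _ /=; rewrite (ord1 i).
Qed.

Lemma open_rVP (W : set 'rV[R]_m) :
  open W <-> forall x, W x ->
    exists2 e : R, 0 < e & forall y, `|y - x| < e -> W y.
Proof.
split=> [oW x Wx|H].
  have /nbhs_ballP[e /= e0 He] := open_nbhs_nbhs (conj oW Wx).
  by exists e => // y yx; apply: He; rewrite mx_norm_ball /ball_ /= distrC.
rewrite openE => x /H[e e0 He]; apply/nbhs_ballP; exists e => //= y.
by rewrite mx_norm_ball /ball_ /= distrC; exact: He.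
Qed.

End RowVectors.

Section DyadicCells.
Context {R : realType} {m : nat}.
Implicit Types (x y : 'rV[R]_m) (k : nat) (z : 'rV[int]_m).

Definition code k x : 'rV[int]_m := \row_i Num.floor (2 ^+ k * x 0 i).

Definition cell k z : set 'rV[R]_m := [set x | code k x = z].

Lemma cellP k z x :
  cell k z x <-> forall i, (z 0 i)%:~R <= 2 ^+ k * x 0 i < (z 0 i)%:~R + 1.
Proof.
split=> [<- i|H].
  by rewrite mxE; have := floor_itv (2 ^+ k * x 0 i); rewrite intrD.
apply/rowP => i; rewrite mxE; apply: floor_def.
by rewrite intrD; exact: H.
Qed.

(** Nesting of dyadic intervals in one coordinate. If the floors of [a] and [b] differed, an integer
    would lie strictly above [a] and at most at [b], and its double would separate the floors of
    [2 a] and [2 b]. *)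
Lemma floor_double (a b : R) :
  Num.floor (2 * a) = Num.floor (2 * b) -> Num.floor a = Num.floor b.
Proof.
wlog ab : a b / Num.floor a < Num.floor b => [hw|].
  case: (ltgtP (Num.floor a) (Num.floor b)) => //.
    by move=> /hw H /H.
  by move=> /hw H /esym /H.
move=> E; exfalso.
have a1 : a < (Num.floor b)%:~R by rewrite -floor_lt_int.
have b1 := floor_le b.
have : Num.floor (2 * a) < 2 * Num.floor b.
  by rewrite floor_lt_int intrM; lra.
rewrite E ltNge; suff -> : 2 * Num.floor b <= Num.floor (2 * b) by [].
by rewrite floor_ge_int intrM; lra.
Qed.

Lemma code_coarser j k x y : (j <= k)%N -> code k x = code k y ->
  code j x = code j y.
Proof.
elim: k => [|k IHk]; first by rewrite leqn0 => /eqP ->.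
rewrite leq_eqVlt => /orP[/eqP -> //|]; rewrite ltnS => jk E.
apply: IHk => //; apply/rowP => i; rewrite !mxE; apply: floor_double.
by move/rowP/(_ i): E; rewrite !mxE !exprS !mulrA.
Qed.

Lemma cell_dist k x y : code k x = code k y -> `|y - x| <= (2 ^+ k)^-1.
Proof.
move=> E; apply: norm_rV_le => [|i]; first by rewrite invr_ge0 exprn_ge0.
have /cellP/(_ i)/andP[x1 x2] : cell k (code k x) x by [].
have /cellP/(_ i)/andP[y1 y2] : cell k (code k x) y by [].
have p0 : 0 < 2 ^+ k :> R by rewrite exprn_gt0.
rewrite -[leRHS]mul1r ler_pdivlMr// -[X in _ * X]gtr0_norm// -normrM !mxE.
by rewrite ler_norml; apply/andP; split; lra.
Qed.

Lemma exp2V_small (e : R) : 0 < e -> exists K, forall k, (K <= k)%N ->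
  (2 ^+ k)^-1 < e.
Proof.
move=> e0; have [K _ HK] := near_infty_natSinv_expn_lt (PosNum e0).
exists K => k Kk; have := HK k Kk => /=.
by rewrite div1r.
Qed.

Lemma cell_in_open (W : set 'rV[R]_m) x : open W -> W x ->
  exists K, forall k, (K <= k)%N -> cell k (code k x) `<=` W.
Proof.
move=> /open_rVP H /H[e e0 He]; have [K HK] := exp2V_small e0.
exists K => k Kk y /esym yx; apply: He.
by apply: le_lt_trans (HK k Kk); exact: cell_dist.
Qed.

(** Dyadic cells are nested, so attaching to each point its coarsest good cell splits an open set
    into disjoint cells. *)
Definition maximal_cell (P : nat -> 'rV[int]_m -> Prop) k z : set 'rV[R]_m :=
  [set y | [/\ code k y = z, P k z & forall j, (j < k)%N -> ~ P j (code j y)]].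

(** Countable additivity is stated for families indexed by natural numbers, so the pairs of level
    and index are enumerated by [pickle_inv]; a number that codes no pair gives the empty set. *)
Definition maximal_cells (P : nat -> 'rV[int]_m -> Prop) (i : nat) : set 'rV[R]_m :=
  if @pickle_inv (nat * 'rV[int]_m)%type i is Some kz
  then maximal_cell P kz.1 kz.2 else set0.

(** All or nothing: two points of one cell share the codes of all coarser levels, so maximality at
    one point of the cell is maximality at every point. *)
Lemma maximal_cellE P k z :
  maximal_cell P k z = set0 \/ (P k z /\ maximal_cell P k z = cell k z).
Proof.
have [[y [yz Pz Hy]]|N] := pselect (maximal_cell P k z !=set0); last first.
  by left; apply/seteqP; split=> // y My; apply: N; exists y.
right; split => //; apply/seteqP; split=> [x []//|x xz]; split => // j jk.
rewrite (@code_coarser j k x y) //; [exact: Hy | exact: ltnW | by rewrite yz].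
Qed.

Lemma maximal_cells_cover P :
  \bigcup_i maximal_cells P i = [set x | exists k, P k (code k x)].
Proof.
apply/seteqP; split=> [x [i _]|x /= [k Pk]].
  rewrite /maximal_cells; case: pickle_inv => // -[k z] [<- Pk _].
  by exists k.
have ex : exists k, `[< P k (code k x) >] by exists k; apply/asboolP.
have /asboolP Pm := ex_minnP ex.
case: (ex_minnP ex) => K /asboolP PK Kmin.
exists (pickle (K, code K x)) => //.
rewrite /maximal_cells pickleK_inv /=; split => // j jK Pj.
by have := Kmin j (introT (asboolP _) Pj); rewrite leqNgt jK.
Qed.

Lemma maximal_cells_triv P : trivIset setT (maximal_cells P).
Proof.
apply/trivIsetP => i j _ _ ij; apply/seteqP; split=> // y [].
rewrite /maximal_cells.
case Ei : pickle_inv => [[k z]|//]; case Ej : pickle_inv => [[k' z']|//] /=.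
move=> [yz Pz Hz] [yz' Pz' Hz'].
have kk' : k = k'.
  case: (ltngtP k k') => // [kk'|kk'].
    by case: (Hz' _ kk'); rewrite yz.
  by case: (Hz _ kk'); rewrite yz'.
case/eqP: ij; have := pickle_invK (T := (nat * 'rV[int]_m)%type) i.
have := pickle_invK (T := (nat * 'rV[int]_m)%type) j.
by rewrite Ei Ej /= => <- <-; rewrite -yz -yz' kk'.
Qed.

End DyadicCells.

Section BorelRV.
Context {R : realType} {m : nat}.
Local Notation rV := (borel_rV R m).

Lemma borel_open (W : set 'rV[R]_m) : open W -> measurable (W : set rV).
Proof. by move=> oW; exact: sub_sigma_algebra. Qed.

Lemma borel_closed (W : set 'rV[R]_m) : closed W -> measurable (W : set rV).
Proof.
move=> cW; rewrite -(setCK W); apply: measurableC; apply: borel_open.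
exact: closed_openC.
Qed.

Lemma continuous_measurable_rV (f : 'rV[R]_m -> R) :
  continuous f -> measurable_fun (setT : set rV) f.
Proof.
move=> /continuousP cf; apply: (@measurability _ _ rV R setT f _ (RGenOpens.measurableE R)).
move=> _ [_ [a [b ->]] <-]; rewrite setTI; apply: borel_open.
by apply: cf; exact: interval_open.
Qed.

Lemma measurable_coord i : measurable_fun (setT : set rV) (fun x : 'rV[R]_m => x 0 i).
Proof. by apply: continuous_measurable_rV; exact: coord_continuous. Qed.

Lemma preimage_cell T (f : T -> 'rV[R]_m) k z :
  f @^-1` (cell k z) = \big[setI/setT]_(i < m)
    [set t | (z 0 i)%:~R <= 2 ^+ k * f t 0 i < (z 0 i)%:~R + 1].
Proof.
rewrite -bigcap_seq; apply/seteqP; split=> [t /= /cellP H i _|t H]; first exact: H.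
by apply/cellP => i; apply: H; rewrite /= mem_index_enum.
Qed.

Lemma measurable_preimage_cell d (T : measurableType d) (f : T -> 'rV[R]_m) k z :
  (forall i, measurable_fun setT (fun t => f t 0 i)) ->
  measurable (f @^-1` (cell k z)).
Proof.
move=> mf; rewrite preimage_cell; apply: bigsetI_measurable => i _.
rewrite [X in measurable X](_ : _ =
  (fun t => 2 ^+ k * f t 0 i) @^-1` `[(z 0 i)%:~R, (z 0 i)%:~R + 1[); last first.
  by apply/seteqP; split=> t /=; rewrite in_itv.
rewrite -[X in measurable X]setTI; apply: measurable_funM => //.
Qed.

Lemma measurable_cell k z : measurable (cell k z : set rV).
Proof.
apply: (@measurable_preimage_cell _ rV id k z) => i; exact: measurable_coord.
Qed.

Lemma measurable_maximal_cells P i : measurable (maximal_cells P i : set rV).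
Proof.
rewrite /maximal_cells; case: pickle_inv => [[k z]|//] /=.
have [->|[_ ->]] := @maximal_cellE R m P k z; first exact: measurable0.
exact: measurable_cell.
Qed.

(** An open set is the union of its maximal dyadic cells, a countable family, and the preimage of a
    cell is cut out by finitely many conditions on single coordinates. *)
Lemma measurable_rV d (T : measurableType d) (f : T -> 'rV[R]_m) :
  (forall i, measurable_fun setT (fun t => f t 0 i)) ->
  measurable_fun setT (f : T -> rV).
Proof.
move=> mf; apply: (@measurability _ _ T rV setT f (@open 'rV[R]_m) erefl).
move=> _ [W oW <-]; rewrite setTI.
pose P k z := @cell R m k z `<=` W.
have -> : W = \bigcup_i maximal_cells P i.
  rewrite maximal_cells_cover; apply/seteqP; split=> x /=.
    by move=> /(cell_in_open oW)[K HK]; exists K; apply: HK.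
  by move=> [k Pk]; apply: Pk.
rewrite preimage_bigcup; apply: bigcupT_measurable => i.
rewrite /maximal_cells; case: pickle_inv => [[k z]|]; last first.
  by rewrite preimage_set0; exact: measurable0.
have [->|[_ ->]] := @maximal_cellE R m P k z.
  by rewrite preimage_set0; exact: measurable0.
exact: measurable_preimage_cell.
Qed.

(** Two measures are compared on an open set by comparing them on the maximal
    good dyadic cells, which form a countable partition. *)
Lemma measure_le_cells (a b : {measure set rV -> \bar R}) (W : set 'rV[R]_m) :
  (forall x, W x -> exists k, cell k (code k x) `<=` W /\
     (a (cell k (code k x)) <= b (cell k (code k x)))%E) ->
  (a W <= b W)%E.
Proof.
move=> H; pose P k z := @cell R m k z `<=` W /\ (a (cell k z) <= b (cell k z))%E.
have -> : W = \bigcup_i maximal_cells P i.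
  rewrite maximal_cells_cover; apply/seteqP; split=> x /=; first by move=> /H.
  by move=> [k [Pk _]]; apply: Pk.
rewrite !measure_semi_bigcup //; try exact: maximal_cells_triv;
  try exact: measurable_maximal_cells;
  try (by apply: bigcupT_measurable => i; exact: measurable_maximal_cells).
apply: lee_nneseries => // i _.
rewrite /maximal_cells; case: pickle_inv => [[k z]|] /=; last by rewrite !measure0.
by have [->|[[_ Pk] ->]] := @maximal_cellE R m P k z; rewrite ?measure0.
Qed.

Lemma measure_eq_cells (a b : {measure set rV -> \bar R}) (W : set 'rV[R]_m) :
  (forall x, W x -> exists k, cell k (code k x) `<=` W /\
     a (cell k (code k x)) = b (cell k (code k x))) ->
  a W = b W.
Proof.
move=> H; apply/eqP; rewrite eq_le; apply/andP; split;
by apply: measure_le_cells => x /H[k [kW kE]]; exists k; rewrite kE.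
Qed.

End BorelRV.

(** * Push-forwards, densities and products as bundled measures *)

Section MeasureConstructions.
Local Open Scope ereal_scope.
Context {R : realType}.

Lemma pack_measure d (T : measurableType d) (f : set T -> \bar R) :
  f set0 = 0 -> (forall A, 0 <= f A) -> semi_sigma_additive f ->
  exists nu : {measure set T -> \bar R}, nu = f :> (set T -> \bar R).
Proof.
move=> f0 fge0 fs; pose M := isMeasure.Build _ _ _ f f0 fge0 fs.
by exists (HB.pack_for {measure set T -> \bar R} f M).
Qed.

(** Measurability is asked on [D] only, so that locally defined maps, such as the inverse of the
    tube map, can be pushed forward without being extended. *)
Lemma push_measure d d' (T : measurableType d) (T' : measurableType d')
    (mu : {measure set T -> \bar R}) (D : set T) (f : T -> T') :
  measurable D -> measurable_fun D f ->
  exists nu : {measure set T' -> \bar R},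
    nu = (fun A => mu (D `&` f @^-1` A)) :> (set T' -> \bar R).
Proof.
move=> mD mf; apply: pack_measure => [|A|F mF tF mUF].
- by rewrite preimage_set0 setI0 measure0.
- exact: measure_ge0.
- rewrite preimage_bigcup setI_bigcupr; apply: measure_semi_sigma_additive.
  + by move=> n; exact: mf.
  + apply/trivIsetP => /= i j _ _ ij; rewrite setIACA -preimage_setI.
    by move/trivIsetP : tF => /(_ _ _ _ _ ij) ->//; rewrite preimage_set0 setI0.
  + by rewrite -setI_bigcupr -preimage_bigcup; exact: mf.
Qed.

Lemma density_measure d (T : measurableType d) (mu : {measure set T -> \bar R})
    (D : set T) (g : T -> \bar R) :
  measurable D -> measurable_fun D g -> (forall x, D x -> 0 <= g x) ->
  exists nu : {measure set T -> \bar R},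
    nu = (fun A => \int[mu]_(x in D `&` A) g x) :> (set T -> \bar R).
Proof.
move=> mD mg g0; apply: pack_measure => [|A|F mF tF mUF].
- by rewrite setI0 integral_set0.
- by apply: integral_ge0 => x [Dx _]; exact: g0.
- rewrite setI_bigcupr ge0_integral_bigcup //.
  + by apply: is_cvg_nneseries => n _ _; apply: integral_ge0 => x [Dx _]; exact: g0.
  + by move=> n; exact: measurableI.
  + rewrite -setI_bigcupr; apply: measurable_funS mg => //.
  + by rewrite -setI_bigcupr => x [Dx _]; exact: g0.
  + apply/trivIsetP => /= i j _ _ ij; rewrite setIACA.
    by move/trivIsetP : tF => /(_ _ _ _ _ ij) ->//; rewrite setI0.
Qed.

Lemma pack_sigma_finite d (T : measurableType d) (mu : {measure set T -> \bar R}) :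
  sigma_finite setT mu ->
  exists nu : {sigma_finite_measure set T -> \bar R},
    nu = mu :> (set T -> \bar R).
Proof.
move=> H.
pose H2 := isSFinite.Build _ _ _ (Measure.sort mu) (sfinite_measure_sigma_finite H).
pose H3 := isSigmaFinite.Build _ _ _ (Measure.sort mu) H.
by exists (HB.pack_for {sigma_finite_measure set T -> \bar R} (Measure.sort mu) H2 H3).
Qed.

Lemma sigma_finite_prod d d' (T : measurableType d) (T' : measurableType d')
    (m1 : {sigma_finite_measure set T -> \bar R})
    (m2 : {sigma_finite_measure set T' -> \bar R}) :
  sigma_finite setT (m1 \x m2).
Proof.
have /sigma_finiteP[F [TF ndF Foo]] := sigma_finiteT m1.
have /sigma_finiteP[G [TG ndG Goo]] := sigma_finiteT m2.
exists (fun n => F n `*` G n).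
  rewrite -setXTT TF TG predeqE => -[x y]; split=> [[[n _ Fx] [k _ Gy]]|].
    exists (maxn n k) => //; split.
    - by move/subsetPset: (ndF _ _ (leq_maxl n k)); apply.
    - by move/subsetPset: (ndG _ _ (leq_maxr n k)); apply.
  by move=> [n _ []/= ? ?]; split; exists n.
move=> k; have [? ?] := Foo k; have [? ?] := Goo k.
split; first exact: measurableX.
by rewrite product_measure1E// lte_mul_pinfty// ge0_fin_numE.
Qed.

End MeasureConstructions.

(** * Lebesgue measure from its recursive definition *)

Section LebesgueRV.
Local Open Scope ereal_scope.
Context {R : realType}.

(** The isomorphism along which [lebesgue_rV] is a product measure; it transports measurability,
    sections and Fubini's theorem to row vectors. *)
Definition consr m (p : R * borel_rV R m) : borel_rV R m.+1 :=
  row_mx p.1%:M p.2.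

Lemma consr0 m p : @consr m p 0%R 0%R = p.1.
Proof.
rewrite /consr mxE; case: splitP => [j _|//].
by rewrite (ord1 j) mxE eqxx mulr1n.
Qed.

Lemma consrS m p (i : 'I_m) : @consr m p 0%R (lift ord0 i) = p.2 0%R i.
Proof.
rewrite /consr mxE; case: splitP => [j E|j [E]].
  by have := ltn_ord j; rewrite -E.
by congr (p.2 _ _); apply: val_inj.
Qed.

Definition unconsr m (x : borel_rV R m.+1) : R * borel_rV R m :=
  (x 0%R 0%R, \row_i x 0%R (lift ord0 i)).

Lemma unconsrK m : cancel (@unconsr m) (@consr m).
Proof.
move=> x; apply/rowP => i; case: (unliftP ord0 i) => [j ->|->].
  by rewrite consrS mxE.
by rewrite consr0.
Qed.

Lemma consrK m : cancel (@consr m) (@unconsr m).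
Proof.
move=> [a v]; rewrite /unconsr consr0 /=; congr pair.
by apply/rowP => i; rewrite mxE consrS.
Qed.

Lemma measurable_consr m : measurable_fun setT (@consr m).
Proof.
apply: measurable_rV => i; case: (unliftP ord0 i) => [j ->|->].
  under eq_fun do rewrite consrS.
  exact: (measurableT_comp (@measurable_coord R m j) (@measurable_snd _ _ _ _)).
under eq_fun do rewrite consr0.
exact: measurable_fst.
Qed.

Lemma measurable_unconsr m : measurable_fun setT (@unconsr m).
Proof.
apply: measurable_fun_pair; first exact: measurable_coord.
apply: measurable_rV => i; under eq_fun do rewrite mxE.
exact: measurable_coord.
Qed.

Lemma lebesgue_rVS m (A : set (borel_rV R m.+1)) :
  lebesgue_rV A = (lebesgue_measure \x @lebesgue_rV R m) (@consr m @^-1` A).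
Proof.
rewrite /product_measure1 /=; apply: eq_integral => x _ /=; congr lebesgue_rV.
by apply/seteqP; split=> v /=; rewrite /xsection /= inE.
Qed.

(** Countable additivity and sigma-finiteness go through the same induction, because the product
    construction in dimension [m + 1] takes a sigma-finite measure as its second factor. *)
Lemma lebesgue_rV_pack m : exists nu : {sigma_finite_measure set (borel_rV R m) -> \bar R},
  nu = @lebesgue_rV R m :> (set (borel_rV R m) -> \bar R).
Proof.
elim: m => [|m [nu nuE]].
  by exists \d_(0%R : borel_rV R 0); apply/funext => A; rewrite /dirac.
pose pm := (lebesgue_measure \x nu)%E.
have [mu' mu'E] := push_measure (lebesgue_measure \x nu) measurableT (@measurable_consr m).
have sf : sigma_finite setT mu'.
  have [F FT Fm] : sigma_finite setT (lebesgue_measure \x nu) by exact: sigma_finite_prod.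
  exists (fun k => @unconsr m @^-1` F k).
    by rewrite -preimage_bigcup -FT preimage_setT.
  move=> k; have [mF Foo] := Fm k; split.
    by rewrite -[X in measurable X]setTI; exact: measurable_unconsr.
  rewrite mu'E /= setTI -comp_preimage.
  by rewrite (_ : _ \o _ = id) // funeqE => x /=; rewrite consrK.
have [nu' nu'E] := pack_sigma_finite sf.
exists nu'; rewrite nu'E mu'E; apply/funext => A.
rewrite setTI lebesgue_rVS; apply: eq_integral => x _ /=.
exact: (congr1 (fun f => f _) nuE).
Qed.

Lemma lebesgue_rV0 m : @lebesgue_rV R m set0 = 0.
Proof. by have [nu <-] := lebesgue_rV_pack m; rewrite measure0. Qed.

Lemma lebesgue_rV_ge0 m A : 0 <= @lebesgue_rV R m A.
Proof. by have [nu <-] := lebesgue_rV_pack m; rewrite measure_ge0. Qed.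

Lemma lebesgue_rV_sigma_additive m : semi_sigma_additive (@lebesgue_rV R m).
Proof.
by have [nu <-] := lebesgue_rV_pack m; exact: measure_semi_sigma_additive.
Qed.

HB.instance Definition _ m := isMeasure.Build _ _ _ (@lebesgue_rV R m)
  (lebesgue_rV0 m) (@lebesgue_rV_ge0 m) (@lebesgue_rV_sigma_additive m).

Lemma sigma_finite_lebesgue_rV m : sigma_finite setT (@lebesgue_rV R m).
Proof. by have [nu <-] := lebesgue_rV_pack m; exact: sigma_finiteT. Qed.

HB.instance Definition _ m := Measure_isSigmaFinite.Build _ _ _ (@lebesgue_rV R m)
  (@sigma_finite_lebesgue_rV m).

Definition box m (a b : 'rV[R]_m) : set 'rV[R]_m :=
  [set x | forall i, (a 0 i <= x 0 i < b 0 i)%R].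

Lemma lebesgue_box m (a b : 'rV[R]_m) : (forall i, a 0 i <= b 0 i)%R ->
  lebesgue_rV (box a b : set (borel_rV R m)) = (\prod_(i < m) (b 0 i - a 0 i))%:E.
Proof.
elim: m => [|m IH] in a b *; move=> ab.
  by rewrite /= big_ord0 indicE mem_set // => -[].
pose a' : 'rV[R]_m := \row_i a 0%R (lift ord0 i).
pose b' : 'rV[R]_m := \row_i b 0%R (lift ord0 i).
have E : consr (m := m) @^-1` (box a b) =
    `[(a 0 0)%R, (b 0 0)%R[%classic `*` (box a' b').
  apply/seteqP; split=> -[x v] /=; rewrite in_itv /=.
    move=> H; split; first by have := H ord0; rewrite consr0.
    by move=> i; rewrite !mxE -(consrS (x, v)).
  move=> [Hx Hv] i; case: (unliftP ord0 i) => [j ->|->]; last by rewrite consr0.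
  by rewrite consrS; have := Hv j; rewrite !mxE.
rewrite lebesgue_rVS E product_measure1E //; last first.
  rewrite (_ : box a' b' = \big[setI/setT]_(i < m)
     ((fun x : borel_rV R m => x 0%R i) @^-1` `[(a' 0 i)%R, (b' 0 i)%R[)).
    apply: bigsetI_measurable => i _; rewrite -[X in measurable X]setTI.
    exact: measurable_coord.
  rewrite -bigcap_seq; apply/seteqP; split=> [x H i _ /=|x H i].
    by rewrite in_itv /=; exact: H.
  have := H i; rewrite /= mem_index_enum in_itv /=; exact.
rewrite [X in _ * X](IH a' b'); last by move=> i; rewrite !mxE.
rewrite [X in X * _](lebesgue_measure_itv `[_, _[) /= lte_fin big_ord_recl.
under eq_bigr do rewrite !mxE.
have := ab ord0; rewrite le_eqVlt => /orP[/eqP ab0|ab0].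
  by rewrite ab0 ltxx subrr mul0r mul0e.
by rewrite ab0 -EFinB -EFinM.
Qed.

End LebesgueRV.

Section EpsilonDelta.
Context {R : realType} {V W : normedModType R}.

Lemma cvg_epsP (f : V -> W) (x : V) (l : W) :
  (f y @[y --> x] --> l) <-> (forall e : R, 0 < e -> exists2 d : R, 0 < d &
     forall y, `|y - x| < d -> `|f y - l| < e).
Proof.
split=> [/cvgrPdist_lt H e e0|H].
  have /nbhs_normP[d /= d0 Hd] := H e e0.
  by exists d => // y yx; rewrite distrC; apply: Hd; rewrite /= distrC.
apply/cvgrPdist_lt => e /H[d d0 Hd]; apply/nbhs_normP; exists d => //= y.
by rewrite /ball_ /= distrC => /Hd; rewrite distrC.
Qed.

Lemma continuous_epsP (f : V -> W) (x : V) :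
  {for x, continuous f} <-> (forall e : R, 0 < e -> exists2 d : R, 0 < d &
     forall y, `|y - x| < d -> `|f y - f x| < e).
Proof. exact: cvg_epsP. Qed.

Lemma continuous_scale_add (r : R) (v : V) : continuous (fun x : V => r *: x + v).
Proof.
move=> x; apply: cvgD; last exact: cvg_cst.
by apply: cvgZ; [exact: cvg_cst|exact: cvg_id].
Qed.

End EpsilonDelta.

Section LinearBound.
Context {R : realType}.

Lemma mulmx_norm_le p q (N : 'M[R]_(p, q)) :
  exists2 C : R, 0 < C & forall v : 'rV_p, `|v *m N| <= C * `|v|.
Proof.
exists (1 + \sum_i \sum_j `|N i j|) => [|v].
  by rewrite ltr_wpDr // sumr_ge0 // => i _; rewrite sumr_ge0.
have S0 : 0 <= \sum_i \sum_j `|N i j|.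
  by rewrite sumr_ge0 // => i _; rewrite sumr_ge0.
apply: norm_rV_le => [|j]; first by rewrite mulr_ge0 // ltW // ltr_wpDr.
rewrite mxE; apply: le_trans (ler_norm_sum _ _ _) _.
rewrite mulrDl mul1r ler_wpDl // mulr_suml; apply: ler_sum => i _.
rewrite normrM mulrC ler_pM ?coord_le_norm //.
by rewrite (bigD1 j) //= lerDl sumr_ge0.
Qed.

Lemma continuous_mulmx p q (N : 'M[R]_(p, q)) :
  continuous (fun v : 'rV[R]_p => v *m N).
Proof.
have [C C0 HC] := mulmx_norm_le N.
move=> v; apply/continuous_epsP => e e0; exists (e / C); first exact: divr_gt0.
move=> w; rewrite ltr_pdivlMr // mulrC -mulmxBl => ?.
exact: le_lt_trans (HC _) _.
Qed.

End LinearBound.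

(** * Lebesgue measure under translations, dilations and linear maps *)

Section LebesgueInvariance.
Local Open Scope ereal_scope.
Context {R : realType}.

Lemma measurable_continuous_rV p q (f : 'rV[R]_p -> 'rV[R]_q) : continuous f ->
  measurable_fun setT (f : borel_rV R p -> borel_rV R q).
Proof.
move=> cf; apply: measurable_rV => i; apply: continuous_measurable_rV => x.
apply: (@continuous_comp _ _ _ f (fun y : 'rV_q => y 0%R i)); first exact: cf.
exact: coord_continuous.
Qed.

Lemma measurable_preimage_rV p q (f : 'rV[R]_p -> 'rV[R]_q) (A : set (borel_rV R q)) :
  continuous f -> measurable A -> measurable (f @^-1` A : set (borel_rV R p)).
Proof.
move=> cf mA; rewrite -[X in measurable X]setTI.
exact: (measurable_continuous_rV cf).
Qed.

Lemma cell_box m k z : @cell R m k z =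
  box (\row_i ((2 ^+ k)^-1 * (z 0 i)%:~R))%R (\row_i ((2 ^+ k)^-1 * ((z 0 i)%:~R + 1)))%R.
Proof.
have p0 : (0 < (2 ^+ k)^-1 :> R)%R by rewrite invr_gt0 exprn_gt0.
have p1 : (2 ^+ k \is a @GRing.unit R)%R by rewrite unitfE lt0r_neq0 // exprn_gt0.
apply/seteqP; split=> x.
  move=> /cellP H i; have := H i; rewrite !mxE -(ler_pM2l p0) -(ltr_pM2l p0).
  by rewrite mulKr.
have p2 : (0 < 2 ^+ k :> R)%R by rewrite exprn_gt0.
move=> H; apply/cellP => i; have := H i; rewrite !mxE -(ler_pM2l p2) -(ltr_pM2l p2).
by rewrite !mulVKr.
Qed.

Lemma lebesgue_cell m k z :
  lebesgue_rV (@cell R m k z : set (borel_rV R m)) = (((2 ^+ k)^-1) ^+ m)%:E.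
Proof.
rewrite cell_box lebesgue_box => [|i].
  congr EFin; rewrite (eq_bigr (fun=> (2 ^+ k)^-1)%R).
    by rewrite prodr_const card_ord.
  by move=> i _; rewrite !mxE -mulrBr addrAC subrr add0r mulr1.
by rewrite !mxE ler_wpM2l ?invr_ge0 ?exprn_ge0 // lerDl.
Qed.

Lemma open_norm_lt m (r : R) : open [set x : 'rV[R]_m | `|x| < r]%R.
Proof.
apply/open_rVP => x /= xr; exists (r - `|x|)%R; first by rewrite subr_gt0.
move=> y yx; rewrite -(subrK x y); apply: le_lt_trans (ler_normD _ _) _; lra.
Qed.

Lemma lebesgue_bounded m (A : set (borel_rV R m)) (r : R) : measurable A ->
  (forall x, A x -> `|x| < r)%R -> lebesgue_rV A < +oo.
Proof.
move=> mA Ar.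
have [r0|r0] := leP r 0%R.
  rewrite (_ : A = set0) ?lebesgue_rV0 // -subset0 => x /Ar.
  by move=> /(le_lt_trans (normr_ge0 _)); rewrite ltNge r0.
have H : forall i : 'I_m, ((const_mx (- r) : 'rV_m) 0 i <= (const_mx r : 'rV_m) 0 i)%R.
  by move=> i; rewrite !mxE; lra.
pose B : set (borel_rV R m) := box (const_mx (- r)%R) (const_mx r).
have AB : lebesgue_rV A <= lebesgue_rV B.
  apply: le_measure; rewrite ?inE // /B.
    rewrite (_ : box _ _ = \big[setI/setT]_(i < m)
       ((fun x : borel_rV R m => x 0%R i) @^-1` `[(- r)%R, r[)).
      apply: bigsetI_measurable => i _; rewrite -[X in measurable X]setTI.
      exact: measurable_coord.
    rewrite -bigcap_seq; apply/seteqP; split=> [x Hx i _ /=|x Hx i].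
      by have := Hx i; rewrite in_itv /= !mxE.
    by have := Hx i; rewrite /= mem_index_enum in_itv /= !mxE; exact.
  move=> x /Ar xr i; rewrite !mxE.
  have := le_lt_trans (coord_le_norm x i) xr; rewrite ltr_norml => /andP[? ?].
  by apply/andP; split => //; exact: ltW.
by apply: le_lt_trans AB _; rewrite lebesgue_box // ltry.
Qed.

Lemma measure_unique_open m (a b : {measure set (borel_rV R m) -> \bar R}) :
  (forall W : set 'rV[R]_m, open W -> a W = b W) ->
  (forall r : R, a [set x | `|x| < r]%R < +oo) ->
  forall A, measurable A -> a A = b A.
Proof.
move=> ab aoo A mA.
apply: (@measure_unique _ R (borel_rV R m) (@open 'rV[R]_m) (fun k => [set x | `|x| < k%:R]%R)) => //.
- by move=> ? ?; exact: openI.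
- by move=> k; exact: open_norm_lt.
- apply/seteqP; split=> // x _; exists (Num.truncn `|x|).+1 => //=.
  exact: truncnS_gt.
Qed.

(** All cells of one level have the same Lebesgue measure and an open set is a disjoint union of
    cells, so the values on cells fix the measure on open sets; [measure_unique_open] then reaches
    all Borel sets. *)
Lemma lebesgue_unique m (nu : {measure set (borel_rV R m) -> \bar R}) (c : R) :
  (0 <= c)%R ->
  (forall k z, nu (@cell R m k z) = (c * ((2 ^+ k)^-1) ^+ m)%:E) ->
  forall A, measurable A -> nu A = c%:E * lebesgue_rV A.
Proof.
move=> c0 H A mA; pose c' := NngNum c0.
suff -> : nu A = mscale c' (@lebesgue_rV R m) A by [].
symmetry; move: A mA; apply: measure_unique_open => [W oW|r].
  apply: measure_eq_cells => x /(cell_in_open oW)[K HK]; exists K; split.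
    exact: HK.
  by rewrite H /= /mscale /= lebesgue_cell EFinM.
rewrite /= /mscale /= lte_mul_pinfty ?lee_fin //.
by apply: (@lebesgue_bounded _ _ r) => //; apply: borel_open; exact: open_norm_lt.
Qed.

Lemma lebesgue_affine m (r : R) (v : 'rV[R]_m) (A : set (borel_rV R m)) :
  (0 < r)%R -> measurable A ->
  lebesgue_rV ((fun x => r *: x + v)%R @^-1` A) = ((r^-1) ^+ m)%:E * lebesgue_rV A.
Proof.
move=> r0 mA.
have cf : continuous (fun x : 'rV[R]_m => r *: x + v)%R.
  exact: continuous_scale_add.
have [nu nuE] := push_measure (@lebesgue_rV R m) measurableT (measurable_continuous_rV cf).
have {nuE} nuE B : nu B = lebesgue_rV ((fun x => r *: x + v)%R @^-1` B).
  by rewrite nuE setTI.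
rewrite -nuE; apply: lebesgue_unique => // [|k z].
  by rewrite exprn_ge0 // invr_ge0 ltW.
have u : (r \is a GRing.unit)%R by rewrite unitfE lt0r_neq0.
have p0 : (0 < (2 ^+ k)^-1 :> R)%R by rewrite invr_gt0 exprn_gt0.
rewrite nuE; pose a i := ((2 ^+ k)^-1 * (z 0 i)%:~R - v 0 i)%R.
rewrite cell_box (_ : _ @^-1` _ =
    box (\row_i (r^-1 * a i))%R (\row_i (r^-1 * (a i + (2 ^+ k)^-1)))%R); last first.
  have K t i : ((2 ^+ k)^-1 * (z 0 i)%:~R <= r * t + v 0 i < (2 ^+ k)^-1 * ((z 0 i)%:~R + 1))%R
      = (r^-1 * a i <= t < r^-1 * (a i + (2 ^+ k)^-1))%R.
    rewrite -[in RHS](ler_pM2l r0) -[in RHS](ltr_pM2l r0) !mulVKr // /a lerBlDr.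
    by rewrite [in RHS]addrAC ltrBrDr mulrDr mulr1.
  by apply/seteqP; split=> x /= H i; have := H i; rewrite !mxE K.
rewrite lebesgue_box => [|i].
  congr EFin; rewrite (eq_bigr (fun=> r^-1 * (2 ^+ k)^-1)%R).
    by rewrite prodr_const card_ord exprMn.
  by move=> i _; rewrite !mxE -mulrBr addrAC subrr add0r.
by rewrite !mxE ler_wpM2l ?invr_ge0 ?(ltW r0) // lerDl ltW.
Qed.

Lemma lebesgue_translate m (v : 'rV[R]_m) (A : set (borel_rV R m)) :
  measurable A -> lebesgue_rV ((fun x => x + v)%R @^-1` A) = lebesgue_rV A.
Proof.
move=> mA; rewrite -[RHS]mul1e -[X in X%:E * _](@expr1n R m) -[X in (X ^+ m)%:E]invr1.
rewrite -(lebesgue_affine v ltr01 mA); congr lebesgue_rV.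
by apply/seteqP; split=> x /=; rewrite scale1r.
Qed.

(** Volume factor of the preimage under [M], measured on the half-open unit cube; [kapE] identifies
    it with the inverse of the absolute determinant. *)
Definition kap m (M : 'M[R]_m) : R :=
  fine (lebesgue_rV ((fun x => x *m M) @^-1` (@cell R m 0 0) : set (borel_rV R m))).

Lemma kap_ge0 m (M : 'M[R]_m) : (0 <= kap M)%R.
Proof. by rewrite fine_ge0. Qed.

(** Every dyadic cell pulls back to a rescaled translate of the preimage [P0] of the unit cube, so
    the push-forward of Lebesgue measure has equal values on the cells of one level and
    [lebesgue_unique] applies. *)
Lemma lebesgue_mulmx_kap m (M : 'M[R]_m) (A : set (borel_rV R m)) :
  M \in unitmx -> measurable A ->
  lebesgue_rV ((fun x => x *m M) @^-1` A) = (kap M)%:E * lebesgue_rV A.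
Proof.
move=> uM mA.
have cf := @continuous_mulmx R m m M.
have [nu nuE] := push_measure (@lebesgue_rV R m) measurableT (measurable_continuous_rV cf).
have {nuE} nuE B : nu B = lebesgue_rV ((fun x => x *m M) @^-1` B).
  by rewrite nuE setTI.
rewrite -nuE; apply: lebesgue_unique => // [|k z]; first exact: kap_ge0.
pose P0 : set (borel_rV R m) := (fun x : 'rV_m => x *m M) @^-1` (@cell R m 0 0).
have mP0 : measurable P0 by apply: measurable_preimage_rV => //; exact: measurable_cell.
have P0oo : lebesgue_rV P0 < +oo.
  have [C C0 HC] := mulmx_norm_le (invmx M).
  apply: (@lebesgue_bounded _ _ (C + C)%R) => // x /=; rewrite /cell /= => xM.
  have : (`|x *m M - 0| <= (2 ^+ 0)^-1)%R.
    by apply: cell_dist; rewrite xM; apply/rowP => i; rewrite !mxE mulr0 floor0.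
  rewrite subr0 expr0 invr1 => xM1.
  rewrite -(mulmxK uM x); apply: le_lt_trans (HC _) _.
  by apply: le_lt_trans (_ : C * 1 < _)%R; [rewrite ler_pM2l | rewrite mulr1 ltrDl].
rewrite nuE (_ : _ @^-1` _ =
    (fun x => 2 ^+ k *: x + - (map_mx intr z *m invmx M))%R @^-1` P0); last first.
  have E x : ((2 ^+ k *: x - map_mx intr z *m invmx M) *m M =
      2 ^+ k *: (x *m M) - map_mx intr z)%R.
    by rewrite mulmxDl mulNmx mulmxKV // -scalemxAl.
  rewrite /P0; apply/seteqP; split=> x /=; rewrite E => /cellP H;
  by apply/cellP => i; have := H i; rewrite !mxE expr0 mul1r add0r !mulr0z subr_ge0 ltrBlDr addrC.
rewrite lebesgue_affine ?exprn_gt0 // -[in LHS](@fineK _ (lebesgue_rV P0)); last first.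
  by rewrite ge0_fin_numE.
by rewrite -EFinM mulrC.
Qed.

Lemma lebesgue_unit_cell m : lebesgue_rV (@cell R m 0 0 : set (borel_rV R m)) = 1.
Proof. by rewrite lebesgue_cell expr0 invr1 expr1n. Qed.

Lemma kapM m (M N : 'M[R]_m) : M \in unitmx -> N \in unitmx ->
  kap (M *m N) = (kap M * kap N)%R.
Proof.
move=> uM uN; apply: EFin_inj; rewrite EFinM -[LHS]mule1 -[X in _ * X](lebesgue_unit_cell m).
rewrite -lebesgue_mulmx_kap ?unitmx_mul ?uM //; last exact: measurable_cell.
rewrite (_ : _ @^-1` _ =
  (fun x => x *m M) @^-1` ((fun x => x *m N) @^-1` (@cell R m 0 0))); last first.
  by apply/seteqP; split=> x /=; rewrite mulmxA.
rewrite lebesgue_mulmx_kap //; last first.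
  by apply: measurable_preimage_rV; [exact: continuous_mulmx|exact: measurable_cell].
by rewrite lebesgue_mulmx_kap ?lebesgue_unit_cell ?mule1 //; exact: measurable_cell.
Qed.

Lemma kap_perm m (s : {perm 'I_m}) : kap (perm_mx s : 'M[R]_m) = 1%R.
Proof.
rewrite /kap (_ : _ @^-1` _ = @cell R m 0 0) ?lebesgue_unit_cell //.
have E x i : (x *m perm_mx s : 'rV[R]_m) 0%R (s i) = x 0%R i.
  rewrite mxE (bigD1 i) //= !mxE eqxx mulr1 big1 ?addr0 // => j ji.
  by rewrite !mxE (inj_eq perm_inj) (negbTE ji) mulr0.
apply/seteqP; split=> x /= /cellP H; apply/cellP => i.
  by have := H (s i); rewrite E !mxE.
by have := H ((s^-1)%g i); rewrite -[in X in _ -> X](permKV s i) E !mxE.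
Qed.

Lemma kap1 m : kap (1%:M : 'M[R]_m) = 1%R.
Proof. by rewrite -perm_mx1 kap_perm. Qed.

Lemma lebesgue_scale1 (a : R) : a != 0%R ->
  lebesgue_measure [set x : R | 0 <= x * a < 1]%R = (`|a|^-1)%:E :> \bar R.
Proof.
move=> a0; have [an|ap|a00] := ltgtP a 0%R; last by rewrite a00 eqxx in a0.
  rewrite (_ : [set _ | _] = `]a^-1%R, 0%R]%classic); last first.
    apply/seteqP; split=> x /=; rewrite in_itv /= nmulr_lge0 //;
      by rewrite -[X in (_ * _ < X)%R](mulVf a0) ltr_nM2r // andbC.
  by rewrite lebesgue_measure_itv /= lte_fin invr_lt0 an -EFinB sub0r ltr0_norm // invrN.
rewrite (_ : [set _ | _] = `[0%R, a^-1%R[%classic); last first.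
  apply/seteqP; split=> x /=; rewrite in_itv /= pmulr_lge0 //;
    by rewrite -[X in (_ * _ < X)%R](mulVf a0) ltr_pM2r.
by rewrite lebesgue_measure_itv /= lte_fin invr_gt0 ap sube0 gtr0_norm.
Qed.

Lemma cell00_consr m (t : R) (v : 'rV[R]_m) :
  @cell R m.+1 0 0 (row_mx t%:M v) <-> (0 <= t < 1)%R /\ @cell R m 0 0 v.
Proof.
have e i : ((0 : 'rV[int]_m) 0 i)%:~R = 0%R :> R by rewrite mxE.
have e' i : ((0 : 'rV[int]_m.+1) 0 i)%:~R = 0%R :> R by rewrite mxE.
split=> [/cellP H|[tH /cellP H]].
  split; first by have := H ord0; rewrite expr0 mul1r e' (consr0 (t, v)) add0r.
  by apply/cellP => i; have := H (lift ord0 i); rewrite e e' (consrS (t, v)).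
apply/cellP => i; rewrite e' expr0 mul1r add0r.
case: (unliftP ord0 i) => [j ->|->]; last by rewrite (consr0 (t, v)).
by rewrite (consrS (t, v)); have := H j; rewrite e expr0 mul1r add0r.
Qed.

(** Fubini in the first coordinate [t]: it is only multiplied by [a], and the section over an
    admissible [t] is a translate of the preimage of the unit cube under [M], since the shear by [b]
    acts on it as a translation. *)
Lemma kap_ublock m (a : R) (b : 'rV[R]_m) (M : 'M[R]_m) :
  a != 0%R -> M \in unitmx ->
  kap (block_mx a%:M b 0 M : 'M[R]_(1 + m)) = (`|a|^-1 * kap M)%R.
Proof.
move=> a0 uM; rewrite /kap lebesgue_rVS /product_measure1.
have E (t : R) (v : 'rV[R]_m) : row_mx t%:M v *m (block_mx a%:M b 0 M : 'M[R]_(1 + m)) =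
    row_mx (t * a)%:M (t *: b + v *m M).
  by rewrite mul_row_block mulmx0 addr0 -scalar_mxM mul_scalar_mx.
transitivity (fine (\int[lebesgue_measure]_t
    ((kap M)%:E * (\1_[set x : R | 0 <= x * a < 1]%R t)%:E))).
  congr fine; apply: eq_integral => t _ /=; rewrite indicE; have [/set_mem/= tH|tH] := boolP (t \in _).
    rewrite mule1 -[RHS]mule1 -(lebesgue_unit_cell m).
    rewrite -(lebesgue_mulmx_kap uM); last exact: measurable_cell.
    rewrite -[RHS](@lebesgue_translate m (t *: b *m invmx M)); last first.
      by apply: measurable_preimage_rV; [exact: continuous_mulmx|exact: measurable_cell].
    congr lebesgue_rV; apply/seteqP; split=> v; rewrite /xsection /= ?inE /consr /= E.
      by move=> /cell00_consr[_]; rewrite mulmxDl mulmxKV // addrC.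
    by rewrite mulmxDl mulmxKV // addrC => ?; apply/cell00_consr.
  rewrite mule0 (_ : xsection _ _ = set0) ?lebesgue_rV0 //.
  apply/seteqP; split=> // v; rewrite /xsection /= ?inE /consr /= E.
  by move=> /cell00_consr[tH']; move: tH; rewrite notin_setE.
have mI : measurable [set x : R | 0 <= x * a < 1]%R.
  rewrite (_ : [set _ | _] = (fun x : R => x * a)%R @^-1` `[0%R, 1%R[).
    by rewrite -[X in measurable X]setTI; apply: measurable_funM.
  by apply/seteqP; split=> x /=; rewrite in_itv.
rewrite ge0_integralZl ?lee_fin ?kap_ge0 //; last exact/measurable_EFinP.
rewrite integral_indic // setIT [X in _ * X](lebesgue_scale1 a0) /=.
by rewrite -/(kap M) mulrC.
Qed.

(** The sections over the first coordinate are not translates of one another here, so Fubini is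
    replaced by a symmetry: the reflection [D] conjugates the shear to its inverse, hence the factor
    squares to 1 and, being nonnegative, equals 1. *)
Lemma kap_lblock1 m (c : 'cV[R]_m) :
  kap (block_mx 1%:M 0 c 1%:M : 'M[R]_(1 + m)) = 1%R.
Proof.
pose D : 'M[R]_(1 + m) := block_mx (-1)%:M 0 0 1%:M.
pose L (c : 'cV[R]_m) : 'M[R]_(1 + m) := block_mx 1%:M 0 c 1%:M.
have DD : D *m D = 1%:M.
  by rewrite mulmx_block !mulmx0 !mul0mx !addr0 add0r mulmx1 -scalar_mxM mulrNN mulr1 -scalar_mx_block.
have DLD d : D *m L d *m D = L (- d)%R.
  rewrite !mulmx_block !mulmx0 !mul0mx !mulmx1 !mul1mx !addr0 !add0r.
  by rewrite -scalar_mxM mulrNN mulr1 scalar_mxC mul_scalar_mx scaleN1r.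
have LL d : L d *m L (- d)%R = 1%:M.
  rewrite mulmx_block !mulmx0 !mul0mx !mulmx1 !mul1mx !addr0 !add0r.
  by rewrite subrr -scalar_mx_block.
have uD : D \in unitmx by case: (mulmx1_unit DD).
have uL d : L d \in unitmx by case: (mulmx1_unit (LL d)).
have kD : kap D = 1%R.
  by rewrite kap_ublock ?oppr_eq0 ?oner_neq0 ?unitmx1 // kap1 normrN normr1 invr1 mulr1.
have uDL : D *m L c \in unitmx by rewrite unitmx_mul uD uL.
have kN : kap (L (- c)%R) = kap (L c).
  by have := kapM uDL uD; rewrite DLD kD mulr1 => ->; rewrite kapM // kD mul1r.
have := kapM (uL c) (uL (- c)%R); rewrite LL kap1 kN => k2.
by apply/eqP; rewrite -(@eqrXn2 _ 2) ?kap_ge0 // expr1n expr2 -/(L c) -k2.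
Qed.

(** One step of Gaussian elimination: after a row exchange the matrix is a lower shear times an
    upper block matrix whose corner is the Schur complement [N], to which the induction applies. *)
Lemma kapE m (M : 'M[R]_m) : M \in unitmx -> kap M = (`|\det M|^-1)%R.
Proof.
elim: m => [|m IH] in M *; move=> uM.
  by rewrite det_mx00 normr1 invr1 (_ : M = 1%:M) ?kap1 //; apply/matrixP => -[].
have [i Mi0] : exists i, M i 0%R != 0%R.
  apply: contrapT => H; have M0 : M *m delta_mx 0%R 0%R = (0 : 'cV_m.+1)%R.
    rewrite -colE; apply/colP => i; rewrite !mxE; apply/eqP/negPn/negP => Hi.
    by apply: H; exists i.
  have := mulKmx uM (delta_mx 0%R 0%R : 'cV_m.+1); rewrite M0 mulmx0.
  by move/matrixP/(_ 0%R 0%R); rewrite !mxE !eqxx /= => /esym/eqP; rewrite oner_eq0.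
pose P : 'M[R]_m.+1 := tperm_mx 0%R i.
have uP : P \in unitmx by exact: unitmx_perm.
pose M1 : 'M[R]_(1 + m) := P *m M.
have PP : P *m P = 1%:M by rewrite /P /tperm_mx -perm_mxM tperm2 perm_mx1.
have ME : M = P *m M1 by rewrite mulmxA PP mul1mx.
have uM1 : M1 \in unitmx by rewrite unitmx_mul uP.
have dP : (`|\det P| = 1)%R by rewrite det_perm normrX normrN normr1 expr1n.
rewrite ME kapM // kap_perm mul1r det_mulmx normrM dP mul1r.
pose a := M1 0%R 0%R; pose b : 'rV[R]_m := ursubmx M1.
pose c : 'cV[R]_m := dlsubmx M1; pose d : 'M[R]_m := drsubmx M1.
have a0 : a != 0%R by rewrite /a /M1 -xrowE mxE tpermL.
have M1E : M1 = block_mx a%:M b c d.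
  rewrite -[LHS]submxK; congr block_mx.
  rewrite [LHS]mx11_scalar; congr (_%:M).
  by rewrite mxE mxE; congr (M1 _ _); exact: val_inj.
pose N := (d - (a^-1 *: c) *m b)%R.
have M1F : M1 = (block_mx 1%:M 0 (a^-1 *: c) 1%:M : 'M[R]_(1 + m)) *m block_mx a%:M b 0 N.
  rewrite M1E mulmx_block !mulmx0 !mul0mx !mul1mx !addr0 /N.
  by rewrite scalar_mxC mul_scalar_mx scalerA divff // scale1r addrC subrK.
have dM1 : \det M1 = (a * \det N)%R.
  by rewrite M1F det_mulmx det_lblock !det1 !mul1r det_ublock det_scalar1.
have uN : N \in unitmx.
  by move: uM1; rewrite !unitmxE dM1 unitrM => /andP[].
have uL : (block_mx 1%:M 0 (a^-1 *: c) 1%:M : 'M[R]_(1 + m)) \in unitmx.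
  by rewrite unitmxE det_lblock !det1 mulr1 unitr1.
have uU : (block_mx a%:M b 0 N : 'M[R]_(1 + m)) \in unitmx.
  by rewrite unitmxE det_ublock det_scalar1 unitrM unitfE a0 -unitmxE.
rewrite [in LHS]M1F kapM // kap_lblock1 mul1r kap_ublock // IH // dM1.
by rewrite normrM invfM.
Qed.

Theorem lebesgue_mulmx m (M : 'M[R]_m) (A : set (borel_rV R m)) :
  M \in unitmx -> measurable A ->
  lebesgue_rV ((fun x => x *m M) @^-1` A) = (`|\det M|^-1)%:E * lebesgue_rV A.
Proof. by move=> uM mA; rewrite lebesgue_mulmx_kap // kapE. Qed.

End LebesgueInvariance.

(** * Change of variables *)

Section HasDiff.
Context {R : realType}.

(** Frechet differentiability with a prescribed matrix, in the row-vector convention where [N] acts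
    on the right. The Gauss map in a chart and the tube map are differentiated in this form. *)
Definition has_diff p q (F : 'rV[R]_p -> 'rV[R]_q) (x : 'rV[R]_p) (N : 'M[R]_(p, q)) :=
  forall e : R, 0 < e -> exists2 d : R, 0 < d &
    forall y, `|y - x| < d -> `|F y - F x - (y - x) *m N| <= e * `|y - x|.

Lemma has_diff_continuous p q F x (N : 'M[R]_(p, q)) :
  has_diff F x N -> {for x, continuous F}.
Proof.
move=> H; apply/continuous_epsP => e e0.
have [C C0 HC] := mulmx_norm_le N.
have [d d0 Hd] := H 1 ltr01.
have e1 : 0 < e / (1 + C) by rewrite divr_gt0 // addr_gt0.
exists (Num.min d (e / (1 + C))) => [|y]; first by rewrite lt_min d0.
rewrite lt_min => /andP[yd]; rewrite ltr_pdivlMr ?addr_gt0 // => ye.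
rewrite -(subrK ((y - x) *m N) (F y - F x)).
apply: le_lt_trans (ler_normD _ _) _; apply: le_lt_trans ye.
rewrite mulrDr mulr1 lerD //; last by rewrite mulrC; exact: HC.
by rewrite -[leRHS]mul1r; exact: Hd.
Qed.

(** If [L] is a right inverse of the differential [N] at [x], then near [x] the
    increment of the argument is recovered, to first order, by applying [L] to
    the increment of the value. *)
Lemma has_diff_inv p q F x (N : 'M[R]_(p, q)) (L : 'M[R]_(q, p)) :
  has_diff F x N -> N *m L = 1%:M ->
  forall e : R, 0 < e -> exists2 d : R, 0 < d &
    forall w, `|w - x| < d -> `|w - x - (F w - F x) *m L| <= e * `|F w - F x|.
Proof.
move=> H NL e e0.
have [C C0 HC] := mulmx_norm_le L.
(* The first bound makes the error at most half of [h], so that [h] is controlled by [g]; the second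
   turns this control into the factor [e]. *)
pose e1 := Num.min (1 / (2 * C)) (e / (2 * C ^+ 2)).
have C2 : 0 < 2 * C by rewrite mulr_gt0.
have C22 : 0 < 2 * C ^+ 2 by rewrite mulr_gt0 // exprn_gt0.
have e10 : 0 < e1 by rewrite lt_min !divr_gt0.
have [d d0 Hd] := H e1 e10; exists d => // w /Hd {}Hd.
set h := w - x in Hd *; set g := F w - F x in Hd *.
have E : h - g *m L = - ((g - h *m N) *m L).
  rewrite [in RHS]mulmxBl opprB; congr (_ - _).
    by rewrite -(mulmxA h N L) NL mulmx1.
have b1 : `|h - g *m L| <= C * (e1 * `|h|).
  by rewrite E normrN; apply: le_trans (HC _) _; rewrite ler_pM2l.
have e1a : 2 * (C * e1) <= 1.
  have : e1 <= 1 / (2 * C) by rewrite ge_min lexx.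
  by rewrite ler_pdivlMr // mulrC mulrA.
have e1b : e1 * (2 * C ^+ 2) <= e.
  have : e1 <= e / (2 * C ^+ 2) by rewrite ge_min lexx orbT.
  by rewrite ler_pdivlMr.
have b2 : `|h| <= 2 * (C * `|g|).
  have t : `|h| <= `|h - g *m L| + `|g *m L|.
    by rewrite -[X in `|X| <= _](subrK (g *m L) h) ler_normD.
  have := HC g; have h0 := normr_ge0 h; nra.
apply: le_trans b1 _; have h0 := normr_ge0 h; have g0 := normr_ge0 g.
apply: le_trans (_ : C * (e1 * (2 * (C * `|g|))) <= _).
  by rewrite ler_pM2l // ler_pM2l.
rewrite (_ : C * _ = e1 * (2 * C ^+ 2) * `|g|); last by ring.
by rewrite ler_wpM2r.
Qed.

(** Continuity of [G] brings [G z] into the range where [has_diff_inv] holds at [G y], and there the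
    increments of [F] are exactly [z - y]. *)
Lemma has_diff_inverse p (F G : 'rV[R]_p -> 'rV[R]_p) (V : set 'rV[R]_p) y (N : 'M[R]_p) :
  open V -> V y -> (forall z, V z -> F (G z) = z) -> {for y, continuous G} ->
  has_diff F (G y) N -> N \in unitmx -> has_diff G y (invmx N).
Proof.
move=> oV Vy FG cG H uN e e0.
have [d d0 Hd] := has_diff_inv H (mulmxV uN) e0.
have /continuous_epsP/(_ d d0)[d1 d10 Hd1] := cG.
have /open_rVP/(_ _ Vy)[d2 d20 Hd2] := oV.
exists (Num.min d1 d2) => [|z]; first by rewrite lt_min d10.
rewrite lt_min => /andP[z1 z2]; have := Hd _ (Hd1 _ z1).
by rewrite !FG //; exact: Hd2.
Qed.

End HasDiff.

Section ChangeOfVariables.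
Local Open Scope ereal_scope.
Context {R : realType}.

Lemma open_ball_rV m (x : 'rV[R]_m) (d : R) : open [set y : 'rV[R]_m | `|y - x| < d]%R.
Proof.
apply/open_rVP => y /= yx; exists (d - `|y - x|)%R; first by rewrite subr_gt0.
by move=> z zy; rewrite -(subrK y z) -addrA; apply: le_lt_trans (ler_normD _ _) _; lra.
Qed.

Lemma ball_rV_center m (x : 'rV[R]_m) (d : R) : (0 < d)%R ->
  [set y : 'rV[R]_m | `|y - x| < d]%R x.
Proof. by rewrite /= subrr normr0. Qed.

Lemma continuous_addr m (x : 'rV[R]_m) : continuous (fun y : 'rV[R]_m => y + x)%R.
Proof.
by move=> y; apply/continuous_epsP => e e0; exists e => // z; rewrite opprD addrACA subrr addr0.
Qed.

Lemma measurable_open_continuous p d (T : measurableType d)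
    (U : set 'rV[R]_p) (G : set (set T)) (f : borel_rV R p -> T) :
  @measurable _ T = <<s G >> -> open U ->
  (forall x, U x -> forall A, G A -> A (f x) ->
     exists2 e : R, (0 < e)%R & forall y, (`|y - x| < e)%R -> A (f y)) ->
  measurable_fun (U : set (borel_rV R p)) f.
Proof.
move=> mG oU cf; apply: (@measurability _ _ (borel_rV R p) _ U f G mG) => _ [A GA <-].
apply: borel_open; apply/open_rVP => x [Ux Ax].
have [e e0 He] := cf x Ux A GA Ax.
have /open_rVP/(_ _ Ux)[e' e'0 He'] := oU.
exists (Num.min e e'); first by rewrite lt_min e0.
by move=> y; rewrite lt_min => /andP[/He Ay /He' Uy].
Qed.

Lemma measurable_fun_open_rV p q (U : set 'rV[R]_p) (f : 'rV[R]_p -> 'rV[R]_q) :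
  open U -> (forall x, U x -> {for x, continuous f}) ->
  measurable_fun (U : set (borel_rV R p)) (f : borel_rV R p -> borel_rV R q).
Proof.
move=> oU cf.
apply: (@measurable_open_continuous _ _ (borel_rV R q) U (@open 'rV[R]_q)) => // x Ux A oA Ax.
have /open_rVP/(_ _ Ax)[e e0 He] := oA.
have /continuous_epsP/(_ e e0)[d d0 Hd] := cf x Ux.
by exists d => // y /Hd /He.
Qed.

Lemma measurable_fun_open_real p (U : set 'rV[R]_p) (f : 'rV[R]_p -> R) :
  open U -> (forall x, U x -> {for x, continuous (f : 'rV[R]_p -> R^o)}) ->
  measurable_fun (U : set (borel_rV R p)) (f : borel_rV R p -> R).
Proof.
move=> oU cf.
apply: (@measurable_open_continuous _ _ R U _ f (RGenOpens.measurableE R)) => //.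
move=> x Ux _ [a [b ->]] /=; rewrite in_itv /= => /andP[ax xb].
have e0 : (0 < Num.min (f x - a) (b - f x))%R by rewrite lt_min !subr_gt0 ax.
have /continuous_epsP/(_ _ e0)[d d0 Hd] := cf x Ux.
exists d => // y /Hd; rewrite lt_min in_itv /= !ltr_norml => /andP[/andP[? ?] /andP[? ?]].
by apply/andP; split; lra.
Qed.

(** The measures may be infinite on [U], so the uniqueness theorem is applied inside the
    neighbourhoods [Q], where [a] is finite, and the result is summed over dyadic cells. *)
Lemma measure_eq_local p (a b : {measure set (borel_rV R p) -> \bar R}) (U : set 'rV[R]_p) :
  (forall x, U x -> exists Q : set 'rV[R]_p, [/\ open Q, Q x, Q `<=` U, a Q < +oo &
    forall W : set 'rV[R]_p, open W -> W `<=` Q -> a W = b W]) ->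
  forall A : set (borel_rV R p), measurable A -> A `<=` U -> a A = b A.
Proof.
move=> H A mA AU.
have oU : open U.
  apply/open_rVP => x /H[Q [oO Ox OU _ _]].
  have /open_rVP/(_ _ Ox)[e e0 He] := oO.
  by exists e => // y /He /OU.
pose aA := mrestr a mA; pose bA := mrestr b mA.
suff : aA U = bA U by rewrite /aA /bA /mrestr setIC (setIidl AU).
apply: measure_eq_cells => x /H[Q [oO Ox OU aO abO]].
have [K HK] := cell_in_open oO Ox.
exists K; have cO := HK K (leqnn _); split; first exact: subset_trans OU.
pose mO := borel_open oO; pose aO' := mrestr a mO; pose bO' := mrestr b mO.
suff : aO' (cell K (code K x) `&` A) = bO' (cell K (code K x) `&` A).
  by rewrite /aO' /bO' /mrestr setIAC (setIidl cO).
apply: measure_unique_open => [W oW|r|].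
- by rewrite /aO' /bO' /= /mrestr; apply: abO; [exact: openI|exact: subIsetr].
- apply: le_lt_trans aO; apply: le_measure; rewrite ?inE //.
    by apply: measurableI => //; apply: borel_open; exact: open_norm_lt.
- by apply: measurableI => //; exact: measurable_cell.
Qed.

Lemma lee_mul1eps (a b : \bar R) : 0 <= b ->
  (forall e : R, (0 < e)%R -> a <= (1 + e)%:E * b) -> a <= b.
Proof.
case: b => [b| |]; rewrite ?leey //.
rewrite lee_fin => b0 H; apply/lee_addgt0Pr => e e0.
apply: le_trans (H (e / (1 + b))%R _) _; first by rewrite divr_gt0 // ltr_pwDl.
rewrite -EFinM -EFinD lee_fin mulrDl mul1r lerD2l mulrAC ler_pdivrMr ?ltr_pwDl //.
by rewrite ler_pM2l // lerDr.
Qed.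

Lemma near_expr_le (a e : R) m : (0 <= a)%R -> (0 < e)%R ->
  exists2 t : R, (0 < t)%R & (a * (1 + 2 * t) ^+ m <= a + e)%R.
Proof.
move=> a0 e0.
have c : {for 0%R, continuous
    ((fun u : R => a * u ^+ m)%R \o (fun t : R => 1 + 2 * t)%R : R^o -> R^o)}.
  apply: continuous_comp.
    by apply: cvgD; [exact: cvg_cst|apply: cvgM; [exact: cvg_cst|exact: cvg_id]].
  by apply: cvgM; [exact: cvg_cst|exact: exprn_continuous].
have /continuous_epsP/(_ e e0)[d d0 Hd] := c.
exists (d / 2)%R; first by rewrite divr_gt0.
have := Hd (d / 2)%R; rewrite /= mulr0 addr0 expr1n mulr1 subr0 gtr0_norm ?divr_gt0 //.
by move=> /(_ ltac:(lra)); rewrite ltr_norml => /andP[_]; lra.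
Qed.

Lemma measurable_box m (a b : 'rV[R]_m) : measurable (box a b : set (borel_rV R m)).
Proof.
rewrite (_ : box _ _ = \big[setI/setT]_(i < m)
   ((fun x : borel_rV R m => x 0%R i) @^-1` `[(a 0 i)%R, (b 0 i)%R[)).
  apply: bigsetI_measurable => i _; rewrite -[X in measurable X]setTI.
  exact: measurable_coord.
rewrite -bigcap_seq; apply/seteqP; split=> [x Hx i _ /=|x Hx i].
  by have := Hx i; rewrite in_itv /=.
by have := Hx i; rewrite /= mem_index_enum in_itv /=; exact.
Qed.

(** On a small cell the map is nearly affine, so after applying [invmx N] and a translation its
    image lies in the cell thickened by [t] times the side, a cube whose side is [1 + 2 t] times
    larger. Measurable subsets [B] are used because the image is not known to be measurable. *)
Lemma diff_cell m (F : 'rV[R]_m -> 'rV[R]_m) x (N : 'M[R]_m) (e : R) :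
  has_diff F x N -> N \in unitmx -> (0 < e)%R ->
  exists K, forall k, (K <= k)%N -> forall B : set (borel_rV R m), measurable B ->
    B `<=` F @` (@cell R m k (code k x)) ->
    lebesgue_rV B <= (`|\det N| + e)%:E *
      lebesgue_rV (@cell R m k (code k x) : set (borel_rV R m)).
Proof.
move=> H uN e0.
have [t t0 Ht] := @near_expr_le `|\det N|%R e m (normr_ge0 _) e0.
have [C C0 HC] := mulmx_norm_le (invmx N).
(* The division by [C] pays for applying [invmx N] to the error term. *)
have [d d0 Hd] := H (t / C)%R (divr_gt0 t0 C0).
have [K HK] := exp2V_small d0.
exists K => k Kk B mB BF.
have {}HK := HK k Kk; set r := ((2 ^+ k)^-1 : R)%R in HK *; have r0 : (0 < r)%R by rewrite invr_gt0 exprn_gt0.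
set z := code k x in BF *.
have zx y : cell k z y -> (`|y - x| <= r)%R by move=> yz; apply: cell_dist; rewrite yz.
clearbody z.
pose a : 'rV[R]_m := (\row_i (r * (z 0 i)%:~R - t * r))%R.
pose b : 'rV[R]_m := (\row_i (r * ((z 0 i)%:~R + 1) + t * r))%R.
have Bsub : B `<=` (fun w => w *m invmx N) @^-1`
    ((fun w => w + (x - F x *m invmx N))%R @^-1` box a b).
  move=> w /BF[y yz <-] i /=.
  have yx := zx y yz.
  have xm := Hd y (le_lt_trans yx HK).
  have E : (F y *m invmx N + (x - F x *m invmx N) =
     y + (F y - F x - (y - x) *m N) *m invmx N)%R.
    rewrite !mulmxBl !mulmxK //; move: (F y *m _) (F x *m _) => u v.
    by apply/rowP => j; rewrite !mxE; ring.
  rewrite E; set q := (_ *m invmx N)%R; have /cellP/(_ i) yi := yz.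
  have qi : (`|q 0 i| <= t * r)%R.
    apply: le_trans (coord_le_norm _ _) _; apply: le_trans (HC _) _.
    apply: le_trans (_ : C * (t / C * r) <= _)%R.
      rewrite ler_pM2l //; apply: le_trans xm _.
      by rewrite ler_pM2l // divr_gt0.
    by rewrite mulrA mulrCA divff ?lt0r_neq0 // mulr1.
  clearbody q; move: yi; rewrite -(ler_pM2l r0) -(ltr_pM2l r0) mulKr ?unitfE ?lt0r_neq0 ?exprn_gt0 //.
  move: qi; rewrite ler_norml !mxE; lra.
have ab i : (a 0 i <= b 0 i)%R.
  by rewrite !mxE; have := mulr_gt0 t0 r0; nra.
apply: le_trans (_ : _ <= lebesgue_rV ((fun w => w *m invmx N) @^-1`
    ((fun w => w + (x - F x *m invmx N))%R @^-1` box a b))) _.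
  have mT : measurable ((fun w => w + (x - F x *m invmx N))%R @^-1` (box a b) : set (borel_rV R m)).
    apply: measurable_preimage_rV; last exact: measurable_box.
    exact: continuous_addr.
  apply: le_measure; rewrite ?inE //.
  by apply: measurable_preimage_rV => //; exact: continuous_mulmx.
rewrite lebesgue_mulmx ?unitmx_inv //; last first.
  apply: measurable_preimage_rV; last exact: measurable_box.
  exact: continuous_addr.
rewrite lebesgue_translate; last exact: measurable_box.
rewrite lebesgue_box // lebesgue_cell -!EFinM lee_fin det_inv normfV invrK.
rewrite (eq_bigr (fun=> r * (1 + 2 * t))%R); last by move=> i _; rewrite !mxE; ring.
rewrite prodr_const card_ord exprMn mulrCA mulrC -/r ler_wpM2r //.
by rewrite exprn_ge0 // ltW.
Qed.

Lemma integral_ge_cst d (T : measurableType d) (mu : {measure set T -> \bar R})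
    (A : set T) (f : T -> R) (c : R) :
  measurable A -> measurable_fun A f -> (0 <= c)%R -> (forall x, A x -> c <= f x)%R ->
  c%:E * mu A <= \int[mu]_(x in A) (f x)%:E.
Proof.
move=> mA mf c0 H; rewrite -integral_cst //; apply: ge0_le_integral => //.
- exact/measurable_EFinP.
Qed.

Lemma integral_le_cst d (T : measurableType d) (mu : {measure set T -> \bar R})
    (A : set T) (f : T -> R) (c : R) :
  measurable A -> measurable_fun A f -> (forall x, A x -> 0 <= f x <= c)%R ->
  \int[mu]_(x in A) (f x)%:E <= c%:E * mu A.
Proof.
move=> mA mf H; rewrite -integral_cst //; apply: ge0_le_integral => //.
- by move=> x Ax; rewrite lee_fin; have /andP[] := H x Ax.
- exact/measurable_EFinP.
- by move=> x Ax; rewrite lee_fin; have /andP[] := H x Ax.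
Qed.

Lemma measure_le_cells1 m (a b : {measure set (borel_rV R m) -> \bar R}) (W : set 'rV[R]_m) :
  (forall e : R, (0 < e)%R -> forall x, W x -> exists k, @cell R m k (code k x) `<=` W /\
     a (cell k (code k x)) <= (1 + e)%:E * b (cell k (code k x))) ->
  a W <= b W.
Proof.
move=> H; apply: lee_mul1eps => // e e0.
have e1 : (0 <= 1 + e)%R by rewrite addr_ge0 // ltW.
exact: (@measure_le_cells _ _ a (mscale (NngNum e1) b) W (H e e0)).
Qed.

Section Statement.
Variables (m : nat) (U V : set 'rV[R]_m) (F G : 'rV[R]_m -> 'rV[R]_m).
Variable N : 'rV[R]_m -> 'M[R]_m.
Hypotheses (oU : open U) (oV : open V).
Hypotheses (UV : forall x, U x -> V (F x)) (VU : forall y, V y -> U (G y)).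
Hypotheses (FK : forall x, U x -> G (F x) = x) (GK : forall y, V y -> F (G y) = y).
Hypothesis (cG : forall y, V y -> {for y, continuous G}).
Hypothesis (dF : forall x, U x -> has_diff F x (N x)).
Hypothesis (uN : forall x, U x -> N x \in unitmx).
Hypothesis (cN : forall x, U x -> {for x, continuous (fun z => \det (N z) : R^o)}).

Let f (x : 'rV[R]_m) : R := `|\det (N x)|%R.

Let cf x : U x -> {for x, continuous (f : 'rV[R]_m -> R^o)}.
Proof.
move=> /cN H; apply: (@continuous_comp _ _ _ (fun z => \det (N z) : R^o) (fun t : R^o => `|t|%R : R^o)).
  exact: H.
exact: norm_continuous.
Qed.

Let f_gt0 x : U x -> (0 < f x)%R.
Proof. by move=> /uN; rewrite unitmxE unitfE /f normr_gt0. Qed.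

Let mf : measurable_fun (U : set (borel_rV R m)) (f : borel_rV R m -> R).
Proof. exact: measurable_fun_open_real. Qed.

Let mG : measurable_fun (V : set (borel_rV R m)) (G : borel_rV R m -> borel_rV R m).
Proof. exact: measurable_fun_open_rV. Qed.

Let mF : measurable_fun (U : set (borel_rV R m)) (F : borel_rV R m -> borel_rV R m).
Proof. by apply: measurable_fun_open_rV => // x /dF /has_diff_continuous. Qed.

Let mU : measurable (U : set (borel_rV R m)) := borel_open oU.
Let mV : measurable (V : set (borel_rV R m)) := borel_open oV.

Let density : exists nu : {measure set (borel_rV R m) -> \bar R},
    nu = (fun A => \int[@lebesgue_rV R m]_(x in U `&` A) (f x)%:E) :> (set (borel_rV R m) -> \bar R).
Proof.
apply: (density_measure _ mU); first exact/measurable_EFinP.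
by move=> x Ux; rewrite lee_fin ltW ?f_gt0.
Qed.

Let near_f x e : U x -> (0 < e)%R -> exists2 d : R, (0 < d)%R &
  forall y, (`|y - x| < d)%R -> U y /\ (`|f y - f x| < e)%R.
Proof.
move=> Ux e0; have /continuous_epsP/(_ e e0)[d d0 Hd] := cf Ux.
have /open_rVP/(_ _ Ux)[d' d'0 Hd'] := oU.
exists (Num.min d d'); first by rewrite lt_min d0.
by move=> y; rewrite lt_min => /andP[/Hd ? /Hd' ?].
Qed.

(** Trades the additive oscillation [h] of the density on a cell for the factor [1 + e] that
    [measure_le_cells1] accepts. *)
Let small_ratio (a e : R) : (0 < a)%R -> (0 < e)%R -> exists h : R,
  [/\ (0 < h)%R, (h < a)%R & (a + h <= (1 + e) * (a - h))%R].
Proof.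
move=> a0 e0; exists (a * (e / (2 + 2 * e)))%R.
have e2 : (0 < 2 + 2 * e)%R by lra.
have q0 : (0 < e / (2 + 2 * e))%R by rewrite divr_gt0.
have q1 : (e / (2 + 2 * e) * (2 + 2 * e) = e)%R by rewrite divfK // lt0r_neq0.
move: (e / _)%R q0 q1 => q q0 q1; have q2 : (q < 1)%R by nra.
split; [exact: mulr_gt0 | by rewrite gtr_pMr |].
have : (0 <= a * (q * e))%R by rewrite !mulr_ge0 // ltW.
by rewrite -[in (1 + e)%R]q1; nra.
Qed.

Let upper (W : set 'rV[R]_m) : open W -> W `<=` U ->
  lebesgue_rV (V `&` G @^-1` W : set (borel_rV R m)) <=
  \int[@lebesgue_rV R m]_(x in W) (f x)%:E.
Proof.
move=> oW WU.
have [a aE] := push_measure (@lebesgue_rV R m) mV mG.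
have [b bE] := density.
suff : a W <= b W by rewrite aE bE (setIidr WU).
apply: measure_le_cells1 => e e0 x Wx; have Ux := WU _ Wx.
have [h [h0 ha hE]] := small_ratio (f_gt0 Ux) e0.
have [d d0 Hd] := near_f Ux h0.
have oB := @open_ball_rV m x d.
have [K1 HK1] := cell_in_open oW Wx.
have [K2 HK2] := cell_in_open oB (ball_rV_center x d0).
have [K3 HK3] := diff_cell (dF Ux) (uN Ux) h0.
pose k := maxn K1 (maxn K2 K3); exists k; split.
  by apply: HK1; rewrite leq_maxl.
have cU : cell k (code k x) `<=` U.
  by apply: subset_trans WU; apply: HK1; rewrite leq_maxl.
have mc := @measurable_cell R m k (code k x).
rewrite aE bE; apply: (@le_trans _ _ ((f x + h)%:E * lebesgue_rV (cell k (code k x) : set (borel_rV R m)))).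
  apply: HK3; first by rewrite !leq_max leqnn !orbT.
    exact: mG.
  by move=> y [Vy Gy]; exists (G y) => //; exact: GK.
apply: (@le_trans _ _ ((1 + e)%:E * ((f x - h)%:E * lebesgue_rV (cell k (code k x) : set (borel_rV R m))))).
  by rewrite muleA -EFinM lee_wpmul2r // lee_fin.
apply: lee_wpmul2l; first by rewrite lee_fin addr_ge0 // ltW.
rewrite setIidr //; apply: integral_ge_cst => //.
- exact: measurable_funS mf.
- by rewrite subr_ge0 ltW.
- have k2 : (K2 <= k)%N by rewrite !leq_max leqnn !orbT.
move=> y cy; have [_] := Hd y (HK2 k k2 y cy).
by rewrite ltr_norml => /andP[]; lra.
Qed.

Let lower (C : set 'rV[R]_m) : open C -> C `<=` V ->
  \int[@lebesgue_rV R m]_(x in (U `&` F @^-1` C : set (borel_rV R m))) (f x)%:E <=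
  lebesgue_rV (C : set (borel_rV R m)).
Proof.
move=> oC CV.
have [b bE] := density.
have [a aE] := push_measure b mU mF.
suff : a C <= lebesgue_rV (C : set (borel_rV R m)) by rewrite aE bE setIA setIid.
apply: measure_le_cells1 => e e0 y Cy; have Vy := CV _ Cy.
have Ux := VU Vy; set x := G y in Ux.
have fx := f_gt0 Ux.
(* The product expands to [1 + h (f x + 1 / f x) + h^2]; with [h <= 1] the last two terms are at
   most [h A]. *)
have [h [h0 hE]] : exists h : R, (0 < h)%R /\ ((f x + h) * ((f x)^-1 + h) <= 1 + e)%R.
  pose A := ((f x)^-1 + f x + 1)%R.
  have A0 : (0 < A)%R by rewrite /A !addr_gt0 // invr_gt0.
  exists (Num.min 1 (e / A))%R; rewrite lt_min ltr01 divr_gt0 //; split => //.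
  set h := Num.min _ _; have h1 : (h <= 1)%R by rewrite ge_min lexx.
  have h2 : (h * A <= e)%R by rewrite -ler_pdivlMr // ge_min lexx orbT.
  have h0 : (0 <= h)%R by rewrite le_min ler01 divr_ge0 // ltW.
  have E : (f x * (f x)^-1 = 1)%R by rewrite divff // lt0r_neq0.
  by rewrite /A in h2; nra.
have [d d0 Hd] := near_f Ux h0.
have /continuous_epsP/(_ d d0)[d' d'0 Hd'] := cG Vy.
have oB := @open_ball_rV m y d'.
have [K1 HK1] := cell_in_open oC Cy.
have [K2 HK2] := cell_in_open oB (ball_rV_center y d'0).
have dG : has_diff G y (invmx (N x)).
  exact: (has_diff_inverse oV Vy GK (cG Vy) (dF Ux) (uN Ux)).
have uNi : invmx (N x) \in unitmx by rewrite unitmx_inv; exact: uN.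
have [K3 HK3] := diff_cell dG uNi h0.
pose k := maxn K1 (maxn K2 K3); exists k; split.
  by apply: HK1; rewrite leq_maxl.
set c := cell k (code k y).
have cV : c `<=` V by apply: subset_trans CV; apply: HK1; rewrite leq_maxl.
have mc : measurable (c : set (borel_rV R m)) by exact: measurable_cell.
rewrite aE bE setIA setIid.
apply: (@le_trans _ _ ((f x + h)%:E * lebesgue_rV (U `&` F @^-1` c : set (borel_rV R m)))).
  apply: integral_le_cst; first exact: mF.
    exact: measurable_funS mf.
  move=> z [Uz cz]; rewrite ltW ?f_gt0 //=.
  have zx : (`|z - x| < d)%R.
    by rewrite -(FK Uz); apply: Hd'; apply: (HK2 k _ (F z) cz); rewrite !leq_max leqnn !orbT.
  by have [_] := Hd _ zx; rewrite ltr_norml => /andP[_]; lra.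
apply: (@le_trans _ _ ((f x + h)%:E * (((f x)^-1 + h)%:E * lebesgue_rV (c : set (borel_rV R m))))).
  apply: lee_wpmul2l; first by rewrite lee_fin addr_ge0 // ltW.
  rewrite /f -normfV -det_inv.
  apply: HK3; first by rewrite !leq_max leqnn !orbT.
    exact: mF.
  by move=> z [Uz cz]; exists (F z) => //; exact: FK.
by rewrite muleA -EFinM lee_wpmul2r // lee_fin.
Qed.

(** The inequality [upper] applied to [F], and to its inverse [G] in [lower],
    give equality on open sets. *)
Theorem change_of_variables (A : set (borel_rV R m)) : measurable A -> A `<=` U ->
  lebesgue_rV (V `&` G @^-1` A : set (borel_rV R m)) =
  \int[@lebesgue_rV R m]_(x in A) `|\det (N x)|%:E.
Proof.
move=> mA AU.
have [a aE] := push_measure (@lebesgue_rV R m) mV mG.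
have [b bE] := density.
suff : a A = b A by rewrite aE bE (setIidr AU).
have key (W : set 'rV[R]_m) : open W -> W `<=` U -> a W = b W.
  move=> oW WU; apply/eqP; rewrite eq_le aE bE (setIidr WU) upper //=.
  have oC : open (V `&` G @^-1` W).
    apply/open_rVP => y [Vy Wy].
    have /open_rVP/(_ _ Wy)[e e0 He] := oW.
    have /continuous_epsP/(_ e e0)[d d0 Hd] := cG Vy.
    have /open_rVP/(_ _ Vy)[d' d'0 Hd'] := oV.
    exists (Num.min d d'); first by rewrite lt_min d0.
    by move=> z; rewrite lt_min => /andP[/Hd /He ? /Hd' ?].
  have := lower oC (@subIsetl _ _ _).
  rewrite (_ : U `&` F @^-1` _ = W) //.
  apply/seteqP; split=> [x [Ux [_]]|x Wx] /=; first by rewrite FK.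
  by have Ux := WU _ Wx; split => //; rewrite FK //; split => //; exact: UV.
apply: (@measure_eq_local _ a b U) => // x Ux.
have [d d0 Hd] := near_f Ux ltr01.
exists [set y : 'rV[R]_m | `|y - x| < d]%R.
have oB := @open_ball_rV m x d.
have BU : [set y : 'rV[R]_m | `|y - x| < d]%R `<=` U by move=> y /Hd[].
split => //; first by rewrite /= subrr normr0.
  rewrite key // bE setIidr //.
  apply: le_lt_trans (_ : _ <= (f x + 1)%:E * lebesgue_rV ([set y : 'rV[R]_m | `|y - x| < d]%R : set (borel_rV R m))) _.
    apply: integral_le_cst; first exact: borel_open.
      exact: measurable_funS mf.
    move=> y /Hd[Uy]; rewrite (ltW (f_gt0 Uy)) ltr_norml => /andP[_]; lra.
  rewrite lte_mul_pinfty ?lee_fin ?addr_ge0 // ?(ltW (f_gt0 Ux)) //.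
  apply: (@lebesgue_bounded _ _ _ (`|x| + d)%R); first exact: borel_open.
  by move=> y /= yx; rewrite -(subrK x y); apply: le_lt_trans (ler_normD _ _) _; lra.
by move=> W oW WB; apply: key => //; exact: subset_trans BU.
Qed.

End Statement.

End ChangeOfVariables.

(** * Convex bodies *)

Section Dot.
Context {R : realType} {m : nat}.
Implicit Types u v w : 'rV[R]_m.

Lemma dotE u v : dot u v = \sum_i u 0 i * v 0 i.
Proof. by rewrite /dot mxE; apply: eq_bigr => i _; rewrite mxE. Qed.

Lemma dotC u v : dot u v = dot v u.
Proof. by rewrite !dotE; apply: eq_bigr => i _; rewrite mulrC. Qed.

Lemma dotDl u v w : dot (u + v) w = dot u w + dot v w.
Proof. by rewrite /dot mulmxDl mxE. Qed.

Lemma dotDr u v w : dot w (u + v) = dot w u + dot w v.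
Proof. by rewrite dotC dotDl !(dotC w). Qed.

Lemma dotZl a u v : dot (a *: u) v = a * dot u v.
Proof. by rewrite /dot -scalemxAl mxE. Qed.

Lemma dotZr a u v : dot u (a *: v) = a * dot u v.
Proof. by rewrite dotC dotZl dotC. Qed.

Lemma dotNl u v : dot (- u) v = - dot u v.
Proof. by rewrite -scaleN1r dotZl mulN1r. Qed.

Lemma dotNr u v : dot u (- v) = - dot u v.
Proof. by rewrite dotC dotNl dotC. Qed.

Lemma dotBl u v w : dot (u - v) w = dot u w - dot v w.
Proof. by rewrite dotDl dotNl. Qed.

Lemma dotBr u v w : dot w (u - v) = dot w u - dot w v.
Proof. by rewrite dotDr dotNr. Qed.

Lemma dot0l u : dot 0 u = 0.
Proof. by rewrite -(scale0r 0) dotZl mul0r. Qed.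

Lemma dot0r u : dot u 0 = 0.
Proof. by rewrite dotC dot0l. Qed.

Definition dot_bilin := (dotDl, dotDr, dotZl, dotZr, dotNl, dotNr).

Lemma dot_ge0 u : 0 <= dot u u.
Proof. by rewrite dotE sumr_ge0 // => i _; rewrite -expr2 sqr_ge0. Qed.

Lemma dot_norm_le u : `|u| ^+ 2 <= dot u u.
Proof.
suff H : `|u| <= Num.sqrt (dot u u).
  by rewrite -[leRHS]sqr_sqrtr ?dot_ge0 // lerXn2r ?nnegrE ?sqrtr_ge0.
apply: norm_rV_le => [|i]; first exact: sqrtr_ge0.
rewrite -sqrtr_sqr ler_wsqrtr // dotE (bigD1 i) //= -expr2 lerDl.
by rewrite sumr_ge0 // => j _; rewrite -expr2 sqr_ge0.
Qed.

Lemma dot_eq0 u : dot u u = 0 -> u = 0.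
Proof.
move=> u0; apply/eqP; rewrite -normr_eq0 -sqrf_eq0 eq_le sqr_ge0 andbT.
by rewrite -[leRHS]u0 dot_norm_le.
Qed.

Lemma dot_gt0 u : u != 0 -> 0 < dot u u.
Proof.
move=> u0; rewrite lt_neqAle dot_ge0 andbT eq_sym; apply/eqP => /dot_eq0 /eqP.
exact/negP.
Qed.

Lemma dot_le_norm u v : `|dot u v| <= m%:R * (`|u| * `|v|).
Proof.
rewrite dotE; apply: le_trans (ler_norm_sum _ _ _) _.
apply: le_trans (_ : \sum_(i < m) `|u| * `|v| <= _).
  by apply: ler_sum => i _; rewrite normrM ler_pM // coord_le_norm.
by rewrite sumr_const card_ord mulr_natl.
Qed.

Lemma dot_cauchy_schwarz u v : dot u v ^+ 2 <= dot u u * dot v v.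
Proof.
have [->|v0] := eqVneq v 0; first by rewrite !dot0r expr0n mulr0.
have := dot_ge0 (dot v v *: u - dot u v *: v).
rewrite !dot_bilin (dotC v u); have := dot_gt0 v0; set a := dot u u; set b := dot u v.
set c := dot v v => c0 H; have : 0 <= c * (a * c - b ^+ 2) by nra.
by rewrite pmulr_rge0 // subr_ge0.
Qed.

Lemma enorm_ge0 u : 0 <= enorm u.
Proof. exact: sqrtr_ge0. Qed.

Lemma enorm_sqr u : enorm u ^+ 2 = dot u u.
Proof. by rewrite sqr_sqrtr // dot_ge0. Qed.

Lemma norm_le_enorm u : `|u| <= enorm u.
Proof.
by rewrite -ler_sqr ?nnegrE ?enorm_ge0 // enorm_sqr dot_norm_le.
Qed.

Lemma dot_le_enorm u v : dot u v <= enorm u * enorm v.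
Proof.
apply: le_trans (ler_norm _) _.
rewrite -ler_sqr ?nnegrE ?mulr_ge0 ?enorm_ge0 // exprMn !enorm_sqr.
by rewrite real_normK ?num_real // dot_cauchy_schwarz.
Qed.

Lemma enormZ a u : enorm (a *: u) = `|a| * enorm u.
Proof.
rewrite /enorm dotZl dotZr mulrA -expr2 sqrtrM ?sqr_ge0 //.
by rewrite sqrtr_sqr.
Qed.

Lemma enormN u : enorm (- u) = enorm u.
Proof. by rewrite /enorm dotNl dotNr opprK. Qed.

Lemma enorm_triangle u v : enorm (u + v) <= enorm u + enorm v.
Proof.
rewrite -ler_sqr ?nnegrE ?addr_ge0 ?enorm_ge0 // sqrrD !enorm_sqr !dot_bilin.
by have := dot_le_enorm u v; rewrite (dotC v u); lra.
Qed.

Lemma enorm_le_norm u : enorm u <= m%:R * `|u|.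
Proof.
rewrite -ler_sqr ?nnegrE ?enorm_ge0 ?mulr_ge0 // enorm_sqr exprMn.
apply: le_trans (_ : m%:R * (`|u| * `|u|) <= _).
  by apply: le_trans (ler_norm _) _; exact: dot_le_norm.
rewrite -expr2 ler_wpM2r ?sqr_ge0 //.
by rewrite -natrX ler_nat; case: (m) => // k; rewrite expnS leq_pmulr // expn1.
Qed.

Lemma enorm_eq0 u : enorm u = 0 -> u = 0.
Proof. by move=> u0; apply: dot_eq0; rewrite -enorm_sqr u0 expr0n. Qed.

Lemma enorm1P u : enorm u = 1 <-> dot u u = 1.
Proof.
split=> [u1|u1]; first by rewrite -enorm_sqr u1 expr1n.
by rewrite /enorm u1 sqrtr1.
Qed.

End Dot.

Section DotContinuity.
Context {R : realType} {V : normedModType R} {m : nat}.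

Lemma cvg_rVP (f : V -> 'rV[R]_m) (x : V) (l : 'rV[R]_m) :
  (f y @[y --> x] --> l) <-> (forall i, (f y 0 i : R^o) @[y --> x] --> (l 0 i : R^o)).
Proof.
split=> [/cvg_epsP H i|H].
  apply/cvg_epsP => e e0; have [d d0 Hd] := H e e0; exists d => // y /Hd.
  by apply: le_lt_trans; have := coord_le_norm (f y - l) i; rewrite !mxE.
apply/cvg_epsP => e e0.
have /boolp.choice[D HD] : forall i, exists d : R, 0 < d /\
    forall y, `|y - x| < d -> `|f y 0 i - l 0 i| < e.
  by move=> i; have /cvg_epsP/(_ e e0)[d d0 Hd] := H i; exists d.
exists (\big[Num.min/1]_i D i).
  by apply: lt_bigmin => // i _; have [] := HD i.
move=> y yx; apply: norm_rV_lt => // i; rewrite !mxE; apply: (HD i).2.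
by apply: lt_le_trans yx _; exact: bigmin_le_cond.
Qed.

Lemma cvg_sum_ord k (f : 'I_k -> V -> R) (x : V) (l : 'I_k -> R) :
  (forall i, (f i y : R^o) @[y --> x] --> (l i : R^o)) ->
  (\sum_i f i y : R^o) @[y --> x] --> (\sum_i l i : R^o).
Proof.
elim: k f l => [|k IH] f l H.
  by under eq_fun do rewrite big_ord0; rewrite big_ord0; exact: cvg_cst.
under eq_fun do rewrite big_ord_recl; rewrite big_ord_recl.
by apply: cvgD; [exact: H|apply: (IH (fun i => f (lift ord0 i)))].
Qed.

Lemma cvg_prod_ord k (f : 'I_k -> V -> R) (x : V) (l : 'I_k -> R) :
  (forall i, (f i y : R^o) @[y --> x] --> (l i : R^o)) ->
  (\prod_i f i y : R^o) @[y --> x] --> (\prod_i l i : R^o).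
Proof.
elim: k f l => [|k IH] f l H.
  by under eq_fun do rewrite big_ord0; rewrite big_ord0; exact: cvg_cst.
under eq_fun do rewrite big_ord_recl; rewrite big_ord_recl.
by apply: cvgM; [exact: H|apply: (IH (fun i => f (lift ord0 i)))].
Qed.

Lemma cvg_dot (f g : V -> 'rV[R]_m) (x : V) (a b : 'rV[R]_m) :
  f y @[y --> x] --> a -> g y @[y --> x] --> b ->
  (dot (f y) (g y) : R^o) @[y --> x] --> (dot a b : R^o).
Proof.
move=> /cvg_rVP fa /cvg_rVP gb; under eq_fun do rewrite dotE; rewrite dotE.
by apply: cvg_sum_ord => i; apply: cvgM.
Qed.

End DotContinuity.

Lemma continuous_dotl (R : realType) m (v x : 'rV[R]_m) :
  {for x, continuous (fun y : 'rV[R]_m => dot y v : R^o)}.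
Proof. by apply: (@cvg_dot R _ m id (fun=> v)); [exact: cvg_id|exact: cst_continuous]. Qed.

Section ConvexBody.
Context {R : realType} {n : nat}.
Variable Omega : set 'rV[R]_n.+1.
Hypothesis (hne : Omega !=set0) (hopen : open Omega) (hbdd : bounded_set Omega).
Hypothesis hconv : convex_set (Omega : set (convex_lmodType 'rV[R]_n.+1)).

Local Notation E := 'rV[R]_n.+1.
Local Notation K := (closure Omega).
Implicit Types x y z p : E.

Lemma closure_epsP (A : set E) x :
  closure A x <-> forall e : R, 0 < e -> exists2 y, A y & `|y - x| < e.
Proof.
rewrite closureEnbhs; split=> [H e e0|H].
  have [y [Ay yx]] : A `&` [set y | `|y - x| < e] !=set0.
    apply: H; first by [].
    by apply: open_nbhs_nbhs; split; [exact: open_ball_rV|exact: ball_rV_center].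
  by exists y.
move=> B C AB /nbhs_normP[e /= e0 He]; have [y Ay yx] := H e e0.
exists y; split; first exact: AB.
by apply: He; rewrite /ball_ /= distrC.
Qed.

Lemma convex_comb x y t : Omega x -> Omega y -> 0 <= t <= 1 ->
  Omega ((1 - t) *: x + t *: y).
Proof.
move=> Ox Oy /andP[t0 t1].
have := hconv (Itv01 t0 t1) (mem_set Oy) (mem_set Ox).
by rewrite inE addrC.
Qed.

Lemma closure_comb x y t : K x -> K y -> 0 <= t <= 1 ->
  K ((1 - t) *: x + t *: y).
Proof.
move=> /closure_epsP Kx /closure_epsP Ky t01; apply/closure_epsP => e e0.
have [x' Ox xx] := Kx e e0; have [y' Oy yy] := Ky e e0.
exists ((1 - t) *: x' + t *: y'); first exact: convex_comb.
rewrite opprD addrACA -!scalerBr; apply: le_lt_trans (ler_normD _ _) _.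
have /andP[t0 t1] := t01.
rewrite !normrZ (ger0_norm t0) ger0_norm ?subr_ge0 //.
have [->|tn1] := eqVneq t 1; first by rewrite subrr mul0r mul1r add0r.
have : t < 1 by rewrite lt_neqAle tn1.
by move=> t1'; nra.
Qed.

(** Replacing [y] by a nearby point [y'] of the open set causes an error that is absorbed in the
    interior endpoint, whose weight [1 - t] is positive. *)
Lemma open_comb x y t : Omega x -> K y -> 0 <= t < 1 ->
  Omega ((1 - t) *: x + t *: y).
Proof.
move=> Ox /closure_epsP Ky /andP[t0 t1].
have /open_rVP/(_ _ Ox)[e e0 He] := hopen.
have t1' : 0 < 1 - t by rewrite subr_gt0.
have [|y' Oy yy] := Ky (e * (1 - t)); first exact: mulr_gt0.
pose x' := x + (t / (1 - t)) *: (y - y').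
have Ox' : Omega x'.
  apply: He; rewrite /x' addrAC subrr add0r normrZ ger0_norm ?divr_ge0 ?(ltW t1') //.
  rewrite mulrAC ltr_pdivrMr // distrC.
  apply: le_lt_trans yy; apply: ler_piMl => //; exact: ltW.
have := convex_comb Ox' Oy; move=> /(_ t); rewrite t0 (ltW t1) => /(_ isT).
rewrite /x' scalerDr scalerA mulrCA divff ?lt0r_neq0 // mulr1 scalerBr -addrA subrK.
exact.
Qed.

(** Otherwise [p] would lie strictly between the interior point [x] and a point of the closure,
    hence in the open set. *)
Lemma open_combN x p s : Omega x -> ~ Omega p -> 0 < s -> ~ K (p + s *: (p - x)).
Proof.
move=> Ox Op s0 Kq; apply: Op; have s1 : 0 < 1 + s by rewrite addr_gt0.
have := @open_comb x _ (1 + s)^-1 Ox Kq.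
rewrite invr_ge0 (ltW s1) invf_lt1 // ltrDl s0 => /(_ isT).
suff -> : (1 - (1 + s)^-1) *: x + (1 + s)^-1 *: (p + s *: (p - x)) = p by [].
by apply/rowP => i; rewrite !mxE; field; rewrite lt0r_neq0.
Qed.

Lemma body_bound : exists2 M : R, 0 < M & forall x, K x -> enorm x <= M.
Proof.
have [M [_ HM]] := hbdd.
pose M1 := `|M| + 1; have M1M : M < M1.
  by rewrite /M1; apply: le_lt_trans (ler_norm M) _; rewrite ltrDl.
have M10 : 0 < M1 by rewrite /M1 ltr_wpDl.
exists (n.+1%:R * (M1 + 1)) => [|x /closure_epsP/(_ 1 ltr01)[y Oy yx]].
  by rewrite mulr_gt0 // addr_gt0.
apply: le_trans (enorm_le_norm x) _; rewrite ler_wpM2l //.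
rewrite -(subrK y x); apply: le_trans (ler_normD _ _) _.
by rewrite addrC lerD ?(HM M1 M1M y Oy) // distrC ltW.
Qed.

Lemma body_compact : compact K.
Proof.
apply: bounded_closed_compact; last exact: closed_closure.
have [M M0 HM] := body_bound; exists M; split; first exact: num_real.
move=> M' MM' x Kx; apply: le_trans (norm_le_enorm x) _.
by apply: le_trans (HM x Kx) _; exact: ltW.
Qed.

Lemma sub_body : Omega `<=` K.
Proof. exact: subset_closure. Qed.

Lemma body_nonempty : K !=set0.
Proof. by have [x Ox] := hne; exists x; exact: sub_body. Qed.

Lemma boundaryE : boundary Omega = K `\` Omega.
Proof. by rewrite /boundary (interior_id _).1. Qed.

Lemma body_min (f : E -> R) : (forall x, {for x, continuous (f : E -> R^o)}) ->
  exists2 x, K x & forall y, K y -> f x <= f y.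
Proof.
move=> cf; have [|x /set_mem Kx Hx] := EVT_min_rV body_nonempty body_compact (f := f).
  by apply: continuous_subspaceT => x; exact: cf.
by exists x => // y Ky; apply: Hx; rewrite inE.
Qed.

Lemma proj_exists Y : exists p, K p /\ forall z, K z -> dot (Y - p) (z - p) <= 0.
Proof.
have [|p Kp Hp] := body_min (f := fun x => dot (x - Y) (x - Y)).
  by move=> x; apply: cvg_dot; exact: continuous_addr.
exists p; split => // z Kz; rewrite leNgt; apply/negP.
(* The squared distance along the segment from [p] to [z] is a quadratic polynomial in [t], minimal
   at 0; a positive linear coefficient [c] is refuted by the small [t] chosen below. *)
have seg t : 0 <= t <= 1 -> 0 <= t * (t * dot (z - p) (z - p) - 2 * dot (Y - p) (z - p)).
  move=> t01; have := Hp _ (closure_comb Kp Kz t01); rewrite -subr_ge0.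
  have -> : (1 - t) *: p + t *: z - Y = t *: (z - p) - (Y - p).
    by apply/rowP => i; rewrite !mxE; ring.
  have -> : p - Y = - (Y - p) by rewrite opprB.
  by move: (z - p) (Y - p) => a w; rewrite !dot_bilin (dotC a w); congr (_ <= _); ring.
move: (dot_ge0 (z - p)) seg; set b := dot (z - p) _; set c := dot (Y - p) _ => b0 seg c0.
pose t := Num.min 1 (c / (1 + b)).
have b1 : 0 < 1 + b by rewrite ltr_pwDl.
have t0 : 0 < t by rewrite lt_min ltr01 divr_gt0.
have t1 : t <= 1 by rewrite ge_min lexx.
have tc : t * (1 + b) <= c by rewrite -ler_pdivlMr // ge_min lexx orbT.
have := seg t; rewrite (ltW t0) t1 => /(_ isT); rewrite pmulr_rge0 //; nra.
Qed.

(** Specified by the obtuse angle inequality rather than by minimal distance, because that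
    inequality is what the Lipschitz bound and the inversion of the tube map rest on. *)
Definition proj (Y : E) : E := get [set p | K p /\ forall z, K z -> dot (Y - p) (z - p) <= 0].

Lemma projP Y : K (proj Y) /\ forall z, K z -> dot (Y - proj Y) (z - proj Y) <= 0.
Proof. exact: (getPex (proj_exists Y)). Qed.

(** Sum of the two obtuse angle inequalities, each tested at the other projection. *)
Lemma proj_lip Y Z :
  dot (proj Y - proj Z) (proj Y - proj Z) <= dot (Y - Z) (Y - Z).
Proof.
have [KY HY] := projP Y; have [KZ HZ] := projP Z.
have := HY _ KZ; have := HZ _ KY.
have -> : Y - Z = (Y - proj Y) - (Z - proj Z) + (proj Y - proj Z).
  by apply/rowP => i; rewrite !mxE; ring.
have -> : proj Z - proj Y = - (proj Y - proj Z) by rewrite opprB.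
have := dot_ge0 (Y - proj Y - (Z - proj Z)).
move: (Y - proj Y) (Z - proj Z) (proj Y - proj Z) => a b c.
rewrite !dot_bilin (dotC b a) (dotC c a) (dotC c b); lra.
Qed.

Lemma proj_unique Y p : K p -> (forall z, K z -> dot (Y - p) (z - p) <= 0) -> proj Y = p.
Proof.
move=> Kp Hp; have [KY HY] := projP Y.
have := HY _ Kp; have := Hp _ KY.
have -> : p - proj Y = - (proj Y - p) by rewrite opprB.
suff z : dot (Y - p) (proj Y - p) <= 0 -> dot (Y - proj Y) (- (proj Y - p)) <= 0 ->
    dot (proj Y - p) (proj Y - p) <= 0.
  move=> h1 h2; apply/eqP; rewrite -subr_eq0; apply/eqP/dot_eq0/eqP.
  by rewrite eq_le dot_ge0 andbT z.
have -> : Y - p = (Y - proj Y) + (proj Y - p) by apply/rowP => i; rewrite !mxE; ring.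
by move: (Y - proj Y) (proj Y - p) => c d; rewrite dotDl dotNr; lra.
Qed.

Lemma proj_id p : K p -> proj p = p.
Proof. by move=> Kp; apply: proj_unique => // z _; rewrite subrr dot0l. Qed.

Lemma proj_continuous : continuous proj.
Proof.
move=> Y; apply/continuous_epsP => e e0.
have m0 : 0 < n.+1%:R :> R by rewrite ltr0n.
exists (e / n.+1%:R) => [|Z]; first by rewrite divr_gt0.
rewrite ltr_pdivlMr // mulrC => H; apply: le_lt_trans H.
apply: le_trans (norm_le_enorm _) _; apply: le_trans (enorm_le_norm _).
by rewrite -ler_sqr ?nnegrE ?enorm_ge0 // !enorm_sqr proj_lip.
Qed.

(** Unit normal in the sense of convex geometry, free of smoothness; at points of a smooth boundary
    it turns out to be the outward unit normal. *)
Definition is_support_normal (X eta : E) :=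
  dot eta eta = 1 /\ forall z, K z -> dot eta (z - X) <= 0.

Definition bdist (Y : E) : R := enorm (Y - proj Y).

Lemma bdist_ge0 Y : 0 <= bdist Y.
Proof. exact: enorm_ge0. Qed.

Lemma bdist_gt0 Y : ~ K Y -> 0 < bdist Y.
Proof.
move=> KY; rewrite lt_neqAle enorm_ge0 andbT eq_sym; apply/eqP => /enorm_eq0 /eqP.
by rewrite subr_eq0 => /eqP H; apply: KY; rewrite H; exact: (projP Y).1.
Qed.

Lemma bdist_continuous : forall Y, {for Y, continuous (bdist : E -> R^o)}.
Proof.
move=> Y; have c1 : {for Y, continuous (fun Z : E => Z - proj Z)}.
  by apply: (@continuousB _ _ _ id proj); [exact: cvg_id|exact: proj_continuous].
apply: (@continuous_comp _ _ _ (fun Z : E => dot (Z - proj Z) (Z - proj Z) : R^o) (@Num.sqrt R)).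
  exact: (cvg_dot c1 c1).
exact: sqrt_continuous.
Qed.

(** From a point of the open set one could still move towards [Y] inside the body, against the
    obtuse angle inequality. *)
Lemma proj_boundary Y : ~ K Y -> boundary Omega (proj Y).
Proof.
move=> KY; rewrite boundaryE; have [Kp Hp] := projP Y; split => // Op.
have /open_rVP/(_ _ Op)[e e0 He] := hopen.
have d0 := bdist_gt0 KY; pose t := e / (1 + `|Y - proj Y|).
have c0 : 0 < 1 + `|Y - proj Y| by rewrite ltr_pwDl.
have t0 : 0 < t by rewrite divr_gt0.
have := Hp (proj Y + t *: (Y - proj Y)) (sub_body (He _ _)).
rewrite addrAC subrr add0r dotZr pmulr_rle0 // => H.
have : bdist Y ^+ 2 <= 0.
  rewrite enorm_sqr; apply: H; rewrite normrZ gtr0_norm // /t mulrAC ltr_pdivrMr //.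
  by rewrite ltr_pM2l // ltrDr.
by rewrite leNgt exprn_gt0.
Qed.

Lemma proj_support_normal Y : ~ K Y ->
  is_support_normal (proj Y) ((bdist Y)^-1 *: (Y - proj Y)).
Proof.
move=> KY; have d0 := bdist_gt0 KY; split=> [|z Kz].
  by rewrite dotZl dotZr -enorm_sqr -/(bdist Y) expr2 mulKf ?mulVf // lt0r_neq0.
by rewrite dotZl pmulr_rle0 ?invr_gt0 //; apply: (projP Y).2.
Qed.

(** The inequality defining a support normal is the obtuse angle inequality at [X] for the point
    [X + t *: eta]. This is what inverts the tube map. *)
Lemma proj_add_normal X eta t : K X -> is_support_normal X eta -> 0 <= t ->
  proj (X + t *: eta) = X /\ bdist (X + t *: eta) = t.
Proof.
move=> KX [e1 H] t0.
have P : proj (X + t *: eta) = X.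
  apply: proj_unique => // z Kz; rewrite addrAC subrr add0r dotZl.
  by rewrite mulr_ge0_le0 // H.
split => //; rewrite /bdist P addrAC subrr add0r enormZ (enorm1P _).2 // mulr1.
exact: ger0_norm.
Qed.

Lemma add_normal_notin X eta t : is_support_normal X eta -> 0 < t ->
  ~ K (X + t *: eta).
Proof.
move=> [e1 H] t0 /H; rewrite addrAC subrr add0r dotZr e1 mulr1 leNgt t0 //.
Qed.

(** The inequality is strict because [z] can be moved a little in the direction [eta] without
    leaving the open set. *)
Lemma support_normal_lt X eta z : is_support_normal X eta -> Omega z ->
  dot eta (z - X) < 0.
Proof.
move=> [e1 H] Oz.
have /open_rVP/(_ _ Oz)[e e0 He] := hopen.
have c0 : 0 < 1 + `|eta| by rewrite ltr_pwDl.
pose t := e / (1 + `|eta|); have t0 : 0 < t by rewrite divr_gt0.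
have := H (z + t *: eta) (sub_body (He _ _)).
have -> : z + t *: eta - X = z - X + t *: eta by rewrite addrAC.
have -> : z + t *: eta - z = t *: eta by rewrite addrAC subrr add0r.
rewrite dotDr dotZr e1 mulr1 normrZ gtr0_norm // => H'.
suff : dot eta (z - X) + t <= 0 by lra.
apply: H'; rewrite /t mulrAC ltr_pdivrMr // ltr_pM2l // ltrDr //.
Qed.

(** The support function is a supremum over the open set, where it is not attained in general;
    compactness gives a maximiser in the closure, and continuity shows that both maxima agree. *)
Lemma supp_fun_attained xi : exists x, [/\ K x, support_function Omega xi = dot x xi &
  forall z, K z -> dot z xi <= support_function Omega xi].
Proof.
have [|x Kx Hx] := body_min (f := fun x => - dot x xi).
  by move=> x; apply: (@continuousN _ _ _ (fun z => dot z xi : R^o)); exact: continuous_dotl.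
have {}Hx z : K z -> dot z xi <= dot x xi by move=> /Hx; rewrite lerN2.
suff -> : support_function Omega xi = dot x xi by exists x; split.
have [x0 Ox0] := hne.
have ub : ubound [set dot z xi | z in Omega] (dot x xi).
  by move=> _ [z Oz <-]; apply: Hx; exact: sub_body.
apply/eqP; rewrite eq_le; apply/andP; split.
  by apply: ge_sup => //; exists (dot x0 xi); exists x0.
rewrite leNgt; apply/negP => lt.
have c : {for x, continuous (fun z => dot z xi : R^o)}.
  exact: continuous_dotl.
have e0 : 0 < dot x xi - support_function Omega xi by rewrite subr_gt0.
have /continuous_epsP/(_ _ e0)[d d0 Hd] := c.
have /closure_epsP/(_ d d0)[y Oy yx] := Kx.
have := Hd y yx; rewrite ltr_norml => /andP[h _].
have : dot y xi <= support_function Omega xi.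
  by apply: ub_le_sup; [exists (dot x xi)|exists y].
lra.
Qed.

Lemma supp_fun_ge xi z : K z -> dot z xi <= support_function Omega xi.
Proof. by have [x [_ _]] := supp_fun_attained xi; apply. Qed.

Lemma supp_fun_bound xi : forall M, (forall x, K x -> enorm x <= M) ->
  `|support_function Omega xi| <= M * enorm xi.
Proof.
move=> M HM; have [x [Kx -> _]] := supp_fun_attained xi.
rewrite ler_norml; apply/andP; split.
  rewrite lerNl -dotNl; apply: le_trans (dot_le_enorm _ _) _.
  by rewrite enormN ler_wpM2r ?enorm_ge0 // HM.
apply: le_trans (dot_le_enorm _ _) _.
by rewrite ler_wpM2r ?enorm_ge0 // HM.
Qed.

Lemma supp_fun_lip xi xi' M : (forall x, K x -> enorm x <= M) ->
  support_function Omega xi - support_function Omega xi' <= M * enorm (xi - xi').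
Proof.
move=> HM; have [x [Kx -> _]] := supp_fun_attained xi.
have := supp_fun_ge xi' Kx.
have := le_trans (dot_le_enorm x (xi - xi')) (ler_wpM2r (enorm_ge0 _) (HM x Kx)).
by rewrite dotBr; lra.
Qed.

Lemma supp_fun_continuous xi : {for xi, continuous (support_function Omega : E -> R^o)}.
Proof.
have [M M0 HM] := body_bound; apply/continuous_epsP => e e0.
have m0 : 0 < M * n.+1%:R by rewrite mulr_gt0 // ltr0n.
exists (e / (M * n.+1%:R)) => [|y]; first by rewrite divr_gt0.
rewrite ltr_pdivlMr // => H.
have L z w : support_function Omega z - support_function Omega w <= M * (n.+1%:R * `|z - w|).
  apply: le_trans (supp_fun_lip _ _ HM) _; rewrite ler_pM2l //; exact: enorm_le_norm.
have := L y xi; have := L xi y; rewrite (distrC xi) => h1 h2.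
by rewrite ltr_norml; apply/andP; split; lra.
Qed.

(** The normals are found by projecting points that lie slightly outside, and
    passing to the limit through the minimum of a continuous function. *)
Lemma support_normal_exists X v e : K X -> 0 < e ->
  (forall t, 0 < t < e -> ~ Omega (X - t *: v)) ->
  exists2 eta, is_support_normal X eta & dot eta v <= 0.
Proof.
move=> KX e0 H; have [z0 Oz0] := hne.
(* [h eta <= 0] says at once that [eta] supports the body at [X] and that [dot eta v <= 0]. As [h]
   attains its minimum on the unit sphere, it suffices to find unit vectors with [h] below every
   positive bound. *)
pose h eta := Num.max (support_function Omega eta - dot eta X) (dot eta v).
pose S : set E := [set x | enorm x = 1].
have Sc : compact S.
  apply: bounded_closed_compact.
    exists 1; split; first exact: num_real.
    move=> M M1 x /= x1; apply: le_trans (norm_le_enorm x) _.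
    by rewrite x1 ltW.
  have -> : S = (fun x : E => dot x x : R^o) @^-1` [set 1].
    by apply/seteqP; split=> x /= /enorm1P.
  apply: closed_comp => [x _|]; first by apply: cvg_dot; exact: cvg_id.
  exact: closed_eq.
have S0 : S !=set0.
  exists (delta_mx 0 ord0); apply/enorm1P; rewrite dotE (bigD1 ord0) //= big1.
    by rewrite !mxE !eqxx /= mulr1 addr0.
  by move=> i i0; rewrite !mxE /= (negbTE i0) mulr0.
have hc : forall x, {for x, continuous (h : E -> R^o)}.
  move=> x; apply: continuous_max.
    apply: (@continuousB _ _ _ (support_function Omega : E -> R^o) (fun z => dot z X : R^o)).
      exact: supp_fun_continuous.
    exact: continuous_dotl.
  exact: continuous_dotl.
have [|eta /set_mem/= eta1 Heta] := EVT_min_rV S0 Sc (f := h).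
  by apply: continuous_subspaceT => x; exact: hc.
suff : h eta <= 0.
  rewrite ge_max => /andP[h1 h2]; exists eta => //; split; first exact/enorm1P.
  by move=> z Kz; have := supp_fun_ge eta Kz; rewrite dotBr (dotC z); lra.
pose C := enorm v + enorm (X - z0) + enorm v.
apply/ler_addgt0Pl => d d0; rewrite addr0.
pose t := Num.min (Num.min (e / 2) 1) (d / (1 + C)).
have C0 : 0 <= C by rewrite !addr_ge0 // enorm_ge0.
have C1 : 0 < 1 + C by rewrite ltr_pwDl.
have t0 : 0 < t by rewrite !lt_min ltr01 !divr_gt0.
have te : t < e.
  by apply: le_lt_trans (_ : e / 2 < e); [rewrite !ge_min lexx|lra].
have t1 : t <= 1 by rewrite !ge_min lexx orbT.
have td : t * (1 + C) <= d by rewrite -ler_pdivlMr // ge_min lexx orbT.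
(* [p] is only known to be outside the open set, so it is pushed away from [z0] to leave the closure
   as well. The shift has order [t ^+ 2] because the inequality at [X] is divided by [t] later. *)
pose p := X - t *: v; pose q := p + t ^+ 2 *: (p - z0).
have Kq : ~ K q.
  by apply: open_combN => //; [apply: H; rewrite t0 te|rewrite exprn_gt0].
have [u1 uH] := proj_support_normal Kq.
set u := _ *: _ in u1 uH.
have uq z : K z -> dot u (z - q) <= 0.
  move=> Kz; have -> : z - q = (z - proj q) - (q - proj q).
    by apply/rowP => i; rewrite !mxE; ring.
  rewrite dotBr; have := uH z Kz; suff : 0 <= dot u (q - proj q) by lra.
  by rewrite /u dotZl mulr_ge0 ?invr_ge0 ?bdist_ge0 ?dot_ge0.
clearbody u; have Su : S u by apply/enorm1P.
have uE : enorm u = 1 by [].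
apply: le_trans (Heta u (mem_set Su)) _; rewrite ge_max.
have bz : enorm (p - z0) <= enorm (X - z0) + enorm v.
  have -> : p - z0 = (X - z0) + (- t) *: v by apply/rowP => i; rewrite !mxE; ring.
  apply: le_trans (enorm_triangle _ _) _; rewrite lerD2l enormZ normrN gtr0_norm //.
  by apply: ler_piMl => //; exact: enorm_ge0.
have bv := dot_le_enorm u v; have bnv := dot_le_enorm u (- v).
have bpz := dot_le_enorm u (p - z0).
rewrite enormN in bnv; rewrite uE !mul1r in bv bnv bpz.
have v0 := enorm_ge0 v; have xz0 := enorm_ge0 (X - z0).
have tP : t * dot u (p - z0) <= enorm (X - z0) + enorm v.
  apply: le_trans (_ : t * (enorm (X - z0) + enorm v) <= _).
    by rewrite ler_pM2l //; exact: le_trans bpz bz.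
  by apply: ler_piMl => //; exact: addr_ge0.
apply/andP; split.
  have [x [Kx -> _]] := supp_fun_attained u.
  have := uq x Kx.
  have -> : x - q = x - X + t *: v - t ^+ 2 *: (p - z0).
    by rewrite /q /p; apply/rowP => i; rewrite !mxE; ring.
  rewrite dotBr dotDr dotBr !dotZr (dotC u x); rewrite dotNr in bnv.
  have : t ^+ 2 * dot u (p - z0) <= t * (enorm (X - z0) + enorm v).
    by rewrite expr2 -mulrA ler_pM2l.
  have : - (t * dot u v) <= t * enorm v by nra.
  by rewrite /C in td; nra.
have := uq X KX.
have -> : X - q = t *: (v - t *: (p - z0)).
  by rewrite /q /p; apply/rowP => i; rewrite !mxE; ring.
rewrite dotZr pmulr_rle0 // dotBr dotZr => h1.
by rewrite /C in td; nra.
Qed.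

Lemma boundary_normal_exists X : boundary Omega X -> exists eta, is_support_normal X eta.
Proof.
rewrite boundaryE => -[KX OX].
have [|eta Heta _] := @support_normal_exists X 0 1 KX ltr01; last by exists eta.
by move=> t _; rewrite scaler0 subr0.
Qed.

End ConvexBody.

(** * Second derivatives *)

Section Derivatives.
Context {R : realType}.

Lemma is_derive_epsP (V W : normedModType R) (f : V -> W) (a v : V) (df : W) :
  is_derive a v f df <-> (forall e : R, 0 < e -> exists2 d : R, 0 < d &
    forall h : R, `|h| < d -> `|f (a + h *: v) - f a - h *: df| <= e * `|h|).
Proof.
split=> [[dv <-] e e0|H].
  have /eqaddoP/(_ e e0)/nbhs_normP[d /= d0 Hd] := derivable_nbhs dv.
  exists d => // h hd; have := Hd h; rewrite /ball_ /= sub0r normrN => /(_ hd).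
  by move=> {}Hd; rewrite (addrC a) -addrA -opprD; exact: Hd.
suff Q : (fun h : R => h^-1 *: ((f \o shift a) (h *: v) - f a)) @ 0^' --> df.
  by split; [apply/cvg_ex; exists df|apply: cvg_lim].
apply/cvgrPdist_le => e e0; have [d d0 Hd] := H e e0.
rewrite near_withinE; apply/nbhs_normP; exists d => //= h.
rewrite /ball_ /= sub0r normrN => hd h0.
rewrite -[X in X - _]scale1r -(@mulVf _ h) // -scalerA -scalerBr normrZ normfV.
by rewrite ler_pdivrMl ?normr_gt0 // mulrC distrC (addrC (h *: v)); exact: Hd.
Qed.

Lemma differentiable_has_diff p q (F : 'rV[R]_p -> 'rV[R]_q) x :
  differentiable F x -> has_diff F x (jacobian F x).
Proof.
move=> dF e e0.
have E := diff_locally dF; move: E; set k := 'o _ => E.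
have /(littleoP [littleo of k])/nbhs_normP[d /= d0 Hd] := e0.
exists d => // y yx; have := Hd (y - x); rewrite /ball_ /= sub0r normrN => /(_ yx).
have -> : k (y - x) = F y - F x - (y - x) *m jacobian F x.
  have := congr1 (fun g => g (y - x)) E; rewrite /= subrK => ->.
  have -> : (cst (F x) + 'd F x + k) (y - x) = F x + 'd F x (y - x) + k (y - x) by [].
  rewrite -deriveEjacobian // deriveE //; move: (k (y - x)) ('d F x (y - x)) => u w.
  by apply/rowP => j; rewrite !mxE; ring.
by [].
Qed.

Lemma is_derive_has_diff p q (F : 'rV[R]_p -> 'rV[R]_q) x N v :
  has_diff F x N -> is_derive x v F (v *m N).
Proof.
move=> H; apply/is_derive_epsP => e e0.
have v0 : 0 < 1 + `|v| by rewrite ltr_pwDl.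
have [d d0 Hd] := H (e / (1 + `|v|)) (divr_gt0 e0 v0).
exists (d / (1 + `|v|)) => [|h]; first exact: divr_gt0.
rewrite ltr_pdivlMr // => hd.
have := Hd (x + h *: v); rewrite addrAC subrr add0r -scalemxAl normrZ => H1.
apply: le_trans (H1 _) _.
  by apply: le_lt_trans hd; rewrite ler_wpM2l // lerDr.
rewrite mulrAC ler_pdivrMr // -mulrA ler_wpM2l ?(ltW e0) // ler_wpM2l // lerDr //.
Qed.

Lemma is_derive_coord_line p q (F : 'rV[R]_p -> 'rV[R]_q) x v (t : R) i :
  differentiable F (x + t *: v) ->
  is_derive (t : R^o) (1 : R^o) (fun s : R^o => F (x + s *: v) 0 i : R^o)
    (('D_v F (x + t *: v)) 0 i).
Proof.
move=> dF; have /is_derive_epsP H := is_derive_has_diff v (differentiable_has_diff dF).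
apply/is_derive_epsP => e e0; have [d d0 Hd] := H e e0.
exists d => // h /Hd; rewrite deriveEjacobian //; apply: le_trans.
have -> : h *: (1 : R^o) = h by rewrite /GRing.scale /= mulr1.
rewrite scalerDl addrA; set w := (X in _ <= `|X|).
have -> : F (x + t *: v + h *: v) 0 i - F (x + t *: v) 0 i -
   h *: ((v *m jacobian F (x + t *: v)) 0 i : R^o) = w 0 i.
  by rewrite /w; move: (v *m _) => u; rewrite !mxE.
exact: coord_le_norm.
Qed.

Lemma second_difference_gap (D c1 c2 c0 a b e s : R) : 0 < s ->
  `|D - c1 - c2 + c0 - s ^+ 2 * a| <= e / 2 * s ^+ 2 ->
  `|D - c2 - c1 + c0 - s ^+ 2 * b| <= e / 2 * s ^+ 2 -> `|a - b| <= e.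
Proof.
move=> s0; have s2 : 0 < s ^+ 2 by rewrite exprn_gt0.
rewrite !ler_norml => /andP[h1 h2] /andP[h3 h4].
by apply/andP; split; rewrite -(ler_pM2l s2); lra.
Qed.

(** Both mixed derivatives are limits of the same second difference quotient. *)
Lemma schwarz p q (F : 'rV[R]_p -> 'rV[R]_q) (U : set 'rV[R]_p) x v w :
  open U -> U x -> (forall z, U z -> differentiable F z) ->
  (forall u z, U z -> differentiable ('D_u F) z) ->
  (forall u u' z, U z -> {for z, continuous ('D_u' ('D_u F))}) ->
  'D_w ('D_v F) x = 'D_v ('D_w F) x.
Proof.
move=> oU Ux dF dF2 cF2; apply/rowP => i.
(* The mean value theorem in the direction [v1] for the difference [psi], then in the direction [w1]
   for [chi], turns the second difference into the mixed derivative at an intermediate point. *)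
have key (e d : R) v1 w1 : 0 < e -> 0 < d ->
   (forall z, `|z - x| < d -> U z /\ `|'D_w1 ('D_v1 F) z 0 i - 'D_w1 ('D_v1 F) x 0 i| < e) ->
   forall s : R, 0 < s -> s * (`|v1| + `|w1|) < d ->
   `|(F (x + s *: v1 + s *: w1) 0 i - F (x + s *: v1) 0 i - F (x + s *: w1) 0 i + F x 0 i)
     - s ^+ 2 * ('D_w1 ('D_v1 F) x 0 i)| <= e * s ^+ 2.
  move=> e0 d0 Hd s s0 sd.
  have inU (a b : R) : 0 <= a <= s -> 0 <= b <= s -> `|x + a *: v1 + b *: w1 - x| < d.
    move=> /andP[a0 as_] /andP[b0 bs].
    have -> : x + a *: v1 + b *: w1 - x = a *: v1 + b *: w1.
      by apply/rowP => j; rewrite !mxE; ring.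
    apply: le_lt_trans (ler_normD _ _) _; rewrite !normrZ !ger0_norm //.
    apply: le_lt_trans sd; rewrite mulrDr.
    by apply: lerD; rewrite ler_wpM2r.
  pose psi (t : R^o) : R^o := F (x + s *: w1 + t *: v1) 0 i - F (x + t *: v1) 0 i.
  have s00 : 0 <= s <= s by rewrite lexx ltW.
  have z00 : (0 : R) <= 0 <= s by rewrite lexx ltW.
  have itvP' (t : R) : t \in `]0, s[ -> 0 <= t <= s.
    by rewrite in_itv /= => /andP[? ?]; rewrite !ltW.
  have dpsi (t : R) : 0 <= t <= s -> is_derive (t : R^o) (1 : R^o) psi
     (('D_v1 F (x + s *: w1 + t *: v1)) 0 i - ('D_v1 F (x + t *: v1)) 0 i).
    move=> ts; apply: is_deriveB; apply: is_derive_coord_line; apply: dF.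
      by apply: (Hd _ _).1; rewrite (addrAC x (s *: w1)); apply: inU.
    by apply: (Hd _ _).1; have := inU t 0 ts z00; rewrite scale0r addr0.
  have [t ts] : exists2 t, t \in `]0, s[ & psi s - psi 0 =
     (('D_v1 F (x + s *: w1 + t *: v1)) 0 i - ('D_v1 F (x + t *: v1)) 0 i) * (s - 0).
    apply: MVT => // [t /itvP'|]; first exact: dpsi.
    apply: derivable_within_continuous => t; rewrite in_itv /= => ts.
    by have [] := dpsi t ts.
  pose chi (r : R^o) : R^o := 'D_v1 F (x + t *: v1 + r *: w1) 0 i.
  have dchi (r : R) : 0 <= r <= s -> is_derive (r : R^o) (1 : R^o) chi
      ('D_w1 ('D_v1 F) (x + t *: v1 + r *: w1) 0 i).
    move=> rs; apply: is_derive_coord_line; apply: dF2.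
    by apply: (Hd _ _).1; apply: inU => //; exact: itvP'.
  have [r rs] : exists2 r, r \in `]0, s[ & chi s - chi 0 =
      'D_w1 ('D_v1 F) (x + t *: v1 + r *: w1) 0 i * (s - 0).
    apply: MVT => // [r /itvP'|]; first exact: dchi.
    apply: derivable_within_continuous => r; rewrite in_itv /= => rs.
    by have [] := dchi r rs.
  rewrite /psi /chi !scale0r !addr0 !subr0 !(addrAC x (s *: w1)) => -> E2.
  have -> : F (x + s *: v1 + s *: w1) 0 i - F (x + s *: v1) 0 i - F (x + s *: w1) 0 i + F x 0 i
      = 'D_w1 ('D_v1 F) (x + t *: v1 + r *: w1) 0 i * s * s by move: E2; set c := F (x + s *: v1) 0 i; lra.
  rewrite -mulrA -expr2 mulrC -mulrBr normrM ger0_norm ?sqr_ge0 // mulrC.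
  rewrite ler_wpM2r ?sqr_ge0 // ltW //; apply: (Hd _ _).2.
  by apply: inU; exact: itvP'.
have near v1 w1 e : 0 < e -> exists2 d : R, 0 < d & forall z, `|z - x| < d ->
    U z /\ `|'D_w1 ('D_v1 F) z 0 i - 'D_w1 ('D_v1 F) x 0 i| < e.
  move=> e0; have /continuous_epsP/(_ e e0)[d d0 Hd] := cF2 v1 w1 x Ux.
  have /open_rVP/(_ _ Ux)[d' d'0 Hd'] := oU.
  exists (Num.min d d'); first by rewrite lt_min d0.
  move=> z; rewrite lt_min => /andP[/Hd zd /Hd' ?]; split => //.
  apply: le_lt_trans zd.
  by have := coord_le_norm ('D_w1 ('D_v1 F) z - 'D_w1 ('D_v1 F) x) i; rewrite !mxE.
apply/eqP; rewrite -subr_eq0 -normr_le0; apply/ler_addgt0Pl => e e0; rewrite addr0.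
have e2 : 0 < e / 2 by rewrite divr_gt0.
have [d1 d10 Hd1] := near v w _ e2; have [d2 d20 Hd2] := near w v _ e2.
pose s := Num.min d1 d2 / (2 * (1 + `|v| + `|w|)).
have c0 : 0 < 1 + `|v| + `|w| by rewrite -addrA ltr_pwDl // addr_ge0.
have m0 : 0 < Num.min d1 d2 by rewrite lt_min d10.
have s0 : 0 < s by rewrite divr_gt0 // mulr_gt0.
have sE : s * (2 * (1 + `|v| + `|w|)) = Num.min d1 d2.
  by rewrite /s divfK // lt0r_neq0 // mulr_gt0.
have sd : s * (`|v| + `|w|) < Num.min d1 d2.
  by rewrite -sE ltr_pM2l //; have := normr_ge0 v; have := normr_ge0 w; lra.
have := key _ _ v w e2 d10 Hd1 s s0; rewrite (lt_le_trans sd) ?ge_min ?lexx // => /(_ isT) k1.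
have := key _ _ w v e2 d20 Hd2 s s0.
rewrite (addrC `|w|) (lt_le_trans sd) ?ge_min ?lexx ?orbT // => /(_ isT).
rewrite (addrAC x (s *: w)); exact: second_difference_gap s0 k1.
Qed.

End Derivatives.

(** * Closure properties of the classes [C^k] *)

Section ClassC.
Context {R : realType}.

Lemma differentiable_epsP (V W : normedModType R) (f : V -> W) (x : V)
    (L : {linear V -> W}) : continuous L ->
  (forall e : R, 0 < e -> exists2 d : R, 0 < d &
     forall h, `|h| < d -> `|f (h + x) - f x - L h| <= e * `|h|) ->
  differentiable f x.
Proof.
move=> cL H; have E : f \o shift x = cst (f x) + L +o_ 0 id.
  apply/eqaddoP => e e0; have [d d0 Hd] := H e e0.
  apply/nbhs_normP; exists d => //= h; rewrite /ball_ /= sub0r normrN => /Hd.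
  by rewrite -addrA -opprD.
apply/diff_locallyP; have -> := diff_unique cL E; split => //.
Qed.

Lemma differentiable_eps (V W : normedModType R) (f : V -> W) (x : V) :
  differentiable f x ->
  (forall e : R, 0 < e -> exists2 d : R, 0 < d &
     forall h, `|h| < d -> `|f (h + x) - f x - 'd f x h| <= e * `|h|).
Proof.
move=> /diff_locallyP[_ /eqaddoP H] e e0.
have /nbhs_normP[d /= d0 Hd] := H e e0; exists d => // h hd.
have := Hd h; rewrite /ball_ /= sub0r normrN => /(_ hd).
by move=> {}Hd; rewrite -addrA -opprD; exact: Hd.
Qed.

Lemma near_eq_differentiable (V W : normedModType R) (f g : V -> W) (x : V) (d : R) :
  0 < d -> (forall y, `|y - x| < d -> f y = g y) ->
  differentiable f x -> differentiable g x.
Proof.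
move=> d0 fg df; apply: (differentiable_epsP (diff_continuous df)) => e e0.
have [d' d'0 Hd'] := differentiable_eps df e0.
exists (Num.min d d') => [|h]; first by rewrite lt_min d0.
rewrite lt_min => /andP[hd /Hd']; rewrite !fg //; first by rewrite subrr normr0.
by rewrite addrK.
Qed.

Section OpenSet.
Context {V : normedModType R}.
Variable U : set V.
Hypothesis oU : forall x, U x -> exists2 d : R, 0 < d & forall y, `|y - x| < d -> U y.

(** [class_C] concerns total functions but constrains them on [U] only; with this transfer, formulas
    for derivatives that hold on the open set can drive the inductions on [k]. *)
Lemma class_C_eq (W : normedModType R) k (f g : V -> W) :
  (forall x, U x -> f x = g x) -> class_C k U f -> class_C k U g.
Proof.
elim: k f g => [|k IH] f g fg /=.
  move=> cf x Ux; have [d d0 Hd] := oU Ux.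
  apply/continuous_epsP => e e0; have /continuous_epsP/(_ e e0)[d' d'0 Hd'] := cf x Ux.
  exists (Num.min d d') => [|y]; first by rewrite lt_min d0.
  by rewrite lt_min => /andP[/Hd Uy /Hd']; rewrite !fg.
move=> [df Cf]; split=> [x Ux|v].
  have [d d0 Hd] := oU Ux.
  by apply: (near_eq_differentiable d0 _ (df x Ux)) => y /Hd /fg.
apply: (IH ('D_v f)) => // x Ux; apply: near_eq_derive.
have [d d0 Hd] := oU Ux; apply/nbhs_normP; exists d => //= y.
by rewrite /ball_ /= distrC => /Hd /fg.
Qed.

Lemma class_CS (W : normedModType R) k (f : V -> W) : class_C k.+1 U f -> class_C k U f.
Proof.
elim: k f => [|k IH] f [df Cf].
  by move=> x Ux; apply: differentiable_continuous; exact: df.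
by split => // v; apply: IH; exact: Cf.
Qed.

Lemma class_C_cst (W : normedModType R) k (a : W) : class_C k U (fun _ : V => a).
Proof.
elim: k a => [|k IH] a; first by move=> x _; exact: cst_continuous.
split=> [x _|v]; first exact: differentiable_cst.
apply: (class_C_eq _ (IH 0)) => x _.
by have [_ /esym] := is_derive_cst a x v.
Qed.

Lemma class_CD (W : normedModType R) k (f g : V -> W) :
  class_C k U f -> class_C k U g -> class_C k U (fun x => f x + g x).
Proof.
elim: k f g => [|k IH] f g; first by move=> cf cg x Ux; exact: (continuousD (cf x Ux) (cg x Ux)).
move=> [df Cf] [dg Cg]; split=> [x Ux|v].
  by apply: differentiableD; [exact: df|exact: dg].
apply: (class_C_eq _ (IH _ _ (Cf v) (Cg v))) => x Ux.
by rewrite -deriveD //; apply: diff_derivable; [exact: df|exact: dg].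
Qed.

Lemma class_CM k (f g : V -> R^o) :
  class_C k U f -> class_C k U g -> class_C k U (fun x => f x * g x : R^o).
Proof.
elim: k f g => [|k IH] f g; first by move=> cf cg x Ux; exact: (continuousM (cf x Ux) (cg x Ux)).
move=> Cf1 Cg1; have := class_CS Cf1; have := class_CS Cg1.
case: Cf1 => df Cf; case: Cg1 => dg Cg => Cgk Cfk; split=> [x Ux|v].
  by apply: differentiableM; [exact: df|exact: dg].
have := class_CD (IH _ _ (Cg v) Cfk) (IH _ _ (Cf v) Cgk).
apply: class_C_eq => x Ux.
rewrite (_ : (fun y => f y * g y : R^o) = f * g) // deriveM; last 2 first.
- by apply: diff_derivable; exact: df.
- by apply: diff_derivable; exact: dg.
by rewrite /GRing.scale /= mulrC; congr (_ + _); rewrite mulrC.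
Qed.

Lemma class_CV k (f : V -> R^o) : (forall x, U x -> f x != 0) ->
  class_C k U f -> class_C k U (fun x => (f x)^-1 : R^o).
Proof.
move=> f0; elim: k => [|k IH].
  by move=> cf x Ux; apply: (@continuousV _ _ f x); [exact: f0|exact: cf].
move=> Cf1; have Cfk := IH (class_CS Cf1).
case: Cf1 => df Cf; split=> [x Ux|v].
  by apply: differentiableV; [exact: df|exact: f0].
have := class_CM (class_C_cst k (-1 : R^o)) (class_CM (class_CM Cfk Cfk) (Cf v)).
apply: class_C_eq => x Ux.
rewrite deriveE; last exact: df.
rewrite deriveE; last by apply: differentiableV; [exact: df|exact: f0].
rewrite diffV; [|exact: df|exact: f0].
by rewrite /= /GRing.scale /= -invfM expr2 mulN1r -mulNr.
Qed.

Lemma class_C_scalev (W : normedModType R) k (f : V -> R^o) (w : W) :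
  class_C k U f -> class_C k U (fun x => f x *: w).
Proof.
elim: k f => [|k IH] f.
  by move=> cf x Ux; apply: continuousZl; exact: cf.
move=> [df Cf]; split=> [x Ux|v]; first by apply: differentiableZl; exact: df.
apply: (class_C_eq _ (IH _ (Cf v))) => x Ux; symmetry.
have dv := derivableP (diff_derivable (v := v) (df x Ux)).
suff [_ ->] : is_derive x v (fun z => f z *: w) ('D_v f x *: w) by [].
apply/is_derive_epsP => e e0.
have w0 : 0 < 1 + `|w| by rewrite ltr_pwDl.
have /is_derive_epsP/(_ _ (divr_gt0 e0 w0))[d d0 Hd] := dv.
exists d => // h /Hd Hh; rewrite scalerA -!scalerBl normrZ.
apply: le_trans (ler_wpM2r (normr_ge0 w) Hh) _.
rewrite mulrAC ler_wpM2r // mulrAC ler_pdivrMr // ler_wpM2l ?(ltW e0) //.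
by rewrite lerDr.
Qed.

Lemma class_C_sum (W : normedModType R) k q (f : 'I_q -> V -> W) :
  (forall i, class_C k U (f i)) -> class_C k U (fun x => \sum_i f i x).
Proof.
elim: q f => [|q IH] f Cf.
  by under eq_fun do rewrite big_ord0; exact: class_C_cst.
under eq_fun do rewrite big_ord_recl.
by apply: class_CD; [exact: Cf|apply: IH].
Qed.

Lemma class_C_rV k q (F : V -> 'rV[R]_q) :
  (forall i, class_C k U (fun x => F x 0 i : R^o)) -> class_C k U F.
Proof.
move=> CF; have := class_C_sum (fun i => class_C_scalev (delta_mx 0 i : 'rV[R]_q) (CF i)).
by apply: class_C_eq => x _; rewrite [RHS]row_sum_delta.
Qed.

End OpenSet.

Lemma class_C_coord k q (U : set 'rV[R]_q) i : open U ->
  class_C k U (fun x : 'rV[R]_q => x 0 i : R^o).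
Proof.
move=> /open_rVP oU; case: k => [|k]; first by move=> x _; exact: coord_continuous.
have D x : differentiable (fun y : 'rV[R]_q => y 0 i : R^o) x by exact: differentiable_coord.
split=> // v; apply: (class_C_eq oU _ (class_C_cst oU k (v 0 i : R^o))) => x _.
symmetry; suff [_ ->] : is_derive x v (fun y : 'rV[R]_q => y 0 i : R^o) (v 0 i) by [].
apply/is_derive_epsP => e e0; exists 1 => // h _.
have -> : (x + h *: v) 0 i - x 0 i - h *: (v 0 i : R^o) = 0.
  by rewrite !mxE /GRing.scale /=; ring.
by rewrite normr0 mulr_ge0 // ltW.
Qed.

(** A directional derivative of the restriction to a line is again the restriction of a directional
    derivative, which closes the induction. It makes straight lines in a chart admissible for
    [is_curve_at]. *)
Lemma class_C_line (W V : normedModType R) k (U : set V) (B : set R^o) (f : V -> W) (y h : V) :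
  class_C k U f -> (forall t, B t -> U (y + t *: h)) ->
  class_C k B (fun t : R^o => f (y + t *: h)).
Proof.
have dl (t : R^o) : differentiable (fun s : R^o => y + s *: h) t.
  apply: differentiableD; first exact: differentiable_cst.
  by apply: differentiableZl; exact: (@ex_diff _ _ _ _ _ _ _ (is_diff_id t)).
move=> Cf BU; elim: k f Cf => [|k IH] f.
  move=> cf t Bt; apply: (@continuous_comp _ _ _ (fun s : R^o => y + s *: h) f).
    exact: differentiable_continuous.
  by apply: cf; exact: BU.
move=> [df Cf]; split=> [t Bt|v].
  apply: (@differentiable_comp _ _ _ _ (fun s : R^o => y + s *: h) f); first exact: dl.
  by apply: df; exact: BU.
rewrite (_ : 'D_v _ = fun t => 'D_(v *: h) f (y + t *: h)); first exact: (IH _ (Cf (v *: h))).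
apply: funext => t; rewrite /derive.
suff -> : (fun s : R => s^-1 *: (((fun s => f (y + s *: h)) \o shift t) (s *: v) - f (y + t *: h)))
  = (fun s : R => s^-1 *: ((f \o shift (y + t *: h)) (s *: (v *: h)) - f (y + t *: h))) by [].
apply: funext => s /=; congr (_ *: (f _ - _)).
by rewrite scalerDl scalerA addrCA addrC (addrC y).
Qed.

End ClassC.

(** * Linear algebra of the shape operator *)

Section Frame.
Context {R : realType} {n : nat}.
Variables (J : 'M[R]_(n, n.+1)) (nu : 'rV[R]_n.+1).

Lemma gram_unit : \rank J = n -> J *m J^T \in unitmx.
Proof.
move=> rJ; have fJ : row_free J by rewrite /row_free rJ.
rewrite -row_free_unit -kermx_eq0 -nz_row_eq0; set v := nz_row _.
have vE : v *m (J *m J^T) = 0 by apply/sub_kermxP; exact: nz_row_sub.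
have : dot (v *m J) (v *m J) = 0.
  by rewrite /dot trmx_mul !mulmxA -(mulmxA v J) vE mul0mx mxE.
by move=> /dot_eq0/eqP; rewrite mulmx_free_eq0.
Qed.

Hypotheses (hJ : J *m nu^T = 0) (hnu : dot nu nu = 1) (hr : \rank J = n).

Local Notation g := (J *m J^T).

(** The unit normal stacked on the tangent rows gives a square matrix with block diagonal Gram
    matrix, so its absolute determinant is the area density. *)
Definition frame : 'M[R]_(1 + n) := col_mx nu J.

Lemma unit_row_mx : nu *m nu^T = 1%:M.
Proof. by rewrite [LHS]mx11_scalar -/(dot nu nu) hnu. Qed.

Lemma normal_mul_gram : nu *m J^T = 0.
Proof. by rewrite -[LHS]trmxK trmx_mul trmxK hJ trmx0. Qed.

Lemma frame_gram : frame *m frame^T = block_mx 1%:M 0 0 g.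
Proof.
by rewrite /frame tr_col_mx mul_col_row unit_row_mx hJ normal_mul_gram.
Qed.

Lemma frame_id : nu^T *m nu + J^T *m invmx g *m J = 1%:M.
Proof.
have ug := gram_unit hr.
have H : frame *m (row_mx nu^T (J^T *m invmx g)) = 1%:M.
  rewrite /frame mul_col_row unit_row_mx hJ !mulmxA normal_mul_gram mul0mx mulmxV //.
  by rewrite -scalar_mx_block.
by have := mulmx1C H; rewrite /frame mul_row_col.
Qed.

Lemma det_frame : \det frame ^+ 2 = \det g.
Proof.
have := congr1 determinant frame_gram.
by rewrite det_mulmx det_tr -expr2 det_lblock det1 mul1r.
Qed.

Lemma gram_det_gt0 : 0 < \det g.
Proof.
have := gram_unit hr; rewrite unitmxE unitfE => d0.
by rewrite lt0r d0 -det_frame sqr_ge0.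
Qed.

Lemma norm_det_frame : `|\det frame| = Num.sqrt (\det g).
Proof. by rewrite -det_frame sqrtr_sqr. Qed.

Lemma tangent_decomp x : x = dot x nu *: nu + x *m J^T *m invmx g *m J.
Proof.
rewrite -[LHS]mulmx1 -frame_id mulmxDr !mulmxA; congr (_ + _).
by rewrite [x *m nu^T]mx11_scalar mul_scalar_mx.
Qed.

Lemma normal_decomp x : J *m x^T = 0 -> x = dot x nu *: nu.
Proof.
move=> Jx; rewrite [LHS]tangent_decomp.
by rewrite -[x *m J^T]trmxK trmx_mul trmxK Jx trmx0 !mul0mx addr0.
Qed.

Variable Q : 'M[R]_n.
Hypothesis hQ : Q^T = Q.

(** The differential of the Gauss map as a matrix on the ambient space, zero on the normal:
    [J^T *m invmx g] extracts chart coordinates of the tangential part, and [Q *m invmx g *m J] is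
    the Weingarten formula. *)
Definition shape := J^T *m invmx g *m Q *m invmx g *m J.

Lemma shape_sym : shape^T = shape.
Proof. by rewrite /shape !trmx_mul trmx_inv trmx_mul !trmxK hQ !mulmxA. Qed.

Lemma normal_shape : nu *m shape = 0.
Proof. by rewrite /shape !mulmxA normal_mul_gram !mul0mx. Qed.

Lemma frame_shape : J *m shape = Q *m invmx g *m J.
Proof. by rewrite /shape !mulmxA mulmxV ?gram_unit // mul1mx. Qed.

(** Multiplying by the frame on the left and its transpose on the right makes the matrix block
    diagonal with blocks [1] and [g + t Q]; the two frames together contribute [\det g]. *)
Lemma det_shape t : \det (1%:M + t *: shape) * \det g = \det (g + t *: Q).
Proof.
have ug := gram_unit hr.
have E : (frame : 'M[R]_(1 + n)) *m (1%:M + t *: shape) *m frame^T = block_mx 1%:M 0 0 (g + t *: Q).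
  have -> : (frame : 'M[R]_(1 + n)) *m (1%:M + t *: shape) = col_mx nu (J + t *: (Q *m invmx g *m J)).
    rewrite /frame mul_col_mx !mulmxDr !mulmx1 -!scalemxAr normal_shape frame_shape.
    by rewrite scaler0 addr0.
  rewrite /frame tr_col_mx mul_col_row unit_row_mx normal_mul_gram !mulmxDl hJ.
  by rewrite -!scalemxAl -!mulmxA hJ !mulmx0 scaler0 addr0 mulVmx // mulmx1.
have := congr1 determinant E; rewrite !det_mulmx det_tr det_lblock det1 mul1r => <-.
by rewrite -det_frame expr2; ring.
Qed.

Lemma frame_mul_shape t :
  frame *m (1%:M + t *: shape : 'M[R]_(1 + n)) = col_mx nu (J + t *: (Q *m invmx g *m J)).
Proof.
rewrite /frame mul_col_mx !mulmxDr !mulmx1 -!scalemxAr normal_shape frame_shape.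
by rewrite scaler0 addr0.
Qed.

End Frame.

Section Spectral.
Context {R : realType} {m : nat}.
Variable S : 'M[R]_m.
Hypothesis hS : S^T = S.

Lemma sym_dot x y : dot (x *m S) y = dot x (y *m S).
Proof. by rewrite /dot trmx_mul hS mulmxA. Qed.

(** A maximizer of the Rayleigh quotient on the orthogonal complement of the
    given eigenvectors is a new eigenvector. *)
Lemma eigenvector_extend k (e : nat -> 'rV[R]_m) : (k < m)%N ->
  (forall i, (i < k)%N -> exists l, e i *m S = l *: e i) ->
  exists v, [/\ dot v v = 1, forall i, (i < k)%N -> dot v (e i) = 0 &
    exists l, v *m S = l *: v].
Proof.
move=> km He; pose E : 'M[R]_(k, m) := \matrix_(i < k) e i.
pose C := [set x : 'rV[R]_m | dot x x = 1 /\ forall i, (i < k)%N -> dot x (e i) = 0].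
have C0 : C !=set0.
  have : kermx E^T != 0.
    rewrite -mxrank_eq0 mxrank_ker mxrank_tr subn_eq0 -ltnNge.
    by apply: leq_ltn_trans km; exact: rank_leq_row.
  rewrite -nz_row_eq0; set v := nz_row _ => v0.
  have vE : v *m E^T = 0 by apply/sub_kermxP; exact: nz_row_sub.
  have d0 := dot_gt0 v0; exists ((Num.sqrt (dot v v))^-1 *: v); split.
    rewrite dotZl dotZr mulrA -expr2 exprVn sqr_sqrtr ?dot_ge0 // mulVf // lt0r_neq0 //.
  move=> i ik; rewrite dotZl; suff -> : dot v (e i) = 0 by rewrite mulr0.
  have := congr1 (fun M : 'rV[R]_k => M 0 (Ordinal ik)) vE; rewrite [RHS]mxE => <-.
  by rewrite !mxE dotE; apply: eq_bigr => j _; rewrite !mxE.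
have cC : compact C.
  apply: bounded_closed_compact.
    exists 1; split; first exact: num_real.
    move=> M M1 x [x1 _]; apply: le_trans (ltW M1); apply: le_trans (norm_le_enorm x) _.
    by rewrite /enorm x1 sqrtr1.
  have -> : C = (fun x => dot x x : R^o) @^-1` [set 1] `&`
      \bigcap_(i in [set i | (i < k)%N]) ((fun x => dot x (e i) : R^o) @^-1` [set 0]).
    by apply/seteqP; split => x /= [x1 xi]; split.
  apply: closedI.
    apply: closed_comp; last exact: closed_eq.
    by move=> x _; exact: (cvg_dot (f := id) (g := id)).
  apply: closed_bigI => i _; apply: closed_comp; last exact: closed_eq.
  by move=> x _; exact: continuous_dotl.
have cf : continuous (fun x : 'rV[R]_m => dot (x *m S) x : R^o).
  by move=> x; apply: (cvg_dot (g := id)); [exact: continuous_mulmx|exact: cvg_id].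
have [|v /set_mem[v1 vi] Hv] := EVT_max_rV C0 cC (f := fun x => dot (x *m S) x).
  by apply: continuous_subspaceT => x; exact: cf.
exists v; split => //; pose l := dot (v *m S) v; exists l.
have Hx x : (forall i, (i < k)%N -> dot x (e i) = 0) -> dot (x *m S) x <= l * dot x x.
  move=> xi; have [->|x0] := eqVneq x 0; first by rewrite mul0mx !dot0l mulr0.
  have d0 := dot_gt0 x0; pose a := Num.sqrt (dot x x).
  have a2 : a ^+ 2 = dot x x by rewrite sqr_sqrtr ?dot_ge0.
  have a0 : a != 0 by apply: contraTneq d0 => a0; rewrite -a2 a0 expr0n ltxx.
  have : dot ((a^-1 *: x) *m S) (a^-1 *: x) <= l.
    apply: Hv; rewrite inE; split; last by move=> i ik; rewrite dotZl xi // mulr0.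
    by rewrite dotZl dotZr mulrA -expr2 exprVn a2 mulVf // lt0r_neq0.
  by rewrite -scalemxAl dotZl dotZr mulrA -expr2 exprVn a2 mulrC ler_pdivrMr.
pose w := v *m S - l *: v.
have vw : dot v w = 0 by rewrite /w dotBr dotZr v1 mulr1 dotC subrr.
have wi i : (i < k)%N -> dot w (e i) = 0.
  move=> ik; rewrite /w dotBl dotZl vi // mulr0 subr0 sym_dot.
  by have [c ->] := He i ik; rewrite dotZr vi // mulr0.
have Sw : dot (v *m S) w = dot w w.
  by rewrite [in RHS]/w dotBl dotZl vw mulr0 subr0.
suff : dot w w = 0 by move=> /dot_eq0/eqP; rewrite subr_eq0 => /eqP.
move: w vw wi Sw => w vw wi Sw; apply/eqP; rewrite eq_le dot_ge0 andbT leNgt; apply/negP => w0.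
pose b := l * dot w w - dot (w *m S) w.
(* Moving from [v] in the admissible direction [w] gains [2 t |w|^2] at first order against a loss
   of order [t ^+ 2], which a maximum forbids for small [t] unless [w] vanishes. *)
have key t : 0 <= t -> 2 * t * dot w w <= t ^+ 2 * b.
  move=> t0; have A i : (i < k)%N -> dot (v + t *: w) (e i) = 0.
    by move=> ik; rewrite dotDl dotZl vi // wi // mulr0 addr0.
  have := Hx _ A; rewrite mulmxDl -scalemxAl !dot_bilin.
  by rewrite (dotC w v) vw (sym_dot w v) (dotC w (v *m S)) Sw v1 -/l /b; lra.
pose t := dot w w / (1 + `|b|).
have c0 : 0 < 1 + `|b| by rewrite ltr_pwDl.
have t0 : 0 < t by rewrite divr_gt0.
have := key t (ltW t0); rewrite expr2 mulrAC -[leRHS]mulrA [leRHS]mulrC -subr_ge0 -mulrBl.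
rewrite pmulr_lge0 // subr_ge0; have : t * b < dot w w * 2; last by lra.
have tE : t * (1 + `|b|) = dot w w by rewrite /t divfK // lt0r_neq0.
have := ler_norm b; nra.
Qed.

End Spectral.

Section SpectralTangent.
Context {R : realType} {n : nat}.
Variables (S : 'M[R]_n.+1) (nu : 'rV[R]_n.+1).
Hypotheses (hS : S^T = S) (hnu : dot nu nu = 1) (nuS : nu *m S = 0).

(** The induction starts with [nu] itself, an eigenvector for the eigenvalue 0, so all later
    eigenvectors are tangent; index 0 is dropped at the end. *)
Lemma eigenbasis : exists (e : 'I_n -> 'rV[R]_n.+1) (k : 'rV[R]_n),
  [/\ forall i, dot (e i) nu = 0, forall i j, dot (e i) (e j) = (i == j)%:R &
      forall i, e i *m S = k 0 i *: e i].
Proof.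
have H k : (k < n.+1)%N -> exists e : nat -> 'rV[R]_n.+1,
   [/\ e 0%N = nu, forall i j, (i <= k)%N -> (j <= k)%N -> dot (e i) (e j) = (i == j)%:R &
       forall i, (i < k.+1)%N -> exists l, e i *m S = l *: e i].
  elim: k => [_|k IH kn].
    exists (fun=> nu); split=> // [i j|i _]; last by exists 0; rewrite scale0r.
    by rewrite !leqn0 => /eqP -> /eqP ->; rewrite hnu.
  have [e [e0 eo es]] := IH (ltnW kn).
  have [v [v1 vo vs]] := eigenvector_extend hS kn es.
  exists (fun i => if i == k.+1 then v else e i); split => //.
    have lt_of i : (i <= k.+1)%N -> i != k.+1 -> (i <= k)%N.
      by rewrite leq_eqVlt ltnS => /orP[->|].
    move=> i j ik jk; have [ik'|ik'] := eqVneq i k.+1; have [jk'|jk'] := eqVneq j k.+1.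
    - by rewrite ik' jk' eqxx v1.
    - by rewrite vo ?ltnS ?lt_of // ik' eq_sym (negPf jk').
    - by rewrite dotC vo ?ltnS ?lt_of // jk' (negPf ik').
    - by rewrite eo ?lt_of.
  move=> i; rewrite ltnS leq_eqVlt; case: (eqVneq i k.+1) => [->|ik] //= ik'; exact: es.
have [e [e0 eo es]] := H n (ltnSn n).
have /boolp.choice[l Hl] : forall i : 'I_n, exists l, e i.+1 *m S = l *: e i.+1.
  by move=> i; apply: es; rewrite ltnS.
exists (fun i : 'I_n => e i.+1), (\row_i l i); split=> [i|i j|i].
- by rewrite -e0 eo.
- by rewrite eo.
- by rewrite mxE.
Qed.

(** In the frame formed by [nu] and the eigenvectors the matrix is diagonal. The basis is arbitrary,
    so this covers the one hidden in any choice of principal curvatures. *)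
Lemma det_eigenbasis (e : 'I_n -> 'rV[R]_n.+1) (k : 'rV[R]_n) (t : R) :
  (forall i, dot (e i) nu = 0) -> (forall i j, dot (e i) (e j) = (i == j)%:R) ->
  (forall i, e i *m S = k 0 i *: e i) ->
  \det (1%:M + t *: S) = \prod_i (1 + t * k 0 i).
Proof.
move=> eo ee es; pose E : 'M[R]_(n, n.+1) := \matrix_i e i.
have EE : E *m E^T = 1%:M.
  apply/matrixP => i j; rewrite !mxE -ee dotE; apply: eq_bigr => l _; by rewrite !mxE.
have Enu : E *m nu^T = 0.
  apply/matrixP => i j; rewrite !mxE -[RHS](eo i) dotE ord1; apply: eq_bigr => l _; by rewrite !mxE.
have rE : \rank E = n by apply/eqP; apply/row_freeP; exists E^T.
have := det_frame Enu hnu; rewrite EE det1 => dE.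
pose D : 'rV[R]_n := \row_i (1 + t * k 0 i).
have F : (frame E nu : 'M[R]_(1 + n)) *m (1%:M + t *: S) = block_mx 1%:M 0 0 (diag_mx D) *m frame E nu.
  rewrite /frame mul_col_mx mul_block_col mul1mx !mul0mx addr0 add0r.
  rewrite mulmxDr mulmx1 -scalemxAr nuS scaler0 addr0; congr col_mx.
  rewrite mulmxDr mulmx1 -scalemxAr; apply/row_matrixP => i.
  rewrite row_mul row_diag_mx -scalemxAl -rowE linearD linearZ /= row_mul !rowK es !mxE.
  by rewrite scalerDl scale1r scalerA.
have := congr1 determinant F; rewrite !det_mulmx det_lblock det1 mul1r det_diag mulrC.
have d0 : \det (frame E nu) != 0.
  by apply: contra_eq_neq dE => ->; rewrite expr0n /= eq_sym oner_eq0.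
by move=> /(mulIf d0) ->; apply: eq_bigr => i _; rewrite mxE.
Qed.

End SpectralTangent.

Lemma prod_elem_sym (R : realType) n (k : 'rV[R]_n) (t : R) :
  \prod_i (1 + t * k 0 i) = \sum_(j < n.+1) elem_sym j k * t ^+ j.
Proof.
under eq_bigr do rewrite addrC.
rewrite bigA_distr (partition_big (fun A : {set 'I_n} => inord #|A| : 'I_n.+1) xpredT) //=.
apply: eq_bigr => j _; rewrite /elem_sym mulr_suml; apply: eq_big => A.
  have : (#|A| < n.+1)%N by rewrite ltnS -[X in (_ <= X)%N]card_ord max_card.
  by move=> An; rewrite -val_eqE /= inordK.
move=> /eqP <-; rewrite inordK; last by rewrite ltnS -[X in (_ <= X)%N]card_ord max_card.
rewrite -big_mkcond /= big_split /= mulrC; congr (_ * _).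
by rewrite prodr_const.
Qed.

(** Inverse Vandermonde matrix at the nodes [0, ..., q - 1]: coefficients are fixed linear
    combinations of values. It recovers each elementary symmetric function of the curvatures from
    products of the factors [1 + l k_i]. *)
Lemma polynomial_interpolation (R : realType) q : exists c : 'I_q -> 'I_q -> R,
  forall (a : 'I_q -> R) j, a j = \sum_l c j l * \sum_i a i * (val l)%:R ^+ i.
Proof.
pose V : 'M[R]_q := Vandermonde q (\row_l (val l)%:R).
have uV : V \in unitmx.
  rewrite unitmxE det_Vandermonde unitfE; apply/prodf_neq0 => i _; apply/prodf_neq0 => j ij.
  by rewrite !mxE subr_eq0 eqr_nat /= neq_ltn ij orbT.
exists (fun j l => invmx V l j) => a j.
have : (\row_i a i) *m V *m invmx V = \row_i a i by rewrite mulmxK.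
move=> /(congr1 (fun M : 'rV[R]_q => M 0 j)); rewrite [RHS]mxE => <-.
rewrite mxE; apply: eq_bigr => l _; rewrite mulrC; congr (_ * _).
by rewrite mxE; apply: eq_bigr => i _; rewrite !mxE.
Qed.

(** * Charts and the outward normal *)

Section Charts.
Context {R : realType} {n : nat}.
Variables (S : set 'rV[R]_n.+1) (U : set 'rV[R]_n) (phi : 'rV[R]_n -> 'rV[R]_n.+1).
Hypothesis hc : is_chart S U phi.

Lemma chart_open : open U. Proof. by case: hc => -[]. Qed.

Lemma chart_rank y : U y -> \rank (jacobian phi y) = n.
Proof. by case: hc => _ _ _; apply. Qed.

Lemma chart_inj y z : U y -> U z -> phi y = phi z -> y = z.
Proof. by case: hc => _ inj _ _ Uy Uz; apply: inj; rewrite inE. Qed.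

Lemma chart_image y : U y -> S (phi y).
Proof.
move=> Uy; case: hc => _ _ /(_ _ chart_open (@subset_refl _ _))[W oW E] _.
have : (phi @` U) (phi y) by exists y.
by rewrite E => -[].
Qed.

Lemma chart_differentiable y : U y -> differentiable phi y.
Proof. by case: hc => -[_ /(_ 1)[d1 _]] _ _ _; exact: d1. Qed.

Lemma chart_differentiable2 v y : U y -> differentiable ('D_v phi) y.
Proof. by case: hc => -[_ /(_ 2)[_ /(_ v)[d1 _]]] _ _ _; exact: d1. Qed.

Lemma chart_continuous2 v w y : U y -> {for y, continuous ('D_w ('D_v phi))}.
Proof. by case: hc => -[_ /(_ 2)[_ /(_ v)[_ /(_ w) c]]] _ _ _; exact: c. Qed.

Lemma chart_has_diff y : U y -> has_diff phi y (jacobian phi y).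
Proof. by move=> Uy; apply: differentiable_has_diff; exact: chart_differentiable. Qed.

Lemma chart_nbhs y V : open V -> V `<=` U -> V y -> exists2 d : R, 0 < d &
  forall X, S X -> `|X - phi y| < d -> exists2 z, V z & phi z = X.
Proof.
move=> oV VU Vy; case: hc => _ _ /(_ _ oV VU)[W oW E] _.
have : (phi @` V) (phi y) by exists y.
rewrite E => -[_ Wy]; have /open_rVP/(_ _ Wy)[d d0 Hd] := oW.
exists d => // X SX /Hd WX; have : (S `&` W) X by split.
by rewrite -E => -[z Vz <-]; exists z.
Qed.

(** The openness clause of [is_chart] is applied to a small neighbourhood of [y]; injectivity
    identifies the parameter it produces with [z]. *)
Lemma chart_inv_continuous y : U y -> forall e : R, 0 < e -> exists2 d : R, 0 < d &
  forall z, U z -> `|phi z - phi y| < d -> `|z - y| < e.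
Proof.
move=> Uy e e0; pose V := U `&` [set z | `|z - y| < e].
have oV : open V by apply: openI; [exact: chart_open|exact: open_ball_rV].
have Vy : V y by split => //; rewrite /= subrr normr0.
have VU : V `<=` U by move=> z [].
have [d d0 Hd] := chart_nbhs oV VU Vy; exists d => // z Uz /(Hd _ (chart_image Uz)).
by move=> [z' [Uz' z'y] /(chart_inj Uz' Uz) <-].
Qed.

Lemma row_jacobian y i : U y -> row i (jacobian phi y) = 'D_(delta_mx 0 i) phi y.
Proof. by move=> Uy; rewrite rowE -deriveEjacobian //; exact: chart_differentiable. Qed.

Lemma chart_line_curve y v : U y -> is_curve_at S (phi y) (fun t : R^o => phi (y + t *: v)).
Proof.
move=> Uy; split; first by rewrite scale0r addr0.
have /open_rVP/(_ _ Uy)[d d0 Hd] := chart_open.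
have v0 : 0 < 1 + `|v| by rewrite ltr_pwDl.
have B (t : R^o) : ball (0 : R^o) (d / (1 + `|v|)) t -> U (y + t *: v).
  rewrite -ball_normE /= sub0r normrN ltr_pdivlMr // => td; apply: Hd.
  rewrite addrAC subrr add0r normrZ; apply: le_lt_trans td.
  by rewrite ler_wpM2l // lerDr.
exists (d / (1 + `|v|)); first exact: divr_gt0.
split; last by move=> _ [t /B Ut <-]; exact: chart_image.
by move=> k; apply: class_C_line B; case: hc => -[_ /(_ k)].
Qed.

Lemma chart_line_derive y v : U y ->
  'D_1 (fun t : R^o => phi (y + t *: v)) (0 : R^o) = v *m jacobian phi y.
Proof.
move=> Uy; have H := is_derive_has_diff v (chart_has_diff Uy).
suff [_ ->] : is_derive (0 : R^o) (1 : R^o) (fun t : R^o => phi (y + t *: v)) (v *m jacobian phi y) by [].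
apply/is_derive_epsP => e e0; have /is_derive_epsP/(_ e e0)[d d0 Hd] := H.
exists d => // h /Hd; rewrite scale0r addr0 add0r.
by rewrite -[h *: (1 : R^o)]/(h * 1) mulr1.
Qed.

End Charts.

(** Both signs of [h] are allowed, so the first-order term would take both signs unless it
    vanishes. *)
Lemma derive_max_orth (R : realType) m (V : normedModType R) (f : V -> 'rV[R]_m) (a v : V) w eta :
  is_derive a v f w ->
  (exists2 d : R, 0 < d & forall h : R, `|h| < d -> dot (f (a + h *: v) - f a) eta <= 0) ->
  dot w eta = 0.
Proof.
move=> /is_derive_epsP H [d d0 Hd]; apply/eqP; rewrite -normr_le0.
apply/ler_addgt0Pl => e e0; rewrite addr0.
have c0 : 0 < 1 + m%:R * `|eta| by rewrite ltr_pwDl // mulr_ge0.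
have [d1 d10 Hd1] := H _ (divr_gt0 e0 c0).
pose h := Num.min d d1 / 2.
have h0 : 0 < h by rewrite divr_gt0 // lt_min d0.
have hm : h < Num.min d d1 by rewrite ltr_pdivrMr // mulr2n mulrDr mulr1 ltrDl lt_min d0.
move: hm; rewrite lt_min => /andP[hd hd1].
have K s : `|s| = h -> s * dot w eta <= e * h.
  move=> sh; have := Hd s; rewrite sh => /(_ hd); have := Hd1 s; rewrite sh => /(_ hd1).
  set F := f (a + s *: v) - f a => H1 H2.
  have : - dot (F - s *: w) eta <= e * h.
    apply: le_trans (_ : m%:R * (`|F - s *: w| * `|eta|) <= _).
      by apply: le_trans (dot_le_norm _ _); rewrite -normrN; exact: ler_norm.
    apply: le_trans (_ : m%:R * (e / (1 + m%:R * `|eta|) * h * `|eta|) <= _).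
      by rewrite ler_wpM2l // ler_wpM2r.
    have -> : m%:R * (e / (1 + m%:R * `|eta|) * h * `|eta|) =
        (m%:R * `|eta|) / (1 + m%:R * `|eta|) * (e * h) by ring.
    apply: ler_piMl; first by rewrite mulr_ge0 // ltW.
    by rewrite ler_pdivrMr // mul1r lerDr.
  by rewrite dotBl dotZl; lra.
have := K h; have := K (- h); rewrite normrN ger0_norm ?(ltW h0) //.
move=> /(_ erefl) k1 /(_ erefl) k2; rewrite ler_norml; apply/andP; split.
  by rewrite -(ler_pM2r h0); lra.
by rewrite -(ler_pM2r h0); lra.
Qed.

(** * Support normals and the outward normal of a smooth convex boundary *)

Section Normals.
Context {R : realType} {n : nat}.
Variable Omega : set 'rV[R]_n.+1.
Hypothesis (hne : Omega !=set0) (hopen : open Omega) (hbdd : bounded_set Omega).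
Hypothesis hconv : convex_set (Omega : set (convex_lmodType 'rV[R]_n.+1)).
Hypothesis hsmooth : smooth_hypersurface (boundary Omega).

Local Notation E := 'rV[R]_n.+1.
Local Notation K := (closure Omega).
Local Notation S := (boundary Omega).

Lemma boundary_body X : S X -> K X.
Proof. by rewrite boundaryE // => -[]. Qed.

Lemma curve_normal p c eta : is_curve_at S p c -> is_support_normal Omega p eta ->
  dot ('D_1 c (0 : R^o)) eta = 0.
Proof.
move=> [cp [e e0 [sc cS]]] [_ He].
have dc : differentiable c (0 : R^o) by have [H _] := sc 1; apply: H; exact: ballxx.
apply: (derive_max_orth (derivableP (diff_derivable dc))).
exists e => // h he; rewrite cp dotC; apply: He; apply: boundary_body; apply: cS.
exists (0 + h *: (1 : R^o)) => //.
by rewrite add0r -[h *: (1 : R^o)]/(h * 1) mulr1 -ball_normE /= sub0r normrN.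
Qed.

Section Chart.
Variables (U : set 'rV[R]_n) (phi : 'rV[R]_n -> 'rV[R]_n.+1).
Hypothesis hc : is_chart S U phi.

Lemma jacobian_normal y eta :
  (forall v, tangent_space S (phi y) v -> dot v eta = 0) -> U y ->
  jacobian phi y *m eta^T = 0.
Proof.
move=> H Uy; apply/row_matrixP => i; rewrite row0 row_mul.
have -> : row i (jacobian phi y) *m eta^T = (dot (row i (jacobian phi y)) eta)%:M.
  by rewrite [LHS]mx11_scalar.
rewrite H ?raddf0 //; exists (fun t : R^o => phi (y + t *: delta_mx 0 i)).
  exact: (chart_line_curve hc).
by rewrite (chart_line_derive hc) // rowE.
Qed.

Lemma chart_normal y eta : U y -> is_support_normal Omega (phi y) eta ->
  jacobian phi y *m eta^T = 0.
Proof.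
move=> Uy He; apply: jacobian_normal => // _ [c Hc <-]; exact: curve_normal Hc He.
Qed.

(** The orthogonal complement of the tangent rows is the line spanned by [nu]. *)
Lemma chart_normal_pm y eta nu : U y -> is_support_normal Omega (phi y) nu ->
  dot eta eta = 1 -> jacobian phi y *m eta^T = 0 -> eta = nu \/ eta = - nu.
Proof.
move=> Uy Hn e1 He; have := normal_decomp (chart_normal Uy Hn) Hn.1 (chart_rank hc Uy) He.
set a := dot eta nu => eE.
have : a ^+ 2 = 1.
  by move: e1; rewrite eE dotZl dotZr Hn.1 mulr1 -expr2.
move=> /eqP; rewrite sqrf_eq1 => /orP[] /eqP aE; rewrite eE aE.
  by left; rewrite scale1r.
by right; rewrite scaleN1r.
Qed.

End Chart.

Lemma opp_support_normal X nu : is_support_normal Omega X nu ->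
  ~ is_support_normal Omega X (- nu).
Proof.
move=> H1 H2; have [z Oz] := hne.
have := support_normal_lt hopen H1 Oz; have := support_normal_lt hopen H2 Oz.
by rewrite dotNl oppr_lt0 => /ltW; rewrite leNgt => /negP.
Qed.

Lemma support_normal_unique X eta nu : S X -> is_support_normal Omega X eta ->
  is_support_normal Omega X nu -> eta = nu.
Proof.
move=> /hsmooth[U [phi [hc [y Uy <-]]]] He Hn.
case: (chart_normal_pm hc Uy Hn He.1 (chart_normal hc Uy He)) => // E.
by case: (opp_support_normal Hn); rewrite -E.
Qed.

(** Orthogonality leaves the candidates [eta] and [- eta]. For the wrong sign the exterior ray of
    the definition runs against [eta], and [support_normal_exists] along it gives a support normal
    whose product with [eta] is nonpositive; uniqueness makes it [eta], a contradiction. *)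
Lemma outward_unit_normalP X nu : S X ->
  is_outward_unit_normal Omega X nu <-> is_support_normal Omega X nu.
Proof.
move=> SX; split=> [[n1 tn [e e0 He]]|Hn]; last first.
  split; first by apply/enorm1P; exact: Hn.1.
    by move=> _ [c Hc <-]; exact: curve_normal Hc Hn.
  exists 1 => // t /andP[t0 _] /sub_body; exact: add_normal_notin Hn t0.
have [eta Heta] := boundary_normal_exists hne hopen hbdd hconv SX.
have [U [phi [hc [y Uy yX]]]] := hsmooth SX; move: SX tn He Heta; rewrite -yX => SX tn He Heta.
case: (chart_normal_pm hc Uy Heta _ (jacobian_normal hc tn Uy)) => [|->//|nE].
  by apply/enorm1P.
have [|e1 He1 Hv] := @support_normal_exists R n Omega hne hopen hbdd hconv (phi y) eta e
    (boundary_body SX) e0.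
  by move=> t te; have := He t te; rewrite nE scalerN.
by move: Hv; rewrite (support_normal_unique SX He1 Heta) Heta.1 ler10.
Qed.

Lemma outward_normalP X : S X -> is_support_normal Omega X (outward_normal Omega X).
Proof.
move=> SX; apply/(outward_unit_normalP _ SX); apply: getPex.
have [eta Heta] := boundary_normal_exists hne hopen hbdd hconv SX.
by exists eta; apply/(outward_unit_normalP _ SX).
Qed.

Lemma outward_normal_unique X eta : S X -> is_support_normal Omega X eta ->
  outward_normal Omega X = eta.
Proof. by move=> SX He; apply: (support_normal_unique SX) => //; exact: outward_normalP. Qed.

(** A vector orthogonal to the normal is a combination of the tangent rows, hence the velocity of a
    straight line in the chart. *)
Lemma tangent_spaceP U phi y v : is_chart S U phi -> U y ->
  tangent_space S (phi y) v <-> dot v (outward_normal Omega (phi y)) = 0.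
Proof.
move=> hc Uy; have Sy := chart_image hc Uy; have Hn := outward_normalP Sy.
split=> [[c Hc <-]|vn]; first exact: curve_normal Hc Hn.
have := tangent_decomp (chart_normal hc Uy Hn) Hn.1 (chart_rank hc Uy) v.
rewrite vn scale0r add0r; set w := _ *m invmx _ => ->.
exists (fun t : R^o => phi (y + t *: w)); first exact: (chart_line_curve hc).
by rewrite (chart_line_derive hc).
Qed.

(** The supporting function [u - <., X>] vanishes only at the normal at [X]. *)
Lemma outward_normal_continuous X0 : S X0 -> forall e : R, 0 < e -> exists2 d : R, 0 < d &
  forall X, S X -> `|X - X0| < d -> `|outward_normal Omega X - outward_normal Omega X0| < e.
Proof.
move=> SX0 e e0; set nu0 := outward_normal Omega X0.
pose C := [set x : E | dot x x = 1 /\ e <= `|x - nu0|].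
pose f := fun x : E => support_function Omega x - dot x X0.
have cf : continuous (f : E -> R^o).
  move=> x; apply: (@continuousB _ _ _ (support_function Omega : E -> R^o) (fun x => dot x X0 : R^o)).
    exact: supp_fun_continuous.
  exact: continuous_dotl.
have cC : compact C.
  apply: bounded_closed_compact.
    exists 1; split; first exact: num_real.
    move=> M M1 x [x1 _]; apply: le_trans (ltW M1); apply: le_trans (norm_le_enorm x) _.
    by rewrite /enorm x1 sqrtr1.
  have -> : C = (fun x => dot x x : R^o) @^-1` [set 1] `&`
      ((fun x => `|x - nu0| : R^o) @^-1` [set t | e <= t]).
    by apply/seteqP; split => x /= [x1 xi]; split.
  apply: closedI.
    apply: closed_comp; last exact: closed_eq.
    by move=> x _; exact: (cvg_dot (f := id) (g := id)).
  apply: closed_comp; last exact: closed_ge.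
  move=> x _; apply: (@continuous_comp _ _ _ (fun y : E => y - nu0) (fun y => `|y| : R^o)).
    exact: continuous_addr.
  exact: norm_continuous.
have Cpos x : C x -> 0 < f x.
  move=> [x1 xe]; rewrite lt_neqAle /f subr_ge0 (dotC x) supp_fun_ge ?andbT //; last exact: boundary_body.
  rewrite eq_sym subr_eq0; apply/eqP => ux.
  suff xs : is_support_normal Omega X0 x.
    by move: xe; rewrite /nu0 (outward_normal_unique SX0 xs) subrr normr0 leNgt e0.
  split => // z Kz; rewrite dotBr subr_le0 (dotC x X0) -ux dotC; exact: supp_fun_ge.
have [[x0 Cx0]|C0] := pselect (C !=set0); last first.
  exists 1 => // X SX _; rewrite ltNge; apply/negP => H; apply: C0.
  by exists (outward_normal Omega X); split => //; exact: (outward_normalP SX).1.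
have C0 : C !=set0 by exists x0.
have [|c /set_mem Cc Hc] := EVT_min_rV C0 cC (f := f).
  by apply: continuous_subspaceT => x; exact: cf.
have m0 : 0 < n.+1%:R :> R by rewrite ltr0n.
exists (f c / n.+1%:R) => [|X SX]; first by rewrite divr_gt0 // Cpos.
have := outward_normalP SX; set nu := outward_normal Omega X => -[n1 Hn].
rewrite ltr_pdivlMr // => XX; rewrite ltNge; apply/negP => H.
have Cn : C nu by split.
have := Hc nu; rewrite inE => /(_ Cn); apply/negP; rewrite -ltNge; apply: le_lt_trans XX.
(* [nu] attains its support value at [X], so [f nu] reduces to a product with the small displacement
   [X - X0], below the minimum of [f] on [C]. *)
have -> : f nu = dot nu (X - X0).
  rewrite /f dotBr; congr (_ - _); have [z [Kz ue Hz]] := supp_fun_attained hne hbdd nu.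
  apply/eqP; rewrite eq_le ue dotC; move: (Hn _ Kz); rewrite dotBr subr_le0 => -> /=.
  by rewrite dotC [leRHS]dotC -ue; apply: Hz; exact: boundary_body.
apply: le_trans (dot_le_enorm _ _) _; rewrite /enorm n1 sqrtr1 mul1r -/(enorm _).
by rewrite mulrC; exact: enorm_le_norm.
Qed.

Lemma normal_monotone X Y : S X -> S Y ->
  0 <= dot (outward_normal Omega X - outward_normal Omega Y) (X - Y).
Proof.
move=> SX SY; have [_ HX] := outward_normalP SX; have [_ HY] := outward_normalP SY.
have := HX _ (boundary_body SY); have := HY _ (boundary_body SX).
by rewrite !dotBl !dotBr; lra.
Qed.

End Normals.

Section HasDiff.
Context {R : realType}.

Lemma near_forall_ord (V : normedModType R) q (P : 'I_q -> V -> Prop) (x : V) :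
  (forall i, exists2 d : R, 0 < d & forall z, `|z - x| < d -> P i z) ->
  exists2 d : R, 0 < d & forall z, `|z - x| < d -> forall i, P i z.
Proof.
move=> H; have /boolp.choice[D HD] : forall i, exists d : R, 0 < d /\
    forall y, `|y - x| < d -> P i y by move=> i; have [d d0 Hd] := H i; exists d.
exists (\big[Num.min/1]_i D i).
  by apply: lt_bigmin => // i _; have [] := HD i.
move=> y yx i; apply: (HD i).2.
by apply: lt_le_trans yx _; exact: bigmin_le_cond.
Qed.

Lemma mulmx_trE p q (w : 'rV[R]_q) (A : 'M[R]_(p, q)) i :
  (w *m A^T) 0 i = dot w (row i A).
Proof. by rewrite dotE mxE; apply: eq_bigr => j _; rewrite !mxE. Qed.

Lemma norm_row_mx0_le m n1 n2 (nu : 'rV[R]_m) (A B : 'M[R]_(n1, m))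
    (a b : 'I_n1 -> 'rV[R]_m) (d : 'rV[R]_n1) (e : R) :
  (forall k, row k A = a k) -> (forall k, row k B = b k) ->
  0 <= e -> (forall k, `|- dot nu (a k) + dot nu (b k) - d 0 k| <= e) ->
  `|row_mx (- (nu *m A^T)) 0 - row_mx (- (nu *m B^T)) 0 - row_mx d 0 : 'rV[R]_(n1 + n2)| <= e.
Proof.
move=> Aa Bb e0 H; rewrite opp_row_mx add_row_mx opp_row_mx add_row_mx subrr subr0 opprK.
apply: norm_rV_le => // j; rewrite mxE; case: (fintype.split j) => k; last by rewrite mxE normr0.
by rewrite mxE [(- d) 0 k]mxE mxE [(- _ : 'rV__) 0 k]mxE !mulmx_trE Aa Bb; exact: H.
Qed.

Lemma norm_mulmx_row_le m n1 n2 (w : 'rV[R]_m) (A C : 'M[R]_(m, n1)) (B D : 'M[R]_(m, n2)) (e : R) :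
  0 <= e -> (forall k, `|(w *m (A - C)) 0 k| <= e) -> (forall k, `|(w *m (B - D)) 0 k| <= e) ->
  `|w *m (row_mx A B - row_mx C D)| <= e.
Proof.
move=> e0 H1 H2; rewrite opp_row_mx add_row_mx mul_mx_row.
by apply: norm_rV_le => // j; rewrite mxE; case: (fintype.split j) => k.
Qed.

(** The unknown increment [eta - nu] solves a linear system: its products with the tangent rows at
    the new point are known because [eta] is orthogonal to them, and its product with [eta + nu] is
    0 because the lengths agree. *)
Lemma normal_difference_mul m n1 (nu eta : 'rV[R]_m) (A B : 'M[R]_(n1, m)) :
  dot nu nu = dot eta eta -> A *m eta^T = 0 -> B *m nu^T = 0 ->
  row_mx ((eta - nu) *m A^T) ((eta - nu) *m (eta + nu)^T) =
  row_mx (- (nu *m A^T)) 0 - row_mx (- (nu *m B^T)) 0.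
Proof.
have t C (w : 'rV[R]_m) : C *m w^T = 0 -> w *m C^T = 0 :> 'rV[R]_n1.
  by move=> H; rewrite -[LHS]trmxK trmx_mul trmxK H trmx0.
move=> ne /t HA /t HB; rewrite opp_row_mx add_row_mx subrr HB oppr0 subr0; congr row_mx.
  by rewrite mulmxBl HA sub0r.
rewrite [LHS]mx11_scalar -/(dot _ _) dotBl !dotDr ne (dotC nu eta).
by rewrite [X in X%:M](_ : _ = 0) ?raddf0 //; ring.
Qed.

Lemma sub_mulmx_split q r (a : 'rV[R]_r) (k h : 'rV[R]_q) (D : 'M[R]_(q, r)) :
  a - k *m D = (a - h *m D) + (h - k) *m D.
Proof. by rewrite mulmxBl addrA subrK. Qed.

(** Differentiability is known only for the right-hand side [G] of a linear system solved by the
    increment of [F]. The coefficient matrix is continuous at [x] with a right inverse there, so the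
    increment of [F] is of the order of [z - x] and the matrix may be frozen at [x]. *)
Lemma has_diff_implicit p q r (F : 'rV[R]_p -> 'rV[R]_q) (G : 'rV[R]_p -> 'rV[R]_r)
    (M : 'rV[R]_p -> 'M[R]_(q, r)) (D : 'M[R]_(p, r)) (L : 'M[R]_(r, q)) x (d0 : R) :
  0 < d0 -> (forall z, `|z - x| < d0 -> (F z - F x) *m M z = G z - G x) ->
  (forall e : R, 0 < e -> exists2 d : R, 0 < d & forall z, `|z - x| < d ->
     forall w : 'rV[R]_q, `|w *m (M z - M x)| <= e * `|w|) ->
  M x *m L = 1%:M -> has_diff G x D -> has_diff F x (D *m L).
Proof.
move=> d00 FG cM ML dG e e0.
have [C C0 HC] := mulmx_norm_le L; have [B B0 HB] := mulmx_norm_le D.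
pose A := 2 * C * (B + 1).
have A0 : 0 < A by rewrite !mulr_gt0 // addr_gt0.
pose e1 := Num.min (1 / (2 * C)) (e / (2 * C * A)).
have C2 : 0 < 2 * C by rewrite mulr_gt0.
have CA : 0 < 2 * C * A by exact: mulr_gt0.
have e10 : 0 < e1 by rewrite lt_min !divr_gt0.
pose e2 := Num.min 1 (e / (2 * C)).
have e20 : 0 < e2 by rewrite lt_min ltr01 divr_gt0.
have [d1 d10 Hd1] := cM _ e10; have [d2 d20 Hd2] := dG _ e20.
exists (Num.min d0 (Num.min d1 d2)) => [|z]; first by rewrite !lt_min d00 d10.
rewrite !lt_min => /andP[/FG zG /andP[/Hd1 zM /Hd2 zD]].
set del := F z - F x in zG *; set h := z - x in zD *; set g := G z - G x in zD zG.
have E : del = g *m L - del *m (M z - M x) *m L.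
  by rewrite -zG -mulmxBl -mulmxBr opprB addrCA subrr addr0 -mulmxA ML mulmx1.
have {}zM := zM del.
have gb : `|g| <= (B + 1) * `|h|.
  have -> : g = (g - h *m D) + h *m D by rewrite subrK.
  apply: le_trans (ler_normD _ _) _; rewrite mulrDl addrC mul1r; apply: lerD; first exact: HB.
  apply: le_trans zD _; apply: le_trans (_ : 1 * `|h| <= _); last by rewrite mul1r.
  by rewrite ler_wpM2r // ge_min lexx.
have delb : `|del| <= A * `|h|.
  have : `|del| <= C * `|g| + C * (e1 * `|del|).
    rewrite [X in `|X| <= _]E; apply: le_trans (ler_normB _ _) _; apply: lerD; first exact: HC.
    by apply: le_trans (HC _) _; rewrite ler_pM2l.
  have : C * (e1 * `|del|) <= 2^-1 * `|del|.
    rewrite mulrA ler_wpM2r // mulrC -ler_pdivlMr // ge_min; apply/orP; left.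
    by rewrite invfM mul1r.
  have : C * `|g| <= C * ((B + 1) * `|h|) by rewrite ler_pM2l.
  rewrite /A; lra.
rewrite mulmxA [X in `|X - _|]E addrAC -mulmxBl.
apply: le_trans (ler_normB _ _) _.
apply: le_trans (_ : C * (e2 * `|h|) + C * (e1 * (A * `|h|)) <= _).
  apply: lerD; first by apply: le_trans (HC _) _; rewrite ler_pM2l.
  apply: le_trans (HC _) _; rewrite ler_pM2l //; apply: le_trans zM _.
  by rewrite ler_pM2l.
have a1 : C * e2 <= e / 2.
  by rewrite mulrC -ler_pdivlMr // ge_min -mulrA -invfM lexx orbT.
have a2 : C * e1 * A <= e / 2.
  have : e1 * (2 * C * A) <= e by rewrite -ler_pdivlMr // ge_min lexx orbT.
  lra.
have := ler_wpM2r (normr_ge0 h) a1; have := ler_wpM2r (normr_ge0 h) a2.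
by rewrite !mulrA; lra.
Qed.

(** Leading term of a nonnegative product of increments; with a curve and the normal along it, it
    gives the sign of the curvatures. *)
Lemma derive_dot_ge0 m (V : normedModType R) (f g : V -> 'rV[R]_m) (x v : V) a b :
  is_derive x v f a -> is_derive x v g b ->
  (exists2 d : R, 0 < d & forall h : R, `|h| < d ->
     0 <= dot (f (x + h *: v) - f x) (g (x + h *: v) - g x)) ->
  0 <= dot a b.
Proof.
move=> /is_derive_epsP df /is_derive_epsP dg [d d0 Hd]; rewrite leNgt; apply/negP => ab.
pose c := m%:R * (`|a| + `|b| + 1).
have c0 : 0 <= c by rewrite mulr_ge0 // !addr_ge0.
have c10 : 0 < 1 + c by rewrite ltr_pwDl.
pose e := Num.min 1 (- dot a b / (1 + c)).
have e0 : 0 < e by rewrite lt_min ltr01 divr_gt0 // oppr_gt0.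
have e1 : e <= 1 by rewrite ge_min lexx.
have ec : e * (1 + c) <= - dot a b by rewrite -ler_pdivlMr // ge_min lexx orbT.
have [d1 d10 Hd1] := df _ e0; have [d2 d20 Hd2] := dg _ e0.
pose M := Num.min d (Num.min d1 d2).
have M0 : 0 < M by rewrite !lt_min d0 d10.
pose h := M / 2; have h0 : 0 < h by rewrite divr_gt0.
have : `|h| < M by rewrite ger0_norm ?(ltW h0) // ltr_pdivrMr // mulr2n mulrDr mulr1 ltrDl.
rewrite !lt_min => /andP[/Hd H0 /andP[/Hd1 H1 /Hd2 H2]].
move: H0 H1 H2; rewrite ger0_norm ?(ltW h0) //.
set F := f _ - _; set G := g _ - _ => H0 H1 H2.
pose r := F - h *: a; pose s := G - h *: b.
have FE : F = h *: a + r by rewrite /r addrC subrK.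
have GE : G = h *: b + s by rewrite /s addrC subrK.
rewrite -/r in H1; rewrite -/s in H2.
have b1 : dot a s <= m%:R * (`|a| * (e * h)).
  apply: le_trans (ler_norm _) _; apply: le_trans (dot_le_norm _ _) _.
  by rewrite ler_wpM2l // ler_wpM2l.
have b2 : dot r b <= m%:R * (e * h * `|b|).
  apply: le_trans (ler_norm _) _; apply: le_trans (dot_le_norm _ _) _.
  by rewrite ler_wpM2l // ler_wpM2r.
have b3 : dot r s <= m%:R * (e * h * (1 * h)).
  apply: le_trans (ler_norm _) _; apply: le_trans (dot_le_norm _ _) _.
  rewrite ler_wpM2l // ler_pM // (le_trans H2) // ler_wpM2r ?(ltW h0) //.
clearbody r s; move: H0; rewrite FE GE !dot_bilin; apply/negP; rewrite -ltNge.
have k1 : h * dot a s <= h * (m%:R * (`|a| * (e * h))) by rewrite ler_pM2l.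
have k2 : h * dot r b <= h * (m%:R * (e * h * `|b|)) by rewrite ler_pM2l.
have k3 : h * (h * (e * (1 + c))) <= h * (h * - dot a b) by rewrite !ler_pM2l.
have k4 : 0 < h * h * e by rewrite !mulr_gt0.
move: k3; rewrite /c; lra.
Qed.

End HasDiff.

(** * Differentiability of the Gauss map and the principal curvatures *)

Section Weingarten.
Context {R : realType} {n : nat}.
Variable Omega : set 'rV[R]_n.+1.
Hypothesis (hne : Omega !=set0) (hopen : open Omega) (hbdd : bounded_set Omega).
Hypothesis hconv : convex_set (Omega : set (convex_lmodType 'rV[R]_n.+1)).
Hypothesis hsmooth : smooth_hypersurface (boundary Omega).
Variables (U : set 'rV[R]_n) (phi : 'rV[R]_n -> 'rV[R]_n.+1).
Hypothesis hc : is_chart (boundary Omega) U phi.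

Local Notation E := 'rV[R]_n.+1.
Local Notation S := (boundary Omega).
Local Notation N := (outward_normal Omega).
Local Notation J := (jacobian phi).

Definition first_form y : 'M[R]_n := J y *m (J y)^T.

(** The sign is that of the outward normal: differentiating the orthogonality of normal and tangent
    vectors turns these entries into products of derivatives of the normal with tangent vectors,
    positive on spheres. *)
Definition second_form (y : 'rV[R]_n) : 'M[R]_n := \matrix_(k, i)
  - dot (N (phi y)) ('D_(delta_mx 0 k) ('D_(delta_mx 0 i) phi) y).

Lemma second_formE y k i : second_form y k i =
  - dot (N (phi y)) ('D_(delta_mx 0 k) ('D_(delta_mx 0 i) phi) y).
Proof. by rewrite mxE. Qed.

Lemma second_form_sym y : U y -> (second_form y)^T = second_form y.
Proof.
move=> Uy; apply/matrixP => i k; rewrite [LHS]mxE !second_formE.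
have h1 z : U z -> differentiable phi z by exact: (chart_differentiable hc).
have h2 u z : U z -> differentiable ('D_u phi) z by exact: (chart_differentiable2 hc).
have h3 u u' z : U z -> {for z, continuous ('D_u' ('D_u phi))}.
  exact: (chart_continuous2 hc).
have := @schwarz R n n.+1 phi U y (delta_mx 0 i) (delta_mx 0 k) (chart_open hc) Uy h1 h2 h3.
by move=> ->.
Qed.

Lemma normal_at y : U y -> is_support_normal Omega (phi y) (N (phi y)).
Proof. by move=> Uy; apply: outward_normalP => //; exact: (chart_image hc). Qed.

Lemma jacobian_normal_at y : U y -> J y *m (N (phi y))^T = 0.
Proof. by move=> Uy; apply: (chart_normal _ hc) => //; exact: normal_at. Qed.

Lemma normal_chart_continuous y : U y -> forall e : R, 0 < e -> exists2 d : R, 0 < d &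
  forall z, U z -> `|z - y| < d -> `|N (phi z) - N (phi y)| < e.
Proof.
move=> Uy e e0; have [d d0 Hd] := outward_normal_continuous hne hopen hbdd hconv hsmooth (chart_image hc Uy) e0.
have /differentiable_continuous/continuous_epsP/(_ d d0)[d1 d10 Hd1] := chart_differentiable hc Uy.
by exists d1 => // z Uz /Hd1; apply: Hd; exact: (chart_image hc).
Qed.

(** The normal is frozen at [y] and only the tangent vectors move, so second derivatives of the
    chart suffice. The zero block is the right-hand side of the equation for the length. *)
Lemma normal_projection_diff y : U y ->
  has_diff (fun z => row_mx (- (N (phi y) *m (J z)^T)) 0 : 'rV[R]_(n + 1)) y
    (row_mx (second_form y) 0).
Proof.
move=> Uy e e0; set nu := N (phi y).
have m0 : 0 < 1 + n.+1%:R * `|nu| by rewrite ltr_pwDl // mulr_ge0.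
have H i : exists2 d : R, 0 < d & forall z, `|z - y| < d ->
    `|- dot nu ('D_(delta_mx 0 i) phi z) + dot nu ('D_(delta_mx 0 i) phi y)
       - ((z - y) *m second_form y) 0 i| <= e * `|z - y|.
  have := differentiable_has_diff (chart_differentiable2 hc (delta_mx 0 i) Uy).
  move=> /(_ _ (divr_gt0 e0 m0))[d d0 Hd]; exists d => // z /Hd.
  set T := jacobian _ y => Hz.
  have -> : ((z - y) *m second_form y) 0 i = - dot nu ((z - y) *m T).
    rewrite /dot trmx_mul mulmxA !mxE -sumrN; apply: eq_bigr => k _.
    rewrite second_formE mulmx_trE rowE -deriveEjacobian; last exact: (chart_differentiable2 hc).
    by rewrite [(z - y)^T _ _]mxE mulrN mulrC.
  have -> : - dot nu ('D_(delta_mx 0 i) phi z) + dot nu ('D_(delta_mx 0 i) phi y)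
       - - dot nu ((z - y) *m T) = - dot nu ('D_(delta_mx 0 i) phi z - 'D_(delta_mx 0 i) phi y - (z - y) *m T).
    rewrite !dotBr; move: (dot nu _) (dot nu _) (dot nu _) => p1 p2 p3; ring.
  rewrite normrN; apply: le_trans (dot_le_norm _ _) _.
  apply: le_trans (_ : n.+1%:R * (`|nu| * (e / (1 + n.+1%:R * `|nu|) * `|z - y|)) <= _).
    by rewrite ler_wpM2l // ler_wpM2l.
  have -> : n.+1%:R * (`|nu| * (e / (1 + n.+1%:R * `|nu|) * `|z - y|)) =
     (n.+1%:R * `|nu|) / (1 + n.+1%:R * `|nu|) * (e * `|z - y|) by ring.
  apply: ler_piMl; first by rewrite mulr_ge0 // ltW.
  by rewrite ler_pdivrMr // mul1r lerDr.
have [d d0 Hd] := near_forall_ord H.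
have /open_rVP/(_ _ Uy)[d1 d10 Hd1] := chart_open hc.
exists (Num.min d d1) => [|z]; first by rewrite lt_min d0.
rewrite lt_min => /andP[/Hd Hz /Hd1 Uz].
have ez : 0 <= e * `|z - y| by rewrite mulr_ge0 // ltW.
rewrite mul_mx_row mulmx0.
exact: (norm_row_mx0_le 1 (fun k => row_jacobian hc k Uz) (fun k => row_jacobian hc k Uy) ez Hz).
Qed.

(** The support inequalities alone give continuity of the normal. Its increment solves the system of
    [normal_difference_mul], whose coefficients are continuous and whose right-hand side is
    differentiable, so [has_diff_implicit] applies. *)
Lemma normal_has_diff y : U y ->
  has_diff (N \o phi) y (second_form y *m invmx (first_form y) *m J y).
Proof.
move=> Uy; set nu := N (phi y).
have Jnu := jacobian_normal_at Uy; have nu1 := (normal_at Uy).1.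
have rJ := chart_rank hc Uy.
pose M z : 'M[R]_(n.+1, n + 1) := row_mx (J z)^T (N (phi z) + nu)^T.
(* At [y] the last column of [M] is twice the normal, whence the factor [2^-1]. *)
pose L : 'M[R]_(n + 1, n.+1) := col_mx (invmx (first_form y) *m J y) (2^-1 *: nu).
have -> : second_form y *m invmx (first_form y) *m J y = row_mx (second_form y) 0 *m L.
  by rewrite /L mul_row_col mul0mx addr0 mulmxA.
have /open_rVP/(_ _ Uy)[d d0 Hd] := chart_open hc.
apply: (has_diff_implicit (M := M) d0 _ _ _ (normal_projection_diff Uy)).
- move=> z /Hd Uz; rewrite /M mul_mx_row /=.
  have nz := normal_at Uz; apply: normal_difference_mul => //; last exact: jacobian_normal_at.
  by rewrite nu1 nz.1.
- move=> e e0; pose e1 := e / n.+1%:R.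
  have e10 : 0 < e1 by rewrite divr_gt0 // ltr0n.
  have H i : exists2 d : R, 0 < d & forall z, `|z - y| < d ->
      `|'D_(delta_mx 0 i) phi z - 'D_(delta_mx 0 i) phi y| < e1.
    by have /differentiable_continuous/continuous_epsP/(_ _ e10) := chart_differentiable2 hc (delta_mx 0 i) Uy.
  have [d1 d10 Hd1] := near_forall_ord H.
  have [d2 d20 Hd2] := normal_chart_continuous Uy e10.
  exists (Num.min d (Num.min d1 d2)) => [|z]; first by rewrite !lt_min d0 d10.
  rewrite !lt_min => /andP[/Hd Uz /andP[/Hd1 z1 /(Hd2 _ Uz) z2]] w.
  have B u : `|u| < e1 -> `|dot w u| <= e * `|w|.
    move=> /ltW ue; apply: le_trans (dot_le_norm _ _) _.
    apply: le_trans (_ : n.+1%:R * (`|w| * e1) <= _).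
      by rewrite ler_wpM2l // ler_wpM2l.
    by rewrite mulrCA [n.+1%:R * _]mulrC divfK ?pnatr_eq0 // mulrC.
  have ew : 0 <= e * `|w| by rewrite mulr_ge0 // ltW.
  apply: norm_mulmx_row_le => // k; rewrite -linearB /= mulmx_trE; apply: B.
    have T (A B : 'M[R]_(n, n.+1)) a b : row k A = a -> row k B = b ->
      `|a - b| < e1 -> `|row k (A - B)| < e1 by move=> <- <-; rewrite linearB.
    exact: (T _ _ _ _ (row_jacobian hc k Uz) (row_jacobian hc k Uy) (z1 k)).
  by rewrite ord1 row_id opprD addrACA subrr addr0.
- rewrite /M /L mul_row_col !mulmxA -scalemxAr -[X in _ + 2^-1 *: X]/((nu + nu)^T *m nu).
  rewrite linearD /= mulmxDl -(frame_id Jnu nu1 rJ) addrC; congr (_ + _).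
  have half (v : 'M[R]_n.+1) : 2^-1 *: (v + v) = v.
    rewrite scalerDr -scalerDl (_ : 2^-1 + 2^-1 = 1 :> R) ?scale1r //; lra.
  exact: half.
Qed.

Definition shape_at y : 'M[R]_n.+1 := shape (J y) (second_form y).

(** The curves in [is_dnormal] are arbitrary curves in the boundary, so the expansion is needed in
    terms of the point itself; [has_diff_inv] converts increments of the point into increments of
    the chart parameter. *)
Lemma normal_ambient_diff y : U y -> forall e : R, 0 < e -> exists2 d : R, 0 < d &
  forall X, S X -> `|X - phi y| < d ->
    `|N X - N (phi y) - (X - phi y) *m shape_at y| <= e * `|X - phi y|.
Proof.
move=> Uy e e0; pose L := (J y)^T *m invmx (first_form y).
have JL : J y *m L = 1%:M by rewrite mulmxA mulmxV // gram_unit // (chart_rank hc).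
pose D := second_form y *m invmx (first_form y) *m J y.
have -> : shape_at y = L *m D by rewrite /shape_at /shape /L /D !mulmxA.
have [C C0 HC] := mulmx_norm_le L; have [B B0 HB] := mulmx_norm_le D.
have C1 : 0 < 2 * (C + 1) by rewrite mulr_gt0 // addr_gt0.
have B2 : 0 < 2 * B by rewrite mulr_gt0.
pose e1 := Num.min 1 (e / (2 * B)).
have e10 : 0 < e1 by rewrite lt_min ltr01 divr_gt0.
have [d1 d10 Hd1] := has_diff_inv (chart_has_diff hc Uy) JL e10.
have [d2 d20 Hd2] := normal_has_diff Uy (divr_gt0 e0 C1).
pose V := U `&` [set z | `|z - y| < Num.min d1 d2].
have oV : open V by apply: openI; [exact: (chart_open hc)|exact: open_ball_rV].
have Vy : V y by split => //; rewrite /= subrr normr0 lt_min d10.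
have VU : V `<=` U by move=> z [].
have [d d0 Hd] := chart_nbhs hc oV VU Vy; exists d => // X SX /(Hd _ SX)[z [Uz]].
rewrite /= lt_min => /andP[/Hd1 z1 /Hd2 z2] <-; move: z1 z2; rewrite /=.
set h := z - y; set k := phi z - phi y; set dN := N _ - N _; rewrite -/D => z1 z2.
have -> : dN - k *m (L *m D) = (dN - h *m D) + (h - k *m L) *m D.
  by rewrite [k *m _]mulmxA; exact: sub_mulmx_split.
have hk : `|h| <= (C + 1) * `|k|.
  have -> : h = (h - k *m L) + k *m L by rewrite subrK.
  apply: le_trans (ler_normD _ _) _; rewrite mulrDl addrC mul1r; apply: lerD; first exact: HC.
  apply: le_trans z1 _; apply: le_trans (_ : 1 * `|k| <= _); last by rewrite mul1r.
  by rewrite ler_wpM2r // ge_min lexx.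
apply: le_trans (ler_normD _ _) _.
have t1 : `|dN - h *m D| <= e / 2 * `|k|.
  apply: le_trans z2 _; apply: le_trans (_ : e / (2 * (C + 1)) * ((C + 1) * `|k|) <= _).
    by rewrite ler_wpM2l // ltW // divr_gt0.
  suff -> : e / (2 * (C + 1)) * ((C + 1) * `|k|) = e / 2 * `|k| by [].
  by field; rewrite lt0r_neq0 // addr_gt0.
have t2 : `|(h - k *m L) *m D| <= e / 2 * `|k|.
  apply: le_trans (HB _) _; apply: le_trans (_ : B * (e1 * `|k|) <= _).
    by rewrite ler_wpM2l // ltW.
  rewrite mulrA ler_wpM2r //.
  have : e1 * (2 * B) <= e by rewrite -ler_pdivlMr // ge_min lexx orbT.
  lra.
by have := lerD t1 t2; lra.
Qed.

Lemma curve_normal_derive y c : U y -> is_curve_at S (phi y) c ->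
  is_derive (0 : R^o) (1 : R^o) (N \o c) ('D_1 c (0 : R^o) *m shape_at y).
Proof.
move=> Uy [cp [r r0 [sc cS]]].
have dc : differentiable c (0 : R^o) by have [H _] := sc 1; apply: H; exact: ballxx.
have /is_derive_epsP H := derivableP (diff_derivable (v := (1 : R^o)) dc).
move: H; set w := 'D_1 c 0 => H.
apply/is_derive_epsP => e e0; have [B B0 HB] := mulmx_norm_le (shape_at y).
have B2 : 0 < 2 * B by rewrite mulr_gt0.
have W2 : 0 < 2 * (`|w| + 1) by rewrite mulr_gt0 // ltr_wpDl.
pose e1 := Num.min 1 (e / (2 * B)).
have e10 : 0 < e1 by rewrite lt_min ltr01 divr_gt0.
have [d1 d10 Hd1] := H _ e10.
have [d2 d20 Hd2] := normal_ambient_diff Uy (divr_gt0 e0 W2).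
exists (Num.min r (Num.min d1 (d2 / (2 * (`|w| + 1))))).
  by rewrite !lt_min r0 d10 divr_gt0.
move=> h; rewrite !lt_min => /andP[hr /andP[/Hd1 h1 h2]]; move: h1; rewrite /= cp.
have -> : 0 + h *: (1 : R^o) = h by rewrite add0r -[h *: (1 : R^o)]/(h * 1) mulr1.
have Sh : S (c h) by apply: cS; exists h => //; rewrite -ball_normE /= sub0r normrN.
set k := c h - phi y; set dN := N _ - N _ => h1.
have kh : `|k| <= (`|w| + 1) * `|h|.
  have -> : k = (k - h *: w) + h *: w by rewrite subrK.
  apply: le_trans (ler_normD _ _) _; rewrite mulrDl addrC mul1r normrZ mulrC lerD //.
  apply: le_trans h1 _; apply: le_trans (_ : 1 * `|h| <= _); last by rewrite mul1r.
  by rewrite ler_wpM2r // ge_min lexx.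
have kd : `|k| < d2.
  apply: le_lt_trans kh _; rewrite ltr_pdivlMr // in h2.
  by have := normr_ge0 h; have := normr_ge0 w; nra.
have := Hd2 _ Sh kd; rewrite -/k -/dN => k2.
have -> : dN - h *: (w *m shape_at y) = (dN - k *m shape_at y) + (k - h *: w) *m shape_at y.
  by rewrite [h *: (_ *m _)]scalemxAl; exact: sub_mulmx_split.
apply: le_trans (ler_normD _ _) _.
have t1 : `|dN - k *m shape_at y| <= e / 2 * `|h|.
  apply: le_trans k2 _; apply: le_trans (_ : e / (2 * (`|w| + 1)) * ((`|w| + 1) * `|h|) <= _).
    by rewrite ler_wpM2l // ltW // divr_gt0.
  suff -> : e / (2 * (`|w| + 1)) * ((`|w| + 1) * `|h|) = e / 2 * `|h| by [].
  by field; rewrite lt0r_neq0 // ltr_wpDl.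
have t2 : `|(k - h *: w) *m shape_at y| <= e / 2 * `|h|.
  apply: le_trans (HB _) _; apply: le_trans (_ : B * (e1 * `|h|) <= _).
    by rewrite ler_wpM2l // ltW.
  rewrite mulrA ler_wpM2r //.
  have : e1 * (2 * B) <= e by rewrite -ler_pdivlMr // ge_min lexx orbT.
  lra.
by have := lerD t1 t2; lra.
Qed.

(** The definition quantifies over all curves with velocity [v]; one such curve exists, which
    determines the value. *)
Lemma is_dnormalP y v w : U y -> tangent_space S (phi y) v ->
  is_dnormal Omega (phi y) v w <-> w = v *m shape_at y.
Proof.
move=> Uy [c0 Hc0 c0v]; split=> [H|-> c Hc <-]; last exact: curve_normal_derive.
by have [_ <-] := H _ Hc0 c0v; have [_ ->] := curve_normal_derive Uy Hc0; rewrite c0v.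
Qed.

Lemma shape_at_sym y : U y -> (shape_at y)^T = shape_at y.
Proof. by move=> Uy; apply: shape_sym; exact: second_form_sym. Qed.

Lemma normal_shape_at y : U y -> N (phi y) *m shape_at y = 0.
Proof. by move=> Uy; apply: normal_shape; exact: jacobian_normal_at. Qed.

Lemma principal_curvatures_exist y : U y -> exists k, are_principal_curvatures Omega (phi y) k.
Proof.
move=> Uy.
have [e [k [en eo es]]] := eigenbasis (shape_at_sym Uy) (normal_at Uy).1 (normal_shape_at Uy).
have T i : tangent_space S (phi y) (e i) by apply/(tangent_spaceP _ _ _ _ _ _ hc).
by exists k, e; split => // i; apply/(is_dnormalP _ Uy (T i)); rewrite es.
Qed.

(** The right-hand side does not involve [k], so the product is the same for every family that the
    definition admits, whichever one [get] returns. *)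
Lemma principal_curvatures_prod y k t : U y -> are_principal_curvatures Omega (phi y) k ->
  \prod_i (1 + t * k 0 i) * \det (first_form y) = \det (first_form y + t *: second_form y).
Proof.
move=> Uy [e [eT eo es]].
rewrite -(det_eigenbasis (normal_at Uy).1 (normal_shape_at Uy) (e := e)) //.
- by apply: det_shape (normal_at Uy).1 _ _ _; [exact: jacobian_normal_at|exact: (chart_rank hc)].
- by move=> i; apply/(tangent_spaceP _ _ _ _ _ _ hc).
- by move=> i; apply/esym/(is_dnormalP _ Uy (eT i)).
Qed.

(** The Gauss map of a convex body is monotone: the product of its increment with that of a curve is
    nonnegative, and the curvature is the leading coefficient. *)
Lemma principal_curvatures_ge0 y k i : U y -> are_principal_curvatures Omega (phi y) k ->
  0 <= k 0 i.
Proof.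
move=> Uy [e [eT eo es]].
have /(is_dnormalP _ Uy (eT i)) E := es i.
have [c Hc cv] := eT i.
have := curve_normal_derive Uy Hc; rewrite cv -E => dN.
have [cp [r r0 [sc cS]]] := Hc.
have dc : differentiable c (0 : R^o) by have [H _] := sc 1; apply: H; exact: ballxx.
have := derivableP (diff_derivable (v := (1 : R^o)) dc); rewrite cv => dC.
have := derive_dot_ge0 dN dC; rewrite dotZl eo eqxx mulr1; apply.
exists r => // h hr; rewrite /= cp; apply: normal_monotone => //.
  apply: cS; exists (0 + h *: (1 : R^o)) => //.
  by rewrite add0r -[h *: (1 : R^o)]/(h * 1) mulr1 -ball_normE /= sub0r normrN.
exact: (chart_image hc).
Qed.

End Weingarten.

Section Determinant.
Context {R : realType} {V : normedModType R}.

Lemma cvg_sum_seq (I : Type) (r : seq I) (f : I -> V -> R) (x : V) (l : I -> R) :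
  (forall i, (f i y : R^o) @[y --> x] --> (l i : R^o)) ->
  (\sum_(i <- r) f i y : R^o) @[y --> x] --> (\sum_(i <- r) l i : R^o).
Proof.
move=> H; elim: r => [|i r IH].
  by under eq_fun do rewrite big_nil; rewrite big_nil; exact: cvg_cst.
by under eq_fun do rewrite big_cons; rewrite big_cons; apply: cvgD.
Qed.

Definition cont_at (f : V -> R) (x : V) := {for x, continuous (f : V -> R^o)}.

Lemma cont_atM (f g : V -> R) x : cont_at f x -> cont_at g x -> cont_at (fun y => f y * g y) x.
Proof. exact: continuousM. Qed.

Lemma cont_atD (f g : V -> R) x : cont_at f x -> cont_at g x -> cont_at (fun y => f y + g y) x.
Proof. exact: continuousD. Qed.

Lemma cont_atN (f : V -> R) x : cont_at f x -> cont_at (fun y => - f y) x.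
Proof. exact: continuousN. Qed.

Lemma cont_atV (f : V -> R) x : f x != 0 -> cont_at f x -> cont_at (fun y => (f y)^-1) x.
Proof. exact: continuousV. Qed.

Lemma cont_at_cst (a : R) x : cont_at (fun=> a) x.
Proof. exact: cst_continuous. Qed.

Lemma cont_at_sum k (f : 'I_k -> V -> R) x : (forall i, cont_at (f i) x) ->
  cont_at (fun y => \sum_i f i y) x.
Proof. exact: cvg_sum_ord. Qed.

Lemma cont_at_dot m (f g : V -> 'rV[R]_m) x : {for x, continuous f} -> {for x, continuous g} ->
  cont_at (fun y => dot (f y) (g y)) x.
Proof. exact: cvg_dot. Qed.

Lemma cont_at_coord m (f : V -> 'rV[R]_m) x i : {for x, continuous f} ->
  cont_at (fun y => f y 0 i) x.
Proof. by move=> cf; exact: (iffLR (cvg_rVP f x (f x)) cf i). Qed.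

Lemma cont_at_det n (A : V -> 'M[R]_n) (x : V) :
  (forall i j, cont_at (fun y => A y i j) x) -> cont_at (fun y => \det (A y)) x.
Proof.
move=> H; apply: cvg_sum_seq => s.
by apply: cont_atM; [exact: cont_at_cst|apply: cvg_prod_ord => i; exact: H].
Qed.

End Determinant.

(** * Continuity and measurability of the mean curvatures *)

Section ChartCurvature.
Context {R : realType} {n : nat}.
Variable Omega : set 'rV[R]_n.+1.
Hypothesis (hne : Omega !=set0) (hopen : open Omega) (hbdd : bounded_set Omega).
Hypothesis hconv : convex_set (Omega : set (convex_lmodType 'rV[R]_n.+1)).
Hypothesis hsmooth : smooth_hypersurface (boundary Omega).

Local Notation E := 'rV[R]_n.+1.
Local Notation K := (closure Omega).
Local Notation S := (boundary Omega).
Local Notation N := (outward_normal Omega).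

Section Chart.
Variables (U : set 'rV[R]_n) (phi : 'rV[R]_n -> 'rV[R]_n.+1).
Hypothesis hc : is_chart (boundary Omega) U phi.
Local Notation J := (jacobian phi).
Local Notation Q := (second_form Omega phi).
Local Notation g := (first_form phi).

Lemma near_chart_eq (f h : 'rV[R]_n -> R) y : U y -> (forall z, U z -> f z = h z) ->
  cont_at h y -> cont_at f y.
Proof.
move=> Uy fh /continuous_epsP H; apply/continuous_epsP => e e0; have [d d0 Hd] := H e e0.
have /open_rVP/(_ _ Uy)[d1 d10 Hd1] := chart_open hc.
exists (Num.min d d1) => [|z]; first by rewrite lt_min d0.
by rewrite lt_min => /andP[/Hd zd /Hd1 /fh ->]; rewrite (fh _ Uy).
Qed.

Lemma continuous_jacobian y i j : U y -> cont_at (fun z => J z i j) y.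
Proof.
move=> Uy; have D z : U z -> J z i j = 'D_(delta_mx 0 i) phi z 0 j.
  by move=> Uz; rewrite -(row_jacobian hc i Uz) [RHS]mxE.
apply: (near_chart_eq Uy D); apply: cont_at_coord.
by apply: differentiable_continuous; exact: (chart_differentiable2 hc).
Qed.

Lemma continuous_first_form y i j : U y -> cont_at (fun z => g z i j) y.
Proof.
move=> Uy; have D z : U z -> g z i j = \sum_k J z i k * J z j k.
  by rewrite mxE => _; apply: eq_bigr => k _; rewrite [(_^T) k j]mxE.
apply: (near_chart_eq Uy D); apply: cont_at_sum => k.
by apply: cont_atM; exact: continuous_jacobian.
Qed.

Lemma continuous_normal_chart y : U y -> {for y, continuous (fun z => N (phi z))}.
Proof.
move=> Uy; apply/continuous_epsP => e e0.
have [d d0 Hd] := normal_chart_continuous hne hopen hbdd hconv hsmooth hc Uy e0.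
have /open_rVP/(_ _ Uy)[d1 d10 Hd1] := chart_open hc.
exists (Num.min d d1) => [|z]; first by rewrite lt_min d0.
by rewrite lt_min => /andP[zd /Hd1 Uz]; exact: Hd.
Qed.

Lemma continuous_second_form y i j : U y -> cont_at (fun z => Q z i j) y.
Proof.
move=> Uy; have D z (_ : U z) := second_formE Omega phi z i j.
apply: (near_chart_eq Uy D); apply: cont_atN; apply: cont_at_dot.
  exact: continuous_normal_chart.
exact: (chart_continuous2 hc).
Qed.

Lemma first_form_gt0 y : U y -> 0 < \det (g y).
Proof.
move=> Uy; apply: (@gram_det_gt0 _ _ _ (N (phi y))).
- exact: (jacobian_normal_at hne hopen hbdd hconv hsmooth hc).
- exact: (normal_at hne hopen hbdd hconv hsmooth hc Uy).1.
- exact: (chart_rank hc).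
Qed.

Lemma principal_curvaturesP y : U y ->
  are_principal_curvatures Omega (phi y) (principal_curvatures Omega (phi y)).
Proof.
by move=> Uy; apply: getPex; exact: (principal_curvatures_exist hne hopen hbdd hconv hsmooth hc).
Qed.

Lemma curvature_prodE y t : U y ->
  \prod_i (1 + t * principal_curvatures Omega (phi y) 0 i) =
  \det (g y + t *: Q y) / \det (g y).
Proof.
move=> Uy; have := principal_curvatures_prod hne hopen hbdd hconv hsmooth hc t Uy (principal_curvaturesP Uy).
by move=> <-; rewrite mulfK // lt0r_neq0 // first_form_gt0.
Qed.

Lemma continuous_det_forms y t : U y -> cont_at (fun z => \det (g z + t *: Q z)) y.
Proof.
move=> Uy; apply: cont_at_det => i j.
have D z : U z -> (g z + t *: Q z) i j = g z i j + t * Q z i j.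
  by move=> _; rewrite [LHS]mxE [X in _ + X]mxE.
apply: (near_chart_eq Uy D); apply: cont_atD; first exact: continuous_first_form.
by apply: cont_atM; [exact: cont_at_cst|exact: continuous_second_form].
Qed.

Lemma continuous_curvature_prod y t : U y ->
  cont_at (fun z => \prod_i (1 + t * principal_curvatures Omega (phi z) 0 i)) y.
Proof.
move=> Uy; apply: (near_chart_eq Uy (fun z Uz => curvature_prodE t Uz)).
apply: cont_atM; first exact: continuous_det_forms.
apply: cont_atV; first by rewrite lt0r_neq0 // first_form_gt0.
by apply: cont_at_det => i j; exact: continuous_first_form.
Qed.

(** The curvatures are chosen point by point in no particular order, so single ones may jump. Their
    symmetric functions are interpolated from the products at [t = 0, ..., n], each a quotient of
    determinants that depends continuously on the point. *)
Lemma continuous_mean_curvature_chart y j : (j <= n)%N -> U y ->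
  cont_at (fun z => mean_curvature Omega j (phi z)) y.
Proof.
move=> jn Uy; have [c Hc] := polynomial_interpolation R n.+1.
pose a z := fun i : 'I_n.+1 => elem_sym i (principal_curvatures Omega (phi z)).
have jn' : (j < n.+1)%N by [].
have D z : U z -> mean_curvature Omega j (phi z) = ('C(n, j)%:R)^-1 * \sum_(l < n.+1)
    c (Ordinal jn') l * \prod_i (1 + (val l)%:R * principal_curvatures Omega (phi z) 0 i).
  move=> _; congr (_ * _); rewrite -[LHS]/(a z (Ordinal jn')) Hc; apply: eq_bigr => l _.
  by rewrite prod_elem_sym.
apply: (near_chart_eq Uy D); apply: cont_atM; first exact: cont_at_cst.
apply: cont_at_sum => l; apply: cont_atM; first exact: cont_at_cst.
exact: continuous_curvature_prod.
Qed.

End Chart.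

Lemma mean_curvature_ge0 j X : S X -> 0 <= mean_curvature Omega j X.
Proof.
move=> /hsmooth[U [phi [hc [y Uy <-]]]]; rewrite mulr_ge0 ?invr_ge0 //.
apply: sumr_ge0 => A _; apply: prodr_ge0 => i _.
exact: (principal_curvatures_ge0 hne hopen hbdd hconv hsmooth hc i Uy (principal_curvaturesP hc Uy)).
Qed.

Lemma curvature_polynomial X s : \prod_i (1 + s * principal_curvatures Omega X 0 i) =
  \sum_(j < n.+1) 'C(n, j)%:R * mean_curvature Omega j X * s ^+ j.
Proof.
rewrite prod_elem_sym; apply: eq_bigr => j _; congr (_ * _).
by rewrite mulrA mulfV ?mul1r // pnatr_eq0 -lt0n bin_gt0 -ltnS.
Qed.

Lemma closed_boundary : closed S.
Proof. by rewrite boundaryE //; apply: closedI; [exact: closed_closure|exact: open_closedC]. Qed.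

Lemma measurable_boundary : measurable (S : set (borel_rV R n.+1)).
Proof. exact: borel_closed closed_boundary. Qed.

(** Relatively open subsets of [A] are traces of ambient open sets. This form suits functions that
    are continuous along the boundary only. *)
Lemma relative_continuous_measurable (A : set E) (f : E -> R) :
  measurable (A : set (borel_rV R n.+1)) ->
  (forall X0, A X0 -> forall e : R, 0 < e -> exists2 d : R, 0 < d &
    forall X, A X -> `|X - X0| < d -> `|f X - f X0| < e) ->
  measurable_fun (A : set (borel_rV R n.+1)) f.
Proof.
move=> mA H; apply: (@measurability _ _ (borel_rV R n.+1) _ A f _ (@RGenOpens.measurableE R)) => _ [_ [a [b ->]] <-].
pose W := [set Y | exists X0 (d : R), [/\ A X0, 0 < d, `|Y - X0| < d &
   forall X, A X -> `|X - X0| < d -> f X \in `]a, b[]].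
have oW : open W.
  apply/open_rVP => Y [X0 [d [AX0 d0 YX Hd]]].
  exists (d - `|Y - X0|); first by rewrite subr_gt0.
  move=> Z ZY; exists X0, d; split => //.
  have -> : Z - X0 = (Z - Y) + (Y - X0) by rewrite addrA subrK.
  by apply: le_lt_trans (ler_normD _ _) _; rewrite -ltrBrDr.
have -> : A `&` f @^-1` `]a, b[ = A `&` W.
  apply/seteqP; split => X [AX]; last first.
    by move=> [X0 [d [AX0 d0 XX Hd]]]; split => //; exact: Hd.
  rewrite /= in_itv /= => /andP[aX Xb]; split => //.
  have e0 : 0 < Num.min (f X - a) (b - f X) by rewrite lt_min !subr_gt0 aX.
  have [d d0 Hd] := H X AX _ e0.
  exists X, d; split => //; first by rewrite subrr normr0.
  move=> Z AZ /(Hd _ AZ); rewrite lt_min !ltr_norml in_itv /=.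
  by move=> /andP[/andP[h1 h2] /andP[h3 h4]]; apply/andP; split; lra.
by apply: measurableI => //; exact: borel_open.
Qed.

Lemma mean_curvature_continuous j X0 : (j <= n)%N -> S X0 -> forall e : R, 0 < e ->
  exists2 d : R, 0 < d &
  forall X, S X -> `|X - X0| < d -> `|mean_curvature Omega j X - mean_curvature Omega j X0| < e.
Proof.
move=> jn /hsmooth[U [phi [hc [y Uy <-]]]] e e0.
have /continuous_epsP/(_ e e0)[d d0 Hd] := continuous_mean_curvature_chart hc jn Uy.
pose V := U `&` [set z | `|z - y| < d].
have oV : open V by apply: openI; [exact: (chart_open hc)|exact: open_ball_rV].
have Vy : V y by split => //; rewrite /= subrr normr0.
have VU : V `<=` U by move=> z [].
have [d' d'0 Hd'] := chart_nbhs hc oV VU Vy; exists d' => // X SX /(Hd' _ SX)[z [Uz zy] <-].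
exact: Hd.
Qed.

Lemma measurable_mean_curvature j : (j <= n)%N ->
  measurable_fun (S : set (borel_rV R n.+1)) (mean_curvature Omega j).
Proof.
move=> jn; apply: relative_continuous_measurable; first exact: measurable_boundary.
by move=> X0 SX0; exact: mean_curvature_continuous.
Qed.

End ChartCurvature.

(** * The tube formula *)

Section Integration.
Local Open Scope ereal_scope.
Context {R : realType}.

Lemma integral_image_measure d1 d2 (X : measurableType d1) (Y : measurableType d2)
    (mu : {measure set X -> \bar R}) (nu : {measure set Y -> \bar R}) (phi : X -> Y)
    (f : Y -> \bar R) :
  measurable_fun setT phi -> (forall B, measurable B -> nu B = mu (phi @^-1` B)) ->
  measurable_fun setT f -> (forall y, 0 <= f y) ->
  \int[nu]_y f y = \int[mu]_x f (phi x).
Proof.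
move=> mphi nuE mf f0.
have mphi_mixin := isMeasurableFun.Build _ _ _ _ _ mphi.
pose phi' : {mfun X >-> Y} := HB.pack phi mphi_mixin.
rewrite (eq_measure_integral (pushforward mu phi')) => [|B mB _]; last exact: nuE.
by rewrite (ge0_integral_pushforward mphi).
Qed.

Lemma lebesgue_rVS_integral m (A : set (borel_rV R m.+1)) (f : borel_rV R m.+1 -> \bar R) :
  measurable A -> measurable_fun A f -> (forall x, A x -> 0 <= f x) ->
  \int[@lebesgue_rV R m.+1]_(x in A) f x =
  \int[@lebesgue_rV R m]_y \int[lebesgue_measure]_s (f \_ A) (consr (s, y)).
Proof.
move=> mA mf f0.
have mfA : measurable_fun setT (f \_ A) by apply/(measurable_restrictT _ mA).
have fA0 x : 0 <= (f \_ A) x by apply: erestrict_ge0.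
rewrite integral_mkcond.
have mc := @measurable_consr R m.
rewrite (integral_image_measure (mu := lebesgue_measure \x @lebesgue_rV R m) mc) //.
  by rewrite fubini_tonelli2 //; exact: measurableT_comp.
by move=> B mB; exact: lebesgue_rVS.
Qed.

Lemma integral_polynomial n (a : 'I_n -> R) (t : R) : (0 < t)%R ->
  \int[lebesgue_measure]_(s in `]0%R, t]) (\sum_j a j * s ^+ j)%R%:E =
  (\sum_j a j * t ^+ j.+1 / j.+1%:R)%R%:E.
Proof.
move=> t0; pose p : {poly R} := (\sum_j (a j / j.+1%:R) *: 'X^(j.+1))%R.
have pE s : (p.[s] = \sum_j a j * s ^+ j.+1 / j.+1%:R)%R.
  rewrite horner_sum; apply: eq_bigr => j _; rewrite hornerZ hornerXn; ring.
have dE s : (p^`().[s] = \sum_j a j * s ^+ j)%R.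
  rewrite linear_sum horner_sum; apply: eq_bigr => j _.
  rewrite /= derivZ derivXn hornerZ hornerMn hornerXn -mulr_natr; field.
  by rewrite addrC natr1 pnatr_eq0.
under eq_integral do rewrite -dE.
have cp := @continuous_horner R p^`().
rewrite integral_itv_obnd_cbnd; last first.
  apply/measurable_EFinP; apply: measurable_funTS; exact: continuous_measurable_fun.
rewrite (@continuous_FTC2 R (horner p^`()) (horner p)) //.
- rewrite -EFinB !pE [X in (_ - X)%R]big1 ?subr0 // => j _.
  by rewrite expr0n mulr0 mul0r.
- exact: continuous_subspaceT.
- split=> [x _||]; first exact: derivable_horner.
  + exact: cvg_at_right_filter (@continuous_horner R p _).
  + exact: cvg_at_left_filter (@continuous_horner R p _).
- by move=> x _; rewrite derivE.
Qed.

End Integration.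

Section OpenSets.
Context {R : realType}.

Lemma cont_at_open_eq m (W : set 'rV[R]_m) (f h : 'rV[R]_m -> R) y : open W -> W y ->
  (forall z, W z -> f z = h z) -> cont_at h y -> cont_at f y.
Proof.
move=> /open_rVP oW Wy fh /continuous_epsP H; apply/continuous_epsP => e e0.
have [d d0 Hd] := H e e0; have [d1 d10 Hd1] := oW _ Wy.
exists (Num.min d d1) => [|z]; first by rewrite lt_min d0.
by rewrite lt_min => /andP[/Hd zd /Hd1 /fh ->]; rewrite (fh _ Wy).
Qed.

Lemma rVB_coord m (u v : 'rV[R]_m) i : (u - v) 0 i = u 0 i - v 0 i.
Proof. by rewrite !mxE. Qed.

Definition vtail m (v : 'rV[R]_m.+1) : 'rV[R]_m := \row_i v 0 (lift ord0 i).

Lemma mulmx_head_tail m q (v : 'rV[R]_m.+1) (a : 'rV[R]_q) (B : 'M[R]_(m, q)) :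
  v *m (col_mx a B : 'M[R]_(1 + m, q)) = v 0 0 *: a + vtail v *m B.
Proof.
apply/rowP => j; rewrite [LHS]mxE big_ord_recl [RHS]mxE; congr (_ + _).
  rewrite [RHS]mxE; congr (_ * _).
  have -> : (ord0 : 'I_(1 + m)) = lshift m ord0 by apply/val_inj.
  by rewrite (col_mxEu a B).
rewrite mxE; apply: eq_bigr => i _; rewrite [in RHS]mxE.
have -> : (lift ord0 i : 'I_(1 + m)) = rshift 1 i by apply/val_inj.
by rewrite (col_mxEd a B).
Qed.

Lemma vtailB_norm m (v w : 'rV[R]_m.+1) : `|vtail v - vtail w| <= `|v - w|.
Proof.
apply: norm_rV_le => // i; rewrite !mxE.
by have := coord_le_norm (v - w) (lift ord0 i); rewrite !mxE.
Qed.

Lemma continuous_vtail m : continuous (@vtail m).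
Proof.
move=> v; apply/continuous_epsP => e e0; exists e => // w.
exact/le_lt_trans/vtailB_norm.
Qed.

Lemma cont_at_vtail m (f : 'rV[R]_m -> R) v : cont_at f (vtail v) ->
  cont_at (fun w => f (vtail w)) v.
Proof. by move=> cf; apply: (@continuous_comp _ _ _ (@vtail m) f) => //; exact: continuous_vtail. Qed.

Lemma cont_at_head m v : cont_at (fun w : 'rV[R]_m.+1 => w 0 0) v.
Proof. exact: coord_continuous. Qed.

End OpenSets.

Section Tube.
Context {R : realType} {n : nat}.
Variable Omega : set 'rV[R]_n.+1.
Hypothesis (hne : Omega !=set0) (hopen : open Omega) (hbdd : bounded_set Omega).
Hypothesis hconv : convex_set (Omega : set (convex_lmodType 'rV[R]_n.+1)).
Hypothesis hsmooth : smooth_hypersurface (boundary Omega).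

Local Notation E := 'rV[R]_n.+1.
Local Notation K := (closure Omega).
Local Notation S := (boundary Omega).
Local Notation N := (outward_normal Omega).

(** Integral of the product of the factors [1 + s k_i] over [0 <= s <= t]: the volume of the outer
    tube of thickness [t] per unit of boundary area. *)
Definition steiner (t : R) (X : E) : R :=
  \sum_(j < n.+1) 'C(n, j)%:R * mean_curvature Omega j X * t ^+ j.+1 / j.+1%:R.

Section Chart.
Variables (U : set 'rV[R]_n) (phi : 'rV[R]_n -> 'rV[R]_n.+1).
Hypothesis hc : is_chart (boundary Omega) U phi.
Local Notation J := (jacobian phi).
Local Notation Q := (second_form Omega phi).
Local Notation g := (first_form phi).

Definition chart_inv (X : E) : 'rV[R]_n := get [set y | U y /\ phi y = X].

Lemma chart_invK y : U y -> chart_inv (phi y) = y.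
Proof.
move=> Uy; have [] : [set z | U z /\ phi z = phi y] (chart_inv (phi y)) 
  by exact: (getPex (ex_intro _ y (conj Uy erefl))).
by move=> Uz /(chart_inj hc Uz Uy).
Qed.

Definition tube_dom : set 'rV[R]_n.+1 := [set v : 'rV[R]_n.+1 | 0 < v 0 0 /\ U (vtail v)].
Definition tube_map (v : 'rV[R]_n.+1) : E := phi (vtail v) + v 0 0 *: N (phi (vtail v)).
Definition tube_img : set E := [set Y | ~ K Y /\ (phi @` U) (proj Omega Y)].
Definition tube_inv (Y : E) : 'rV[R]_n.+1 :=
  consr (bdist Omega Y, chart_inv (proj Omega Y) : borel_rV R n).
Definition normal_diff y : 'M[R]_(n, n.+1) := Q y *m invmx (g y) *m J y.
(** The first row is the derivative in the distance, the remaining rows are the derivatives in the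
    chart parameters, with [normal_diff] from [normal_has_diff]. *)
Definition tube_diff (v : 'rV[R]_n.+1) : 'M[R]_n.+1 :=
  col_mx (N (phi (vtail v))) (J (vtail v) + v 0 0 *: normal_diff (vtail v)) : 'M[R]_(1 + n, n.+1).

Lemma vtail_consr p : vtail (@consr R n p) = p.2.
Proof. by apply/rowP => i; rewrite mxE consrS. Qed.

Lemma consr_vtail (v : 'rV[R]_n.+1) : consr (v 0 0, vtail v : borel_rV R n) = v.
Proof. exact: (@unconsrK R n v). Qed.

Lemma tube_dom_open : open tube_dom.
Proof.
apply/open_rVP => v [v0 Uv]; have /open_rVP/(_ _ Uv)[d d0 Hd] := chart_open hc.
exists (Num.min (v 0 0) d); first by rewrite lt_min v0.
move=> w; rewrite lt_min => /andP[w0 wd]; split; last first.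
  by apply: Hd; apply: le_lt_trans (vtailB_norm _ _) wd.
have := le_lt_trans (coord_le_norm (w - v) 0) w0; rewrite !mxE ltr_norml => /andP[h1 _]; lra.
Qed.

Lemma tube_img_open : open tube_img.
Proof.
case: (hc) => _ _ /(_ _ (chart_open hc) (@subset_refl _ _))[W oW WE] _.
have -> : tube_img = ~` K `&` proj Omega @^-1` W.
  apply/seteqP; split => Y [KY HY]; split => //.
    by move: HY; rewrite WE => -[].
  by rewrite WE; split => //; exact: proj_boundary.
apply: openI; first by apply: closed_openC; exact: closed_closure.
by apply: open_comp => // Y _; exact: proj_continuous.
Qed.

Lemma tube_proj v : tube_dom v -> [/\ ~ K (tube_map v), proj Omega (tube_map v) = phi (vtail v) &
  bdist Omega (tube_map v) = v 0 0].
Proof.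
move=> [v0 Uv]; have Sv := chart_image hc Uv.
have Hn := outward_normalP hne hopen hbdd hconv hsmooth Sv.
have [p1 p2] := proj_add_normal hne hbdd hconv (boundary_body hopen Sv) Hn (ltW v0).
by split => //; exact: add_normal_notin Hn v0.
Qed.

Lemma tube_mapP v : tube_dom v -> tube_img (tube_map v).
Proof. by move=> dv; have [k1 k2 k3] := tube_proj dv; split => //; rewrite k2; exists (vtail v) => //; case: dv. Qed.

Lemma tube_mapK v : tube_dom v -> tube_inv (tube_map v) = v.
Proof.
move=> dv; have [k1 k2 k3] := tube_proj dv; rewrite /tube_inv k2 k3 chart_invK ?consr_vtail //.
by case: dv.
Qed.

Lemma tube_inv_proj Y : tube_img Y -> (tube_inv Y) 0 0 = bdist Omega Y /\
  vtail (tube_inv Y) = chart_inv (proj Omega Y) /\ U (chart_inv (proj Omega Y)) /\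
  phi (chart_inv (proj Omega Y)) = proj Omega Y.
Proof.
move=> [KY [y Uy yE]]; rewrite /tube_inv vtail_consr consr0 /= -yE chart_invK //.
Qed.

Lemma tube_invP Y : tube_img Y -> tube_dom (tube_inv Y).
Proof.
move=> IY; have [e1 [e2 [e3 _]]] := tube_inv_proj IY; split; last by rewrite e2.
by rewrite e1; apply: bdist_gt0 => //; case: IY.
Qed.

Lemma normal_proj Y : ~ K Y -> N (proj Omega Y) = (bdist Omega Y)^-1 *: (Y - proj Omega Y).
Proof.
move=> KY; apply: (outward_normal_unique hne hopen hbdd hconv hsmooth).
  exact: proj_boundary.
exact: proj_support_normal.
Qed.

Lemma tube_invK Y : tube_img Y -> tube_map (tube_inv Y) = Y.
Proof.
move=> IY; have [e1 [e2 [e3 e4]]] := tube_inv_proj IY; have [KY _] := IY.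
rewrite /tube_map e1 e2 e4 normal_proj // scalerA mulfV ?scale1r ?lt0r_neq0 ?bdist_gt0 //.
by rewrite addrC subrK.
Qed.

Lemma tube_inv_continuous Y : tube_img Y -> {for Y, continuous tube_inv}.
Proof.
move=> IY; apply/continuous_epsP => e e0.
have [e1 [e2 [e3 e4]]] := tube_inv_proj IY.
have [d d0 Hd] := chart_inv_continuous hc e3 e0.
have /continuous_epsP/(_ d d0)[d1 d10 Hd1] := @proj_continuous _ _ _ hne hbdd hconv Y.
have /continuous_epsP/(_ e e0)[d2 d20 Hd2] := bdist_continuous hne hbdd hconv (Y := Y).
have /open_rVP/(_ _ IY)[d3 d30 Hd3] := tube_img_open.
exists (Num.min d1 (Num.min d2 d3)) => [|Z]; first by rewrite !lt_min d10 d20.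
rewrite !lt_min => /andP[z1 /andP[z2 z3]].
have IZ := Hd3 _ z3; have [f1 [f2 [f3 f4]]] := tube_inv_proj IZ.
apply: norm_rV_lt => // i; rewrite rVB_coord; case: (unliftP ord0 i) => [j ->|->].
  have := coord_le_norm (vtail (tube_inv Z) - vtail (tube_inv Y)) j.
  rewrite rVB_coord [vtail _ 0 j]mxE [vtail (tube_inv Y) 0 j]mxE.
  move=> /le_lt_trans; apply; rewrite f2 e2; apply: Hd => //; rewrite f4 e4; exact: Hd1.
by rewrite f1 e1; exact: Hd2.
Qed.

Lemma tube_has_diff v : tube_dom v -> has_diff tube_map v (tube_diff v).
Proof.
move=> [v0 Uv] e e0; set y := vtail v; set s := v 0 0.
have e3 : 0 < e / 3 by rewrite divr_gt0.
have es : 0 < e / 3 / (1 + s) by rewrite divr_gt0 // ltr_pwDl // ltW.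
have [d1 d10 Hd1] := chart_has_diff hc Uv e3.
have [d2 d20 Hd2] := normal_has_diff hne hopen hbdd hconv hsmooth hc Uv es.
have [d3 d30 Hd3] := normal_chart_continuous hne hopen hbdd hconv hsmooth hc Uv e3.
have /open_rVP/(_ _ Uv)[d4 d40 Hd4] := chart_open hc.
exists (Num.min (Num.min d1 d2) (Num.min d3 d4)) => [|w]; first by rewrite !lt_min d10 d20 d30.
rewrite !lt_min => /andP[/andP[w1 w2] /andP[w3 w4]].
have B := vtailB_norm w v.
have {}w1 := Hd1 _ (le_lt_trans B w1); have {}w2 := Hd2 _ (le_lt_trans B w2).
have {}w3 := Hd3 _ (Hd4 _ (le_lt_trans B w4)) (le_lt_trans B w3).
rewrite /tube_map /tube_diff -/y -/s in w1 w2 w3 *.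
rewrite -/(normal_diff y) /= in w2.
have -> : (w - v) *m (col_mx (N (phi y)) (J y + s *: normal_diff y) : 'M[R]_(1 + n, n.+1)) =
   (w 0 0 - s) *: N (phi y) + (vtail w - y) *m (J y + s *: normal_diff y).
  have -> : w 0 0 - s = (w - v) 0 0 by rewrite !mxE.
  have -> : vtail w - y = vtail (w - v) by apply/rowP => i; rewrite !mxE.
  exact: mulmx_head_tail.
set h := vtail w - y in B w1 w2 *; set a := w 0 0.
(* The error splits into the chart error, [s] times the error for the normal, and a product of two
   increments; each receives a third of [e]. *)
have -> : phi (vtail w) + a *: N (phi (vtail w)) - (phi y + s *: N (phi y)) -
   ((a - s) *: N (phi y) + h *m (J y + s *: normal_diff y)) =
   (phi (vtail w) - phi y - h *m J y) + s *: (N (phi (vtail w)) - N (phi y) - h *m normal_diff y)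
   + (a - s) *: (N (phi (vtail w)) - N (phi y)).
  have gen (p p' n1 n2 u1 u2 : E) : p' + a *: n2 - (p + s *: n1) - ((a - s) *: n1 + (u1 + s *: u2)) =
      p' - p - u1 + s *: (n2 - n1 - u2) + (a - s) *: (n2 - n1).
    by apply/rowP => i; rewrite !mxE; ring.
  rewrite mulmxDr -scalemxAr; exact: gen.
apply: le_trans (ler_normD _ _) _; rewrite normrZ.
have -> : e * `|w - v| = e / 3 * `|w - v| + e / 3 * `|w - v| + e / 3 * `|w - v| by field.
apply: lerD; last first.
  rewrite mulrC; apply: ler_pM => //; first exact: ltW.
  by have := coord_le_norm (w - v) 0; rewrite !mxE.
apply: le_trans (ler_normD _ _) _; apply: lerD.
  by apply: le_trans w1 _; rewrite ler_wpM2l // ltW.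
rewrite normrZ ger0_norm ?(ltW v0) //.
apply: le_trans (_ : s * (e / 3 / (1 + s) * `|h|) <= _); first by rewrite ler_wpM2l // ltW.
have -> : s * (e / 3 / (1 + s) * `|h|) = s / (1 + s) * (e / 3 * `|h|) by ring.
apply: le_trans (_ : 1 * (e / 3 * `|h|) <= _); last by rewrite mul1r ler_wpM2l // ltW.
have s1 : 0 < 1 + s by rewrite ltr_pwDl // ltW.
apply: ler_wpM2r; first by rewrite mulr_ge0 // ltW.
by rewrite ler_pdivrMr // mul1r lerDr.
Qed.

(** The matrix is the frame times the identity plus a multiple of [shape]: the frame gives the area
    density, the other factor the product over the curvatures, nonnegative since they are. *)
Lemma norm_det_tube_diff v : tube_dom v -> `|\det (tube_diff v)| =
  area_density phi (vtail v) *
  \prod_i (1 + v 0 0 * principal_curvatures Omega (phi (vtail v)) 0 i).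
Proof.
move=> [v0 Uv]; set y := vtail v in Uv *.
have Jn := jacobian_normal_at hne hopen hbdd hconv hsmooth hc Uv.
have n1 := (normal_at hne hopen hbdd hconv hsmooth hc Uv).1.
have rk := chart_rank hc Uv.
have -> : tube_diff v = frame (J y) (N (phi y)) *m (1%:M + v 0 0 *: shape (J y) (Q y)).
  by rewrite (frame_mul_shape Jn rk).
have pE := principal_curvatures_prod hne hopen hbdd hconv hsmooth hc (v 0 0) Uv
  (principal_curvaturesP hne hopen hbdd hconv hsmooth hc Uv).
have := det_shape Jn n1 rk (Q y) (v 0 0); rewrite -/(g y) -pE.
have g0 := first_form_gt0 hne hopen hbdd hconv hsmooth hc Uv.
move=> /(mulIf (lt0r_neq0 g0)) dE.
rewrite det_mulmx normrM dE (norm_det_frame Jn n1); congr (_ * _).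
rewrite ger0_norm // prodr_ge0 // => i _; rewrite addr_ge0 // mulr_ge0 ?(ltW v0) //.
exact: (principal_curvatures_ge0 hne hopen hbdd hconv hsmooth hc i Uv (principal_curvaturesP hne hopen hbdd hconv hsmooth hc Uv)).
Qed.

Lemma area_density_gt0 y : U y -> 0 < area_density phi y.
Proof.
by move=> Uy; rewrite /area_density sqrtr_gt0; exact: (first_form_gt0 hne hopen hbdd hconv hsmooth hc).
Qed.

Lemma continuous_area_density y : U y -> cont_at (area_density phi) y.
Proof.
move=> Uy; apply: (@continuous_comp _ _ _ (fun z => \det (g z) : R^o) (@Num.sqrt R)).
  by apply: cont_at_det => i j; exact: (continuous_first_form hc).
exact: sqrt_continuous.
Qed.

Lemma tube_diff_unit v : tube_dom v -> tube_diff v \in unitmx.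
Proof.
move=> dv; rewrite unitmxE unitfE -normr_gt0 norm_det_tube_diff //; case: dv => v0 Uv.
rewrite mulr_gt0 ?area_density_gt0 // prodr_gt0 // => i _.
rewrite ltr_pwDl // mulr_ge0 ?(ltW v0) //.
exact: (principal_curvatures_ge0 hne hopen hbdd hconv hsmooth hc i Uv (principal_curvaturesP hne hopen hbdd hconv hsmooth hc Uv)).
Qed.

Lemma continuous_det_tube_diff v : tube_dom v -> cont_at (fun w => \det (tube_diff w)) v.
Proof.
move=> dv; have Uv := dv.2.
pose f w := \det (frame (J (vtail w)) (N (phi (vtail w)))) *
  (\det (g (vtail w) + w 0 0 *: Q (vtail w)) / \det (g (vtail w))).
apply: (cont_at_open_eq (h := f) tube_dom_open dv) => [w [w0 Uw]|].
  have Jn := jacobian_normal_at hne hopen hbdd hconv hsmooth hc Uw.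
  have n1 := (normal_at hne hopen hbdd hconv hsmooth hc Uw).1.
  have rk := chart_rank hc Uw.
  have -> : tube_diff w = frame (J (vtail w)) (N (phi (vtail w))) *m
      (1%:M + w 0 0 *: shape (J (vtail w)) (Q (vtail w))).
    by rewrite (frame_mul_shape Jn rk).
  rewrite det_mulmx /f; congr (_ * _).
  rewrite -(det_shape Jn n1 rk (Q (vtail w)) (w 0 0)) mulfK // lt0r_neq0 //.
  exact: (first_form_gt0 hne hopen hbdd hconv hsmooth hc Uw).
apply: cont_atM.
  apply: (@cont_at_vtail _ _ (fun y => \det (frame (J y) (N (phi y))))).
  apply: cont_at_det => i j; rewrite /frame.
  case: (splitP (i : 'I_(1 + n))) => k ik.
    have -> : i = lshift n k by apply/val_inj.
    apply: (cont_at_open_eq (h := fun z => N (phi z) 0 j) (chart_open hc) Uv) => [z _|].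
      by rewrite (col_mxEu (N (phi z)) (J z)) ord1.
    apply: cont_at_coord; exact: (continuous_normal_chart hne hopen hbdd hconv hsmooth hc).
  have -> : i = rshift 1 k by apply/val_inj.
  apply: (cont_at_open_eq (h := fun z => J z k j) (chart_open hc) Uv) => [z _|].
    by rewrite (col_mxEd (N (phi z)) (J z)).
  exact: (continuous_jacobian hc).
apply: cont_atM.
  apply: cont_at_det => i j.
  apply: (cont_at_open_eq (h := fun w => g (vtail w) i j + w 0 0 * Q (vtail w) i j) tube_dom_open dv).
    by move=> w _; rewrite [LHS]mxE [X in _ + X]mxE.
  apply: cont_atD; first by apply: (cont_at_vtail (f := fun y => g y i j)); exact: (continuous_first_form hc).
  apply: cont_atM; first exact: cont_at_head.
  apply: (cont_at_vtail (f := fun y => Q y i j)).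
  exact: (continuous_second_form hne hopen hbdd hconv hsmooth hc).
apply: cont_atV; first by rewrite lt0r_neq0 //; exact: (first_form_gt0 hne hopen hbdd hconv hsmooth hc Uv).
apply: (cont_at_vtail (f := fun y => \det (g y))).
by apply: cont_at_det => i j; exact: (continuous_first_form hc).
Qed.

(** Change of variables by the tube map, then integration in the distance first: over a fixed
    boundary point the Jacobian is a polynomial in the distance, and its antiderivative is
    [steiner]. *)
Lemma tube_chart_measure (B : set (borel_rV R n)) (t : R) : measurable B -> B `<=` U -> 0 < t ->
  lebesgue_rV [set Y | ~ K Y /\ bdist Omega Y <= t /\ (phi @` B) (proj Omega Y)] =
  (\int[@lebesgue_rV R n]_(y in B) (area_density phi y * steiner t (phi y))%:E)%E.
Proof.
move=> mB BU t0.
pose A : set (borel_rV R n.+1) := @unconsr R n @^-1` (`]0, t] `*` B).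
have mA : measurable A.
  rewrite -[A]setTI; apply: (@measurable_unconsr R n) => //.
  by apply: measurableX => //; exact: measurable_itv.
have AE v : A v <-> 0 < v 0 0 <= t /\ B (vtail v).
  by rewrite /A /unconsr /= in_itv.
have AU : A `<=` tube_dom by move=> v /AE[/andP[v0 _] /BU].
have -> : [set Y | ~ K Y /\ bdist Omega Y <= t /\ (phi @` B) (proj Omega Y)] =
    tube_img `&` tube_inv @^-1` A.
  apply/seteqP; split => Y.
    move=> [KY [Yt [z Bz zE]]].
    have IY : tube_img Y by split => //; exists z => //; exact: BU.
    have [e1 [e2 [e3 e4]]] := tube_inv_proj IY.
    split => //; apply/AE; rewrite e1 e2 bdist_gt0 //; split => //.
    by rewrite -zE chart_invK //; exact: BU.
  move=> [IY /AE]; have [e1 [e2 [e3 e4]]] := tube_inv_proj IY; rewrite e1 e2.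
  move=> [/andP[_ Yt] BY]; have [KY _] := IY; split => //; split => //.
  by exists (chart_inv (proj Omega Y)).
rewrite (change_of_variables tube_dom_open tube_img_open tube_mapP tube_invP tube_mapK tube_invK
  tube_inv_continuous tube_has_diff tube_diff_unit continuous_det_tube_diff mA AU).
have mdet : measurable_fun A (fun x : borel_rV R n.+1 => `|\det (tube_diff x)|%:E).
  apply/measurable_EFinP; apply: (@measurableT_comp _ _ _ _ _ _ (@Num.norm _ R)) => //.
  apply: (measurable_funS _ AU); first exact: borel_open tube_dom_open.
  apply: measurable_fun_open_real; first exact: tube_dom_open.
  exact: continuous_det_tube_diff.
rewrite lebesgue_rVS_integral // [RHS]integral_mkcond; apply: eq_integral => y _.
rewrite [RHS]/patch; case: ifPn => [/set_mem By|/negP nBy]; last first.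
  apply: integral0_eq => s _; rewrite /patch; case: ifPn => // /set_mem /AE.
  by rewrite vtail_consr => -[_ By]; case: nBy; rewrite inE.
have Uy := BU _ By.
transitivity (\int[lebesgue_measure]_(s in `]0%R, t]) (\sum_(j < n.+1)
    (area_density phi y * 'C(n, j)%:R * mean_curvature Omega j (phi y)) * s ^+ j)%R%:E)%E.
  rewrite [RHS]integral_mkcond; apply: eq_integral => s _; rewrite /patch.
  have AsE : (consr (s, y) \in A) = (s \in `]0%R, t]%classic).
    apply/idP/idP; rewrite !inE.
      by move=> /AE; rewrite consr0 vtail_consr /= in_itv => -[].
    by move=> st; apply/AE; rewrite consr0 vtail_consr.
  rewrite AsE; case: ifPn => // /set_mem st; congr EFin.
  rewrite norm_det_tube_diff; last by apply/AU/AE; rewrite consr0 vtail_consr.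
  rewrite vtail_consr consr0 /= curvature_polynomial mulr_sumr.
  by apply: eq_bigr => j _; rewrite !mulrA.
rewrite integral_polynomial //; congr EFin; rewrite /steiner mulr_sumr.
by apply: eq_bigr => j _; rewrite !mulrA.
Qed.

End Chart.
End Tube.

Section Density.
Import HBNNSimple.
Local Open Scope ereal_scope.
Context d (T : measurableType d) {R : realType}.
Variables (mu nu : {measure set T -> \bar R}) (g : T -> R).
Hypotheses (mg : measurable_fun setT g) (g0 : forall x, (0 <= g x)%R).
Hypothesis nuE : forall A, measurable A -> nu A = \int[mu]_(x in A) (g x)%:E.

Let mge : measurable_fun setT (fun x => (g x)%:E). Proof. exact/measurable_EFinP. Qed.

(** On indicators this is the hypothesis on [nu]; simple functions follow by linearity, and monotone
    convergence does the rest. *)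
Lemma integral_density (f : T -> \bar R) : measurable_fun setT f -> (forall x, 0 <= f x) ->
  \int[nu]_x f x = \int[mu]_x (f x * (g x)%:E).
Proof.
move=> mf f0; pose h := nnsfun_approx measurableT mf.
have mh n : measurable_fun setT (h n) by exact: measurable_funP.
have ndh x a b : (a <= b)%N -> (h a x <= h b x)%R by move=> ab; exact/lefP/nd_nnsfun_approx.
have -> : \int[nu]_x f x = lim (\int[nu]_x (EFin \o h n) x @[n --> \oo]).
  have fE x : f x = lim ((EFin \o h n) x @[n --> \oo]).
    by apply/esym/cvg_lim => //; apply: cvg_nnsfun_approx.
  under eq_integral => x _ do rewrite fE.
  apply: monotone_convergence => //.
  - by move=> n; apply/measurable_EFinP.
  - by move=> n x _ /=; rewrite lee_fin.
  - by move=> x _ a b ab; rewrite lee_fin; exact: ndh.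
have -> : \int[mu]_x (f x * (g x)%:E) = lim (\int[mu]_x ((EFin \o h n) x * (g x)%:E) @[n --> \oo]).
  have fg x : f x * (g x)%:E = lim ((EFin \o h n) x * (g x)%:E @[n --> \oo]).
    by apply/esym/cvg_lim => //; apply: cvgeZr => //; exact: cvg_nnsfun_approx.
  under eq_integral => x _ do rewrite fg.
  apply: monotone_convergence => //.
  - by move=> n; apply/emeasurable_funM => //; exact/measurable_EFinP.
  - by move=> n x _ /=; rewrite mule_ge0 // lee_fin.
  - by move=> x _ a b ab /=; rewrite lee_wpmul2r ?lee_fin //; exact: ndh.
congr (lim (_ @ \oo)); apply/funext => n.
transitivity (\int[nu]_x (\sum_(y \in range (h n)) (y * \1_(h n @^-1` [set y]) x)%:E)).
  by apply: eq_integral => t _; rewrite /= fimfunE -fsumEFin.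
have mind r : measurable_fun setT (fun x => (r * \1_(h n @^-1` [set r]) x)%:E).
  by apply: (measurable_comp measurableT) => //; exact: measurable_funM.
rewrite ge0_integral_fsum //; last by move=> y r _; exact: nnfun_muleindic_ge0.
transitivity (\int[mu]_x (\sum_(y \in range (h n)) (y * \1_(h n @^-1` [set y]) x)%:E * (g x)%:E));
  last first.
  under [LHS]eq_integral => x _.
    rewrite -ge0_mule_fsuml => [|y]; last exact: nnfun_muleindic_ge0.
    rewrite fsumEFin // -(fimfunE _ x); over.
  by [].
rewrite ge0_integral_fsum //; last 2 first.
  - by move=> y; apply: emeasurable_funM.
  - move=> y r _; apply: mule_ge0; [exact: nnfun_muleindic_ge0|by rewrite lee_fin].
apply: eq_fsbigr => r rhn.
under [LHS]eq_integral do rewrite EFinM.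
rewrite integralZl_indic_nnsfun //.
under [RHS]eq_integral do rewrite EFinM -muleA.
have r0 : (0 <= r)%R by move: rhn; rewrite inE => -[t _ <-].
have mA : measurable (h n @^-1` [set r]) by rewrite -[X in measurable X]setTI; exact: mh.
rewrite ge0_integralZl //; last 2 first.
- by apply: emeasurable_funM => //; apply/measurable_EFinP.
- by move=> t _; rewrite mule_ge0 ?lee_fin.
congr (_ * _); rewrite integral_indic // setIT nuE //.
rewrite [LHS]integral_mkcond; apply: eq_integral => x _.
by rewrite epatch_indic muleC.
Qed.

End Density.

(** * From charts to the area measure of the whole boundary *)

Section Transfer.
Context {R : realType} {n : nat}.
Variable Omega : set 'rV[R]_n.+1.
Hypothesis (hne : Omega !=set0) (hopen : open Omega) (hbdd : bounded_set Omega).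
Hypothesis hconv : convex_set (Omega : set (convex_lmodType 'rV[R]_n.+1)).
Hypothesis hsmooth : smooth_hypersurface (boundary Omega).
Variable mu : {measure set (borel_rV R n.+1) -> \bar R}.
Hypothesis hmu : is_area_measure (boundary Omega) mu.

Local Notation E := 'rV[R]_n.+1.
Local Notation K := (closure Omega).
Local Notation S := (boundary Omega).

Section Chart.
Variables (U : set 'rV[R]_n) (phi : 'rV[R]_n -> 'rV[R]_n.+1).
Hypothesis hc : is_chart (boundary Omega) U phi.

Let mU : measurable (U : set (borel_rV R n)). Proof. exact: borel_open (chart_open hc). Qed.

Let mS : measurable (S : set (borel_rV R n.+1)). Proof. exact: measurable_boundary. Qed.

(** The inverse chart, extended by 0 off the image of the chart, is Borel because it is continuous
    along that image; the image of [B] becomes a preimage under it. *)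
Lemma measurable_chart_image (B : set (borel_rV R n)) : measurable B -> B `<=` U ->
  measurable (phi @` B : set (borel_rV R n.+1)).
Proof.
move=> mB BU; pose D : set (borel_rV R n.+1) := phi @` U.
have mD : measurable D.
  case: (hc) => _ _ /(_ _ (chart_open hc) (@subset_refl _ _))[W oW WE] _.
  by rewrite /D WE; apply: measurableI => //; exact: borel_open.
pose psi (X : borel_rV R n.+1) : borel_rV R n := \row_i ((fun X => chart_inv U phi X 0 i) \_ D) X.
have psiE X : D X -> psi X = chart_inv U phi X.
  by move=> DX; apply/rowP => i; rewrite mxE /patch mem_set.
have mpsi : measurable_fun setT psi.
  apply: measurable_rV => i; under eq_fun do rewrite mxE.
  apply/(measurable_restrictT _ mD); apply: (relative_continuous_measurable mD).
  move=> _ [y Uy <-] e e0; have [d d0 Hd] := chart_inv_continuous hc Uy e0.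
  exists d => // _ [z Uz <-] /(Hd _ Uz); rewrite !(chart_invK hc) //.
  by apply: le_lt_trans; rewrite -rVB_coord; exact: coord_le_norm.
have -> : phi @` B = D `&` psi @^-1` B.
  apply/seteqP; split=> [_ [y By <-]|_ [[y Uy <-]]].
    have Uy := BU _ By; have Dy : D (phi y) by exists y.
    by split => //; rewrite /= psiE // (chart_invK hc).
  have Dy : D (phi y) by exists y.
  by rewrite /= psiE // (chart_invK hc) // => By; exists y.
by apply: measurableI => //; rewrite -[X in measurable X]setTI; exact: mpsi.
Qed.

Lemma measurable_chart : measurable_fun (U : set (borel_rV R n)) (phi : borel_rV R n -> borel_rV R n.+1).
Proof.
apply: measurable_fun_open_rV; first exact: (chart_open hc).
by move=> y Uy; apply: differentiable_continuous; exact: (chart_differentiable hc).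
Qed.

Lemma measurable_area_density :
  measurable_fun (U : set (borel_rV R n)) (area_density phi : borel_rV R n -> R).
Proof.
apply: measurable_fun_open_real; first exact: (chart_open hc).
by move=> y Uy; exact: (continuous_area_density hc Uy).
Qed.

(** Chart and density are extended by 0 outside [U], which turns the right-hand side into an
    integral against a push-forward; on subsets of the image of [B] this push-forward agrees with
    [mu] by the definition of area measure. *)
Lemma area_transfer (B : set (borel_rV R n)) (f : E -> R) : measurable B -> B `<=` U ->
  measurable_fun (S : set (borel_rV R n.+1)) f -> (forall X, S X -> 0 <= f X) ->
  (\int[mu]_(X in phi @` B) (f X)%:E =
   \int[@lebesgue_rV R n]_(y in B) (area_density phi y * f (phi y))%:E)%E.
Proof.
move=> mB BU mf f0; pose a : borel_rV R n -> R := area_density phi \_ U.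
have ma : measurable_fun setT a by apply/(measurable_restrictT _ mU); exact: measurable_area_density.
have a0 y : 0 <= a y by rewrite /a /patch; case: ifPn => // _; exact: sqrtr_ge0.
have mae : measurable_fun setT (fun y => (a y)%:E) by exact/measurable_EFinP.
have ae0 y : setT y -> (0 <= (a y)%:E)%E by rewrite lee_fin.
have [nu0 nu0E] := density_measure (@lebesgue_rV R n) measurableT mae ae0.
pose phi' : borel_rV R n -> borel_rV R n.+1 := fun y => if y \in U then phi y else 0.
have mphi' : measurable_fun setT phi'.
  apply: measurable_rV => i.
  have -> : (fun t => phi' t 0 i) = (fun t => phi t 0 i) \_ U.
    by apply/funext => t; rewrite /phi' /patch; case: ifPn => // _; rewrite mxE.
  apply/(measurable_restrictT _ mU).
  have mc := @measurable_coord R n.+1 i.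
  exact: (measurable_comp measurableT (subsetT _) mc measurable_chart).
have [nu nuE] := push_measure nu0 measurableT mphi'.
have mP := measurable_chart_image mB BU.
have PS : phi @` B `<=` S by move=> _ [y By <-]; apply: (chart_image hc); exact: BU.
rewrite (eq_measure_integral nu) => [|A mA AP]; last first.
  have AU y : U y -> A (phi y) -> B y.
    by move=> Uy /AP[z Bz] /(chart_inj hc (BU _ Bz) Uy) <-.
  pose C : set (borel_rV R n) := U `&` phi @^-1` A.
  have mC : measurable C by exact: measurable_chart.
  have -> : A = phi @` C.
    apply/seteqP; split => [X AX|_ [y [Uy Ay] <-]] //.
    by have [z Bz zX] := AP _ AX; exists z => //; split; [exact: BU|rewrite /= zX].
  rewrite (hmu.2 _ _ hc) //; last by move=> y [].
  rewrite nuE nu0E !setTI [RHS]integral_mkcond [LHS]integral_mkcond.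
  apply: eq_integral => y _; rewrite /patch.
  case: ifPn => [/set_mem [Uy Ay]|/negP nC].
    by rewrite mem_set /a /patch ?mem_set // /phi' /= mem_set // ; exists y.
  case: ifPn => // /set_mem; rewrite /= /phi' /a /patch.
  case: ifPn => [/set_mem Uy [z [Uz Az] /(chart_inj hc Uz Uy) zy]|//].
  by case: nC; rewrite inE; split => //; rewrite -zy.
have mfP : measurable_fun (phi @` B : set (borel_rV R n.+1)) (fun X => (f X)%:E).
  by apply/measurable_EFinP; exact: measurable_funS mf.
rewrite integral_mkcond.
pose F : borel_rV R n.+1 -> \bar R := fun X => (f X)%:E.
pose P : set (borel_rV R n.+1) := phi @` B.
have mfT : measurable_fun setT (F \_ P) by apply/(measurable_restrictT _ mP).
have fT0 X : (0 <= (F \_ P) X)%E.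
  by apply: erestrict_ge0 => Y /PS; rewrite lee_fin; exact: f0.
rewrite (integral_image_measure (mu := nu0) mphi') //; last first.
  by move=> A mA; rewrite nuE setTI.
rewrite (@integral_density _ _ R (@lebesgue_rV R n) nu0 a) //; last 2 first.
- by move=> A mA; rewrite nu0E setTI.
- by apply: measurableT_comp.
rewrite [RHS]integral_mkcond; apply: eq_integral => y _.
rewrite [RHS]/patch; case: ifPn => [/set_mem By|/negP nBy].
  have Uy := BU _ By; rewrite /phi' mem_set // /patch mem_set; last by exists y.
  by rewrite /a /patch mem_set // -EFinM mulrC.
rewrite -[RHS]/(0%E : \bar R); have [Uy|nUy] := pselect (U y); last first.
  have -> : a y = 0 by rewrite /a /patch memNset.
  by rewrite mule0.
rewrite [X in (X * _)%E]/patch memNset ?mul0e // /phi' mem_set //.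
by move=> [z Bz /(chart_inj hc (BU _ Bz) Uy) zy]; case: nBy; rewrite inE -zy.
Qed.

End Chart.

Lemma steiner_ge0 t X : 0 <= t -> S X -> 0 <= steiner Omega t X.
Proof.
move=> t0 SX; apply: sumr_ge0 => j _.
apply: mulr_ge0; last by rewrite invr_ge0.
apply: mulr_ge0; last exact: exprn_ge0.
by apply: mulr_ge0 => //; exact: mean_curvature_ge0.
Qed.

Lemma measurable_steiner t : measurable_fun (S : set (borel_rV R n.+1)) (steiner Omega t).
Proof.
apply: measurable_sum => j; apply: measurable_funM => //; apply: measurable_funM => //.
apply: measurable_funM => //.
by apply: (measurable_mean_curvature hne hopen hbdd hconv hsmooth); rewrite -ltnS.
Qed.

Definition tube (t : R) : set (borel_rV R n.+1) := [set Y | ~ K Y /\ bdist Omega Y <= t].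

Lemma measurable_tube t : measurable (tube t).
Proof.
have -> : tube t = ~` K `&` (bdist Omega @^-1` [set s | s <= t]).
  by apply/seteqP; split.
apply: measurableI; first by apply: measurableC; apply: borel_closed; exact: closed_closure.
apply: borel_closed; apply: (closed_comp (f := bdist Omega : E -> R^o)); last exact: closed_le.
by move=> Y _; exact: bdist_continuous.
Qed.

Lemma measurable_proj : measurable_fun setT (proj Omega : borel_rV R n.+1 -> borel_rV R n.+1).
Proof.
apply: (@measurable_fun_open_rV R n.+1 n.+1 setT); first exact: openT.
by move=> Y _; exact: proj_continuous.
Qed.

(** Both sides are measures in [A] and are compared on small dyadic cells, which act as a partition
    of unity: a cell off the boundary gives 0 on both sides, and a cell that meets the boundary
    inside one chart is settled by [tube_chart_measure]. *)
Lemma tube_measure (A : set (borel_rV R n.+1)) t : measurable A -> 0 < t ->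
  (lebesgue_rV (tube t `&` proj Omega @^-1` A) =
   \int[mu]_(X in S `&` A) (steiner Omega t X)%:E)%E.
Proof.
move=> mA t0; have mT := measurable_tube t.
have [a aE] := push_measure (@lebesgue_rV R n.+1) mT (measurable_funTS measurable_proj).
have mst : measurable_fun (S : set (borel_rV R n.+1)) (fun X => (steiner Omega t X)%:E).
  by apply/measurable_EFinP; exact: measurable_steiner.
have st0 X : S X -> (0 <= (steiner Omega t X)%:E)%E.
  by move=> SX; rewrite lee_fin steiner_ge0 // ltW.
have [b bE] := density_measure mu (measurable_boundary hopen) mst st0.
suff : mrestr a mA setT = mrestr b mA setT by rewrite /mrestr !setTI aE bE.
apply: measure_eq_cells => X _.
have [SX|SX] := pselect (S X); last first.
  have [k Hk] := cell_in_open (closed_openC (closed_boundary hopen)) SX.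
  exists k; split => //; have {}Hk := Hk k (leqnn _).
  set C := cell k (code k X) in Hk *.
  have e1 : tube t `&` proj Omega @^-1` (C `&` A) = set0.
    apply/seteqP; split => // Y [[KY _] [/Hk SY _]]; apply: SY.
    exact: (proj_boundary hne hopen hbdd hconv).
  have e2 : S `&` (C `&` A) = set0 by apply/seteqP; split => // Y [SY [/Hk]].
  by rewrite /= /mrestr aE bE e1 e2 measure0 integral_set0.
have [U [phi [hc [x Ux xX]]]] := hsmooth SX.
case: (hc) => _ _ /(_ _ (chart_open hc) (@subset_refl _ _))[W oW WE] _.
have WX : W X.
  have : (phi @` U) X by exists x.
  by rewrite WE => -[].
have [k Hk] := cell_in_open oW WX; exists k; split => //; have {}Hk := Hk k (leqnn _).
set C := cell k (code k X) in Hk *.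
have mCA : measurable (C `&` A : set (borel_rV R n.+1)).
  by apply: measurableI => //; exact: measurable_cell.
pose B : set (borel_rV R n) := U `&` phi @^-1` (C `&` A).
have mB : measurable B.
  by apply: (measurable_chart hc) => //; exact: borel_open (chart_open hc).
have BU : B `<=` U by move=> y [].
have SCE Y : S Y -> (C `&` A) Y -> (phi @` B) Y.
  move=> SY CAY; have : (phi @` U) Y by rewrite WE; split => //; apply: Hk; case: CAY.
  by move=> [y Uy yY]; exists y => //; split => //; rewrite /= yY.
rewrite /= /mrestr aE bE.
have -> : tube t `&` proj Omega @^-1` (C `&` A) =
    [set Y | ~ K Y /\ bdist Omega Y <= t /\ (phi @` B) (proj Omega Y)].
  apply/seteqP; split => Y.
    move=> [[KY Yt] Cp]; split => //; split => //; apply: SCE => //.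
    exact: (proj_boundary hne hopen hbdd hconv).
  by move=> [KY [Yt [y [Uy Cy] yE]]]; split => //; rewrite /= -yE.
apply: etrans (tube_chart_measure hne hopen hbdd hconv hsmooth hc mB BU t0) _.
rewrite -(area_transfer hc mB BU (measurable_steiner t)); last first.
  by move=> Y SY; rewrite steiner_ge0 // ltW.
congr (\int[_]_(_ in _) _)%E; apply/seteqP; split => Y.
  by move=> [y [Uy Cy] <-]; split => //; exact: (chart_image hc).
by move=> [SY CAY]; exact: SCE.
Qed.

End Transfer.

(** * The round sphere and polar coordinates *)

Section Stereographic.
Context {R : realType} {n : nat}.

Lemma dot_head_tail m (v w : 'rV[R]_m.+1) : dot v w = v 0 0 * w 0 0 + dot (vtail v) (vtail w).
Proof. by rewrite !dotE big_ord_recl; congr (_ + _); apply: eq_bigr => i _; rewrite !mxE. Qed.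

Lemma head_tail_eq m (v w : 'rV[R]_m.+1) : v 0 0 = w 0 0 -> vtail v = vtail w -> v = w.
Proof. by move=> e1 e2; rewrite -(consr_vtail v) -(consr_vtail w) e1 e2. Qed.

Variable s : R.
Hypothesis s2 : s * s = 1.

Definition stereo_den (y : 'rV[R]_n) : R := 1 + \sum_i y 0 i * y 0 i.

(** Inverse stereographic projection from the pole whose first coordinate is [s], where [s] is 1 or
    -1; the two signs together cover the sphere. *)
Definition stereo (y : 'rV[R]_n) : 'rV[R]_n.+1 :=
  consr (s * (1 - 2 * (stereo_den y)^-1), (2 * (stereo_den y)^-1) *: y : borel_rV R n).

Definition stereo_inv (X : 'rV[R]_n.+1) : 'rV[R]_n := (1 - s * X 0 0)^-1 *: vtail X.

Lemma stereo_denE y : stereo_den y = 1 + dot y y. Proof. by rewrite dotE. Qed.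

Lemma stereo_den_gt0 y : 0 < stereo_den y.
Proof. by rewrite stereo_denE ltr_pwDl // dot_ge0. Qed.

Lemma stereo_head y : stereo y 0 0 = s * (1 - 2 * (stereo_den y)^-1).
Proof. by rewrite /stereo consr0. Qed.

Lemma stereo_tail y : vtail (stereo y) = (2 * (stereo_den y)^-1) *: y.
Proof. by rewrite /stereo vtail_consr. Qed.

Lemma stereo_gap y : 1 - s * stereo y 0 0 = 2 * (stereo_den y)^-1.
Proof. by rewrite stereo_head mulrA s2 mul1r opprB addrC subrK. Qed.

Lemma stereo_gap_gt0 y : 0 < 1 - s * stereo y 0 0.
Proof. by rewrite stereo_gap mulr_gt0 // invr_gt0 stereo_den_gt0. Qed.

Lemma stereoK y : stereo_inv (stereo y) = y.
Proof.
rewrite /stereo_inv stereo_gap stereo_tail scalerA mulVf ?scale1r //.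
by rewrite mulf_neq0 ?pnatr_eq0 // invr_neq0 // lt0r_neq0 // stereo_den_gt0.
Qed.

Lemma stereo_sphere y : esphere (stereo y).
Proof.
apply/enorm1P; rewrite dot_head_tail stereo_head stereo_tail dotZl dotZr.
have -> : dot y y = stereo_den y - 1 by rewrite stereo_denE addrC addKr.
have := lt0r_neq0 (stereo_den_gt0 y); set a := stereo_den y => a0.
transitivity (s * s * (1 - 2 * a^-1) ^+ 2 + (2 * a^-1) ^+ 2 * (a - 1)); first by ring.
by rewrite s2; field.
Qed.

Lemma stereo_invK X : esphere X -> s * X 0 0 < 1 -> stereo (stereo_inv X) = X.
Proof.
move=> /enorm1P; rewrite dot_head_tail => X1; rewrite -subr_gt0 => b0.
have bn := lt0r_neq0 b0; set b := 1 - s * X 0 0 in b0 bn.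
have tE : dot (vtail X) (vtail X) = (2 - b) * b.
  have : X 0 0 * X 0 0 = (1 - b) ^+ 2.
    by rewrite /b opprB addrC subrK expr2 mulrACA s2 mul1r.
  by move=> E; move: X1; rewrite E => /(canRL (addKr _)) ->; ring.
have dE : stereo_den (stereo_inv X) = 2 * b^-1.
  by rewrite stereo_denE /stereo_inv -/b dotZl dotZr tE; field.
apply: head_tail_eq.
  rewrite stereo_head dE; transitivity (s * (1 - b)); first by field.
  by rewrite /b opprB addrC subrK mulrA s2 mul1r.
rewrite stereo_tail dE /stereo_inv -/b scalerA.
by rewrite (_ : _ * _ = 1) ?scale1r //; field.
Qed.

Lemma stereo_inv_continuous (X : 'rV[R]_n.+1) : s * X 0 0 < 1 -> {for X, continuous stereo_inv}.
Proof.
rewrite -subr_gt0 => b0.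
have c1 : cont_at (fun Y : 'rV[R]_n.+1 => (1 - s * Y 0 0)^-1) X.
  apply: cont_atV; first exact: lt0r_neq0.
  apply: cont_atD; first exact: cont_at_cst.
  by apply: cont_atN; apply: cont_atM; [exact: cont_at_cst|exact: cont_at_head].
apply/cvg_rVP => i.
have c2 : cont_at (fun Y : 'rV[R]_n.+1 => (1 - s * Y 0 0)^-1 * vtail Y 0 i) X.
  by apply: cont_atM => //; apply: cont_at_coord; exact: continuous_vtail.
have E Y : stereo_inv Y 0 i = (1 - s * Y 0 0)^-1 * vtail Y 0 i by rewrite [LHS]mxE.
by rewrite E; under eq_fun do rewrite E; exact: c2.
Qed.

Let oT : forall x : 'rV[R]_n, setT x -> exists2 d : R, 0 < d & forall y, `|y - x| < d -> setT y.
Proof. by move=> x _; exists 1. Qed.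

Lemma smooth_stereo_den : smooth_on [set: 'rV[R]_n] (stereo_den : 'rV[R]_n -> R^o).
Proof.
move=> k; apply: (class_CD oT); first exact: (class_C_cst oT).
apply: (class_C_sum oT (f := fun i y => y 0 i * y 0 i : R^o)) => i.
by apply: (class_CM oT); apply: class_C_coord; exact: openT.
Qed.

Lemma smooth_stereo : smooth_on [set: 'rV[R]_n] stereo.
Proof.
move=> k; apply: (class_C_rV oT) => i.
have Ca : class_C k [set: 'rV[R]_n] (fun y => 2 * (stereo_den y)^-1 : R^o).
  apply: (class_CM oT); first exact: (class_C_cst oT).
  apply: (class_CV oT); last exact: smooth_stereo_den.
  by move=> x _; rewrite lt0r_neq0 // stereo_den_gt0.
case: (unliftP ord0 i) => [j ->|->].
  apply: (class_C_eq oT (f := fun y => 2 * (stereo_den y)^-1 * y 0 j : R^o)).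
    by move=> y _; rewrite /stereo consrS [RHS]mxE.
  by apply: (class_CM oT) => //; apply: class_C_coord; exact: openT.
apply: (class_C_eq oT (f := fun y => s * (1 + -1 * (2 * (stereo_den y)^-1)) : R^o)).
  by move=> y _; rewrite stereo_head mulN1r.
apply: (class_CM oT); first exact: (class_C_cst oT).
apply: (class_CD oT); first exact: (class_C_cst oT).
by apply: (class_CM oT) => //; exact: (class_C_cst oT).
Qed.

(** For [v] in the kernel all coordinates of [stereo] have zero derivative along [v]. A tail
    coordinate is the parameter coordinate [f] times the gap [h], whose derivative is also 0, so the
    product rule leaves [h 0] times [v 0 i] equal to 0, with [h 0] positive. *)
Lemma stereo_rank y : \rank (jacobian stereo y) = n.
Proof.
apply/eqP; rewrite -/(row_free _) -kermx_eq0 -nz_row_eq0; apply/eqP; set v := nz_row _.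
have vJ : v *m jacobian stereo y = 0 by apply/sub_kermxP; exact: nz_row_sub.
have ds : differentiable stereo (y + (0 : R) *: v).
  by rewrite scale0r addr0; have [H _] := smooth_stereo 1; exact: H.
have D i : is_derive (0 : R^o) (1 : R^o) (fun t : R^o => stereo (y + t *: v) 0 i : R^o) 0.
  have := is_derive_coord_line i ds; rewrite deriveEjacobian // scale0r addr0 vJ.
  by rewrite mxE.
apply/rowP => i; rewrite [RHS]mxE; have D0 := D 0; have Di := D (lift ord0 i).
pose f (t : R^o) : R^o := y 0 i + t * v 0 i.
pose h (t : R^o) : R^o := 1 - s * stereo (y + t *: v) 0 0.
have fE : (fun t : R^o => stereo (y + t *: v) 0 (lift ord0 i) : R^o) = (fun t => f t * h t).
  apply/funext => t; rewrite /h stereo_gap /stereo consrS /= mxE mulrC.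
  by rewrite /f !mxE.
have df : is_derive (0 : R^o) (1 : R^o) f (v 0 i).
  apply/is_derive_epsP => e e0; exists 1 => // a _.
  rewrite /f -[a *: (1 : R^o)]/(a * 1) mulr1 add0r mul0r addr0.
  have -> : y 0 i + a * v 0 i - y 0 i - a *: (v 0 i : R^o) = 0 by rewrite /GRing.scale /=; ring.
  by rewrite normr0 mulr_ge0 // ltW.
have dh : is_derive (0 : R^o) (1 : R^o) h 0.
  apply/is_derive_epsP => e e0; have /is_derive_epsP H := D0.
  have s0 : 0 < 1 + `|s| by rewrite ltr_pwDl.
  have [d d0 Hd] := H _ (divr_gt0 e0 s0); exists d => // a /Hd.
  rewrite !scaler0 !subr0 /h => Ha.
  have -> : forall p q : R, 1 - s * p - (1 - s * q) = - s * (p - q) by move=> *; ring.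
  rewrite normrM normrN; apply: le_trans (ler_wpM2l (normr_ge0 s) Ha) _.
  have -> : `|s| * (e / (1 + `|s|) * `|a|) = `|s| / (1 + `|s|) * (e * `|a|) by ring.
  apply: ler_piMl; first by rewrite mulr_ge0 // ltW.
  by rewrite ler_pdivrMr // mul1r lerDr.
have Dfh : is_derive (0 : R^o) (1 : R^o) (fun t => f t * h t) (f 0 *: (0 : R^o) + h 0 *: (v 0 i : R^o)).
  exact: is_deriveM.
rewrite -fE in Dfh.
have : 0 = f 0 *: (0 : R^o) + h 0 *: (v 0 i : R^o).
  by have [_ E1] := Di; have [_ E2] := Dfh; rewrite -[LHS]E1 E2.
rewrite scaler0 add0r => /esym/eqP; rewrite -[_ *: _]/(h 0 * v 0 i) mulf_eq0.
have /negPf -> : h 0 != 0 by apply: lt0r_neq0; exact: stereo_gap_gt0.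
by move=> /eqP.
Qed.

Lemma stereo_chart : is_chart (@esphere R n.+1) [set: 'rV[R]_n] stereo.
Proof.
split.
- by split; [exact: openT|exact: smooth_stereo].
- by move=> y z _ _ E; rewrite -(stereoK y) E stereoK.
- move=> V oV _; exists [set X : 'rV[R]_n.+1 | s * X 0 0 < 1 /\ V (stereo_inv X)].
    apply/open_rVP => X [X1 VX].
    have /open_rVP/(_ _ VX)[e e0 He] := oV.
    have /continuous_epsP/(_ e e0)[d d0 Hd] := stereo_inv_continuous X1.
    have b0 : 0 < 1 - s * X 0 0 by rewrite subr_gt0.
    have c : cont_at (fun Y : 'rV[R]_n.+1 => s * Y 0 0) X.
      by apply: cont_atM; [exact: cont_at_cst|exact: cont_at_head].
    have /continuous_epsP/(_ _ b0)[d' d'0 Hd'] := c.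
    exists (Num.min d d') => [|Y]; first by rewrite lt_min d0.
    rewrite lt_min => /andP[/Hd yd /Hd']; rewrite ltr_norml => /andP[_ yd'].
    by split; [move: yd'; lra|exact: He].
  apply/seteqP; split=> [_ [y Vy <-]|X [SX [X1 VX]]].
    split; first exact: stereo_sphere.
    by split; [rewrite -subr_gt0; exact: stereo_gap_gt0|rewrite stereoK].
  by exists (stereo_inv X) => //; exact: stereo_invK.
- by move=> y _; exact: stereo_rank.
Qed.

End Stereographic.

(** * The unit ball as an instance of the convex domains treated so far *)

Section UnitBall.
Context {R : realType} {n : nat}.
Local Notation E := 'rV[R]_n.+1.

Lemma sphere_smooth : smooth_hypersurface (@esphere R n.+1).
Proof.
move=> X SX; have [X1|X1] := ltP (X 0 0) 1.
  exists setT, (stereo 1); split; first by apply: stereo_chart; rewrite mulr1.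
  by exists (stereo_inv 1 X) => //; apply: stereo_invK; rewrite ?mulr1 // mul1r.
exists setT, (stereo (-1)); split; first by apply: stereo_chart; rewrite mulrNN mulr1.
exists (stereo_inv (-1) X) => //; apply: stereo_invK; rewrite ?mulrNN ?mulr1 // mulN1r.
by apply: lt_trans (ltr01); rewrite oppr_lt0; exact: lt_le_trans X1.
Qed.

Definition unit_ball : set E := [set x | enorm x < 1].

Lemma enorm_continuous : continuous (@enorm R n.+1 : E -> R^o).
Proof.
move=> x; apply: (@continuous_comp _ _ _ (fun y : E => dot y y : R^o) (@Num.sqrt R)).
  exact: (cvg_dot (f := id) (g := id)).
exact: sqrt_continuous.
Qed.

Lemma enorm0 : enorm (0 : E) = 0.
Proof. by rewrite /enorm dot0l sqrtr0. Qed.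

Lemma unit_ball_nonempty : unit_ball !=set0.
Proof. by exists 0; rewrite /unit_ball /= enorm0. Qed.

Lemma unit_ball_open : open unit_ball.
Proof. by apply: (open_comp (f := @enorm R n.+1 : E -> R^o) (D := [set t | t < 1])) => [x _|]; [exact: enorm_continuous|exact: open_lt]. Qed.

Lemma unit_ball_bounded : bounded_set unit_ball.
Proof.
exists 1; split; first exact: num_real.
by move=> M M1 x x1; apply: le_trans (norm_le_enorm x) _; apply/ltW/(lt_trans x1).
Qed.

Lemma unit_ball_convex : convex_set (unit_ball : set (convex_lmodType E)).
Proof.
move=> x y l; rewrite !inE => x1 y1.
rewrite -[conv l x y]/(l%:num *: (x : E) + (1 - l%:num) *: (y : E)).
have l0 : 0 <= l%:num by [].
have l1 : 0 <= 1 - l%:num by rewrite subr_ge0.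
rewrite /unit_ball /=; apply: le_lt_trans (enorm_triangle _ _) _.
rewrite !enormZ !ger0_norm //.
have [->|ln0] := eqVneq (l%:num) 0; first by rewrite mul0r add0r subr0 mul1r.
have lp : 0 < l%:num by rewrite lt0r ln0.
have := ler_wpM2l l1 (ltW y1); have : l%:num * enorm x < l%:num * 1 by rewrite ltr_pM2l.
by lra.
Qed.

Lemma closure_unit_ball : closure unit_ball = eball 1.
Proof.
apply/seteqP; split.
  have cE : eball 1 = closure (eball 1 : set E).
    apply/closure_id.
    by apply: (closed_comp (f := @enorm R n.+1 : E -> R^o) (D := [set t | t <= 1])) => [x _|]; [exact: enorm_continuous|exact: closed_le].
  by rewrite cE; apply: closure_subset => x /ltW.
move=> x; rewrite /eball /= => x1; apply/closure_epsP => e e0.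
have c0 : 0 < 1 + `|x| by rewrite ltr_pwDl.
pose t := Num.min (1 / 2) (e / (2 * (1 + `|x|))).
have t0 : 0 < t by rewrite lt_min !divr_gt0 // mulr_gt0.
have t1 : t <= 1 / 2 by rewrite ge_min lexx.
have te : t * (2 * (1 + `|x|)) <= e by rewrite -ler_pdivlMr ?mulr_gt0 // ge_min lexx orbT.
exists ((1 - t) *: x).
  rewrite /unit_ball /= enormZ ger0_norm; last by lra.
  by have := enorm_ge0 x; nra.
have -> : (1 - t) *: x - x = - (t *: x) by apply/rowP => i; rewrite !mxE; ring.
rewrite normrN normrZ ger0_norm ?(ltW t0) //.
by have := normr_ge0 x; nra.
Qed.

Lemma boundary_unit_ball : boundary unit_ball = @esphere R n.+1.
Proof.
rewrite boundaryE; last exact: unit_ball_open.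
rewrite closure_unit_ball; apply/seteqP; split => x.
  by move=> [x1 /negP]; rewrite -leNgt => x2; apply/eqP; rewrite eq_le x1 x2.
by rewrite /esphere /eball /unit_ball /= => ->; rewrite lexx ltxx.
Qed.

Lemma unit_ball_smooth : smooth_hypersurface (boundary unit_ball).
Proof. by rewrite boundary_unit_ball; exact: sphere_smooth. Qed.

Lemma unit_ball_normal X : esphere X -> outward_normal unit_ball X = X.
Proof.
move=> SX; apply: (outward_normal_unique unit_ball_nonempty unit_ball_open unit_ball_bounded
  unit_ball_convex unit_ball_smooth); first by rewrite boundary_unit_ball.
have X1 : dot X X = 1 by apply/enorm1P.
split => // z; rewrite closure_unit_ball => z1; rewrite dotBr X1 subr_le0.
by apply: le_trans (dot_le_enorm _ _) _; rewrite SX mul1r.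
Qed.

(** On the sphere the outward normal is the point itself, so along a curve the derivative of the
    normal is the velocity; the product with the unit eigenvector isolates the curvature. *)
Lemma unit_ball_curvatures X i : esphere X -> principal_curvatures unit_ball X 0 i = 1.
Proof.
move=> SX; have [U [phi [hc [y Uy yX]]]] := unit_ball_smooth (eq_ind_r (fun A : set E => A X) SX boundary_unit_ball).
have := principal_curvaturesP unit_ball_nonempty unit_ball_open unit_ball_bounded
  unit_ball_convex unit_ball_smooth hc Uy.
rewrite yX => -[e [eT eo /(_ i) es]].
have [c Hc cv] := eT i; have [cX [r r0 [sc cS]]] := Hc.
have dc : differentiable c (0 : R^o) by have [H _] := sc 1; apply: H; exact: ballxx.
have [_ E] := es c Hc cv.
have : 'D_1 (outward_normal unit_ball \o c) (0 : R^o) = 'D_1 c (0 : R^o).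
  apply: near_eq_derive; apply/nbhs_normP; exists r => //= t tr.
  by apply: unit_ball_normal; rewrite -boundary_unit_ball; apply: cS; exists t => //; rewrite -ball_normE.
rewrite E cv => /(congr1 (fun w => dot w (e i))).
by rewrite dotZl eo eqxx mulr1.
Qed.

Lemma unit_ball_mean_curvature j X : (j <= n)%N -> esphere X -> mean_curvature unit_ball j X = 1.
Proof.
move=> jn SX; rewrite /mean_curvature /elem_sym.
under eq_bigr do under eq_bigr do rewrite unit_ball_curvatures //.
under eq_bigr do rewrite big1 //.
rewrite sumr_const; have -> : #|[pred A : {set 'I_n} | #|A| == j]| = 'C(n, j).
  by rewrite -[X in 'C(X, j)]card_ord -card_draws; apply: eq_card => A; rewrite !inE.
by rewrite mulVf // pnatr_eq0 -lt0n bin_gt0.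
Qed.

(** Absorption identity for binomial coefficients, the discrete form of integrating the [n]-th power
    of [1 + s] from 0 to [t]. *)
Lemma sum_binomial_steiner (t : R) :
  \sum_(j < n.+1) 'C(n, j)%:R * t ^+ j.+1 / j.+1%:R = ((1 + t) ^+ n.+1 - 1) / n.+1%:R.
Proof.
have -> : (1 + t) ^+ n.+1 - 1 = \sum_(j < n.+1) 'C(n.+1, j.+1)%:R * t ^+ j.+1.
  rewrite exprDn big_ord_recl expr1n bin0 expr0 mulr1 mulr1n addrAC subrr add0r.
  by apply: eq_bigr => j _; rewrite expr1n mul1r lift0 mulr_natl.
rewrite mulr_suml.
apply: eq_bigr => j _; have n0 : n.+1%:R != 0 :> R by rewrite pnatr_eq0.
have j0 : j.+1%:R != 0 :> R by rewrite pnatr_eq0.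
apply: (mulIf n0); rewrite divfK //; apply: (mulIf j0).
have := congr1 (fun k => k%:R : R) (mul_bin_diag n.+1 j); rewrite !natrM => H.
transitivity (n.+1%:R * 'C(n, j)%:R * t ^+ j.+1); first by field.
by rewrite H; ring.
Qed.

Lemma unit_ball_steiner t X : esphere X -> steiner unit_ball t X = ((1 + t) ^+ n.+1 - 1) / n.+1%:R.
Proof.
move=> SX; rewrite -sum_binomial_steiner; apply: eq_bigr => j _.
by rewrite unit_ball_mean_curvature ?mulr1 // -ltnS.
Qed.

End UnitBall.

Section RealMeasures.
Local Open Scope ereal_scope.
Context {R : realType}.

Lemma measure_unique_real (m1 m2 : {measure set (measurableTypeR R) -> \bar R}) :
  (forall b : R, m1 `]-oo, b]%classic = m2 `]-oo, b]%classic) ->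
  (forall b : R, m1 `]-oo, b]%classic < +oo) ->
  forall A, measurable A -> m1 A = m2 A.
Proof.
move=> m12 m1oo.
have mI (b : R) : measurable (`]-oo, b]%classic : set (measurableTypeR R)) by exact: measurable_itv.
have H (a b : R) : m1 `]a, b]%classic = m2 `]a, b]%classic.
  have [ba|ab] := leP b a.
    by rewrite set_itv_ge ?measure0 // bnd_simp -leNgt.
  have E : (`]-oo, b]%classic = `]-oo, a] `|` `]a, b] :> set R)%classic.
    by rewrite -itv_bndbnd_setU // bnd_simp // ltW.
  have D : [disjoint `]-oo, a]%classic & (`]a, b]%classic : set R)].
    apply/disj_setPS => x [/=]; rewrite !in_itv /= => xa /andP[ax _].
    by move: (lt_le_trans ax xa); rewrite ltxx.
  have U (m : {measure set (measurableTypeR R) -> \bar R}) :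
      m `]-oo, b]%classic = m `]-oo, a]%classic + m `]a, b]%classic.
    by rewrite E measureU //; apply/eqP; rewrite -[_ == _]/(disj_set _ _).
  have fa : m2 `]-oo, a]%classic \is a fin_num by rewrite ge0_fin_numE // -m12.
  have := m12 b; rewrite !U (m12 a) ![m2 `]-oo, a]%classic + _]addeC.
  by move=> /(congr1 (fun z => z - m2 `]-oo, a]%classic)); rewrite !addeK.
apply: (@measure_unique _ R (measurableTypeR R) (@ocitv R) (fun k => `]- k%:R, k%:R]%classic)%R) => //.
- exact: ocitvI.
- by move=> k; exact: is_ocitv.
- apply/seteqP; split=> // x _; exists (Num.truncn `|x|).+1 => //=.
  have := truncnS_gt `|x|; rewrite ltr_norml in_itv /= => /andP[-> /ltW ->] //.
- by move=> _ [[a b] _ <-]; exact: H.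
- move=> k; apply: le_lt_trans (m1oo k%:R); apply: le_measure; rewrite ?inE //.
  by move=> x /=; rewrite !in_itv /= => /andP[].
Qed.

Lemma ltey_mul_pos (c : R) (x : \bar R) : (0 < c)%R -> 0 <= x -> c%:E * x < +oo -> x < +oo.
Proof. by case: x => [r| |] c0 // _; rewrite ?ltry // gt0_muley ?lte_fin. Qed.

End RealMeasures.

(** * Polar coordinates from the tube formula of the unit ball *)

Section Polar.
Context {R : realType} {n : nat}.
Local Notation E := 'rV[R]_n.+1.
Local Notation m := (n.+1).
Variable theta : {measure set (borel_rV R m) -> \bar R}.
Hypothesis htheta : is_area_measure (@esphere R m) theta.

Definition dir (Y : E) : E := (enorm Y)^-1 *: Y.

Lemma enorm_neq0 (Y : E) : Y != 0 -> 0 < enorm Y.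
Proof. by move=> Y0; rewrite lt0r enorm_ge0 andbT; apply: contra Y0 => /eqP /enorm_eq0 ->. Qed.

Lemma enorm_dir (Y : E) : Y != 0 -> enorm (dir Y) = 1.
Proof.
move=> /enorm_neq0 Y0; rewrite /dir enormZ ger0_norm ?invr_ge0 ?(ltW Y0) //.
by rewrite mulVf // lt0r_neq0.
Qed.

Lemma dirK (Y : E) : Y != 0 -> enorm Y *: dir Y = Y.
Proof. by move=> /enorm_neq0 Y0; rewrite scalerA mulfV ?scale1r // lt0r_neq0. Qed.

Lemma dirZ (Y : E) a : 0 < a -> dir (a *: Y) = dir Y.
Proof.
move=> a0; rewrite /dir enormZ gtr0_norm // scalerA; congr (_ *: _).
by rewrite invfM mulrAC mulVf ?mul1r // lt0r_neq0.
Qed.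

Lemma open_punctured : open [set Y : E | Y != 0].
Proof.
have -> : [set Y : E | Y != 0] = (@enorm R m : E -> R^o) @^-1` [set t | t != 0].
  apply/seteqP; split => Y /=; first by move=> /enorm_neq0 /lt0r_neq0.
  by apply: contra => /eqP ->; rewrite enorm0.
by apply: (open_comp (f := @enorm R m : E -> R^o)) => [x _|]; [exact: enorm_continuous|exact: open_neq].
Qed.

Lemma dir_continuous (Y : E) : Y != 0 -> {for Y, continuous dir}.
Proof.
move=> /enorm_neq0 Y0; apply/cvg_rVP => i.
have DE Z : dir Z 0 i = (enorm Z)^-1 * Z 0 i by rewrite mxE.
rewrite DE; under eq_fun do rewrite DE.
apply: (cont_atM (f := fun Z : E => (enorm Z)^-1) (g := fun Z : E => Z 0 i)).
  by apply: cont_atV; [rewrite lt0r_neq0|exact: enorm_continuous].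
exact: coord_continuous.
Qed.

Lemma measurable_dir : measurable_fun ([set Y : E | Y != 0] : set (borel_rV R m))
  (dir : borel_rV R m -> borel_rV R m).
Proof. by apply: measurable_fun_open_rV; [exact: open_punctured|exact: dir_continuous]. Qed.

Lemma measurable_punctured : measurable ([set Y : E | Y != 0] : set (borel_rV R m)).
Proof. exact: borel_open open_punctured. Qed.

Lemma measurable_origin : measurable ([set 0] : set (borel_rV R m)).
Proof.
have -> : [set 0] = ~` [set Y : E | Y != 0].
  by apply/seteqP; split => Y /=; [move=> ->; rewrite eqxx|move=> /negP; rewrite negbK => /eqP].
by apply: measurableC; exact: measurable_punctured.
Qed.

Lemma measurable_enorm : measurable_fun setT (@enorm R m : borel_rV R m -> R).
Proof. by apply: continuous_measurable_rV; exact: enorm_continuous. Qed.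

Definition cone (A : set E) (b : R) : set (borel_rV R m) :=
  [set Y | Y != 0 /\ enorm Y <= b /\ A (dir Y)].

Lemma measurable_cone (A : set (borel_rV R m)) b : measurable A -> measurable (cone A b).
Proof.
move=> mA; have -> : cone A b = ([set Y : E | Y != 0] `&` dir @^-1` A) `&` (@enorm R m) @^-1` `]-oo, b].
  apply/seteqP; split => Y /=; rewrite in_itv /=; first by move=> [? []].
  by move=> [[]].
apply: measurableI; first exact: (measurable_dir measurable_punctured).
by rewrite -[X in measurable X]setTI; apply: measurable_enorm => //; exact: measurable_itv.
Qed.

Lemma cone_finite (A : set (borel_rV R m)) b : measurable A -> (lebesgue_rV (cone A b) < +oo)%E.
Proof.
move=> mA; apply: (@lebesgue_bounded _ _ _ (b + 1)); first exact: measurable_cone.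
by move=> x [_ [xb _]]; apply: le_lt_trans (norm_le_enorm x) _; apply: le_lt_trans xb _; rewrite ltrDl.
Qed.

Lemma cone_scale (A : set (borel_rV R m)) b : measurable A -> 0 < b ->
  lebesgue_rV (cone A b) = ((b ^+ m)%:E * lebesgue_rV (cone A 1))%E.
Proof.
move=> mA b0; have bn : b != 0 by rewrite lt0r_neq0.
have uM : ((b^-1)%:M : 'M[R]_m) \in unitmx by rewrite unitmxE det_scalar unitfE expf_neq0 // invr_neq0.
have := lebesgue_mulmx uM (measurable_cone 1 mA).
rewrite det_scalar normrX ger0_norm ?invr_ge0 ?(ltW b0) // exprVn invrK => <-.
congr lebesgue_rV; apply/seteqP; split => Y; rewrite /cone /= mul_mx_scalar.
  move=> [Y0 [Yb AY]]; split; first by rewrite scaler_eq0 invr_eq0 negb_or bn.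
  rewrite dirZ ?invr_gt0 // enormZ ger0_norm ?invr_ge0 ?(ltW b0) //.
  by split => //; rewrite mulrC ler_pdivrMr // mul1r.
rewrite scaler_eq0 invr_eq0 negb_or => -[/andP[_ Y0]].
rewrite dirZ ?invr_gt0 // enormZ ger0_norm ?invr_ge0 ?(ltW b0) //.
by move=> [Yb AY]; split => //; split => //; move: Yb; rewrite mulrC ler_pdivrMr // mul1r.
Qed.

Let hne := @unit_ball_nonempty R n.
Let hopen := @unit_ball_open R n.
Let hbdd := @unit_ball_bounded R n.
Let hconv := @unit_ball_convex R n.
Let hsmooth := @unit_ball_smooth R n.

Let hmu : is_area_measure (boundary (@unit_ball R n)) theta.
Proof. by rewrite boundary_unit_ball. Qed.

Lemma unit_ball_proj (Y : E) : 1 < enorm Y ->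
  proj (@unit_ball R n) Y = dir Y /\ bdist (@unit_ball R n) Y = enorm Y - 1.
Proof.
move=> Y1; have Y0 : Y != 0 by apply: contraTneq Y1 => ->; rewrite enorm0 ltr10.
have SX := enorm_dir Y0.
have SX' : boundary (@unit_ball R n) (dir Y) by rewrite boundary_unit_ball.
have := outward_normalP hne hopen hbdd hconv hsmooth SX'; rewrite unit_ball_normal // => Hn.
have Y2 : 0 <= enorm Y - 1 by rewrite subr_ge0 ltW.
have := proj_add_normal hne hbdd hconv (boundary_body hopen SX') Hn Y2.
by rewrite -[X in X + _]scale1r -scalerDl addrC subrK dirK.
Qed.

(** The shell is the tube of thickness 1 around the unit ball, where the projection is [dir]; the
    curvatures are all 1, so [steiner] is constant on the sphere. *)
Lemma sphere_shell (A : set (borel_rV R m)) : measurable A ->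
  lebesgue_rV ([set Y : E | 1 < enorm Y <= 2 /\ A (dir Y)] : set (borel_rV R m)) =
  (((2 ^+ m - 1) / m%:R)%:E * theta A)%E.
Proof.
move=> mA; have := tube_measure hne hopen hbdd hconv hsmooth hmu mA ltr01.
rewrite boundary_unit_ball => H.
have -> : [set Y : E | 1 < enorm Y <= 2 /\ A (dir Y)] =
    tube (@unit_ball R n) 1 `&` proj (@unit_ball R n) @^-1` A.
  apply/seteqP; split => Y.
    move=> [/andP[Y1 Y2] AY]; have [p1 p2] := unit_ball_proj Y1.
    split; last by rewrite /= p1.
    split; last by rewrite p2 lerBlDr.
    by rewrite closure_unit_ball /eball /= => /(lt_le_trans Y1); rewrite ltxx.
  move=> [[KY Yt] AY]; have Y1 : 1 < enorm Y.
    by rewrite ltNge; apply/negP => Y1; apply: KY; rewrite closure_unit_ball.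
  have [p1 p2] := unit_ball_proj Y1; move: Yt AY; rewrite /= p1 p2 => Yt AY.
  by rewrite Y1; split => //; rewrite -lerBlDr.
rewrite H; under eq_integral => X /set_mem[SX _] do rewrite unit_ball_steiner //.
have mS : measurable (@esphere R m : set (borel_rV R m)).
  by rewrite -boundary_unit_ball; exact: measurable_boundary.
rewrite integral_cst; last exact: measurableI.
congr (_ * _)%E; rewrite (measureDI theta mA mS) [X in (X + _)%E](_ : _ = 0%E) ?add0e.
  by rewrite setIC.
apply/eqP; rewrite eq_le measure_ge0 andbT -htheta.1; apply: le_measure; rewrite ?inE.
- exact: measurableD.
- exact: measurableC.
- by move=> X [].
Qed.

(** Two relations determine the cone of radius 1: scaling gives the factor [2 ^+ m] at radius 2, and
    the difference of the two cones is the shell. Solving for the volume uses that both quantities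
    are finite. *)
Lemma cone_measure (A : set (borel_rV R m)) b : measurable A -> 0 < b ->
  lebesgue_rV (cone A b) = ((b ^+ m / m%:R)%:E * theta A)%E.
Proof.
move=> mA b0; rewrite cone_scale //; have f := cone_finite 1 mA.
have fn : lebesgue_rV (cone A 1) \is a fin_num by rewrite ge0_fin_numE.
have two0 : (0 : R) < 2 by [].
have E2 : cone A 2 = cone A 1 `|` [set Y : E | 1 < enorm Y <= 2 /\ A (dir Y)].
  apply/seteqP; split => Y.
    move=> [Y0 [Y2 AY]]; have [Y1|Y1] := leP (enorm Y) 1; first by left.
    by right; split => //; rewrite Y1.
  move=> [[Y0 [Y1 AY]]|[/andP[Y1 Y2] AY]].
    by split => //; split => //; apply: le_trans Y1 _; rewrite ler1n.
  by split => //; apply: contraTneq Y1 => ->; rewrite enorm0 ltr10.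
have ms : measurable ([set Y : E | 1 < enorm Y <= 2 /\ A (dir Y)] : set (borel_rV R m)).
  have -> : [set Y : E | 1 < enorm Y <= 2 /\ A (dir Y)] = cone A 2 `\` cone A 1.
    apply/seteqP; split => Y.
      move=> [/andP[Y1 Y2] AY]; split; last by move=> [_ [/(lt_le_trans Y1)]]; rewrite ltxx.
      by split => //; apply: contraTneq Y1 => ->; rewrite enorm0 ltr10.
    move=> [[Y0 [Y2 AY]] nY]; split => //; rewrite Y2 andbT ltNge; apply/negP => Y1.
    by apply: nY.
  by apply: measurableD; exact: measurable_cone.
have E4 : (lebesgue_rV (cone A 1) + ((2 ^+ m - 1) / m%:R)%:E * theta A =
    (2 ^+ m)%:E * lebesgue_rV (cone A 1))%E.
  rewrite -(sphere_shell mA) -(cone_scale mA two0) E2; apply/esym/measureU => //.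
    exact: measurable_cone.
  apply/seteqP; split => // Y [[_ [Y1 _]] [/andP[Y2 _] _]].
  by move: (lt_le_trans Y2 Y1); rewrite ltxx.
have p0 : 0 < (2 ^+ m - 1) / m%:R :> R.
  by rewrite divr_gt0 ?ltr0n // subr_gt0 exprn_egt1 // ltr1n.
have tf : theta A \is a fin_num.
  rewrite ge0_fin_numE //; have : (((2 ^+ m - 1) / m%:R)%:E * theta A < +oo)%E.
    rewrite -(sphere_shell mA); apply: le_lt_trans (cone_finite 2 mA).
    apply: le_measure; rewrite ?inE //; first exact: measurable_cone.
    by rewrite E2; right.
  exact: ltey_mul_pos.
move: E4; rewrite -(fineK fn) -(fineK tf); set x := fine _; set y := fine _; rewrite -!EFinM -EFinD => -[H].
congr EFin; have m0 : m%:R != 0 :> R by rewrite pnatr_eq0.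
have xE : (2 ^+ m - 1) * x = (2 ^+ m - 1) * (y / m%:R).
  rewrite mulrBl mul1r -H; field.
  by rewrite -[1]/(1%:R) -natrD.
have q0 : 2 ^+ m - 1 != 0 :> R by rewrite gt_eqF // subr_gt0 exprn_egt1 // ltr1n.
by rewrite (mulfI q0 xE); field.
Qed.

Lemma sphere_finite : (theta setT < +oo)%E.
Proof.
have := cone_finite 1 (@measurableT _ (borel_rV R m)); rewrite cone_measure // expr1n.
by apply: ltey_mul_pos => //; rewrite divr_gt0.
Qed.

(** Extended by 0 so that radial integrals run over the whole line. *)
Definition radial_density (r : R) : R := if 0 < r then r ^+ n else 0.

Lemma radial_density_ge0 r : 0 <= radial_density r.
Proof. by rewrite /radial_density; case: ifPn => // /ltW r0; exact: exprn_ge0. Qed.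

Lemma measurable_radial_density : measurable_fun setT (radial_density : measurableTypeR R -> R).
Proof.
have -> : radial_density = (fun r : measurableTypeR R => r ^+ n) \_ `]0, +oo[.
  apply/funext => r; rewrite /radial_density /patch; have -> : (r \in `]0%R, +oo[%classic) = (0 < r).
    by apply/idP/idP; rewrite inE /= in_itv /= andbT.
  by [].
apply/(measurable_restrictT _ (measurable_itv _)); apply: measurable_funTS.
by apply: continuous_measurable_fun => r; exact: exprn_continuous.
Qed.

Lemma integral_radial b : 0 <= b ->
  (\int[lebesgue_measure]_(r in `]-oo, b]%classic) (radial_density r)%:E)%E = (b ^+ m / m%:R)%:E.
Proof.
move=> b0.
transitivity (\int[lebesgue_measure]_(r in `]0%R, b]) (r ^+ n)%:E)%E.
  rewrite [LHS]integral_mkcond [RHS]integral_mkcond; apply: eq_integral => r _.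
  rewrite /patch; have -> : (r \in `]-oo, b]%classic) = (r <= b).
    by apply/idP/idP; rewrite inE /= in_itv.
  have -> : (r \in `]0%R, b]%classic) = (0 < r <= b) by apply/idP/idP; rewrite inE /= in_itv.
  by rewrite /radial_density; case: (ltP 0 r); case: (leP r b).
move: b0; rewrite le_eqVlt => /orP[/eqP <-|b0].
  by rewrite set_itv_ge ?bnd_simp ?ltxx // integral_set0 expr0n mul0r.
have := integral_polynomial (fun j : 'I_n.+1 => (j == ord_max)%:R) b0.
have sumE (g : 'I_n.+1 -> R) : \sum_j (j == ord_max)%:R * g j = g ord_max.
  by rewrite (bigD1 ord_max) //= eqxx mul1r big1 ?addr0 // => i /negPf ->; rewrite mul0r.
under eq_integral do rewrite sumE.
move=> ->; congr EFin; under eq_bigr do rewrite -mulrA.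
exact: (sumE (fun j : 'I_n.+1 => b ^+ j.+1 / j.+1%:R)).
Qed.

Lemma integral_radial_neg b : b < 0 ->
  (\int[lebesgue_measure]_(r in `]-oo, b]%classic) (radial_density r)%:E)%E = 0%E.
Proof.
move=> b0; apply: integral0_eq => r; rewrite /= in_itv /= => rb.
by rewrite /radial_density ltNge (ltW (le_lt_trans rb b0)).
Qed.

(** Dilation by 2 fixes the origin and multiplies volumes by a power of 2 greater than 1, so this
    finite volume vanishes. *)
Lemma lebesgue_origin : lebesgue_rV ([set 0] : set (borel_rV R m)) = 0%E.
Proof.
have m1 : measurable ([set 0] : set (borel_rV R m)) by exact: measurable_origin.
have f : lebesgue_rV ([set 0] : set (borel_rV R m)) \is a fin_num.
  rewrite ge0_fin_numE //; apply: (@lebesgue_bounded _ _ _ 1) => // x ->.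
  by rewrite normr0.
have u2 : (2 : R) != 0 by [].
have uM : ((2%:R : R)%:M : 'M[R]_m) \in unitmx by rewrite unitmxE det_scalar unitfE expf_neq0.
have := lebesgue_mulmx uM m1.
have -> : (fun x : 'rV[R]_m => x *m (2%:R : R)%:M) @^-1` [set 0] = [set 0].
  apply/seteqP; split => x /=; rewrite mul_mx_scalar => /eqP.
    by rewrite scaler_eq0 (negPf u2) /= => /eqP.
  by move=> /eqP ->; rewrite scaler0.
rewrite det_scalar -(fineK f); set x := fine _; rewrite -EFinM => -[E]; congr EFin.
have p2 : 1 < (2 : R) ^+ m by rewrite exprn_egt1 // ltr1n.
rewrite ger0_norm in E; last by rewrite exprn_ge0.
have p0 : (2 : R) ^+ m != 0 by rewrite expf_neq0.
have : (2 ^+ m - 1) * x = 0 by rewrite mulrBl mul1r {1}E mulrA mulfV // mul1r subrr.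
by move=> /eqP; rewrite mulf_eq0 subr_eq0 gt_eqF //= => /eqP.
Qed.

Lemma dir0 : dir 0 = 0. Proof. by rewrite /dir scaler0. Qed.

Lemma measurable_dirT : measurable_fun setT (dir : borel_rV R m -> borel_rV R m).
Proof.
apply: measurable_rV => i.
have -> : (fun t => dir t 0 i) = (fun t => dir t 0 i) \_ [set Y : E | Y != 0].
  apply/funext => Y; rewrite /patch; case: ifPn => // /negP; rewrite inE /= => /negP.
  by rewrite negbK => /eqP ->; rewrite dir0 mxE.
apply/(measurable_restrictT _ measurable_punctured).
exact: (measurable_comp measurableT (subsetT _) (@measurable_coord R m i) measurable_dir).
Qed.

(** For fixed [B] both sides are measures in [A] that agree on half-lines by [cone_measure], and
    [measure_unique_real] concludes. The origin, where the direction is meaningless, is split off as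
    a null set. *)
Lemma polar_rectangle (rho : {measure set (measurableTypeR R) -> \bar R})
    (A : set (measurableTypeR R)) (B : set (borel_rV R m)) :
  (forall I : set (measurableTypeR R), measurable I ->
    rho I = (\int[lebesgue_measure]_(r in I) (radial_density r)%:E)%E) ->
  measurable A -> measurable B ->
  lebesgue_rV ([set Y | A (enorm Y) /\ B (dir Y)] : set (borel_rV R m)) = (rho A * theta B)%E.
Proof.
move=> rhoE mA mB.
have mDB : measurable ([set Y : E | Y != 0] `&` dir @^-1` B : set (borel_rV R m)).
  exact: (measurable_dir measurable_punctured).
have mE : measurable_fun ([set Y : E | Y != 0] `&` dir @^-1` B : set (borel_rV R m))
    (@enorm R m : borel_rV R m -> measurableTypeR R) by exact: measurable_funTS measurable_enorm.
have [m1 m1E] := push_measure (@lebesgue_rV R m) mDB mE.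
have tB : (theta B < +oo)%E by apply: le_lt_trans sphere_finite; apply: le_measure; rewrite ?inE.
have tf : theta B \is a fin_num by rewrite ge0_fin_numE.
have t0 : (0 <= fine (theta B))%R by rewrite fine_ge0.
transitivity (m1 A).
  have mX : measurable ([set Y : E | A (enorm Y) /\ B (dir Y)] : set (borel_rV R m)).
    have -> : [set Y : E | A (enorm Y) /\ B (dir Y)] = (@enorm R m) @^-1` A `&` dir @^-1` B by [].
    apply: measurableI; rewrite -[X in measurable X]setTI; first exact: measurable_enorm.
    exact: measurable_dirT.
  rewrite m1E; apply: etrans (measureDI _ mX measurable_punctured) _.
  rewrite [X in (X + _)%E](_ : _ = 0%E) ?add0e.
    congr lebesgue_rV; apply/seteqP; split => Y /=; first by move=> [[]].
    by move=> [[? ?] ?].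
  apply/eqP; rewrite eq_le measure_ge0 andbT -lebesgue_origin; apply: le_measure; rewrite ?inE.
  - by apply: measurableD => //; exact: measurable_punctured.
  - exact: measurable_origin.
  - by move=> Y [_ /negP] /=; rewrite negbK => /eqP.
transitivity (mscale (NngNum t0) rho A); last by rewrite /mscale /= fineK // muleC.
have m1b b : m1 `]-oo, b]%classic = mscale (NngNum t0) rho `]-oo, b]%classic.
  have -> : mscale (NngNum t0) rho `]-oo, b]%classic = (theta B * rho `]-oo, b]%classic)%E.
    by rewrite -[in RHS](fineK tf).
  rewrite m1E rhoE; last exact: measurable_itv.
  have -> : [set Y : E | Y != 0] `&` dir @^-1` B `&` (@enorm R m) @^-1` `]-oo, b] = cone B b.
    apply/seteqP; split => Y /=; rewrite in_itv /=; first by move=> [[]].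
    by move=> [? []].
  have [b0|b0] := leP b 0.
    have -> : cone B b = set0.
      apply/seteqP; split => // Y [Y0 [Yb _]].
      by have := lt_le_trans (enorm_neq0 Y0) (le_trans Yb b0); rewrite ltxx.
    rewrite measure0; move: b0; rewrite le_eqVlt => /orP[/eqP ->|b0].
      by rewrite integral_radial // expr0n mul0r mule0.
    by rewrite integral_radial_neg // mule0.
  by rewrite integral_radial ?(ltW b0) //; apply: etrans (cone_measure mB b0) _; rewrite muleC.
apply: (measure_unique_real m1b) => // b; rewrite m1b /= /mscale /= rhoE; last exact: measurable_itv.
have [b0|b0] := leP 0 b; first by rewrite integral_radial // -EFinM ltry.
by rewrite integral_radial_neg // mule0.
Qed.

(** By [polar_rectangle] the image of Lebesgue measure under norm and direction is a product
    measure, to which Tonelli applies. At the origin [dir] is 0, so a point is always its norm times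
    its direction. *)
Lemma polar_integral (F : borel_rV R m -> \bar R) : measurable_fun setT F -> (forall Y, (0 <= F Y)%E) ->
  (\int[@lebesgue_rV R m]_Y F Y =
   \int[theta]_xi \int[lebesgue_measure]_r (F (r *: (xi : E)) * (radial_density r)%:E))%E.
Proof.
move=> mF F0.
have mg : measurable_fun setT (fun r : measurableTypeR R => (radial_density r)%:E).
  apply/measurable_EFinP; exact: measurable_radial_density.
have g0 (r : measurableTypeR R) : setT r -> (0 <= (radial_density r)%:E)%E.
  by rewrite lee_fin radial_density_ge0.
have [rho0 rho0E] := density_measure lebesgue_measure measurableT mg g0.
have rhoE (I : set (measurableTypeR R)) : measurable I ->
    rho0 I = (\int[lebesgue_measure]_(r in I) (radial_density r)%:E)%E.
  by move=> mI; rewrite rho0E setTI.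
have sfr : sigma_finite setT rho0.
  exists (fun k : nat => `]-oo, k%:R]%classic).
    apply/seteqP; split=> // x _; exists (Num.truncn `|x|).+1 => //=.
    by rewrite in_itv /= (le_trans (ler_norm x)) // ltW // truncnS_gt.
  by move=> k; split; [exact: measurable_itv|rewrite rhoE ?integral_radial ?ltry //; exact: measurable_itv].
have sft : sigma_finite setT theta.
  exists (fun _ => setT); first by rewrite bigcup_const //; exists 0%N.
  by move=> _; split => //; exact: sphere_finite.
have [rho rhoE'] := pack_sigma_finite sfr; have [th thE] := pack_sigma_finite sft.
pose D (Y : borel_rV R m) : measurableTypeR R * borel_rV R m := (enorm (Y : E), dir Y).
have mD : measurable_fun setT D by apply: measurable_fun_pair; [exact: measurable_enorm|exact: measurable_dirT].
have [q qE] := push_measure (@lebesgue_rV R m) measurableT mD.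
have rect A B : measurable A -> measurable B -> q (A `*` B) = (rho A * th B)%E.
  by move=> mA mB; rewrite qE rhoE' thE setTI; exact: polar_rectangle.
have prodE := product_measure_unique rect.
pose G (p : measurableTypeR R * borel_rV R m) : \bar R := F (p.1 *: (p.2 : E)).
have mP : measurable_fun setT (fun p : measurableTypeR R * borel_rV R m => (p.1 *: (p.2 : E) : borel_rV R m)).
  apply: measurable_rV => i; under eq_fun do rewrite mxE.
  apply: (measurable_funM (f := fun p : measurableTypeR R * borel_rV R m => p.1 : R)); first exact: measurable_fst.
  exact: (measurableT_comp (@measurable_coord R m i) measurable_snd).
have mG : measurable_fun setT G by exact: (measurableT_comp mF mP).
have G0 p : (0 <= G p)%E by exact: F0.
transitivity (\int[q]_p G p)%E.
  rewrite (integral_image_measure (mu := @lebesgue_rV R m) mD) //; last first.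
    by move=> B mB; rewrite qE setTI.
  apply: eq_integral => Y _; rewrite /G /D /=; congr F.
  by have [->|Y0] := eqVneq Y 0; rewrite ?dir0 ?scaler0 // dirK.
rewrite (eq_measure_integral (rho \x th)%E) => [|B mB _]; last first.
  by first [exact: prodE | exact: (esym (prodE _ mB))].
rewrite fubini_tonelli2 //.
rewrite (eq_measure_integral theta) => [|B mB _]; last exact: (congr1 (fun g => g B) thE).
apply: eq_integral => xi _; rewrite /fubini_G.
rewrite (eq_measure_integral rho0) => [|B mB _]; last exact: (congr1 (fun g => g B) rhoE').
apply: integral_density => //.
- exact: measurable_radial_density.
- exact: radial_density_ge0.
- by apply: (measurableT_comp mG); exact: measurable_fun_pair.
Qed.

End Polar.

(** * Parallel bodies along a ray *)

Section Expansion.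
Context {R : realType}.

Lemma bin2_natr m : 'C(m, 2)%:R * 2 = m%:R * (m%:R - 1) :> R.
Proof.
elim: m => [|m IH]; first by rewrite bin0n /= mul0r mul0r.
by rewrite binS bin1 natrD mulrDl IH -natr1; ring.
Qed.

Lemma pow_expansion m : exists2 B : R, 0 <= B & forall y, `|y| <= 1 ->
  `|(1 + y) ^+ m - (1 + m%:R * y + 'C(m, 2)%:R * y ^+ 2)| <= B * `|y| ^+ 3.
Proof.
elim: m => [|m [B B0 IH]].
  by exists 0 => // y _; rewrite expr0 bin0n /= !mul0r !addr0 subrr normr0.
exists ('C(m, 2)%:R + 2 * B) => [|y y1]; first by rewrite addr_ge0 ?mulr_ge0.
have -> : (1 + y) ^+ m.+1 - (1 + m.+1%:R * y + 'C(m.+1, 2)%:R * y ^+ 2) =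
    'C(m, 2)%:R * y ^+ 3 +
    (1 + y) * ((1 + y) ^+ m - (1 + m%:R * y + 'C(m, 2)%:R * y ^+ 2)).
  by rewrite binS bin1 natrD exprS -[m.+1%:R]natr1; ring.
apply: le_trans (ler_normD _ _) _; rewrite [X in _ <= X]mulrDl; apply: lerD.
  by rewrite normrM normrX ger0_norm.
rewrite normrM -mulrA; apply: ler_pM => //; last exact: IH.
by apply: le_trans (ler_normD _ _) _; rewrite normr1; lra.
Qed.

(** For [s = 1/t] and excess [e], the radial function times [s] is [s u + sqrt (1 + 2 w)] with
    [w = s^2 (u^2 - e) / 2]; this replaces the root by its upper bound [1 + w]. *)
Definition radius_up (s u e : R) : R := 1 + s * u + s ^+ 2 * (u ^+ 2 - e) / 2.

(** Uses the lower bound [1 + w - w^2] of the same root, valid for small [w]. *)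
Definition radius_low (s u e : R) : R :=
  radius_up s u e - (s ^+ 2 * (u ^+ 2 - e) / 2) ^+ 2.

(** Taylor polynomial of degree 2 in [s] common to the [m]-th powers of both bounds; the coefficient
    of [u^2] merges the correction term with the second binomial term. *)
Definition radius_poly m (s u e : R) : R :=
  1 + m%:R * u * s + (m%:R * u ^+ 2 - e) * (m%:R / 2 * s ^+ 2).

Lemma radius_corr (M s u e : R) : 0 < s -> s * M <= 8^-1 -> `|u| <= M -> 0 <= e <= M ^+ 2 ->
  `|s ^+ 2 * (u ^+ 2 - e) / 2| <= (s * M) ^+ 2 / 2.
Proof.
move=> s0 sM uM /andP[e0 eM]; have M0 : 0 <= M by apply: le_trans uM.
have u2 : u ^+ 2 <= M ^+ 2 by rewrite -[u ^+ 2]ger0_norm ?sqr_ge0 // normrX lerXn2r ?nnegrE.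
have u20 := sqr_ge0 u; have s2 := sqr_ge0 s.
rewrite normrM [ `|2^-1|]ger0_norm ?invr_ge0 // ler_pM2r ?invr_gt0 // normrM ger0_norm //.
by rewrite exprMn; apply: ler_wpM2l => //; rewrite ler_norml; apply/andP; split; lra.
Qed.

(** The threshold [8^-1] for [s M] keeps the increment [y] below 1 in absolute value, so
    [pow_expansion] applies, and every remainder is a multiple of the cube of [s M]. *)
Lemma radius_expansion m (M : R) : 0 < M -> exists2 D : R, 0 <= D & forall s u e,
  0 < s -> s * M <= 8^-1 -> `|u| <= M -> 0 <= e <= M ^+ 2 ->
  radius_up s u e ^+ m <= radius_poly m s u e + D * s ^+ 3 /\
  radius_poly m s u e - D * s ^+ 3 <= radius_low s u e ^+ m.
Proof.
move=> M0; have [B B0 HB] := pow_expansion m.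
pose C : R := 'C(m, 2)%:R; have C0 : 0 <= C by [].
pose k : R := m%:R; have k0 : 0 <= k by [].
exists ((8 * B + 3 * C + k) * M ^+ 3).
  by rewrite mulr_ge0 ?exprn_ge0 ?(ltW M0) // !addr_ge0 ?mulr_ge0.
move=> s u e s0 sM uM eM; set w := s ^+ 2 * (u ^+ 2 - e) / 2.
have wb : `|w| <= (s * M) ^+ 2 / 2 by exact: radius_corr.
have su : `|s * u| <= s * M by rewrite normrM gtr0_norm // ler_pM2l.
set x := s * u in su; set z := s * M in sM wb su.
have z0 : 0 <= z by rewrite mulr_ge0 ?ltW.
have z2 : z ^+ 2 <= z / 8 by rewrite expr2; apply: ler_wpM2l.
(* Both bounds have this form, with [q = 0] for the upper and [q = w ^+ 2] for the lower one. *)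
have key q : 0 <= q <= w ^+ 2 ->
    `|(1 + (x + w - q)) ^+ m - radius_poly m s u e| <= (8 * B + 3 * C + k) * z ^+ 3.
  move=> /andP[q0 qw]; set y := x + w - q.
  have w2 : w ^+ 2 <= z ^+ 4 / 4.
    rewrite -[w ^+ 2]ger0_norm ?sqr_ge0 // normrX.
    by have := lerXn2r 2 (normr_ge0 w : _ \in Num.nneg) (_ : _ \in Num.nneg) wb; rewrite ?nnegrE => H; apply: le_trans (H _) _; [rewrite mulr_ge0 ?sqr_ge0 ?invr_ge0|rewrite exprMn; lra].
  have z3 : 0 <= z ^+ 3 by exact: exprn_ge0.
  have z4 : z ^+ 4 <= z ^+ 3 / 8 by rewrite (exprSr z 3); apply: ler_wpM2l.
  have z32 : z ^+ 3 <= z ^+ 2 / 8 by rewrite (exprSr z 2); apply: ler_wpM2l => //; exact: sqr_ge0.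
  have [wl wu] : - (z ^+ 2 / 2) <= w /\ w <= z ^+ 2 / 2 by apply/andP; rewrite -ler_norml.
  have [xl xu] : - z <= x /\ x <= z by apply/andP; rewrite -ler_norml.
  have yz : `|y| <= 2 * z by rewrite ler_norml; apply/andP; split; rewrite /y; lra.
  have yx : `|y - x| <= z ^+ 2 by rewrite ler_norml; apply/andP; split; rewrite /y; lra.
  have yx' : `|y + x| <= 3 * z by rewrite ler_norml; apply/andP; split; rewrite /y; lra.
  have y1 : `|y| <= 1 by apply: le_trans yz _; lra.
  have -> : (1 + y) ^+ m - radius_poly m s u e =
      ((1 + y) ^+ m - (1 + k * y + C * y ^+ 2)) + C * ((y - x) * (y + x)) - k * q.
    have E : radius_poly m s u e = 1 + k * (x + w) + C * x ^+ 2.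
      have CE : C * 2 = k * (k - 1) by exact: bin2_natr.
      have {}CE : C = k * (k - 1) / 2 by rewrite -CE mulfK.
      by rewrite /radius_poly CE /x /w /k; field.
    by rewrite E /y; ring.
  have h1 : `|(1 + y) ^+ m - (1 + k * y + C * y ^+ 2)| <= B * (8 * z ^+ 3).
    apply: le_trans (HB y y1) _; apply: ler_wpM2l => //.
    have -> : 8 * z ^+ 3 = (2 * z) ^+ 3 by ring.
    by apply: lerXn2r => //; rewrite nnegrE // mulr_ge0.
  have h2 : `|C * ((y - x) * (y + x))| <= C * (3 * z ^+ 3).
    rewrite normrM ger0_norm //; apply: ler_wpM2l => //; rewrite normrM.
    by apply: le_trans (ler_pM _ _ yx yx') _ => //; have -> : z ^+ 2 * (3 * z) = 3 * z ^+ 3 by ring.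
  have h3 : `|k * q| <= k * z ^+ 3 by rewrite ger0_norm ?mulr_ge0 //; apply: ler_wpM2l => //; lra.
  apply: le_trans (ler_normB _ _) _; apply: le_trans (lerD (le_trans (ler_normD _ _) (lerD h1 h2)) h3) _.
  by rewrite le_eqVlt; apply/orP; left; apply/eqP; ring.
have DE : (8 * B + 3 * C + k) * M ^+ 3 * s ^+ 3 = (8 * B + 3 * C + k) * z ^+ 3 by rewrite /z; ring.
rewrite DE; have w20 := sqr_ge0 w; split.
  have q0 : 0 <= (0 : R) <= w ^+ 2 by rewrite lexx.
  have := key 0 q0; rewrite subr0 addrA ler_norml => /andP[_]; rewrite lerBlDr -/(radius_up s u e).
  by rewrite addrC.
have q0 : 0 <= w ^+ 2 <= w ^+ 2 by rewrite w20 lexx.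
have := key (w ^+ 2) q0; rewrite !addrA ler_norml => /andP[+ _].
by rewrite -/(radius_up s u e) -/(radius_low s u e) lerBrDr addrC.
Qed.

End Expansion.

(** * Variational properties of the excess and the radial function *)

Section Excess.
Context {R : realType} {n : nat}.
Variable Omega : set 'rV[R]_n.+1.
Hypothesis (hne : Omega !=set0) (hopen : open Omega) (hbdd : bounded_set Omega).
Hypothesis hconv : convex_set (Omega : set (convex_lmodType 'rV[R]_n.+1)).
Variable M : R.
Hypotheses (M0 : 0 < M) (hM : forall x, closure Omega x -> enorm x <= M).

Local Notation E := 'rV[R]_n.+1.
Local Notation K := (closure Omega).
Local Notation u := (support_function Omega).
Local Notation p := (proj Omega).
Local Notation d := (bdist Omega).

(** [excess (R *: xi)] is the quantity [m_R] of the introduction. *)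
Definition excess (Y : E) : R := d Y ^+ 2 - dot Y Y + 2 * u Y.

Lemma excessE Y : excess Y = dot (p Y) (p Y) + 2 * (u Y - dot (p Y) Y).
Proof.
rewrite /excess /bdist enorm_sqr !dot_bilin (dotC Y (p Y)).
set a := dot Y Y; set b := dot _ _; set c := dot _ _; set e := u Y.
by clearbody a b c e; ring.
Qed.

Lemma proj_le_excess Y : dot (p Y) (p Y) <= excess Y.
Proof.
have [KY _] := projP hne hbdd hconv Y.
by rewrite excessE lerDl mulr_ge0 // subr_ge0; exact: supp_fun_ge.
Qed.

Lemma excess_ge0 Y : 0 <= excess Y.
Proof. exact: le_trans (dot_ge0 _) (proj_le_excess Y). Qed.

(** The obtuse angle inequality and the expansion of the squared norm of [p Y - z] show that the
    projection minimises the right-hand side. The properties below come from testing suitable points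
    [z]. *)
Lemma excess_le z Y : K z -> excess Y <= dot z z + 2 * (u Y - dot z Y).
Proof.
move=> Kz; have [_ /(_ z Kz)] := projP hne hbdd hconv Y; rewrite excessE.
have := dot_ge0 (p Y - z); rewrite !dot_bilin (dotC z (p Y)) (dotC Y z) (dotC Y (p Y)).
set a := dot z z; set b := dot (p Y) (p Y); set c := dot z Y; set e := dot (p Y) Y.
set f := dot (p Y) z; set h := u Y; clearbody a b c e f h => h1 h2; lra.
Qed.

(** Tested at a support point in the direction [Y], where the gap term vanishes. *)
Lemma excess_bound Y : 0 <= excess Y <= M ^+ 2.
Proof.
rewrite excess_ge0 /=; have [x [Kx uE _]] := supp_fun_attained hne hbdd Y.
have := excess_le Y Kx; rewrite uE subrr mulr0 addr0 => /le_trans; apply.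
by rewrite -enorm_sqr; apply: lerXn2r; rewrite ?nnegrE ?enorm_ge0 ?(ltW M0) // hM.
Qed.

Lemma supp_funZ a Y : 0 <= a -> u (a *: Y) = a * u Y.
Proof.
move=> a0; have [x [Kx ux _]] := supp_fun_attained hne hbdd Y.
have [z [Kz uz _]] := supp_fun_attained hne hbdd (a *: Y).
apply/eqP; rewrite eq_le; apply/andP; split.
  by rewrite uz dotZr; apply: ler_wpM2l => //; exact: supp_fun_ge.
by rewrite ux -dotZr; exact: supp_fun_ge.
Qed.

(** The projection of the farther point is tested at the nearer one; its gap to the support function
    is nonnegative and scales linearly along the ray. *)
Lemma excess_mono a b Y : 0 <= a <= b -> excess (a *: Y) <= excess (b *: Y).
Proof.
move=> /andP[a0 ab]; have b0 := le_trans a0 ab.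
have [Kp _] := projP hne hbdd hconv (b *: Y).
apply: le_trans (excess_le (a *: Y) Kp) _; rewrite [X in _ <= X]excessE lerD2l ler_pM2l //.
rewrite !supp_funZ // !dotZr -!mulrBr; apply: ler_wpM2r => //.
by rewrite subr_ge0; exact: supp_fun_ge.
Qed.

(** The projection of [Y] is tested at half of [Y], which halves the gap term and keeps the squared
    norm. *)
Lemma excess_half Y : 2 * excess (2^-1 *: Y) <= dot (p Y) (p Y) + excess Y.
Proof.
have [Kp _] := projP hne hbdd hconv Y; have := excess_le (2^-1 *: Y) Kp.
rewrite [excess Y]excessE supp_funZ ?invr_ge0 // dotZr.
set a := excess _; set b := dot _ _; set c := dot _ _; set e := u Y.
by clearbody a b c e => h; lra.
Qed.

Lemma excess_continuous Y : cont_at excess Y.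
Proof.
have c1 : cont_at d Y by exact: bdist_continuous.
have c2 : cont_at u Y by exact: supp_fun_continuous.
have c3 : cont_at (fun Z : E => dot Z Z) Y by exact: (cvg_dot cvg_id cvg_id).
have c4 : cont_at (fun Z => d Z * d Z - dot Z Z) Y.
  by apply: cont_atD; [exact: cont_atM|exact: cont_atN].
have -> : excess = (fun Z => (d Z * d Z - dot Z Z) + 2 * u Z) by [].
by apply: cont_atD => //; apply: cont_atM => //; exact: cont_at_cst.
Qed.

Lemma bdist_ray xi r : dot xi xi = 1 -> 0 <= r ->
  d (r *: xi) ^+ 2 = (r - u xi) ^+ 2 - u xi ^+ 2 + excess (r *: xi).
Proof.
move=> x1 r0; rewrite /excess supp_funZ // dotZl dotZr x1.
set a := d _; set b := u xi; clearbody a b; ring.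
Qed.

Lemma supp_fun_le xi : dot xi xi = 1 -> `|u xi| <= M.
Proof.
move=> /enorm1P x1; have := supp_fun_bound hne hbdd xi hM.
by rewrite x1 mulr1.
Qed.

(** A larger [r] would satisfy [s r > 1/2], so its excess would be at least the one at distance
    [1 / (2 s)], and [bdist_ray] would put the point farther than [1 / s] from the body. *)
Lemma radius_up_le xi s r : dot xi xi = 1 -> 0 < s -> s * M <= 8^-1 -> 0 < r ->
  d (r *: xi) <= s^-1 -> s * r <= radius_up s (u xi) (excess ((2 * s)^-1 *: xi)).
Proof.
move=> x1 s0 sM r0 dr; set b := excess _; set U := u xi.
have uM := supp_fun_le x1; rewrite -/U in uM.
have bM : 0 <= b <= M ^+ 2 by exact: excess_bound.
have := radius_corr s0 sM uM bM; set w := _ / 2 => wb.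
rewrite /radius_up -/w leNgt; apply/negP => lt.
have sU : `|s * U| <= s * M by rewrite normrM gtr0_norm // ler_pM2l.
set z := s * M in sM wb sU.
have z0 : 0 <= z by rewrite mulr_ge0 ?ltW.
have z2 : z ^+ 2 <= z / 8 by rewrite expr2; apply: ler_wpM2l.
have [wl wu] : - (z ^+ 2 / 2) <= w /\ w <= z ^+ 2 / 2 by apply/andP; rewrite -ler_norml.
have [xl xu] : - z <= s * U /\ s * U <= z by apply/andP; rewrite -ler_norml.
have r2 : (2 * s)^-1 <= r.
  by rewrite invfM mulrC ler_pdivrMl // mulrC; lra.
have be : b <= excess (r *: xi).
  by apply: excess_mono; rewrite r2 invr_ge0 mulr_ge0 // ltW.
have sd : (s * d (r *: xi)) ^+ 2 <= 1.
  have sd1 : s * d (r *: xi) <= 1 by rewrite mulrC -ler_pdivlMr // mul1r.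
  by apply: exprn_ile1 => //; rewrite mulr_ge0 ?(ltW s0) // bdist_ge0.
rewrite exprMn (bdist_ray x1 (ltW r0)) -/U in sd.
have sbe : s ^+ 2 * b <= s ^+ 2 * excess (r *: xi) by apply: ler_wpM2l => //; exact: sqr_ge0.
set q := excess _ in be sd sbe; set y := s * r - s * U.
have y1 : (1 + w) ^+ 2 < y ^+ 2.
  by rewrite ltrXn2r ?nnegrE //; rewrite /y; lra.
have ye : s ^+ 2 * ((r - U) ^+ 2 - U ^+ 2 + q) = y ^+ 2 - s ^+ 2 * U ^+ 2 + s ^+ 2 * q by rewrite /y; ring.
have we : 2 * w = s ^+ 2 * U ^+ 2 - s ^+ 2 * b by rewrite /w; field.
have w2 := sqr_ge0 w; have e2 : (1 + w) ^+ 2 = 1 + 2 * w + w ^+ 2 by ring.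
lra.
Qed.

(** Here [s r <= 2], so the excess at [r] is at most the one at distance [2 / s], and the square of
    [1 + w - w^2] does not exceed [1 + 2 w]. *)
Lemma radius_low_le xi s r : dot xi xi = 1 -> 0 < s -> s * M <= 8^-1 -> 0 < r ->
  s * r <= radius_low s (u xi) (excess ((2 / s) *: xi)) -> d (r *: xi) <= s^-1.
Proof.
move=> x1 s0 sM r0; set a := excess _; set U := u xi.
have uM := supp_fun_le x1; rewrite -/U in uM.
have aM : 0 <= a <= M ^+ 2 by exact: excess_bound.
have := radius_corr s0 sM uM aM; rewrite /radius_low /radius_up; set w := _ / 2 => wb sr.
have sU : `|s * U| <= s * M by rewrite normrM gtr0_norm // ler_pM2l.
set z := s * M in sM wb sU.
have z0 : 0 <= z by rewrite mulr_ge0 ?ltW.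
have z2 : z ^+ 2 <= z / 8 by rewrite expr2; apply: ler_wpM2l.
have [wl wu] : - (z ^+ 2 / 2) <= w /\ w <= z ^+ 2 / 2 by apply/andP; rewrite -ler_norml.
have [xl xu] : - z <= s * U /\ s * U <= z by apply/andP; rewrite -ler_norml.
have w2 := sqr_ge0 w; have w3 : w ^+ 2 <= 1 / 8.
  rewrite -[w ^+ 2]ger0_norm ?sqr_ge0 // normrX; apply: le_trans (_ : (1 / 8) ^+ 2 <= _); last by lra.
  by apply: lerXn2r; rewrite ?nnegrE //; lra.
have r2 : r <= 2 / s by rewrite ler_pdivlMr // mulrC; lra.
have ea : excess (r *: xi) <= a by apply: excess_mono; rewrite r2 ltW.
have sea : s ^+ 2 * excess (r *: xi) <= s ^+ 2 * a by apply: ler_wpM2l => //; exact: sqr_ge0.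
have sr0 : 0 < s * r by rewrite mulr_gt0.
suff H : (s * d (r *: xi)) ^+ 2 <= 1 ^+ 2.
  have sd0 : 0 <= s * d (r *: xi) by rewrite mulr_ge0 ?(ltW s0) // bdist_ge0.
  by move: H; rewrite ler_pXn2r ?nnegrE // => H; rewrite -[s^-1]mul1r ler_pdivlMr // mulrC.
rewrite exprMn (bdist_ray x1 (ltW r0)) -/U.
set q := excess _ in ea sea *; set y := s * r - s * U.
have y1 : y ^+ 2 <= (1 + w - w ^+ 2) ^+ 2.
  rewrite -[y ^+ 2]ger0_norm ?sqr_ge0 // normrX; apply: lerXn2r; rewrite ?nnegrE //; first by lra.
  by rewrite ler_norml; apply/andP; split; rewrite /y; lra.
have ye : s ^+ 2 * ((r - U) ^+ 2 - U ^+ 2 + q) = y ^+ 2 - s ^+ 2 * U ^+ 2 + s ^+ 2 * q by rewrite /y; ring.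
have we : 2 * w = s ^+ 2 * U ^+ 2 - s ^+ 2 * a by rewrite /w; field.
have e2 : (1 + w - w ^+ 2) ^+ 2 = 1 + 2 * w - w ^+ 2 * (1 + 2 * w - w ^+ 2) by ring.
have e3 : 0 <= w ^+ 2 * (1 + 2 * w - w ^+ 2) by rewrite mulr_ge0 //; lra.
rewrite expr1n; lra.
Qed.

End Excess.

Lemma cont_atX (R : realType) (V : normedModType R) (f : V -> R) x k : cont_at f x -> cont_at (fun y => f y ^+ k) x.
Proof.
move=> cf; elim: k => [|k IH]; first exact: cont_at_cst.
under eq_fun do rewrite exprS.
by have := cont_atM cf IH; rewrite /cont_at /prop_for /continuous_at -exprS.
Qed.

(** * Integrals over the unit sphere and bounds along rays *)

Section SphereIntegral.
Context {R : realType} {n : nat}.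
Local Notation E := 'rV[R]_n.+1.
Local Notation m := (n.+1).
Variable theta : {measure set (borel_rV R m) -> \bar R}.
Hypothesis htheta : is_area_measure (@esphere R m) theta.
Local Notation S := (@esphere R m : set (borel_rV R m)).

Lemma measurable_sphere : measurable S.
Proof. by rewrite -boundary_unit_ball; exact: (measurable_boundary unit_ball_open). Qed.

Lemma sphere_integral_setT (f : borel_rV R m -> \bar R) : measurable_fun setT f ->
  (forall x, (0 <= f x)%E) -> (\int[theta]_xi f xi = \int[theta]_(xi in S) f xi)%E.
Proof.
move=> mf f0; rewrite (ge0_negligible_integral (N := ~` S)) // ?htheta.1 //.
  by rewrite setTD setCK.
by apply: measurableC; exact: measurable_sphere.
Qed.

Lemma sphere_area_lty : (theta S < +oo)%E.
Proof.
apply: le_lt_trans (sphere_finite htheta); apply: le_measure; rewrite ?inE //.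
exact: measurable_sphere.
Qed.

Lemma continuous_measurable_cont_at (f : E -> R) : (forall x, cont_at f x) ->
  measurable_fun setT (f : borel_rV R m -> R).
Proof. by move=> cf; apply: continuous_measurable_rV => x; exact: cf. Qed.

Lemma sphere_integrable (f : E -> R) : (forall x, cont_at f x) ->
  theta.-integrable S (EFin \o f).
Proof.
move=> cf; apply: measurable_bounded_integrable; first exact: measurable_sphere.
- exact: sphere_area_lty.
- by apply: measurable_funTS; exact: continuous_measurable_cont_at.
have Sc x : esphere x -> closure (@unit_ball R n) x.
  by rewrite closure_unit_ball /esphere /eball /= => ->.
have [a _ Ha] := body_min unit_ball_nonempty unit_ball_bounded cf.
have [b _ Hb] := body_min unit_ball_nonempty unit_ball_bounded (fun x => cont_atN (cf x)).
exists (`|f a| + `|f b|); split; first exact: num_real.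
move=> y yM x /Sc xS; apply: le_trans (ltW yM); rewrite ler_norml.
have h1 := Ha _ xS; have h2 := Hb _ xS; rewrite lerN2 in h2.
have a1 : - `|f a| <= f a by exact: lerNnormlW (lexx _).
have b1 := ler_norm (f b); have b0 := normr_ge0 (f b); have a0 := normr_ge0 (f a).
by apply/andP; split; lra.
Qed.

Definition sphere_int (f : E -> R) : R := (\int[theta]_(xi in S) f xi).

Lemma sphere_intE (f : E -> R) : (forall x, cont_at f x) ->
  (\int[theta]_(xi in S) (f xi)%:E = (sphere_int f)%:E)%E.
Proof.
move=> cf; rewrite /sphere_int /Rintegral fineK //.
by apply: integrable_fin_num; [exact: measurable_sphere|exact: sphere_integrable].
Qed.

Lemma sphere_int_le (f g : E -> R) : (forall x, cont_at f x) -> (forall x, cont_at g x) ->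
  (forall x, dot x x = 1 -> f x <= g x) -> sphere_int f <= sphere_int g.
Proof.
move=> cf cg fg; apply: le_Rintegral; try exact: sphere_integrable; first exact: measurable_sphere.
by move=> x /enorm1P; exact: fg.
Qed.

Lemma sphere_intD (f g : E -> R) : (forall x, cont_at f x) -> (forall x, cont_at g x) ->
  sphere_int (fun x => f x + g x) = sphere_int f + sphere_int g.
Proof. by move=> cf cg; apply: RintegralD; try exact: sphere_integrable; exact: measurable_sphere. Qed.

Lemma sphere_intZ a (f : E -> R) : (forall x, cont_at f x) ->
  sphere_int (fun x => a * f x) = a * sphere_int f.
Proof. by move=> cf; apply: RintegralZl; try exact: sphere_integrable; exact: measurable_sphere. Qed.

Lemma sphere_intB (f g : E -> R) : (forall x, cont_at f x) -> (forall x, cont_at g x) ->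
  sphere_int (fun x => f x - g x) = sphere_int f - sphere_int g.
Proof. by move=> cf cg; apply: RintegralB; try exact: sphere_integrable; exact: measurable_sphere. Qed.

Lemma sphere_int_cst a : sphere_int (fun=> a) = a * sphere_area theta.
Proof. by apply: Rintegral_cst; exact: measurable_sphere. Qed.

Lemma sphere_int_ge0 (f : E -> R) : (forall x, dot x x = 1 -> 0 <= f x) -> 0 <= sphere_int f.
Proof. by move=> f0; apply: Rintegral_ge0 => x /enorm1P; exact: f0. Qed.

Section Polar.
Variable F : borel_rV R m -> \bar R.
Hypotheses (mF : measurable_fun setT F) (F0 : forall Y, (0 <= F Y)%E).

Let ray (xi : E) : measurableTypeR R -> \bar R := fun r => (F (r *: xi) * (radial_density (n := n) r)%:E)%E.

Lemma ray_ge0 xi r : (0 <= ray xi r)%E.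
Proof. by apply: mule_ge0 => //; rewrite lee_fin radial_density_ge0. Qed.

Lemma measurable_radial_EFin : measurable_fun setT (fun r : measurableTypeR R => (radial_density (n := n) r)%:E).
Proof. by apply/measurable_EFinP; exact: measurable_radial_density. Qed.

Lemma measurable_ray xi : measurable_fun setT (ray xi).
Proof.
apply: emeasurable_funM; last exact: measurable_radial_EFin.
apply: (measurableT_comp mF); apply: measurable_rV => i; under eq_fun do rewrite mxE.
by apply: measurable_funM.
Qed.

Lemma ray_upper xi (c rho : R) : 0 <= c -> 0 <= rho ->
  (forall r, 0 < r -> (F (r *: xi) <= c%:E)%E) -> (forall r, rho < r -> F (r *: xi) = 0%E) ->
  (\int[lebesgue_measure]_r ray xi r <= (c * (rho ^+ m / m%:R))%:E)%E.
Proof.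
move=> c0 rho0 Fc Frho; rewrite EFinM -integral_radial //.
have mI : measurable (`]-oo, rho]%classic : set (measurableTypeR R)) by exact: measurable_itv.
rewrite -ge0_integralZl_EFin //; last 2 first.
- by move=> r _; rewrite lee_fin radial_density_ge0.
- by apply: measurable_funTS; exact: measurable_radial_EFin.
rewrite [X in (_ <= X)%E]integral_mkcond; apply: ge0_le_integral => //.
- by move=> r _; exact: ray_ge0.
- exact: measurable_ray.
- apply/(measurable_restrictT _ mI); apply: measurable_funTS.
  by apply: emeasurable_funM => //; exact: measurable_radial_EFin.
move=> r _; rewrite /patch; case: ifPn => [_|].
  rewrite /ray; have [r0|r0] := ltP 0 r.
    by apply: lee_wpmul2r; [rewrite lee_fin radial_density_ge0|exact: Fc].
  by rewrite /radial_density ltNge r0 /= !mule0.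
move=> /negP; rewrite inE /= in_itv /= => /negP; rewrite -ltNge => rr.
by rewrite /ray Frho // mul0e.
Qed.

Lemma ray_lower xi (c a rho : R) : 0 <= c -> 0 <= a -> a <= rho ->
  (forall r, a < r -> r <= rho -> (c%:E <= F (r *: xi))%E) ->
  ((c * ((rho ^+ m - a ^+ m) / m%:R))%:E <= \int[lebesgue_measure]_r ray xi r)%E.
Proof.
move=> c0 a0 ar Fc.
have mI (b : R) : measurable (`]-oo, b]%classic : set (measurableTypeR R)) by exact: measurable_itv.
have mJ : measurable (`]a, rho]%classic : set (measurableTypeR R)) by exact: measurable_itv.
have mR D := measurable_funTS (D := D) measurable_radial_EFin.
have r0 (r : measurableTypeR R) : (0 <= (radial_density (n := n) r)%:E)%E.
  by rewrite lee_fin radial_density_ge0.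
have E2 : (\int[lebesgue_measure]_(r in `]a, rho]%classic) (radial_density (n := n) r)%:E =
    ((rho ^+ m - a ^+ m) / m%:R)%:E)%E.
  have := integral_radial (n := n) (le_trans a0 ar).
  have -> : (`]-oo, rho]%classic = `]-oo, a] `|` `]a, rho] :> set R)%classic.
    by rewrite -itv_bndbnd_setU // bnd_simp.
  rewrite ge0_integral_setU //; last first.
    apply/disj_setPS => x [/=]; rewrite !in_itv /= => xa /andP[ax _].
    by move: (lt_le_trans ax xa); rewrite ltxx.
  rewrite integral_radial // => H.
  set J := (\int[_]_(_ in _) _)%E in H *.
  have -> : J = ((a ^+ m / m%:R)%:E + J - (a ^+ m / m%:R)%:E)%E by rewrite [(_ + J)%E]addeC addeK.
  by rewrite H -EFinB -mulrBl.
rewrite EFinM -E2 -ge0_integralZl_EFin //.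
rewrite [X in (X <= _)%E]integral_mkcond; apply: ge0_le_integral => //.
- by move=> r _; rewrite /patch; case: ifPn => // _; apply: mule_ge0.
- apply/(measurable_restrictT _ mJ).
  by apply: emeasurable_funM => //; exact: mR.
- exact: measurable_ray.
move=> r _; rewrite /patch; case: ifPn => [|_]; last exact: ray_ge0.
rewrite inE /= in_itv /= => /andP[h1 h2]; apply: lee_wpmul2r => //; exact: Fc.
Qed.

Lemma measurable_ray_integral :
  measurable_fun setT (fun xi : borel_rV R m => \int[lebesgue_measure]_r ray xi r)%E.
Proof.
pose G (p : measurableTypeR R * borel_rV R m) : \bar R := ray p.2 p.1.
have G0 p : (0 <= G p)%E by exact: ray_ge0.
have mG : measurable_fun setT G.
  apply: emeasurable_funM; last exact: (measurableT_comp measurable_radial_EFin measurable_fst).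
  apply: (measurableT_comp mF); apply: measurable_rV => i; under eq_fun do rewrite mxE.
  apply: (measurable_funM (f := fun p : measurableTypeR R * borel_rV R m => p.1 : R)); first exact: measurable_fst.
  exact: (measurableT_comp (@measurable_coord R m i) measurable_snd).
exact: (@measurable_fun_fubini_tonelli_G _ _ (measurableTypeR R) (borel_rV R m) R lebesgue_measure G mG G0).
Qed.

(** Bounds on each ray with continuous [c] and [rho] are enough, so the exact radial function of the
    domain never has to be integrated. *)
Lemma polar_upper (c rho : E -> R) : (forall x, cont_at c x) -> (forall x, cont_at rho x) ->
  (forall x, 0 <= c x) ->
  (forall x, dot x x = 1 -> [/\ 0 <= rho x, forall r, 0 < r -> (F (r *: x) <= (c x)%:E)%E &
     forall r, rho x < r -> F (r *: x) = 0%E]) ->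
  (\int[@lebesgue_rV R m]_Y F Y <= (m%:R^-1 * sphere_int (fun x => (c x * rho x ^+ m)%R))%:E)%E.
Proof.
move=> cc cr c0 H; rewrite (polar_integral htheta) // sphere_integral_setT; last 2 first.
- exact: measurable_ray_integral.
- by move=> xi; apply: integral_ge0 => r _; exact: ray_ge0.
have cf x : cont_at (fun x => c x * rho x ^+ m) x by apply: cont_atM => //; exact: cont_atX.
rewrite -sphere_intZ // -sphere_intE; last by move=> x; apply: cont_atM => //; exact: cont_at_cst.
apply: ge0_le_integral; first exact: measurable_sphere.
- by move=> xi _; apply: integral_ge0 => r _; exact: ray_ge0.
- by apply: measurable_funTS; exact: measurable_ray_integral.
- apply: measurable_funTS; apply/measurable_EFinP; apply: continuous_measurable_cont_at => x.
  by apply: cont_atM => //; exact: cont_at_cst.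
move=> x /enorm1P /H[r0 h1 h2]; apply: le_trans (ray_upper (c0 x) r0 h1 h2) _.
by rewrite [m%:R^-1 * _]mulrC -mulrA.
Qed.

(** The inner radius [a] discards the part of the ray without a lower bound: it is 0 for the
    parallel body, and a radius enclosing the body for the tube. *)
Lemma polar_lower (a : R) (c rho : E -> R) : (forall x, cont_at c x) -> (forall x, cont_at rho x) ->
  0 <= a -> (forall x, 0 <= c x) ->
  (forall x, dot x x = 1 -> a <= rho x /\
     forall r, a < r -> r <= rho x -> ((c x)%:E <= F (r *: x))%E) ->
  ((m%:R^-1 * sphere_int (fun x => (c x * (rho x ^+ m - a ^+ m))%R))%:E <= \int[@lebesgue_rV R m]_Y F Y)%E.
Proof.
move=> cc cr a0 c0 H; rewrite (polar_integral htheta) // sphere_integral_setT; last 2 first.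
- exact: measurable_ray_integral.
- by move=> xi; apply: integral_ge0 => r _; exact: ray_ge0.
have cf x : cont_at (fun x => c x * (rho x ^+ m - a ^+ m)) x.
  by apply: cont_atM => //; apply: cont_atD; [exact: cont_atX|exact: cont_at_cst].
have mc : measurable_fun setT (fun x : borel_rV R m => (m%:R^-1 * (c x * (rho x ^+ m - a ^+ m)))%:E).
  apply/measurable_EFinP; apply: continuous_measurable_cont_at => x.
  by apply: cont_atM => //; exact: cont_at_cst.
rewrite -sphere_intZ // -sphere_intE; last by move=> x; apply: cont_atM => //; exact: cont_at_cst.
apply: ge0_le_integral; first exact: measurable_sphere.
- move=> x /enorm1P /H[ar _]; rewrite lee_fin mulr_ge0 ?invr_ge0 // mulr_ge0 // subr_ge0.
  by apply: lerXn2r; rewrite ?nnegrE // (le_trans a0 ar).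
- exact: measurable_funTS.
- by apply: measurable_funTS; exact: measurable_ray_integral.
move=> x /enorm1P /H[ar h]; apply: le_trans (ray_lower (c0 x) a0 ar h).
by rewrite mulrCA [_^-1 * _]mulrC.
Qed.

End Polar.
End SphereIntegral.

(** * Expansion of the volume of parallel bodies and of weighted tubes *)

Section Asymptotics.
Context {R : realType} {n : nat}.
Local Notation E := 'rV[R]_n.+1.
Local Notation m := (n.+1).
Variable theta : {measure set (borel_rV R m) -> \bar R}.
Hypothesis htheta : is_area_measure (@esphere R m) theta.
Variable Omega : set 'rV[R]_n.+1.
Hypothesis (hne : Omega !=set0) (hopen : open Omega) (hbdd : bounded_set Omega).
Hypothesis hconv : convex_set (Omega : set (convex_lmodType 'rV[R]_n.+1)).
Variable M : R.
Hypotheses (M0 : 0 < M) (hM : forall x, closure Omega x -> enorm x <= M).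

Local Notation K := (closure Omega).
Local Notation u := (support_function Omega).
Local Notation d := (bdist Omega).
Local Notation p := (proj Omega).
Local Notation T := (sphere_int theta).
Local Notation omega := (sphere_area theta).
Local Notation exc := (excess Omega).

Definition parallel_body (t : R) : set (borel_rV R m) := [set Y : E | d Y <= t].

Definition mean_excess (r : R) : R := T (fun xi => exc (r *: xi)).

Lemma cont_supp x : cont_at u x.
Proof. exact: supp_fun_continuous. Qed.

Lemma cont_excess_ray r x : cont_at (fun xi => exc (r *: xi)) x.
Proof.
apply: (@continuous_comp _ _ _ (fun xi : E => r *: xi) (exc : E -> R^o)); last exact: excess_continuous.
exact: scaler_continuous.
Qed.

Lemma cont_radius_up s e x : (forall x, cont_at e x) -> cont_at (fun xi => radius_up s (u xi) (e xi)) x.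
Proof.
move=> ce; have cu := @cont_supp x.
apply: cont_atD; first by apply: cont_atD; [exact: cont_at_cst|apply: cont_atM => //; exact: cont_at_cst].
apply: cont_atM; last exact: cont_at_cst.
apply: cont_atM; first exact: cont_at_cst.
by apply: cont_atD; [exact: cont_atX|exact: cont_atN].
Qed.

Lemma cont_radius_low s e x : (forall x, cont_at e x) -> cont_at (fun xi => radius_low s (u xi) (e xi)) x.
Proof.
move=> ce; have cu := @cont_supp x; apply: cont_atD; first exact: cont_radius_up.
apply/cont_atN/cont_atX; apply: cont_atM; last exact: cont_at_cst.
apply: cont_atM; first exact: cont_at_cst.
by apply: cont_atD; [exact: cont_atX|exact: cont_atN].
Qed.

(** First-order form of the bounds, for the places where only positivity or the leading order of the
    radius matters. *)
Lemma radius_bounds s U e : 0 < s -> s * M <= 8^-1 -> `|U| <= M -> 0 <= e <= M ^+ 2 ->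
  1 - 2 * (s * M) <= radius_low s U e /\ radius_up s U e <= 1 + 2 * (s * M).
Proof.
move=> s0 sM uM eM; have := radius_corr s0 sM uM eM; rewrite /radius_low /radius_up; set w := _ / 2 => wb.
have sU : `|s * U| <= s * M by rewrite normrM gtr0_norm // ler_pM2l.
set z := s * M in sM wb sU *.
have z0 : 0 <= z by rewrite mulr_ge0 ?ltW.
have z2 : z ^+ 2 <= z / 8 by rewrite expr2; apply: ler_wpM2l.
have [wl wu] : - (z ^+ 2 / 2) <= w /\ w <= z ^+ 2 / 2 by apply/andP; rewrite -ler_norml.
have [xl xu] : - z <= s * U /\ s * U <= z by apply/andP; rewrite -ler_norml.
have w2 : w ^+ 2 <= z / 16.
  rewrite -[w ^+ 2]ger0_norm ?sqr_ge0 // normrX expr2.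
  have h : `|w| <= z / 16 by lra.
  have h1 : `|w| <= 1 by lra.
  by apply: le_trans (ler_pM _ _ h h1) _ => //; rewrite mulr1.
by split; lra.
Qed.

Lemma measurable_parallel_body t : measurable (parallel_body t).
Proof.
have -> : parallel_body t = setT `&` d @^-1` `]-oo, t].
  by rewrite setTI; apply/seteqP; split => Y; rewrite /parallel_body /= in_itv.
have cd x : cont_at d x by exact: bdist_continuous.
exact: (continuous_measurable_cont_at cd measurableT (measurable_itv _)).
Qed.

Lemma parallel_body_bound t Y : parallel_body t Y -> enorm Y <= t + M.
Proof.
move=> dY; have [Kp _] := projP hne hbdd hconv Y.
by rewrite -[Y](subrK (p Y)); apply: le_trans (enorm_triangle _ _) _; apply: lerD => //; exact: hM.
Qed.

Lemma parallel_body_finite t : (lebesgue_rV (parallel_body t) < +oo)%E.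
Proof.
apply: (@lebesgue_bounded _ _ _ (t + M + 1)); first exact: measurable_parallel_body.
move=> Y /parallel_body_bound h; apply: le_lt_trans (norm_le_enorm Y) _.
by apply: le_lt_trans h _; rewrite ltrDl.
Qed.

Definition indic_mul (A : set E) (g : E -> R) (Y : borel_rV R m) : \bar R := (\1_A (Y : E) * g Y)%:E.

Lemma measurable_indic_mul (A : set E) g : measurable (A : set (borel_rV R m)) -> (forall x, cont_at g x) ->
  measurable_fun setT (indic_mul A g).
Proof.
move=> mA cg; apply/measurable_EFinP.
apply: (measurable_funM (f := \1_(A : set (borel_rV R m)) : borel_rV R m -> R)).
  exact: measurable_indic.
exact: continuous_measurable_cont_at.
Qed.

Lemma indic_mul_ge0 A g Y : (forall x, 0 <= g x) -> (0 <= indic_mul A g Y)%E.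
Proof. by move=> g0; rewrite lee_fin mulr_ge0. Qed.

Lemma supp_sphere x : dot x x = 1 -> `|u x| <= M.
Proof. exact: (supp_fun_le hne hbdd hM). Qed.

Lemma excess_bounds Y : 0 <= exc Y <= M ^+ 2.
Proof. exact: (excess_bound hne hbdd hconv M0 hM). Qed.

Lemma radius_le s r x : dot x x = 1 -> 0 < s -> s * M <= 8^-1 -> 0 < r -> parallel_body s^-1 (r *: x) ->
  s * r <= radius_up s (u x) (exc ((2 * s)^-1 *: x)).
Proof. by move=> x1 s0 sM r0; apply: (radius_up_le hne hbdd hconv M0 hM). Qed.

Lemma radius_le2 s r x : dot x x = 1 -> 0 < s -> s * M <= 8^-1 -> 0 < r -> parallel_body s^-1 (r *: x) ->
  s * r <= 1 + 2 * (s * M).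
Proof.
move=> x1 s0 sM r0 h; apply: le_trans (radius_le x1 s0 sM r0 h) _.
exact: (radius_bounds s0 sM (supp_sphere x1) (excess_bounds _)).2.
Qed.

Lemma radius_ge s r x : dot x x = 1 -> 0 < s -> s * M <= 8^-1 -> 0 < r ->
  s * r <= radius_low s (u x) (exc ((2 / s) *: x)) -> parallel_body s^-1 (r *: x).
Proof. by move=> x1 s0 sM r0 h; apply: (radius_low_le hne hbdd hconv M0 hM). Qed.

Lemma lebesgue_indic (A : set (borel_rV R m)) : measurable A ->
  (\int[@lebesgue_rV R m]_Y indic_mul A (fun=> 1%R) Y = lebesgue_rV A)%E.
Proof.
move=> mA; transitivity (\int[@lebesgue_rV R m]_Y (\1_A Y)%:E)%E.
  by apply: eq_integral => Y _; rewrite /indic_mul mulr1.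
by apply: etrans (integral_indic _ measurableT mA) _; rewrite setIT.
Qed.

Lemma radius_ge0 s r x : dot x x = 1 -> 0 < s -> s * M <= 8^-1 ->
  0 <= radius_low s (u x) (exc (r *: x)) /\ 0 <= radius_up s (u x) (exc (r *: x)).
Proof.
move=> x1 s0 sM; have [h _] := radius_bounds s0 sM (supp_sphere x1) (excess_bounds (r *: x)).
have h1 : 0 <= radius_low s (u x) (exc (r *: x)) by apply: le_trans h; lra.
by split => //; apply: le_trans h1 _; rewrite /radius_low gerBl sqr_ge0.
Qed.

Lemma parallel_body_upper s : 0 < s -> s * M <= 8^-1 ->
  m%:R * s ^+ m * fine (lebesgue_rV (parallel_body s^-1)) <=
  T (fun x => radius_up s (u x) (exc ((2 * s)^-1 *: x)) ^+ m).
Proof.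
move=> s0 sM; have sn : s != 0 by rewrite lt0r_neq0.
have cr x : cont_at (fun xi => radius_up s (u xi) (exc ((2 * s)^-1 *: xi))) x.
  by apply: cont_radius_up => y; exact: cont_excess_ray.
have mB := measurable_parallel_body s^-1.
have c1 (x : E) : cont_at (fun=> 1 : R) x by exact: cont_at_cst.
have := @polar_upper _ _ _ htheta (indic_mul (parallel_body s^-1) (fun=> 1)) (measurable_indic_mul mB c1)
  (fun Y => indic_mul_ge0 _ _ (fun=> ler01)) (fun=> 1)
  (fun x => s^-1 * radius_up s (u x) (exc ((2 * s)^-1 *: x))) c1.
rewrite lebesgue_indic // => H.
have {H} : (lebesgue_rV (parallel_body s^-1) <=
    (m%:R^-1 * (s^-1 ^+ m * T (fun x => radius_up s (u x) (exc ((2 * s)^-1 *: x)) ^+ m)))%:E)%E.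
  apply: le_trans (H _ _ _) _ => //.
  - by move=> x; apply: cont_atM => //; exact: cont_at_cst.
  - move=> x x1; have [_ h1] := radius_ge0 (2 * s)^-1 x1 s0 sM.
    split => [|r r0|r rr].
    + by rewrite mulr_ge0 ?invr_ge0 ?(ltW s0).
    + by rewrite lee_fin mulr1 indicE; case: (_ \in _).
    + rewrite /indic_mul indicE; case: (boolP (_ \in _)) => [/set_mem h|_]; last by rewrite mul0r.
      have r0 : 0 < r.
        by apply: le_lt_trans rr; rewrite mulr_ge0 ?invr_ge0 ?(ltW s0).
      have := radius_le x1 s0 sM r0 h; rewrite leNgt => /negP[].
      by rewrite -ltr_pdivrMl.
  rewrite -[s^-1 ^+ m * _]sphere_intZ //; last by move=> x; exact: cont_atX.
  by rewrite lee_fin /T; under eq_Rintegral do rewrite mul1r exprMn.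
have f := parallel_body_finite s^-1.
have fn : lebesgue_rV (parallel_body s^-1) \is a fin_num by rewrite ge0_fin_numE.
rewrite -{1}(fineK fn) lee_fin; set v := fine _; set t := T _ => h.
have mp : 0 < m%:R * s ^+ m by rewrite mulr_gt0 ?exprn_gt0 ?ltr0n.
have := ler_wpM2l (ltW mp) h; congr (_ <= _).
by rewrite exprVn; field; rewrite expf_neq0 //= -[1]/(1%:R) -natrD.
Qed.

Lemma parallel_body_lower s : 0 < s -> s * M <= 8^-1 ->
  T (fun x => radius_low s (u x) (exc ((2 / s) *: x)) ^+ m) <=
  m%:R * s ^+ m * fine (lebesgue_rV (parallel_body s^-1)).
Proof.
move=> s0 sM; have sn : s != 0 by rewrite lt0r_neq0.
have cr x : cont_at (fun xi => radius_low s (u xi) (exc ((2 / s) *: xi))) x.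
  by apply: cont_radius_low => y; exact: cont_excess_ray.
have mB := measurable_parallel_body s^-1.
have c1 (x : E) : cont_at (fun=> 1 : R) x by exact: cont_at_cst.
have := @polar_lower _ _ _ htheta (indic_mul (parallel_body s^-1) (fun=> 1)) (measurable_indic_mul mB c1)
  (fun Y => indic_mul_ge0 _ _ (fun=> ler01)) 0 (fun=> 1)
  (fun x => s^-1 * radius_low s (u x) (exc ((2 / s) *: x))) c1.
rewrite lebesgue_indic // => H.
have {H} : ((m%:R^-1 * (s^-1 ^+ m * T (fun x => radius_low s (u x) (exc ((2 / s) *: x)) ^+ m)))%:E <=
    lebesgue_rV (parallel_body s^-1))%E.
  apply: le_trans (H _ _ _ _) => //.
  - rewrite -sphere_intZ //; last by move=> x; exact: cont_atX.
    by rewrite lee_fin /T; under [X in _ <= _ * X]eq_Rintegral do rewrite mul1r expr0n subr0 exprMn.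
  - by move=> x; apply: cont_atM => //; exact: cont_at_cst.
  - move=> x x1; have [h1 _] := radius_ge0 (2 / s) x1 s0 sM.
    split => [|r r0 rr].
      by rewrite mulr_ge0 ?invr_ge0 ?(ltW s0).
    have h : parallel_body s^-1 (r *: x) by apply: (radius_ge x1 s0 sM r0); rewrite -ler_pdivlMl.
    by rewrite /indic_mul indicE mem_set // mul1r.
have f := parallel_body_finite s^-1.
have fn : lebesgue_rV (parallel_body s^-1) \is a fin_num by rewrite ge0_fin_numE.
rewrite -{1}(fineK fn) lee_fin; set v := fine _; set t := T _ => h.
have mp : 0 < m%:R * s ^+ m by rewrite mulr_gt0 ?exprn_gt0 ?ltr0n.
have := ler_wpM2l (ltW mp) h; congr (_ <= _).
by rewrite exprVn; field; rewrite expf_neq0 //= -[1]/(1%:R) -natrD.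
Qed.

Lemma cont_radius_poly s e x : (forall x, cont_at e x) -> cont_at (fun xi => radius_poly m s (u xi) (e xi)) x.
Proof.
move=> ce; have cu := @cont_supp x; rewrite /radius_poly.
apply: cont_atD; first apply: cont_atD; first exact: cont_at_cst.
  by apply: cont_atM; [apply: cont_atM => //; exact: cont_at_cst|exact: cont_at_cst].
apply: cont_atM; last exact: cont_at_cst.
by apply: cont_atD; [apply: cont_atM; [exact: cont_at_cst|exact: cont_atX]|exact: cont_atN].
Qed.

(** The radius [r] at which the excess is taken is kept apart from the scale [s], because the upper
    and lower bounds take it at different multiples of [1 / s]. *)
Definition mean_poly (s r : R) : R :=
  omega + m%:R * T u * s + (m%:R * T (fun x => u x ^+ 2) - mean_excess r) * (m%:R / 2 * s ^+ 2).

Lemma mean_radius_poly s r : T (fun x => radius_poly m s (u x) (exc (r *: x))) = mean_poly s r.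
Proof.
have c1 (a : R) (x : E) : cont_at (fun=> a) x by exact: cont_at_cst.
have cu x : cont_at u x := @cont_supp x.
have cu2 x : cont_at (fun x => u x ^+ 2) x by exact: cont_atX.
have ce x : cont_at (fun x => exc (r *: x)) x by exact: cont_excess_ray.
pose a := m%:R * s; pose b := m%:R * (m%:R / 2 * s ^+ 2); pose c := m%:R / 2 * s ^+ 2.
have -> : (fun x => radius_poly m s (u x) (exc (r *: x))) =
    (fun x => (1 + a * u x) + b * u x ^+ 2 - c * exc (r *: x)).
  apply/funext => x; rewrite /radius_poly /a /b /c; set U := u x; set e := exc _.
  by clearbody U e; field.
have ca x : cont_at (fun x => a * u x) x by exact: cont_atM.
have cb x : cont_at (fun x => b * u x ^+ 2) x by exact: cont_atM.
have cc x : cont_at (fun x => c * exc (r *: x)) x by exact: cont_atM.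
have cd x : cont_at (fun x => 1 + a * u x) x by exact: cont_atD.
rewrite sphere_intB //; last by move=> x; exact: cont_atD.
rewrite !sphere_intD // !sphere_intZ // sphere_int_cst // mul1r /mean_poly /mean_excess /a /b /c.
by set U := T _; set V := T _; set W := T _; set z := sphere_area _; clearbody U V W z; field.
Qed.

(** The factor with [s ^+ m] normalises the volume so that the constant term is the area of the unit
    sphere. Both estimates integrate [radius_expansion] over directions. *)
Lemma parallel_body_asymptotics : exists2 D : R, 0 <= D & forall s, 0 < s -> s * M <= 8^-1 ->
  mean_poly s (2 / s) - D * s ^+ 3 <= m%:R * s ^+ m * fine (lebesgue_rV (parallel_body s^-1))
  <= mean_poly s (2 * s)^-1 + D * s ^+ 3.
Proof.
have [D D0 HD] := radius_expansion m M0.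
have o0 : 0 <= omega by rewrite /sphere_area fine_ge0.
exists (D * omega) => [|s s0 sM]; first exact: mulr_ge0.
have ce r x : cont_at (fun x => exc (r *: x)) x by exact: cont_excess_ray.
have cp r x : cont_at (fun x => radius_poly m s (u x) (exc (r *: x))) x by exact: cont_radius_poly.
have DE : D * omega * s ^+ 3 = T (fun=> D * s ^+ 3) by rewrite sphere_int_cst // mulrAC.
have c1 (a : R) (x : E) : cont_at (fun=> a) x by exact: cont_at_cst.
apply/andP; split.
  apply: le_trans (parallel_body_lower s0 sM); rewrite -mean_radius_poly DE -sphere_intB //.
  apply: sphere_int_le => //.
  - by move=> x; apply: cont_atD => //; exact: cont_atN.
  - by move=> x; apply: cont_atX; exact: cont_radius_low.
  by move=> x x1; exact: (HD _ _ _ s0 sM (supp_sphere x1) (excess_bounds _)).2.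
apply: le_trans (parallel_body_upper s0 sM) _; rewrite -mean_radius_poly DE -sphere_intD //.
apply: sphere_int_le => //.
- by move=> x; apply: cont_atX; exact: cont_radius_up.
- by move=> x; exact: cont_atD.
by move=> x x1; exact: (HD _ _ _ s0 sM (supp_sphere x1) (excess_bounds _)).1.
Qed.

Lemma mean_excess_mono a b : 0 <= a <= b -> mean_excess a <= mean_excess b.
Proof.
move=> ab; apply: sphere_int_le => // [x|x|x _]; try exact: cont_excess_ray.
exact: (excess_mono hne hbdd hconv).
Qed.

Lemma mean_excess_ge0 a : 0 <= mean_excess a.
Proof. by apply: sphere_int_ge0 => // x _; case/andP: (excess_bounds (a *: x)). Qed.

Lemma mean_excess_le a : mean_excess a <= M ^+ 2 * omega.
Proof.
rewrite -sphere_int_cst; apply: sphere_int_le => // [x|x|x _].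
- exact: cont_excess_ray.
- exact: cont_at_cst.
by case/andP: (excess_bounds (a *: x)).
Qed.

Definition proj_sq (Y : E) : R := dot (p Y) (p Y).

Lemma cont_proj_sq x : cont_at proj_sq x.
Proof. by apply: cont_at_dot; exact: proj_continuous. Qed.

Lemma tube_sub_body t Y : tube Omega t Y -> parallel_body t Y.
Proof. by move=> []. Qed.

(** Points of the parallel body lie within distance [2 / s] of the origin, so the excess is replaced
    by its value there in each direction, and the domain by a ball. *)
Lemma body_excess_upper s : 0 < s -> s * M <= 8^-1 ->
  (\int[@lebesgue_rV R m]_Y indic_mul (parallel_body s^-1) exc Y <=
   (m%:R^-1 * (s^-1 * (1 + 2 * (s * M))) ^+ m * mean_excess (2 / s))%:E)%E.
Proof.
move=> s0 sM; set rho := s^-1 * _; have z0 : 0 <= s * M by rewrite mulr_ge0 ?ltW.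
have rho0 : 0 <= rho by rewrite mulr_ge0 ?invr_ge0 ?(ltW s0) //; lra.
have ce r x : cont_at (fun x => exc (r *: x)) x by exact: cont_excess_ray.
have mB := measurable_parallel_body s^-1.
have e0 Y : 0 <= exc Y by case/andP: (excess_bounds Y).
have cE x : cont_at exc x by exact: excess_continuous.
have H := @polar_upper _ _ _ htheta (indic_mul (parallel_body s^-1) exc) (measurable_indic_mul mB cE)
  (fun Y => indic_mul_ge0 _ _ e0) (fun x => exc ((2 / s) *: x)) (fun=> rho) (ce _).
apply: le_trans (H _ _ _) _.
- by move=> x; exact: cont_at_cst.
- by [].
- move=> x x1; split => // [r r0|r rr].
    rewrite /indic_mul indicE lee_fin; case: (boolP (_ \in _)) => [/set_mem h|_]; last by rewrite mul0r.
    rewrite mul1r; apply: (excess_mono hne hbdd hconv); rewrite (ltW r0) /=.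
    have := radius_le2 x1 s0 sM r0 h => h2; rewrite ler_pdivlMr // mulrC; lra.
  rewrite /indic_mul indicE; case: (boolP (_ \in _)) => [/set_mem h|_]; last by rewrite mul0r.
  have r0 : 0 < r by exact: le_lt_trans rr.
  have := radius_le2 x1 s0 sM r0 h; rewrite leNgt => /negP[].
  by rewrite -ltr_pdivrMl.
rewrite lee_fin; under [X in _ * X <= _]eq_Rintegral do rewrite mulrC.
by rewrite [X in _ * X <= _](sphere_intZ htheta) // mulrA.
Qed.

Lemma tube_proj_upper s : 0 < s -> s * M <= 8^-1 ->
  (\int[@lebesgue_rV R m]_Y indic_mul (tube Omega s^-1) proj_sq Y <=
   (m%:R^-1 * (s^-1 * (1 + 2 * (s * M))) ^+ m * mean_excess (2 / s))%:E)%E.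
Proof.
move=> s0 sM; apply: le_trans (body_excess_upper s0 sM).
have mt : measurable (tube Omega s^-1) by exact: measurable_tube.
have cE x : cont_at exc x by exact: excess_continuous.
apply: ge0_le_integral => //.
- by move=> Y _; apply: indic_mul_ge0 => Z; exact: dot_ge0.
- by apply: measurable_indic_mul => // x; exact: cont_proj_sq.
- by apply: measurable_indic_mul => //; exact: measurable_parallel_body.
move=> Y _; rewrite /indic_mul !indicE lee_fin; apply: ler_pM => //.
- exact: dot_ge0.
- case: (boolP (Y \in tube _ _)) => [/set_mem/tube_sub_body h|_]; first by rewrite mem_set.
  by [].
- exact: (proj_le_excess hne hbdd hconv).
Qed.

(** [excess_half] bounds the squared projection below by a difference; the subtracted excess is
    moved to the right and estimated by [body_excess_upper]. The radius [k] stays fixed as [s] tends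
    to 0: beyond it points are outside the body because [M <= k], and the excess at half of them is
    at least that at distance [k / 2]. *)
Lemma tube_proj_lower s k : 0 < s -> s * M <= 8^-1 -> M <= k -> s * k <= 2^-1 ->
  ((m%:R^-1 * ((s^-1 * (1 - 2 * (s * M))) ^+ m - k ^+ m) * (2 * mean_excess (k / 2)))%:E <=
  \int[@lebesgue_rV R m]_Y indic_mul (tube Omega s^-1) proj_sq Y +
   (m%:R^-1 * (s^-1 * (1 + 2 * (s * M))) ^+ m * mean_excess (2 / s))%:E)%E.
Proof.
move=> s0 sM Mk sk; set rho := s^-1 * (1 - _); have z0 : 0 <= s * M by rewrite mulr_ge0 ?ltW.
have k0 : 0 <= k by apply: le_trans Mk; exact: ltW.
have e0 Y : 0 <= exc Y by case/andP: (excess_bounds Y).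
have cE x : cont_at exc x by exact: excess_continuous.
have mt : measurable (tube Omega s^-1) by exact: measurable_tube.
have mB := measurable_parallel_body s^-1.
pose g (Y : E) : R := 2 * exc (2^-1 *: Y).
have cg x : cont_at g x by apply: cont_atM; [exact: cont_at_cst|exact: cont_excess_ray].
have g0 Y : 0 <= g Y by rewrite mulr_ge0.
apply: le_trans (_ : (\int[@lebesgue_rV R m]_Y indic_mul (tube Omega s^-1) g Y <= _)%E); last first.
  apply: le_trans (leeD2l _ (body_excess_upper s0 sM)).
  have q0 Y : 0 <= proj_sq Y by exact: dot_ge0.
  have cq x : cont_at proj_sq x by exact: cont_proj_sq.
  rewrite -ge0_integralD //; first last.
  - exact: measurable_indic_mul.
  - by move=> Y _; exact: indic_mul_ge0.
  - exact: measurable_indic_mul.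
  - by move=> Y _; exact: indic_mul_ge0.
  apply: ge0_le_integral => //.
  - by move=> Y _; exact: indic_mul_ge0.
  - exact: measurable_indic_mul.
  - by apply: emeasurable_funD; exact: measurable_indic_mul.
  move=> Y _; rewrite /indic_mul -EFinD lee_fin !indicE.
  case: (boolP (Y \in tube _ _)) => [/set_mem/tube_sub_body h|_].
    by rewrite (mem_set h) !mul1r; exact: (excess_half hne hbdd hconv).
  by rewrite !mul0r add0r mulr_ge0.
have ce r x : cont_at (fun x => exc (r *: x)) x by exact: cont_excess_ray.
have H := @polar_lower _ _ _ htheta (indic_mul (tube Omega s^-1) g) (measurable_indic_mul mt cg)
  (fun Y => indic_mul_ge0 _ _ g0) k (fun x => 2 * exc ((k / 2) *: x)) (fun=> rho).
apply: le_trans (H _ _ _ _ _).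
- rewrite lee_fin; under [X in _ <= _ * X]eq_Rintegral do rewrite mulrC mulrA.
  by rewrite [X in _ <= _ * X](sphere_intZ htheta) // !mulrA.
- by move=> x; apply: cont_atM => //; exact: cont_at_cst.
- by move=> x; exact: cont_at_cst.
- exact: k0.
- by move=> x; exact: mulr_ge0.
move=> x x1; split; first by rewrite /rho ler_pdivlMl //; lra.
move=> r kr rr; have r0 : 0 < r by exact: le_lt_trans kr.
have hb : parallel_body s^-1 (r *: x).
  apply: (radius_ge x1 s0 sM r0).
  apply: le_trans (radius_bounds s0 sM (supp_sphere x1) (excess_bounds _)).1.
  by rewrite -ler_pdivlMl.
have ht : tube Omega s^-1 (r *: x).
  split => // /hM; rewrite enormZ gtr0_norm //; move/enorm1P: x1 => ->; rewrite mulr1.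
  by move=> rM; move: (lt_le_trans kr (le_trans rM Mk)); rewrite ltxx.
rewrite /indic_mul indicE mem_set // mul1r lee_fin /g ler_pM2l // scalerA mulrC.
by apply: (excess_mono hne hbdd hconv); rewrite mulr_ge0 ?invr_ge0 //= ler_pM2l ?invr_gt0 // ltW.
Qed.

End Asymptotics.

(** * Steiner polynomials *)

Section Steiner.
Context {R : realType} {n : nat}.
Local Notation E := 'rV[R]_n.+1.
Local Notation m := (n.+1).
Variable Omega : set 'rV[R]_n.+1.
Hypothesis (hne : Omega !=set0) (hopen : open Omega) (hbdd : bounded_set Omega).
Hypothesis hconv : convex_set (Omega : set (convex_lmodType 'rV[R]_n.+1)).
Hypothesis hsmooth : smooth_hypersurface (boundary Omega).
Variable mu : {measure set (borel_rV R m) -> \bar R}.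
Hypothesis hmu : is_area_measure (boundary Omega) mu.

Local Notation K := (closure Omega).
Local Notation S := (boundary Omega : set (borel_rV R m)).
Local Notation p := (proj Omega).
Local Notation H := (mean_curvature Omega).

(** A contraction by [t < 1] towards a point of the open set maps the closure into [Omega], so
    [t ^+ m] times its volume is at most that of [Omega]; then [t] tends to 1. *)
Lemma closure_measure : lebesgue_rV (K : set (borel_rV R m)) = lebesgue_rV (Omega : set (borel_rV R m)).
Proof.
have mK : measurable (K : set (borel_rV R m)) by apply: borel_closed; exact: closed_closure.
have mO : measurable (Omega : set (borel_rV R m)) by exact: borel_open.
have [M M0 hM] := body_bound hbdd.
have Kf : (lebesgue_rV (K : set (borel_rV R m)) < +oo)%E.
  apply: (@lebesgue_bounded _ _ _ (M + 1)) => // x /hM h.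
  by apply: le_lt_trans (norm_le_enorm x) _; apply: le_lt_trans h _; rewrite ltrDl.
have OK : (lebesgue_rV (Omega : set (borel_rV R m)) <= lebesgue_rV (K : set (borel_rV R m)))%E.
  by apply: le_measure; rewrite ?inE //; exact: subset_closure.
have Kn : lebesgue_rV (K : set (borel_rV R m)) \is a fin_num by rewrite ge0_fin_numE.
have On : lebesgue_rV (Omega : set (borel_rV R m)) \is a fin_num.
  by rewrite ge0_fin_numE //; exact: le_lt_trans Kf.
apply/eqP; rewrite eq_le OK andbT -(fineK Kn) -(fineK On) lee_fin.
set a := fine _; set b := fine _; have a0 : 0 <= a by rewrite fine_ge0.
have [x0 Ox0] := hne.
have key t : 0 < t < 1 -> t ^+ m * a <= b.
  move=> /andP[t0 t1]; have := lebesgue_affine ((1 - t) *: x0) t0 mO => AE.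
  have : (lebesgue_rV (K : set (borel_rV R m)) <= ((t^-1) ^+ m)%:E * lebesgue_rV (Omega : set (borel_rV R m)))%E.
    rewrite -AE; apply: le_measure; rewrite ?inE //.
      by apply: measurable_preimage_rV => //; exact: continuous_scale_add.
    move=> x Kx; rewrite /= [t *: x + _]addrC; apply: open_comb => //.
    by rewrite t1 ltW.
  rewrite -(fineK Kn) -(fineK On) -EFinM lee_fin -/a -/b => h.
  by rewrite exprVn ler_pdivlMl ?exprn_gt0 in h.
have bern (e : R) : 0 <= e <= 1 -> forall k, 1 - k%:R * e <= (1 - e) ^+ k.
  move=> /andP[e0 e1]; elim=> [|k IH]; first by rewrite expr0 mul0r subr0.
  rewrite exprS; apply: le_trans (_ : (1 - e) * (1 - k%:R * e) <= _).
    have : 0 <= k%:R * e ^+ 2 by rewrite mulr_ge0 ?sqr_ge0.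
    by rewrite -natr1; set q := k%:R; move=> h; lra.
  by apply: ler_wpM2l => //; rewrite subr_ge0.
apply/ler_addgt0Pr => e e0; pose c : R := m%:R * a; have c0 : 0 <= c by exact: mulr_ge0.
pose h := e / (c + e + 1); have q0 : 0 < c + e + 1 by lra.
have h0 : 0 < h by rewrite divr_gt0.
have h1 : h < 1 by rewrite ltr_pdivrMr // mul1r; lra.
have := key (1 - h); rewrite subr_gt0 h1 gtrBl h0 => /(_ isT) k1.
have := bern h; rewrite (ltW h0) (ltW h1) => /(_ isT m) k2.
have k3 := ler_wpM2r a0 k2.
have k4 : c * h <= e.
  by rewrite /h mulrA ler_pdivrMr // mulrC; apply: ler_wpM2l; [exact: ltW|lra].
have k5 : (1 - m%:R * h) * a = a - c * h by rewrite /c; ring.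
by lra.
Qed.

Lemma parallel_body_split t : 0 <= t ->
  (lebesgue_rV (parallel_body Omega t) = lebesgue_rV (Omega : set (borel_rV R m)) + lebesgue_rV (tube Omega t))%E.
Proof.
move=> t0; rewrite -closure_measure.
have mK : measurable (K : set (borel_rV R m)) by apply: borel_closed; exact: closed_closure.
have mt : measurable (tube Omega t) by exact: measurable_tube.
have -> : parallel_body Omega t = (K : set (borel_rV R m)) `|` tube Omega t.
  apply/seteqP; split => Y.
    by move=> h; have [KY|KY] := pselect (K Y); [left|right].
  by move=> [KY|[_ h] //]; rewrite /parallel_body /= /bdist (proj_id hne hbdd hconv KY) subrr enorm0.
by apply: measureU => //; apply/seteqP; split => // Y [KY []].
Qed.

(** By [tube_measure] the projection sends the volume of the tube to a measure with density
    [steiner] against [mu], and a function of the projection is integrated against that image. *)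
Lemma tube_integral (g : E -> R) t : (forall x, cont_at g x) -> (forall x, 0 <= g x) -> 0 < t ->
  (\int[@lebesgue_rV R m]_Y indic_mul (tube Omega t) (fun Y => g (p Y)) Y =
   \int[mu]_(X in S) (g X * steiner Omega t X)%:E)%E.
Proof.
move=> cg g0 t0; have mt : measurable (tube Omega t) by exact: measurable_tube.
have mp := measurable_proj hne hbdd hconv.
have mS : measurable S by exact: measurable_boundary.
have mg : measurable_fun setT (fun x : borel_rV R m => (g x)%:E).
  by apply/measurable_EFinP; exact: continuous_measurable_cont_at.
have [nu0 nu0E] := push_measure (@lebesgue_rV R m) mt (measurable_funTS (@measurable_id _ (borel_rV R m) setT)).
have [nu nuE] := push_measure (@lebesgue_rV R m) mt (measurable_funTS mp).
have nuT : (\int[nu]_X (g X)%:E = \int[nu0]_Y (g (p Y))%:E)%E.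
  apply: (integral_image_measure mp) => //.
  by move=> B mB; rewrite nuE nu0E.
transitivity (\int[nu]_X (g X)%:E)%E.
  rewrite nuT; apply/esym.
  have m1 : measurable_fun setT (\1_(tube Omega t) : borel_rV R m -> R) by exact: measurable_indic.
  have i0 (x : borel_rV R m) : 0 <= \1_(tube Omega t) x :> R by [].
  have nuI A : measurable A -> nu0 A = (\int[@lebesgue_rV R m]_(x in A) (\1_(tube Omega t) x)%:E)%E.
    move=> mA; rewrite nu0E; apply/esym; exact: (integral_indic _ mA mt).
  have := integral_density m1 i0 nuI (f := fun Y => (g (p Y))%:E).
  move=> -> //; first by apply: eq_integral => Y _; rewrite /indic_mul -EFinM mulrC.
    exact: (measurableT_comp mg mp).
  by move=> Y; rewrite lee_fin.
have ms := measurable_steiner hne hopen hbdd hconv hsmooth t.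
pose G : borel_rV R m -> R := steiner Omega t \_ S.
have mG : measurable_fun setT G by apply/(measurable_restrictT _ mS).
have G0 x : 0 <= G x.
  rewrite /G /patch; case: ifPn => // /set_mem Sx.
  by apply: (steiner_ge0 hne hopen hbdd hconv hsmooth) => //; exact: ltW.
have nuS A : measurable A -> nu A = (\int[mu]_(x in A) (G x)%:E)%E.
  move=> mA; rewrite nuE; apply: etrans (tube_measure hne hopen hbdd hconv hsmooth hmu mA t0) _.
  rewrite setIC integral_mkcondr; apply: eq_integral => x _.
  by rewrite /G /patch; case: ifP.
rewrite (integral_density mG G0 nuS mg); last by move=> x; rewrite lee_fin.
rewrite [RHS]integral_mkcond; apply: eq_integral => x _.
by rewrite /G /patch; case: ifP => _; rewrite -EFinM // mulr0.
Qed.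

Lemma steiner_integral (g : E -> R) t : (forall x, cont_at g x) -> (forall x, 0 <= g x) -> 0 < t ->
  (\int[mu]_(X in S) (g X * steiner Omega t X)%:E =
   \sum_(j < n.+1) ('C(n, j)%:R * t ^+ j.+1 / j.+1%:R)%:E * \int[mu]_(X in S) (H j X * g X)%:E)%E.
Proof.
move=> cg g0 t0; have mS : measurable S by exact: measurable_boundary.
have mH (j : 'I_n.+1) : measurable_fun S (fun X : borel_rV R m => (H j X * g X)%:E).
  apply/measurable_EFinP; apply: measurable_funM.
    by apply: (measurable_mean_curvature hne hopen hbdd hconv hsmooth); rewrite -ltnS.
  by apply: measurable_funTS; exact: continuous_measurable_cont_at.
have H0 (j : 'I_n.+1) X : S X -> (0 <= (H j X * g X)%:E)%E.
  by move=> SX; rewrite lee_fin mulr_ge0 // (mean_curvature_ge0 hne hopen hbdd hconv hsmooth).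
have c0 (j : 'I_n.+1) : 0 <= 'C(n, j)%:R * t ^+ j.+1 / j.+1%:R :> R.
  by rewrite !mulr_ge0 ?invr_ge0 // exprn_ge0 // ltW.
transitivity (\sum_(j < n.+1) \int[mu]_(X in S) (('C(n, j)%:R * t ^+ j.+1 / j.+1%:R)%:E * (H j X * g X)%:E))%E; last first.
  by apply: eq_bigr => j _; apply: ge0_integralZl_EFin => //; exact: H0.
rewrite -ge0_integral_sum //.
- apply: eq_integral => X _; rewrite sumEFin /steiner mulr_sumr; congr EFin; apply: eq_bigr => j _.
  by rewrite !mulrA; ring.
- by move=> j; apply: emeasurable_funM => //; exact: measurable_cst.
- by move=> j X SX; apply: mule_ge0; [rewrite lee_fin|exact: H0].
Qed.

(** The weight 1 gives [I_j]; the squared norm with [j = n] gives the weighted integral of the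
    theorem. *)
Definition curvature_moment (g : E -> R) (j : nat) : R := (\int[mu]_(X in S) (H j X * g X)).

Lemma tube_finite t : (lebesgue_rV (tube Omega t) < +oo)%E.
Proof.
have [M _ hM] := body_bound hbdd.
apply: le_lt_trans (parallel_body_finite hne hbdd hconv hM t); apply: le_measure; rewrite ?inE.
- exact: measurable_tube.
- exact: measurable_parallel_body.
- exact: tube_sub_body.
Qed.

(** Finiteness is drawn from the tube of thickness 1, which has finite volume: up to a positive
    factor each moment is one of the nonnegative terms that sum to the weighted volume of that
    tube. *)
Lemma curvature_moment_finite (g : E -> R) B j : (forall x, cont_at g x) -> (forall x, 0 <= g x) ->
  0 <= B -> (forall x, K x -> g x <= B) -> (j <= n)%N ->
  (\int[mu]_(X in S) (H j X * g X)%:E = (curvature_moment g j)%:E)%E.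
Proof.
move=> cg g0 B0 gB jn; rewrite /curvature_moment /Rintegral fineK // ge0_fin_numE; last first.
  apply: integral_ge0 => X SX.
  by rewrite lee_fin mulr_ge0 // (mean_curvature_ge0 hne hopen hbdd hconv hsmooth).
have mt : measurable (tube Omega 1) by exact: measurable_tube.
have : (\int[mu]_(X in S) (g X * steiner Omega 1 X)%:E < +oo)%E.
  rewrite -tube_integral //.
  apply: (@le_lt_trans _ _ (B%:E * lebesgue_rV (tube Omega 1))%E); last first.
    have f := tube_finite 1.
    have fn : lebesgue_rV (tube Omega 1) \is a fin_num by rewrite ge0_fin_numE.
    by rewrite -(fineK fn) -EFinM ltry.
  have cgp x : cont_at (fun Y => g (p Y)) x.
    by apply: (@continuous_comp _ _ _ p (g : E -> R^o)); [exact: proj_continuous|exact: cg].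
  have c1 (x : E) : cont_at (fun=> 1 : R) x by exact: cont_at_cst.
  rewrite -(lebesgue_indic mt) -ge0_integralZl_EFin //; last 2 first.
  - by move=> Y _; exact: indic_mul_ge0.
  - exact: measurable_indic_mul.
  apply: ge0_le_integral => //.
  - by move=> Y _; exact: indic_mul_ge0.
  - exact: measurable_indic_mul.
  - by apply: emeasurable_funM => //; exact: measurable_indic_mul.
  move=> Y _; rewrite /indic_mul -EFinM lee_fin mulr1 mulrC; apply: ler_wpM2r => //.
  by apply: gB; exact: (projP hne hbdd hconv Y).1.
rewrite steiner_integral // (bigD1 (Ordinal (jn : (j < n.+1)%N))) //=.
have nn (i : nat) : (0 <= \int[mu]_(X in S) (H i X * g X)%:E)%E.
  apply: integral_ge0 => X SX.
  by rewrite lee_fin mulr_ge0 // (mean_curvature_ge0 hne hopen hbdd hconv hsmooth).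
move=> h; apply: (@ltey_mul_pos R ('C(n, j)%:R * 1 ^+ j.+1 / j.+1%:R)) => //.
  by rewrite expr1n mulr1 divr_gt0 // ltr0n bin_gt0.
apply: le_lt_trans h; rewrite leeDl //; apply: sume_ge0 => i _; apply: mule_ge0 => //.
Qed.

Lemma tube_integral_poly (g : E -> R) B t : (forall x, cont_at g x) -> (forall x, 0 <= g x) ->
  0 <= B -> (forall x, K x -> g x <= B) -> 0 < t ->
  (\int[@lebesgue_rV R m]_Y indic_mul (tube Omega t) (fun Y => g (p Y)) Y =
   (\sum_(j < n.+1) 'C(n, j)%:R * t ^+ j.+1 / j.+1%:R * curvature_moment g j)%:E)%E.
Proof.
move=> cg g0 B0 gB t0; rewrite tube_integral // steiner_integral // -sumEFin; apply: eq_bigr => j _.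
by rewrite EFinM (curvature_moment_finite cg g0 B0 gB) // -ltnS.
Qed.

(** Absorption turns [m C(n, j) / (j + 1)] into [C(m, j + 1)], which equals [C(m, n - j)] by
    symmetry; in the variable [s = 1/t] the power becomes [n - j] too. *)
Lemma steiner_coef (j : 'I_n.+1) (s : R) : s != 0 ->
  m%:R * s ^+ m * ('C(n, j)%:R * (s^-1) ^+ j.+1 / j.+1%:R) = 'C(m, n - j)%:R * s ^+ (n - j).
Proof.
move=> s0; have jn : (j <= n)%N by rewrite -ltnS.
have -> : 'C(m, n - j) = 'C(m, j.+1).
  by rewrite -(bin_sub (n := m) (m := j.+1)) // subSS.
have E1 : m%:R * 'C(n, j)%:R = j.+1%:R * 'C(m, j.+1)%:R :> R by rewrite -!natrM mul_bin_diag.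
have E2 : s ^+ m = s ^+ (n - j) * s ^+ j.+1 by rewrite -exprD addnS subnK.
have j0 : j.+1%:R != 0 :> R by rewrite pnatr_eq0.
rewrite E2 exprVn; set a := s ^+ j.+1; have a0 : a != 0 by rewrite expf_neq0.
transitivity (m%:R * 'C(n, j)%:R / j.+1%:R * s ^+ (n - j) * (a / a)); first by ring.
by rewrite E1 mulfV // mulr1 [j.+1%:R * _]mulrC mulfK.
Qed.

Lemma tube_integral_scaled (g : E -> R) B s : (forall x, cont_at g x) -> (forall x, 0 <= g x) ->
  0 <= B -> (forall x, K x -> g x <= B) -> 0 < s ->
  m%:R * s ^+ m * fine (\int[@lebesgue_rV R m]_Y indic_mul (tube Omega s^-1) (fun Y => g (p Y)) Y)%E =
   \sum_(i < n.+1) 'C(m, i)%:R * curvature_moment g (n - i) * s ^+ i.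
Proof.
move=> cg g0 B0 gB s0; rewrite (tube_integral_poly cg g0 B0 gB) ?invr_gt0 //= mulr_sumr.
rewrite [RHS](reindex_inj rev_ord_inj) /=; apply: eq_bigr => j _.
have jn : (j <= n)%N by rewrite -ltnS.
rewrite mulrA steiner_coef ?lt0r_neq0 // subSS subKn // mulrAC.
by [].
Qed.

End Steiner.

(** * Comparison of coefficients *)

Section Comparison.
Context {R : realType}.

Lemma limit_ge0 (a D s0 : R) : 0 < s0 -> (forall s, 0 < s -> s < s0 -> - (D * s) <= a) -> 0 <= a.
Proof.
(* With this [c] the test value [s = e / c] lies below [s0] and satisfies [D s <= e]. *)
move=> s00 H; apply/ler_addgt0Pr => e e0; pose c := `|D| + e / s0 + 1.
have q : 0 < e / s0 by rewrite divr_gt0.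
have c0 : 0 < c by rewrite /c; have := normr_ge0 D; lra.
have := H (e / c); rewrite divr_gt0 // => /(_ isT).
have h1 : e / c < s0.
  rewrite ltr_pdivrMr // mulrC -ltr_pdivrMr // /c; have := normr_ge0 D; lra.
move=> /(_ h1) h2; have h3 : D * (e / c) <= e.
  rewrite mulrA ler_pdivrMr // mulrC; apply: ler_wpM2l; first exact: ltW.
  by apply: le_trans (ler_norm D) _; rewrite /c; lra.
lra.
Qed.

(** Successive division by [s] and passage to 0: the two inequalities share the coefficients of
    order 0 and 1, which must vanish, while at order 2 each one leaves a sign. *)
Lemma compare_quadratic (a b c c' D s0 : R) : 0 < s0 -> s0 <= 1 ->
  (forall s, 0 < s -> s < s0 -> - (D * s ^+ 3) <= a + b * s + c * s ^+ 2 /\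
     a + b * s + c' * s ^+ 2 <= D * s ^+ 3) ->
  [/\ a = 0, b = 0, 0 <= c & c' <= 0].
Proof.
move=> s00 s01 H; have sm s : 0 < s -> s < s0 -> [/\ s ^+ 2 <= s, s ^+ 3 <= s ^+ 2 & 0 < s ^+ 2].
  move=> s0' ss; have s1 : s <= 1 by rewrite (le_trans (ltW ss)).
  split; last exact: exprn_gt0.
    by rewrite expr2 ger_pMl.
  by rewrite exprS ger_pMl // exprn_gt0.
have nD := ler_norm D; have D0 := normr_ge0 D.
have bound (x s : R) : 0 <= s -> - (`|x| * s) <= x * s /\ x * s <= `|x| * s.
  move=> s0'; rewrite -mulNr; split; apply: ler_wpM2r => //; last exact: ler_norm.
  exact: lerNnormlW (lexx _).
have Hs s : 0 < s -> s < s0 -> - (`|D| * s ^+ 3) <= a + b * s + c * s ^+ 2 /\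
     a + b * s + c' * s ^+ 2 <= `|D| * s ^+ 3.
  move=> s0' ss; have [h1 h2] := H s s0' ss.
  have : D * s ^+ 3 <= `|D| * s ^+ 3 by apply: ler_wpM2r => //; apply: exprn_ge0; exact: ltW.
  by split; lra.
have DM s : 0 < s -> s < s0 -> `|D| * s ^+ 3 <= `|D| * s ^+ 2 /\ `|D| * s ^+ 2 <= `|D| * s.
  by move=> s0' ss; have [h1 h2 _] := sm s s0' ss; split; exact: ler_wpM2l.
have cM (x s : R) : 0 < s -> s < s0 -> `|x| * s ^+ 2 <= `|x| * s.
  by move=> s0' ss; have [h1 h2 _] := sm s s0' ss; exact: ler_wpM2l.
have a0 : a = 0.
  apply/eqP; rewrite eq_le -[X in X && _]oppr_ge0; apply/andP; split.
    apply: (@limit_ge0 _ (`|b| + `|c'| + `|D|) s0) => // s s0' ss.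
    have [_ h] := Hs s s0' ss; have [_ _ q] := sm s s0' ss.
    have [h1 _] := bound b s (ltW s0'); have [h2 _] := bound c' _ (ltW q).
    have h3 := cM c' s s0' ss; have [h4 h5] := DM s s0' ss.
    by rewrite !mulrDl; lra.
  apply: (@limit_ge0 _ (`|b| + `|c| + `|D|) s0) => // s s0' ss.
  have [h _] := Hs s s0' ss; have [_ _ q] := sm s s0' ss.
  have [_ h1] := bound b s (ltW s0'); have [_ h2] := bound c _ (ltW q).
  have h3 := cM c s s0' ss; have [h4 h5] := DM s s0' ss.
  by rewrite !mulrDl; lra.
have Hb s : 0 < s -> s < s0 -> - (`|D| * s ^+ 2) <= b + c * s /\ b + c' * s <= `|D| * s ^+ 2.
  move=> s0' ss; have := Hs s s0' ss; rewrite a0 !add0r => -[h1 h2]; split.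
    by rewrite -(ler_pM2r s0') mulNr -mulrA -exprSr mulrDl -mulrA -expr2.
  by rewrite -(ler_pM2r s0') -mulrA -exprSr mulrDl -mulrA -expr2.
have b0 : b = 0.
  apply/eqP; rewrite eq_le -[X in X && _]oppr_ge0; apply/andP; split.
    apply: (@limit_ge0 _ (`|c'| + `|D|) s0) => // s s0' ss.
    have [_ h] := Hb s s0' ss; have [h2 _] := bound c' _ (ltW s0').
    by have [h4 h5] := DM s s0' ss; rewrite !mulrDl; lra.
  apply: (@limit_ge0 _ (`|c| + `|D|) s0) => // s s0' ss.
  have [h _] := Hb s s0' ss; have [_ h2] := bound c _ (ltW s0').
  by have [h4 h5] := DM s s0' ss; rewrite !mulrDl; lra.
have Hc s : 0 < s -> s < s0 -> - (`|D| * s) <= c /\ c' <= `|D| * s.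
  move=> s0' ss; have := Hb s s0' ss; rewrite b0 !add0r => -[h1 h2]; split.
    by rewrite -(ler_pM2r s0') mulNr -mulrA -expr2.
  by rewrite -(ler_pM2r s0') -mulrA -expr2.
split => //.
  by apply: (@limit_ge0 _ `|D| s0) => // s s0' ss; exact: (Hc s s0' ss).1.
rewrite -oppr_ge0; apply: (@limit_ge0 _ `|D| s0) => // s s0' ss.
by rewrite lerN2; exact: (Hc s s0' ss).2.
Qed.

Lemma sandwich_combine (P w z0 z1 z2 z3 z4 z5 Y1 Y2 Y3 Y4 : R) :
  w + z3 + Y3 - z4 <= P -> P <= w + z3 + Y4 + z4 ->
  - z5 <= P - (z0 + z1 + z2) -> P - (z0 + z1 + z2) <= z5 -> Y1 <= Y3 -> Y4 <= Y2 ->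
  - (z4 + z5) <= z0 - w + (z1 - z3) + (z2 - Y1) /\
  z0 - w + (z1 - z3) + (z2 - Y2) <= z4 + z5.
Proof. by move=> *; split; lra. Qed.

Lemma sum_first_bound k (c : nat -> R) : exists2 D : R, 0 <= D & forall s, 0 < s -> s <= 1 ->
  `|\sum_(i < k.+1) c i * s ^+ i - c 0%N| <= D * s.
Proof.
exists (\sum_(i < k) `|c i.+1|) => [|s s0 s1]; first exact: sumr_ge0.
rewrite big_ord_recl expr0 mulr1 addrC addKr mulr_suml.
apply: le_trans (ler_norm_sum _ _ _) _; apply: ler_sum => i _.
rewrite lift0 normrM normrX (gtr0_norm s0) exprS; apply: ler_wpM2l => //.
by rewrite ger_pMr // exprn_ile1 // ltW.
Qed.

Lemma sum_third_bound k (c : nat -> R) : exists2 D : R, 0 <= D & forall s, 0 < s -> s <= 1 ->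
  `|\sum_(i < k.+3) c i * s ^+ i - (c 0%N + c 1%N * s + c 2%N * s ^+ 2)| <= D * s ^+ 3.
Proof.
exists (\sum_(i < k) `|c i.+3|) => [|s s0 s1]; first exact: sumr_ge0.
rewrite 3!big_ord_recl /= !expr0 !mulr1 expr1 /bump /= !add1n.
set t := \sum_(i < k) _; have tE : t = \sum_(i < k) c i.+3 * s ^+ i.+3 by apply: eq_bigr.
have -> : c 0%N + (c 1%N * s + (c 2%N * s ^+ 2 + t)) - (c 0%N + c 1%N * s + c 2%N * s ^+ 2) = t by ring.
rewrite tE mulr_suml; apply: le_trans (ler_norm_sum _ _ _) _; apply: ler_sum => i _.
rewrite normrM normrX (gtr0_norm s0); apply: ler_wpM2l => //.
by rewrite -addn3 exprD ger_pMl ?exprn_gt0 // exprn_ile1 // ltW.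
Qed.

Lemma pow_near1 m : exists2 B : R, 0 <= B & forall y, `|y| <= 1 -> `|(1 + y) ^+ m - 1| <= B * `|y|.
Proof.
have [B B0 HB] := @pow_expansion R m.
exists (m%:R + 'C(m, 2)%:R + B) => [|y y1]; first by rewrite !addr_ge0.
have n0 := normr_ge0 y.
have y2 : `|y| ^+ 2 <= `|y| by rewrite expr2; apply: le_trans (ler_wpM2l n0 y1) _; rewrite mulr1.
have y3 : `|y| ^+ 3 <= `|y| by rewrite exprS; apply: le_trans (ler_wpM2r (sqr_ge0 _) y1) _; rewrite mul1r.
have -> : (1 + y) ^+ m - 1 = ((1 + y) ^+ m - (1 + m%:R * y + 'C(m, 2)%:R * y ^+ 2)) +
    m%:R * y + 'C(m, 2)%:R * y ^+ 2 by ring.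
have h1 := HB y y1.
have h2 : `|m%:R * y| <= m%:R * `|y| by rewrite normrM ger0_norm.
have h3 : `|'C(m, 2)%:R * y ^+ 2| <= 'C(m, 2)%:R * `|y|.
  by rewrite normrM ger0_norm // normrX; apply: ler_wpM2l.
have h4 : B * `|y| ^+ 3 <= B * `|y| by apply: ler_wpM2l.
apply: le_trans (ler_normD _ _) _; apply: le_trans (lerD (ler_normD _ _) h3) _.
rewrite !mulrDl; lra.
Qed.

End Comparison.

(** * The three integrals expressed through the support function and the limit excess *)

Section Identities.
Context {R : realType} {n : nat}.
Hypothesis hn : (1 <= n)%N.
Local Notation E := 'rV[R]_n.+1.
Local Notation m := (n.+1).
Variable theta : {measure set (borel_rV R m) -> \bar R}.
Hypothesis htheta : is_area_measure (@esphere R m) theta.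
Variable Omega : set 'rV[R]_n.+1.
Hypothesis (hne : Omega !=set0) (hopen : open Omega) (hbdd : bounded_set Omega).
Hypothesis hconv : convex_set (Omega : set (convex_lmodType 'rV[R]_n.+1)).
Hypothesis hsmooth : smooth_hypersurface (boundary Omega).
Variable mu : {measure set (borel_rV R m) -> \bar R}.
Hypothesis hmu : is_area_measure (boundary Omega) mu.

Local Notation u := (support_function Omega).
Local Notation T := (sphere_int theta).
Local Notation omega := (sphere_area theta).
Local Notation I := (curvature_integral Omega mu).
Local Notation J := (curvature_moment Omega mu).
Local Notation me := (mean_excess theta Omega).

(** The limit $L$, written as a supremum since the mean excess is monotone and bounded. *)
Definition excess_limit : R := sup [set me r | r in [set r : R | 0 <= r]].

Lemma mean_excess_le_limit r : 0 <= r -> me r <= excess_limit.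
Proof.
move=> r0; have [M M0 hM] := body_bound hbdd.
apply: ub_le_sup; last by exists r.
exists (M ^+ 2 * omega) => _ [a _ <-]; exact: (mean_excess_le htheta hne hbdd hconv M0 hM).
Qed.

Lemma excess_limit_le a : (forall r, 1 <= r -> me r <= a) -> excess_limit <= a.
Proof.
move=> H; apply: ge_sup; first by exists (me 0); exists 0 => //=.
move=> _ [r /= r0 <-]; have [r1|r1] := leP 1 r; first exact: H.
by apply: le_trans (H 1 (lexx _)); apply: (mean_excess_mono htheta hne hbdd hconv); rewrite r0 ltW.
Qed.

(** The tube contributes the powers up to [n]; the top coefficient is the volume of the body itself,
    since [Negz 0] is the integer -1 and [I_(-1)] carries the factor [n + 1]. *)
Lemma parallel_body_poly s : 0 < s ->
  m%:R * s ^+ m * fine (lebesgue_rV (parallel_body Omega s^-1)) =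
  \sum_(i < m.+1) (if (i <= n)%N then 'C(m, i)%:R * I (n - i)%:Z else I (Negz 0)) * s ^+ i.
Proof.
move=> s0; have t0 : 0 <= s^-1 by rewrite invr_ge0 ltW.
rewrite (parallel_body_split hne hopen hbdd hconv t0) // fineD; last 2 first.
- rewrite ge0_fin_numE //; have [M _ hM] := body_bound hbdd.
  apply: (@lebesgue_bounded _ _ _ (M + 1)) => [|x Ox]; first exact: borel_open.
  apply: le_lt_trans (norm_le_enorm x) _; apply: le_lt_trans (hM x (sub_body Ox)) _.
  by rewrite ltrDl.
- by rewrite ge0_fin_numE //; exact: tube_finite.
have mt : measurable (tube Omega s^-1) by exact: measurable_tube.
have c1 (x : E) : cont_at (fun=> 1 : R) x by exact: cont_at_cst.
have := tube_integral_scaled hne hopen hbdd hconv hsmooth hmu c1 (fun=> ler01) ler01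
  (fun _ _ => lexx 1) s0.
rewrite (lebesgue_indic mt) => TE.
rewrite mulrDr TE [RHS]big_ord_recr /= ltnn [LHS]addrC; congr (_ + _); last by rewrite mulrAC.
apply: eq_bigr => i _; have -> : (i <= n)%N by rewrite -ltnS.
congr (_ * _ * _); rewrite /curvature_moment /=.
by apply: eq_Rintegral => X _; rewrite mulr1.
Qed.

Lemma curvature_integral_identities :
  I (n%:Z - 1) = T u /\ n%:R * I (n%:Z - 2) = m%:R * T (fun x => u x ^+ 2) - excess_limit.
Proof.
have [M M0 hM] := body_bound hbdd.
have [D D0 HD] := parallel_body_asymptotics htheta hne hbdd hconv M0 hM.
pose c i := if (i <= n)%N then 'C(m, i)%:R * I (n - i)%:Z else I (Negz 0).
(* The sum has [n + 2] terms, so a coefficient of order 2 exists because [n >= 1]. *)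
have [D' D'0 HD'] : exists2 D : R, 0 <= D & forall s, 0 < s -> s <= 1 ->
    `|\sum_(i < m.+1) c i * s ^+ i - (c 0%N + c 1%N * s + c 2%N * s ^+ 2)| <= D * s ^+ 3.
  by have := sum_third_bound n.-1 c; rewrite -[(n.-1).+3]/((n.-1).+1.+2) prednK.
have c1 : c 1%N = m%:R * I (n%:Z - 1).
  by rewrite /c hn bin1 -(subzn hn).
have c2 : c 2%N = m%:R * n%:R / 2 * I (n%:Z - 2).
  have -> : m%:R * n%:R / 2 = 'C(m, 2)%:R :> R.
    have two : (2 : R) != 0 by [].
    have nE : n%:R = m%:R - 1 :> R by rewrite -natr1 addrK.
    by apply: (mulIf two); rewrite bin2_natr divfK // nE.
  rewrite /c; case: leqP => n2; last by rewrite -(subzn n2).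
  (* For [n = 1] the coefficient of order 2 is the top one, and the index [n - 2 = -1] selects the
     volume term. *)
  have n1 : n = 1%N by apply/eqP; rewrite eqn_leq hn n2.
  have -> : n%:Z - 2 = Negz 0 by rewrite n1.
  by have -> : 'C(m, 2) = 1%N; [rewrite n1|rewrite mul1r].
pose s0 := Num.min 1 (8^-1 / M).
have s00 : 0 < s0 by rewrite lt_min ltr01 divr_gt0.
have s01 : s0 <= 1 by rewrite ge_min lexx.
have s0M s : s < s0 -> s * M <= 8^-1.
  by rewrite lt_min => /andP[_ h]; rewrite -ler_pdivlMr // ltW.
pose U1 := T u; pose U2 := T (fun x => u x ^+ 2); pose L := excess_limit.
(* One side bounds all mean excesses by [L], the other uses the mean excess at a fixed [k], which is
   below the one at [1 / (2 s)] once [s] is small. The supremum over [k] closes the gap at the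
   end. *)
have key k : 1 <= k ->
    [/\ c 0%N - omega = 0, c 1%N - m%:R * U1 = 0, 0 <= c 2%N - (m%:R * U2 - L) * (m%:R / 2) &
     c 2%N - (m%:R * U2 - me k) * (m%:R / 2) <= 0].
  move=> k1; have k0 : 0 < k by lra.
  pose s1 := Num.min s0 (2 * k)^-1; have s10 : 0 < s1 by rewrite lt_min s00 invr_gt0 mulr_gt0.
  apply: (@compare_quadratic _ _ _ _ _ (D + D') s1) => // [|s sp ss].
    by rewrite ge_min s01.
  have ss0 : s < s0 by move: ss; rewrite lt_min => /andP[].
  have sk : s < (2 * k)^-1 by move: ss; rewrite lt_min => /andP[].
  have s1' : s <= 1 by apply: le_trans s01; exact: ltW.
  have := HD s sp (s0M s ss0); rewrite (parallel_body_poly sp) -/c => /andP[h1 h2].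
  have := HD' s sp s1'; rewrite ler_norml => /andP[h3 h4].
  have q0 : 0 <= m%:R / 2 * s ^+ 2 :> R by rewrite mulr_ge0 ?exprn_ge0 ?(ltW sp) // divr_ge0.
  have L1 : me (2 / s) <= L by apply: mean_excess_le_limit; rewrite divr_ge0 // ltW.
  have L2 : me k <= me (2 * s)^-1.
    apply: (mean_excess_mono htheta hne hbdd hconv); rewrite (ltW k0) /=.
    have sk1 : s * (2 * k) <= 1 by rewrite -ler_pdivlMr ?mulr_gt0 // mul1r ltW.
    by rewrite -[(2 * s)^-1]mul1r ler_pdivlMr ?mulr_gt0 // mulrCA [k * s]mulrC mulrCA.
  have L3 := ler_wpM2r q0 (lerB (lexx (m%:R * U2)) L1).
  have L4 := ler_wpM2r q0 (lerB (lexx (m%:R * U2)) L2).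
  move: h1 h2 L3 L4; rewrite /mean_poly -/U1 -/U2.
  move: h3 h4; set P := \sum_(i < _) _; set A := me (2 / s); set B := me (2 * s)^-1.
  set S3 := s ^+ 3; set S2 := s ^+ 2; set ck := me k; clearbody P A B S2 S3 ck.
  set q := m%:R / 2 * S2; set a := m%:R * U1; move=> h3 h4 h1 h2 L3 L4.
  have G x : (c 2%N - (m%:R * U2 - x) * (m%:R / 2)) * S2 = c 2%N * S2 - (m%:R * U2 - x) * q.
    by rewrite mulrBl -mulrA.
  rewrite !G [(D + D') * S3]mulrDl [(c 1%N - a) * s]mulrBl.
  move: h1 h2 h3 h4 L3 L4; set Y1 := (_ - L) * q; set Y2 := (_ - ck) * q; set Y3 := (_ - A) * q; set Y4 := (_ - B) * q.
  set z1 := c 1%N * s; set z2 := c 2%N * S2; set z3 := a * s; set z4 := D * S3; set z5 := D' * S3; set z0 := c 0%N.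
  exact: sandwich_combine.
have [_ + c2L _] := key 1 (lexx 1); rewrite c1 -mulrBr => /eqP.
rewrite mulf_eq0 pnatr_eq0 /= subr_eq0 => /eqP IU; split => //.
have m0 : 0 < m%:R / 2 :> R by rewrite divr_gt0.
have E1 : c 2%N = n%:R * I (n%:Z - 2) * (m%:R / 2).
  by rewrite c2; set x := I _; clearbody x; ring.
rewrite E1 -mulrBl pmulr_lge0 // subr_ge0 in c2L.
apply/eqP; rewrite eq_le c2L andbT -/U2 -/L lerBrDr addrC -lerBrDr.
apply: excess_limit_le => k k1; have [_ _ _] := key k k1.
by rewrite E1 -mulrBl pmulr_lle0 //; set x := n%:R * _; clearbody x; lra.
Qed.

(** The weighted tube is at most the integral of the excess, whose normalised limit is at most [L].
    Conversely [tube_proj_lower] gives in the limit that twice a mean excess is at most [J + L], and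
    the supremum yields [L <= J]. *)
Lemma curvature_moment_identity : J (fun X => dot X X) n = excess_limit.
Proof.
have [M M0 hM] := body_bound hbdd.
pose g (X : E) := dot X X; have g0 X : 0 <= g X by exact: dot_ge0.
have cg x : cont_at g x by exact: (cvg_dot cvg_id cvg_id).
have gM x : closure Omega x -> g x <= M ^+ 2.
  by move=> /hM h; rewrite /g -enorm_sqr; apply: lerXn2r; rewrite ?nnegrE ?enorm_ge0 ?(ltW M0).
have M20 : 0 <= M ^+ 2 by exact: sqr_ge0.
pose W s := fine (\int[@lebesgue_rV R m]_Y indic_mul (tube Omega s^-1) (fun Y => g (proj Omega Y)) Y)%E.
have WE s : 0 < s -> (\int[@lebesgue_rV R m]_Y indic_mul (tube Omega s^-1) (proj_sq Omega) Y = (W s)%:E)%E.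
  move=> sp; have t0 : 0 < s^-1 by rewrite invr_gt0.
  by rewrite /W (tube_integral_poly hne hopen hbdd hconv hsmooth hmu cg g0 M20 gM t0).
pose c i := 'C(m, i)%:R * J g (n - i).
have [D D0 HD] := sum_first_bound n c.
have c0 : c 0%N = J g n by rewrite /c bin0 mul1r subn0.
have HW s : 0 < s -> s <= 1 -> `|m%:R * s ^+ m * W s - J g n| <= D * s.
  move=> sp s1; rewrite (tube_integral_scaled hne hopen hbdd hconv hsmooth hmu cg g0 M20 gM sp).
  by rewrite -c0; exact: HD.
have [B B0 HB] := @pow_near1 R m.
pose s0 := Num.min 1 (8^-1 / M).
have s00 : 0 < s0 by rewrite lt_min ltr01 divr_gt0.
have s01 s : s < s0 -> s <= 1 by rewrite lt_min => /andP[/ltW].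
have s0M s : s < s0 -> s * M <= 8^-1.
  by rewrite lt_min => /andP[_ h]; rewrite -ler_pdivlMr // ltW.
have L0 : 0 <= excess_limit.
  by apply: le_trans (mean_excess_le_limit (lexx 0)); exact: (mean_excess_ge0 theta hne hbdd hconv M0 hM).
set L := excess_limit in L0 *.
have up s : 0 < s -> s < s0 -> m%:R * s ^+ m * (m%:R^-1 * (s^-1 * (1 + 2 * (s * M))) ^+ m * me (2 / s)) <= L + 2 * B * M * L * s.
  move=> sp ss; have sn : s ^+ m != 0 by rewrite expf_neq0 // lt0r_neq0.
  have -> : m%:R * s ^+ m * (m%:R^-1 * (s^-1 * (1 + 2 * (s * M))) ^+ m * me (2 / s)) =
      (1 + 2 * (s * M)) ^+ m * me (2 / s).
    rewrite exprMn exprVn; set x := s ^+ m in sn *; set y := (1 + _) ^+ m; set z := me _.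
    clearbody x y z; field; rewrite sn /= -[1]/(1%:R) -natrD.
    by rewrite pnatr_eq0.
  have y0 : 0 <= 2 * (s * M) by rewrite !mulr_ge0 // ltW.
  have y1 : `|2 * (s * M)| <= 1 by rewrite ger0_norm //; have := s0M s ss; lra.
  have := HB _ y1; rewrite (ger0_norm y0) ler_norml => /andP[_ h].
  apply: le_trans (_ : (1 + 2 * (s * M)) ^+ m * L <= _).
    apply: ler_wpM2l; first by rewrite exprn_ge0 // addr_ge0.
    by apply: mean_excess_le_limit; rewrite divr_ge0 // ltW.
  have h1 : (1 + 2 * (s * M)) ^+ m <= 1 + B * (2 * (s * M)) by lra.
  apply: le_trans (ler_wpM2r L0 h1) _; rewrite le_eqVlt; apply/orP; left; apply/eqP; ring.
apply/eqP; rewrite -/g eq_le; apply/andP; split.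
  rewrite -subr_ge0; apply: (@limit_ge0 _ _ (D + 2 * B * M * L) s0) => // s sp ss.
  have := tube_proj_upper htheta hne hbdd hconv M0 hM sp (s0M s ss); rewrite WE // lee_fin => h.
  have mp : 0 <= m%:R * s ^+ m :> R by rewrite mulr_ge0 ?exprn_ge0 // ltW.
  have h1 := le_trans (ler_wpM2l mp h) (up s sp ss).
  by have := HW s sp (s01 s ss); rewrite ler_norml => /andP[h2 h3]; rewrite mulrDl; lra.
suff H k : 1 <= k -> me k <= (J g n + L) / 2.
  by have := excess_limit_le H; rewrite -/L; lra.
(* [tube_proj_lower] takes the mean excess at half of its radius and needs that radius to enclose
   the body. *)
move=> k1; pose k' := Num.max (2 * k) M.
have k'M : M <= k' by rewrite le_max lexx orbT.
have kk' : 2 * k <= k' by rewrite le_max lexx.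
have k'0 : 0 < k' by lra.
have mk : me k <= me (k' / 2).
  by apply: (mean_excess_mono htheta hne hbdd hconv); apply/andP; split; lra.
apply: le_trans mk _; set x := me (k' / 2).
have x0 : 0 <= x by exact: (mean_excess_ge0 theta hne hbdd hconv M0 hM).
rewrite -subr_ge0; pose s1 := Num.min s0 (2^-1 / k').
have s10 : 0 < s1 by rewrite lt_min s00 divr_gt0.
apply: (@limit_ge0 _ _ ((D + 2 * B * M * L + 2 * x * (2 * B * M + k')) / 2) s1) => // s sp s's.
have ss : s < s0 by move: s's; rewrite lt_min => /andP[].
have sk : s * k' <= 2^-1 by move: s's; rewrite lt_min => /andP[_ h]; rewrite -ler_pdivlMr // ltW.
have := tube_proj_lower htheta hne hbdd hconv M0 hM sp (s0M s ss) k'M sk.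
rewrite WE // -EFinD lee_fin => h.
have mp : 0 <= m%:R * s ^+ m :> R by rewrite mulr_ge0 ?exprn_ge0 // ltW.
have := ler_wpM2l mp h; rewrite [X in _ <= X -> _]mulrDr => h1.
have h2 := le_trans h1 (lerD (lexx _) (up s sp ss)).
have := HW s sp (s01 s ss); rewrite ler_norml => /andP[_ h3].
have E1 : m%:R * s ^+ m * (m%:R^-1 * ((s^-1 * (1 - 2 * (s * M))) ^+ m - k' ^+ m) * (2 * x)) =
    ((1 - 2 * (s * M)) ^+ m - (s * k') ^+ m) * (2 * x).
  have sn : s ^+ m != 0 by rewrite expf_neq0 // lt0r_neq0.
  rewrite !exprMn exprVn; set a := s ^+ m in sn *; set y := (1 - _) ^+ m; set z := k' ^+ m.
  clearbody a y z x; field; rewrite sn /= -[1]/(1%:R) -natrD.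
  by rewrite pnatr_eq0.
rewrite E1 in h2.
have y0 : 0 <= 2 * (s * M) by rewrite !mulr_ge0 // ltW.
have y1 : `|- (2 * (s * M))| <= 1 by rewrite normrN ger0_norm //; have := s0M s ss; lra.
have := HB _ y1; rewrite normrN (ger0_norm y0) ler_norml => /andP[h4 _].
have sk0 : 0 <= s * k' by rewrite mulr_ge0 ?ltW.
have h5 : (s * k') ^+ m <= s * k'.
  rewrite exprS -[X in _ <= X]mulr1; apply: ler_wpM2l => //; apply: exprn_ile1 => //; lra.
have h6 : 1 - (B * (2 * (s * M)) + s * k') <= (1 - 2 * (s * M)) ^+ m - (s * k') ^+ m by lra.
have x20 : 0 <= 2 * x by lra.
have h7 := le_trans (ler_wpM2r x20 h6) h2.
have E2 : (1 - (B * (2 * (s * M)) + s * k')) * (2 * x) = 2 * x - 2 * x * (2 * B * M + k') * s by ring.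
rewrite E2 in h7; set X := 2 * x * _ in h7 *; set Y := 2 * B * M * L in h7 *.
have -> : (D + Y + X) / 2 * s = (D * s + Y * s + X * s) / 2 by ring.
by move: h7; set z := m%:R * _ * W s; rewrite -/z in h3; clearbody z X Y; lra.
Qed.

End Identities.

(** * Antipodal symmetry of the sphere and the support function of a ball *)

Section Final.
Context {R : realType} {n : nat}.
Local Notation E := 'rV[R]_n.+1.
Local Notation m := (n.+1).
Variable theta : {measure set (borel_rV R m) -> \bar R}.
Hypothesis htheta : is_area_measure (@esphere R m) theta.

(** By [cone_measure] the measure [theta] is read off from volumes of cones, and Lebesgue measure is
    invariant under the central symmetry. *)
Lemma sphere_antipodal (A : set (borel_rV R m)) : measurable A ->
  theta ((fun x : E => - x) @^-1` A) = theta A.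
Proof.
move=> mA.
have uM : ((-1)%:M : 'M[R]_m) \in unitmx by rewrite unitmxE det_scalar unitfE expf_neq0 // oppr_eq0 oner_eq0.
have mN : measurable ((fun x : E => - x) @^-1` A : set (borel_rV R m)).
  by apply: measurable_preimage_rV => // x; exact: (@continuousN _ _ _ id x cvg_id).
have c1 := cone_measure htheta mA ltr01; have c2 := cone_measure htheta mN ltr01.
have := lebesgue_mulmx uM (measurable_cone (1 : R) mA).
rewrite det_scalar normrX normrN1 expr1n invr1 mul1e.
have -> : (fun x : E => x *m (-1)%:M) @^-1` cone A 1 = cone ((fun x : E => - x) @^-1` A) 1.
  have dirN (Y : E) : dir (- Y) = - dir Y by rewrite /dir enormN scalerN.
  have opp (Y : E) : Y *m (-1)%:M = - Y by rewrite mul_mx_scalar scaleN1r.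
  by apply/seteqP; split => Y; rewrite /cone /= opp oppr_eq0 enormN dirN.
rewrite c1 c2; set c : R := 1 ^+ m / m%:R.
have c0 : c != 0 by rewrite /c expr1n mul1r invr_eq0 pnatr_eq0.
move=> /(congr1 (fun z => (c^-1)%:E * z)%E).
by rewrite !muleA -!EFinM mulVf // !mul1e.
Qed.

Lemma sphere_int_opp (f : E -> R) : (forall x, cont_at f x) -> (forall x, 0 <= f x) ->
  sphere_int theta (fun x => f (- x)) = sphere_int theta f.
Proof.
move=> cf f0.
have cN (x : E) : {for x, continuous (fun x : E => - x)} by exact: (@continuousN _ _ _ id x cvg_id).
have cfN x : cont_at (fun x => f (- x)) x by apply: (@continuous_comp _ _ _ (fun x : E => - x) (f : E -> R^o)); [exact: cN|exact: cf].
have mN : measurable_fun setT ((fun x : E => - x) : borel_rV R m -> borel_rV R m).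
  by apply: measurable_continuous_rV => x; exact: cN.
have mf g : (forall x, cont_at g x) -> measurable_fun setT (fun x : borel_rV R m => (g x)%:E).
  by move=> cg; apply/measurable_EFinP; exact: continuous_measurable_cont_at.
suff : ((sphere_int theta (fun x => f (- x)))%:E = (sphere_int theta f)%:E)%E by case.
rewrite -!(sphere_intE htheta) // -!(sphere_integral_setT htheta) //; try by [exact: mf|move=> x; rewrite lee_fin].
apply/esym; apply: (integral_image_measure mN) => // [B mB|]; last exact: mf.
exact: (esym (sphere_antipodal mB)).
Qed.

Lemma support_eball (r : R) (x : E) : 0 <= r -> dot x x = 1 -> support_function (eball r) x = r.
Proof.
move=> r0 x1; have e1 : enorm x = 1 by apply/enorm1P.
have ub : ubound [set dot y x | y in eball r] r.
  move=> _ [y yr <-]; apply: le_trans (dot_le_enorm y x) _; rewrite e1 mulr1; exact: yr.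
have rx : [set dot y x | y in eball r] r.
  exists (r *: x); last by rewrite dotZl x1 mulr1.
  by rewrite /eball /= enormZ e1 mulr1 ger0_norm.
apply/eqP; rewrite eq_le; apply/andP; split; first by apply: ge_sup => //; exists r.
by apply: ub_le_sup => //; exists r.
Qed.

End Final.

Theorem theorem1p3 (R : realType) (n : nat) (hn : (1 <= n)%N)
    (Omega : set 'rV[R]_n.+1)
    (hne : Omega !=set0)
    (hopen : open Omega)
    (hbdd : bounded_set Omega)
    (hconv : convex_set (Omega : set (convex_lmodType 'rV[R]_n.+1)))
    (hsmooth : smooth_hypersurface (boundary Omega))
    (mu : {measure set (borel_rV R n.+1) -> \bar R})
    (hmu : is_area_measure (boundary Omega) mu)
    (theta : {measure set (borel_rV R n.+1) -> \bar R})
    (htheta : is_area_measure (@esphere R n.+1) theta) :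
  let omega := sphere_area theta in
  let I := curvature_integral Omega mu in
  let r := I (n%:Z - 1) / omega in
  \int[mu]_(X in boundary Omega) (mean_curvature Omega n X * enorm X ^+ 2)
    - n.+1%:R / omega * I (n%:Z - 1) ^+ 2 + n%:R * I (n%:Z - 2)
  = n.+1%:R * delta2 theta Omega (eball r) ^+ 2
  /\ r = mean_width theta Omega / 2.
Proof.
move=> omega I r; pose u := support_function Omega.
have [M M0 hM] := body_bound hbdd.
have [I1 I2] := curvature_integral_identities hn htheta hne hopen hbdd hconv hsmooth hmu.
have J1 := curvature_moment_identity htheta hne hopen hbdd hconv hsmooth hmu.
have cu x : cont_at u x by exact: supp_fun_continuous.
have c1 (a : R) (x : 'rV[R]_n.+1) : cont_at (fun=> a) x by exact: cont_at_cst.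
(* [support_eball] needs a nonnegative radius; the sign comes from that of the mean curvatures. *)
have r0 : 0 <= r.
  apply: divr_ge0; last by rewrite /omega /sphere_area fine_ge0.
  have -> : n%:Z - 1 = (n - 1)%:Z by rewrite -(subzn hn).
  apply: Rintegral_ge0 => X SX.
  exact: (mean_curvature_ge0 hne hopen hbdd hconv hsmooth).
split; last first.
  rewrite /r /mean_width -/omega.
  have -> : \int[theta]_(xi in @esphere R n.+1) (support_function Omega xi + support_function Omega (- xi)) =
      sphere_int theta (fun x => u x + u (- x)) by [].
  have cN x : cont_at (fun x => u (- x)) x.
    by apply: (@continuous_comp _ _ _ (fun x : 'rV[R]_n.+1 => - x) (u : _ -> R^o)); [exact: (@continuousN _ _ _ id x cvg_id)|exact: cu].
  have ce x : cont_at (@enorm R n.+1) x by exact: enorm_continuous.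
  (* [sphere_int_opp] applies to nonnegative functions, so [u] is made nonnegative by adding an even
     function, whose integral cancels afterwards. *)
  pose v (x : 'rV[R]_n.+1) := u x + M * enorm x.
  have cMe x : cont_at (fun x : 'rV[R]_n.+1 => M * enorm x) x by exact: cont_atM.
  have cv x : cont_at v x by exact: cont_atD.
  have v0 x : 0 <= v x.
    have := supp_fun_bound hne hbdd x hM; rewrite ler_norml => /andP[h _].
    by rewrite /v -lerBlDr sub0r.
  have vE : sphere_int theta v = sphere_int theta u + sphere_int theta (fun x => M * enorm x) by exact: sphere_intD.
  have vN : sphere_int theta (fun x => v (- x)) =
      sphere_int theta (fun x => u (- x)) + sphere_int theta (fun x => M * enorm x).
    by rewrite -sphere_intD //; apply: eq_Rintegral => x _; rewrite /v enormN.
  have := sphere_int_opp htheta cv v0; rewrite vE vN => /addIr uN.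
  rewrite sphere_intD // uN /I I1 -/u; set a := sphere_int _ _; set b := omega^-1.
  by clearbody a b; field.
have -> : \int[mu]_(X in boundary Omega) (mean_curvature Omega n X * enorm X ^+ 2) =
    curvature_moment Omega mu (fun X => dot X X) n.
  by apply: eq_Rintegral => X _; rewrite enorm_sqr.
rewrite J1 /I I2 I1 -/u /delta2 sqr_sqrtr; last by apply: Rintegral_ge0 => x _; exact: sqr_ge0.
pose U1 := sphere_int theta u; pose U2 := sphere_int theta (fun x => u x ^+ 2).
have cu2 x : cont_at (fun x => u x ^+ 2) x by exact: cont_atX.
have -> : \int[theta]_(xi in @esphere R n.+1) (support_function Omega xi - support_function (eball r) xi) ^+ 2 =
    sphere_int theta (fun x => (u x ^+ 2 - (2 * r) * u x) + r ^+ 2).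
  apply: eq_Rintegral => x /set_mem /enorm1P x1; rewrite support_eball // -/u.
  by set a := u x; clearbody a; ring.
have cru x : cont_at (fun x => (2 * r) * u x) x by exact: cont_atM.
have cB x : cont_at (fun x => u x ^+ 2 - (2 * r) * u x) x by apply: cont_atD => //; exact: cont_atN.
rewrite sphere_intD // sphere_intB // sphere_intZ // sphere_int_cst // -/U1 -/U2 -/omega.
have rE : r = U1 / omega by rewrite /r /I I1.
(* If [omega] is 0, division by it gives 0, so [r] vanishes and both sides are [n.+1] times the
   integral of [u ^+ 2]. *)
have [w0|w0] := eqVneq omega 0.
  rewrite rE w0 invr0; set L := excess_limit _ _; clearbody L U1 U2; ring.
rewrite rE; set L := excess_limit _ _; clearbody L U1 U2 omega; field.
exact: w0.
Qed.
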